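(* Consider the SPDE on the separable Hilbert space $H$ $$dr_t = (A r_t + \alpha(r_t))\,dt + \sigma(r_{t-})\,dX_t,\qquad r_0 = h_0,$$ where $A$, $\alpha$, $\sigma$ and $X$ satisfy the standing assumptions in the context, and suppose that the SPDE is linear, i.e. $\alpha$ is constant. Then the SPDE has an affine realization if and only if the volatility $\sigma$ is $A$-quasi-exponential.
   Context: Standing assumptions. $(\Omega,\mathcal{F},(\mathcal{F}_t)_{t \ge 0},\mathbb{P})$ is a filtered probability space satisfying the usual conditions; $X$ is an $\mathbb{R}^m$-valued Lévy process ($m \in \mathbb{N}$) whose components $X^1,\ldots,X^m$ are nontrivial square-integrable martingales; $H$ is a (real) separable Hilbert space; $A : \mathcal{D}(A) \subset H \to H$ is the generator of a $C_0$-semigroup $(S_t)_{t\ge 0}$ on $H$ which is pseudo-contractive, i.e. $\|S_t\| \le e^{\omega t}$ for all $t \ge 0$, for some $\omega \in \mathbb{R}$; $\alpha : H \to H$ and $\sigma=(\sigma^1,\ldots,\sigma^m) : H \to H^m$ are Lipschitz continuous. Weak solution. For $h_0 \in H$ the weak solution of the SPDE is the $H$-valued càdlàg adapted process $r$ (unique up to indistinguishability; it exists because $A$ generates a pseudo-contractive $C_0$-semigroup, $\alpha$ and $\sigma$ are Lipschitz continuous, and the components of the Lévy process $X$ are square-integrable martingales) such that for each $\xi \in \mathcal{D}(A^* )$ $$\langle \xi,r_t\rangle = \langle \xi,h_0\rangle + \int_0^t \big(\langle A^*\xi,r_s\rangle + \langle \xi,\alpha(r_s)\rangle\big)ds + \sum_{k=1}^m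 \int_0^t \langle \xi,\sigma^k(r_{s-})\rangle dX^k_s,\quad t \ge 0.$$ Quasi-exponential volatility. Let $\mathcal{D}(A^\infty) = \bigcap_{n \in \mathbb{N}} \mathcal{D}(A^n)$. If $\sigma^k(H) \subset \mathcal{D}(A^{\infty})$ for all $k=1,\ldots,m$, set $$A_{\sigma} := \sum_{k=1}^m \langle A^n \sigma^k(h) : n \in \mathbb{N}_0,\ h \in H \rangle,$$ where $\langle\cdot\rangle$ denotes the linear span. The volatility $\sigma$ is called $A$-quasi-exponential if $\sigma^k(H) \subset \mathcal{D}(A^{\infty})$ for all $k=1,\ldots,m$ and $\dim A_\sigma < \infty$. Foliations and affine realizations. Let $V\subset H$ be a finite dimensional subspace. A family $(\mathcal{M}_t)_{t \ge 0}$ of subsets of $H$ is a ($C^0$-)foliation generated by $V$ if there is a continuous map $\psi : \mathbb{R}_+ \to H$ with $\mathcal{M}_t = \psi(t) + V$ for all $t \ge 0$. It is invariant for the SPDE if for all $t_0 \ge 0$ and $h_0 \in \mathcal{M}_{t_0}$ the weak solution $r$ with $r_0=h_0$ satisfies, outside a $\mathbb{P}$-nullset, $r_t \in \mathcal{M}_{t_0+t}$ for all $t \ge 0$. The SPDE has an affine realization generated by $V$ if for every $h_0 \in H$ there is an invariant foliation $(\mathcal{M}_t)_{t \ge 0}$ generated by $V$ with $h_0 \in \mathcal{M}_0$. The SPDE has an affine realization if it has an affine realization generated by some finite dimensional subspace $V \subset H$.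
   Formalization: Nontriviality of the components of X is strengthened to: no nonzero linear combination of X^1,...,X^m is trivial; with only each component nontrivial the claim fails (X^1=X^2 Brownian, A=0, alpha=0, sigma^1=id, sigma^2=-id, dim H infinite). *)

(* Defs.v *)
From HB Require Import structures.
From mathcomp Require Import all_boot all_order all_algebra.
From mathcomp Require Import all_classical all_reals all_analysis.

Set Implicit Arguments.
Unset Strict Implicit.
Unset Printing Implicit Defensive.

Import Order.TTheory GRing.Theory Num.Theory.
Import numFieldNormedType.Exports.

Local Open Scope classical_set_scope.
Local Open Scope ring_scope.

(** Hilbert space structure, linear spans and unbounded operators *)
Section hilbert.
Context {R : realType} {H : completeNormedModType R}.

(* A Hilbert space is a complete normed module whose norm comes from the
   inner product [ip]. *)
Definition inner_product (ip : H -> H -> R) : Prop :=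
  [/\ forall x y, ip x y = ip y x,
      forall a x y z, ip (a *: x + y) z = a * ip x z + ip y z &
      forall x, ip x x = `|x| ^+ 2].

Definition separable : Prop := exists2 Q : set H, countable Q & dense Q.

Definition linear_span (B : set H) : set H :=
  [set v | exists (n : nat) (c : 'I_n -> R) (b : 'I_n -> H),
     (forall i, B (b i)) /\ v = \sum_i c i *: b i].

Definition finite_dimensional (W : set H) : Prop :=
  exists (n : nat) (b : 'I_n -> H), W `<=` linear_span (range b).

Definition finite_dimensional_subspace (V : set H) : Prop :=
  V = linear_span V /\ finite_dimensional V.

Definition C0_semigroup (S : R -> H -> H) : Prop :=
  [/\ forall t : R, 0 <= t -> linear (S t) /\ continuous (S t),
      forall h, S 0 h = h,
      forall (s t : R) h, 0 <= s -> 0 <= t -> S (s + t) h = S s (S t h) &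
      forall h, S t h @[t --> 0^'+] --> h].

Definition pseudo_contractive (S : R -> H -> H) : Prop :=
  exists omega : R, forall (t : R) h, 0 <= t -> `|S t h| <= expR (omega * t) * `|h|.

(* An unbounded operator is a domain [D : set H] with a total map
   [A : H -> H] of which only the values on [D] matter. *)
Definition generator (S : R -> H -> H) (D : set H) (A : H -> H) : Prop :=
  forall h g : H,
    (D h /\ A h = g) <-> (t^-1 *: (S t h - h) @[t --> 0^'+] --> g).

Fixpoint dom_pow (D : set H) (A : H -> H) (n : nat) : set H :=
  if n is n'.+1 then [set h | D h /\ dom_pow D A n' (A h)] else setT.

Definition dom_infty (D : set H) (A : H -> H) : set H :=
  \bigcap_n dom_pow D A n.

(* [adjoint_at ip D A xi eta]: xi is in the domain of the adjoint and the
   adjoint maps xi to eta, which is unique as [D] is dense. *)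
Definition adjoint_at (ip : H -> H -> R) (D : set H) (A : H -> H) (xi eta : H)
  : Prop := forall h, D h -> ip xi (A h) = ip eta h.

Definition A_sigma (A : H -> H) (m : nat) (sigma : 'I_m -> H -> H) : set H :=
  [set v | exists u : 'I_m -> H,
     (forall k, linear_span
        [set g | exists n h, g = iter n A (sigma k h)] (u k)) /\
     v = \sum_k u k].

Definition quasi_exponential (D : set H) (A : H -> H) (m : nat)
    (sigma : 'I_m -> H -> H) : Prop :=
  (forall k h, dom_infty D A (sigma k h)) /\
  finite_dimensional (A_sigma A sigma).

Definition foliation (V : set H) (M : R -> set H) : Prop :=
  exists psi : R -> H, {within `[0, +oo[%classic, continuous psi} /\
    forall t : R, 0 <= t -> M t = [set psi t + v | v in V].

End hilbert.
Arguments separable {R} H.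

(** Stochastic processes, indexed by [R] but only considered at times t >= 0 *)
Section processes.
Context {R : realType} {d : measure_display} {Omega : measurableType d}.
Variables (P : probability Omega R) (F : R -> set (set Omega)).

Definition usual_conditions : Prop :=
  [/\ forall t : R, 0 <= t -> sigma_algebra setT (F t) /\ F t `<=` measurable,
      forall s t : R, 0 <= s -> s <= t -> F s `<=` F t,
      forall t : R, 0 <= t -> \bigcap_(s in [set s | t < s]) F s `<=` F t,
      measure_is_complete P &
      forall N, P.-negligible N -> F 0 N].

Definition adapted (T : topologicalType) (Y : R -> Omega -> T) : Prop :=
  forall t : R, 0 <= t -> forall B, <<s (@open T) >> B -> F t (Y t @^-1` B).

Definition cadlag (T : topologicalType) (x : R -> T) : Prop :=
  forall t : R, 0 <= t ->
    (x u @[u --> t^'+] --> x t) /\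
    (0 < t -> exists l : T, x u @[u --> t^'-] --> l).

Definition adapted_cadlag (T : topologicalType) (Y : R -> Omega -> T) : Prop :=
  adapted Y /\ {ae P, forall w, cadlag (Y ^~ w)}.

Definition left_limit (T : ptopologicalType) (Y : R -> Omega -> T)
    (s : R) (w : Omega) : T := lim (Y u w @[u --> s^'-]).

(* Levy process with respect to the filtration. *)
Definition levy_process (m : nat) (X : R -> Omega -> 'rV[R]_m) : Prop :=
  [/\ adapted_cadlag X,
      {ae P, forall w, X 0 w = 0},
      forall (s t : R) E B, 0 <= s -> s <= t -> F s E -> <<s (@open 'rV[R]_m) >> B ->
        P (E `&` [set w | B (X t w - X s w)%R]) =
        (P E * P [set w | B (X t w - X s w)%R])%E &
      forall (s t : R) B, 0 <= s -> s <= t -> <<s (@open 'rV[R]_m) >> B ->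
        P [set w | B (X t w - X s w)%R] = P [set w | B (X (t - s) w)]].

Definition square_integrable_martingale (M : R -> Omega -> R) : Prop :=
  [/\ adapted M,
      forall t : R, 0 <= t -> M t \in Lfun P 2%:E &
      forall (s t : R) E, 0 <= s -> s <= t -> F s E ->
        \int[P]_(w in E) M t w = \int[P]_(w in E) M s w].

Definition trivial_process (M : R -> Omega -> R) : Prop :=
  forall t : R, 0 <= t -> {ae P, forall w, M t w = 0}.

(* For u the k-th unit vector this says that the component X^k is nontrivial.
   The other directions exclude redundant components: if X^2 = X^1, then the
   volatility (sigma^1, - sigma^1) drives a deterministic equation, whatever
   sigma^1 is. *)
Definition nontrivial_components (m : nat) (X : R -> Omega -> 'rV[R]_m)
  : Prop := forall u : 'I_m -> R, (exists k, u k != 0) ->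
    ~ trivial_process (fun t w => \sum_k u k * X t w ord0 k).

Definition component (m : nat) (X : R -> Omega -> 'rV[R]_m) (k : 'I_m)
  : R -> Omega -> R := fun t w => X t w ord0 k.

(* The simple process that is the sum of phi_i 1_{]a_i, b_i]} with phi_i
   bounded and F_{a_i}-measurable. *)
Record simple := Simple {
  simple_size : nat;
  simple_left : 'I_simple_size -> R;
  simple_right : 'I_simple_size -> R;
  simple_coef : 'I_simple_size -> Omega -> R }.
Arguments simple_left : clear implicits.
Arguments simple_right : clear implicits.
Arguments simple_coef : clear implicits.

Definition simple_predictable (Z : simple) : Prop :=
  forall i,
    [/\ 0 <= simple_left Z i, simple_left Z i <= simple_right Z i,
        exists c : R, forall w, `|simple_coef Z i w| <= c &
        forall B, <<s (@open R) >> B ->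
          F (simple_left Z i) (simple_coef Z i @^-1` B)].

Definition simple_value (Z : simple) (s : R) (w : Omega) : R :=
  \sum_i simple_coef Z i w *
    (\1_(`]simple_left Z i, simple_right Z i]%classic) s).

Definition simple_integral (Z : simple) (M : R -> Omega -> R)
    (t : R) (w : Omega) : R :=
  \sum_i simple_coef Z i w *
    (M (Num.min (simple_right Z i) t) w - M (Num.min (simple_left Z i) t) w).

Definition cvg0_in_probability (Z : nat -> Omega -> \bar R) : Prop :=
  forall eps : R, 0 < eps ->
    P [set w | eps%:E <= `|Z n w|]%E @[n --> \oo] --> 0%E.

(* The Ito integral: I_t is the limit in probability of the integrals of simple
   processes Z_n such that the integral of (Z_n - Y)^2 over [0, t] converges to
   0 in probability.  Integrating against ds is justified because the
   integrator M is a square-integrable martingale and a Levy process, whose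
   predictable quadratic variation is ds up to a constant. *)
Definition stochastic_integral (M Y I : R -> Omega -> R) : Prop :=
  adapted_cadlag I /\
  exists Z : nat -> simple,
    (forall n, simple_predictable (Z n)) /\
    forall t : R, 0 <= t ->
      cvg0_in_probability (fun n w =>
        (\int[lebesgue_measure]_(s in `[0%R, t])
            ((simple_value (Z n) s w - Y s w) ^+ 2)%:E)%E) /\
      cvg0_in_probability (fun n w =>
        (simple_integral (Z n) M t w - I t w)%:E).

End processes.

(** The equation dr = (A r + alpha(r)) dt + sigma(r_-) dX *)
Section spde.
Context {R : realType} {d : measure_display} {Omega : measurableType d}.
Variables (P : probability Omega R) (F : R -> set (set Omega)) (m : nat)
  (X : R -> Omega -> 'rV[R]_m).
Context {H : completeNormedModType R}.
Variables (ip : H -> H -> R) (D : set H) (A : H -> H)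
  (alpha : H -> H) (sigma : 'I_m -> H -> H).

Definition weak_solution (h0 : H) (r : R -> Omega -> H) : Prop :=
  adapted_cadlag P F r /\
  forall xi Axi : H, adjoint_at ip D A xi Axi ->
    exists I : 'I_m -> R -> Omega -> R,
      (forall k, stochastic_integral P F (component X k)
         (fun s w => ip xi (sigma k (left_limit r s w))) (I k)) /\
      {ae P, forall w, forall t : R, 0 <= t ->
         ip xi (r t w) = ip xi h0
           + \int[lebesgue_measure]_(s in `[0, t])
               (ip Axi (r s w) + ip xi (alpha (r s w)))
           + \sum_k I k t w}.

(* The weak solution is determined up to indistinguishability, so the
   condition is put on every version; existence keeps it from being vacuous. *)
Definition invariant_foliation (M : R -> set H) : Prop :=
  forall (t0 : R) h0, 0 <= t0 -> M t0 h0 ->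
    (exists r, weak_solution h0 r) /\
    forall r, weak_solution h0 r ->
      {ae P, forall w, forall t : R, 0 <= t -> M (t0 + t) (r t w)}.

Definition affine_realization_by (V : set H) : Prop :=
  forall h0, exists M : R -> set H,
    [/\ foliation V M, invariant_foliation M & M 0 h0].

Definition has_affine_realization : Prop :=
  exists V : set H, finite_dimensional_subspace V /\ affine_realization_by V.

End spde.

(* Main.v *)
(** Suppose first that there is an affine realization generated by V. A functional
    eta orthogonal to V takes deterministic values along every weak solution, so
    the functionals with this property have finite codimension. If such an eta lies
    in the domain of the adjoint of A, its martingale part <eta, sigma(r)> . X has
    zero variance; as no combination of the components of X is trivial, eta
    annihilates the range of every sigma^k, and the equation shows that the adjoint
    maps eta to a deterministic functional again. Since A is the adjoint of its
    adjoint, the finite-dimensional annihilator of the deterministic functionals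
    lies in the domain of A, is invariant under A, and contains the range of sigma.

    Conversely, let V = A_sigma be finite-dimensional. It is invariant under A, and
    the leaves are psi(t) + V, where psi solves the equation without noise. Starting
    on a leaf, the coordinates of r - psi in V solve a stochastic differential
    equation with Lipschitz coefficients. The Euler schemes on the dyadic grids
    converge almost surely, locally uniformly along a subsequence, to a solution of
    it; in the stochastic integrals these schemes are themselves the approximating
    simple processes. Any weak solution stays on the leaves: tested with a
    functional that vanishes on V, the difference r - psi solves the homogeneous
    deterministic equation with initial value 0. *)
Require Import Defs.
From HB Require Import structures.
From mathcomp Require Import all_boot all_order all_algebra.
From mathcomp Require Import all_classical all_reals all_analysis.
From mathcomp Require Import measurable_realfun lra ring.

Set Implicit Arguments.
Unset Strict Implicit.
Unset Printing Implicit Defensive.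

Import Order.TTheory GRing.Theory Num.Theory.
Import numFieldNormedType.Exports.

Local Open Scope classical_set_scope.
Local Open Scope ring_scope.

(** * Hilbert spaces *)

(** The stochastic integral is specified only as a limit in probability of simple integrals: it has
    no moments a priori, and its approximants are arbitrary. Lenglart's inequality exchanges them
    for Riemann sums at left endpoints, uniformly over adapted events that restrict the cells. These
    events play the role of stopping times, and only the stopped sums are squared or paired.

    Exceptional null sets depend on the functional that tests the equation and on the time.
    Separability provides countably many pairs dense in the graph of the adjoint, and right
    continuity takes care of the times.

    Later on, membership in the domain of [A] is verified weakly; the adjoints of the integrals [J]
    of the semigroup supply the test functionals. Determinism along solutions is the property to
    follow because it survives the adjoint: without a martingale part, the image is read off from
    the right derivative of a deterministic path.

    Invariance includes the existence of solutions on each leaf. There time is one more integrator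
    beside the components of [X], so that a single set of estimates covers drift and noise. *)

Section epsilon.
Context {R : realType} {V : normedModType R}.
Implicit Types (f : R -> V) (l : V).

Lemma right_limP f t l : f u @[u --> t^'+] --> l <->
  (forall e : R, 0 < e -> exists2 d : R, 0 < d &
     forall u, t < u -> u < t + d -> `|f u - l| < e).
Proof.
split=> [/cvgrPdist_lt fl e e0|fl].
  have := fl e e0; rewrite near_withinE => /nbhs_ballP[d /= d0 dP].
  exists d => // u tu utd; rewrite distrC; apply: dP => //.
  by rewrite /ball/= distrC gtr0_norm ?subr_gt0// ltrBlDl.
apply/cvgrPdist_lt => e e0; have [d d0 dP] := fl e e0.
rewrite near_withinE; apply/nbhs_ballP; exists d => //= u ud tu.
rewrite distrC; apply: dP => //; move: ud; rewrite /ball/= distrC.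
by rewrite gtr0_norm ?subr_gt0// ltrBlDl.
Qed.

Lemma left_limP f t l : f u @[u --> t^'-] --> l <->
  (forall e : R, 0 < e -> exists2 d : R, 0 < d &
     forall u, u < t -> t - d < u -> `|f u - l| < e).
Proof.
split=> [/cvgrPdist_lt fl e e0|fl].
  have := fl e e0; rewrite near_withinE => /nbhs_ballP[d /= d0 dP].
  exists d => // u ut utd; rewrite distrC; apply: dP => //.
  by rewrite /ball/= gtr0_norm ?subr_gt0//; lra.
apply/cvgrPdist_lt => e e0; have [d d0 dP] := fl e e0.
rewrite near_withinE; apply/nbhs_ballP; exists d => //= u ud ut.
rewrite distrC; apply: dP => //; move: ud; rewrite /ball/=.
by rewrite gtr0_norm ?subr_gt0//; lra.
Qed.

Lemma seq_limP (u : nat -> V) l : u n @[n --> \oo] --> l <->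
  (forall e : R, 0 < e -> exists N, forall n, (N <= n)%N -> `|u n - l| < e).
Proof.
split=> [/cvgrPdist_lt ul e e0|ul].
  have [N _ NP] := ul e e0; exists N => n Nn; rewrite distrC; exact: NP.
apply/cvgrPdist_lt => e e0; have [N NP] := ul e e0.
by exists N => // n /= Nn; rewrite distrC; exact: NP.
Qed.

Lemma inv_lt_eps (e : R) : 0 < e -> exists N : nat, N.+1%:R^-1 < e.
Proof.
move=> e0; have [N _ NP] := near_infty_natSinv_lt (PosNum e0).
by exists N; exact: (NP N (leqnn _)).
Qed.

Lemma near_dist (y : V) (e : R) : 0 < e -> \forall z \near y, `|y - z| < e.
Proof.
by move=> e0; apply/nbhs_ballP; exists e => //= z; rewrite -ball_normE.
Qed.

End epsilon.

Lemma cauchy_limit {R : realType} {V : completeNormedModType R} (u : nat -> V) :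
  (forall e : R, 0 < e -> exists N, forall n p, (N <= n)%N -> (N <= p)%N ->
     `|u n - u p| < e) -> cvg (u @ \oo).
Proof.
move=> uc; apply/cauchy_cvgP; apply: cauchy_exP => e e0.
have [N NP] := uc e e0; exists (u N); exists N => // n /= Nn.
by rewrite -ball_normE /ball_/=; exact: NP.
Qed.

Section inner.
Context {R : realType} {H : completeNormedModType R}.
Variable ip : H -> H -> R.
Hypothesis ipH : inner_product ip.

Lemma ipC x y : ip x y = ip y x. Proof. by case: ipH. Qed.
Lemma ip0l y : ip 0 y = 0.
Proof. by case: ipH => _ L _; have := L 1 0 0 y; rewrite scaler0 addr0 mul1r; lra. Qed.
Lemma ipDl x y z : ip (x + y) z = ip x z + ip y z.
Proof. by case: ipH => _ L _; have := L 1 x y z; rewrite scale1r mul1r. Qed.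
Lemma ipZl a x z : ip (a *: x) z = a * ip x z.
Proof. by case: ipH => _ L _; have := L a x 0 z; rewrite addr0 ip0l addr0. Qed.
Lemma ipNl x z : ip (- x) z = - ip x z.
Proof. by rewrite -scaleN1r ipZl mulN1r. Qed.
Lemma ipBl x y z : ip (x - y) z = ip x z - ip y z.
Proof. by rewrite ipDl ipNl. Qed.
Lemma ip0r y : ip y 0 = 0. Proof. by rewrite ipC ip0l. Qed.
Lemma ipDr x y z : ip z (x + y) = ip z x + ip z y.
Proof. by rewrite ipC ipDl !(ipC z). Qed.
Lemma ipZr a x z : ip z (a *: x) = a * ip z x.
Proof. by rewrite ipC ipZl (ipC z). Qed.
Lemma ipNr x z : ip z (- x) = - ip z x.
Proof. by rewrite ipC ipNl (ipC z). Qed.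
Lemma ipBr x y z : ip z (x - y) = ip z x - ip z y.
Proof. by rewrite ipDr ipNr. Qed.
Lemma ip_sq x : ip x x = `|x| ^+ 2. Proof. by case: ipH. Qed.

Lemma ip_suml n (c : 'I_n -> R) (b : 'I_n -> H) y :
  ip (\sum_i c i *: b i) y = \sum_i c i * ip (b i) y.
Proof.
elim/big_rec2: _ => [|i u v _ <-]; first by rewrite ip0l.
by rewrite ipDl ipZl.
Qed.

Lemma ip_sumr n (c : 'I_n -> R) (b : 'I_n -> H) y :
  ip y (\sum_i c i *: b i) = \sum_i c i * ip y (b i).
Proof. by rewrite ipC ip_suml; apply: eq_bigr => i _; rewrite ipC. Qed.

Lemma cauchy_schwarz x y : `|ip x y| <= `|x| * `|y|.
Proof.
have [->|y0] := eqVneq y 0; first by rewrite ip0r !normr0 mulr0.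
have ny : 0 < `|y| by rewrite normr_gt0.
rewrite -(@ler_pXn2r _ 2) ?nnegrE ?mulr_ge0//.
have : 0 <= ip (x - (ip x y / `|y| ^+ 2) *: y) (x - (ip x y / `|y| ^+ 2) *: y).
  by rewrite ip_sq sqr_ge0.
rewrite !(ipBl, ipBr, ipZl, ipZr) !ip_sq (ipC y x) real_normK ?num_real//.
set a := ip x y; set X := `|x|; set Y := `|y|.
have Y0 : Y != 0 by rewrite normr_eq0.
have -> : X ^+ 2 - a / Y ^+ 2 * a - (a / Y ^+ 2 * a - a / Y ^+ 2 * (a / Y ^+ 2 * Y ^+ 2))
   = X ^+ 2 - a ^+ 2 / Y ^+ 2 by field.
by rewrite subr_ge0 ler_pdivrMr ?exprn_gt0// exprMn.
Qed.

Lemma ip_inj x : (forall y, ip x y = 0) -> x = 0.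
Proof.
move=> /(_ x); rewrite ip_sq => /eqP.
by rewrite expf_eq0/= normr_eq0 => /eqP.
Qed.

Lemma ip_injr x y : (forall z, ip z x = ip z y) -> x = y.
Proof.
move=> xy; apply/eqP; rewrite -subr_eq0; apply/eqP; apply: ip_inj => z.
by rewrite ipC ipBr xy subrr.
Qed.

Lemma norm_le_ip x (C : R) : 0 <= C -> (forall y, ip x y <= C * `|y|) -> `|x| <= C.
Proof.
move=> C0 /(_ x); rewrite ip_sq => xC.
have [->|x0] := eqVneq x 0; first by rewrite normr0.
by rewrite -(@ler_pM2r _ `|x|) ?normr_gt0// -expr2.
Qed.

Lemma ip_continuous x : continuous (ip x).
Proof.
move=> y; apply/cvgrPdist_lt => e e0.
near=> z; rewrite -ipBr (le_lt_trans (cauchy_schwarz _ _))//.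
have x1 : 0 < `|x| + 1 by rewrite ltr_wpDl.
rewrite (@le_lt_trans _ _ ((`|x| + 1) * `|y - z|))//.
  by rewrite ler_wpM2r// lerDl.
rewrite mulrC -ltr_pdivlMr//; near: z.
by apply: near_dist; rewrite divr_gt0.
Unshelve. all: end_near. Qed.

Lemma parallelogram (x y : H) :
  `|x + y| ^+ 2 + `|x - y| ^+ 2 = `|x| ^+ 2 *+ 2 + `|y| ^+ 2 *+ 2.
Proof. by rewrite -!ip_sq !(ipDl, ipDr, ipNl, ipNr); ring. Qed.

(* The representing vector minimizes |x|^2 - 2 l x. *)
Lemma riesz (l : H -> R) (C : R) :
  (forall a x y, l (a *: x + y) = a * l x + l y) ->
  (forall x, `|l x| <= C * `|x|) -> exists z, forall x, l x = ip z x.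
Proof.
move=> lin bnd.
have l0 : l 0 = 0.
  by have := lin 1 0 0; rewrite scaler0 addr0 mul1r; lra.
have lD x y : l (x + y) = l x + l y by have := lin 1 x y; rewrite scale1r mul1r.
have lZ a x : l (a *: x) = a * l x by have := lin a x 0; rewrite addr0 l0 addr0.
pose J x := `|x| ^+ 2 - 2 * l x.
have JC x : - C ^+ 2 <= J x.
  have := bnd x; rewrite ler_norml => /andP[_]; rewrite /J.
  by have := sqr_ge0 (`|x| - C); nra.
have infJ : has_inf (range J).
  by split; [exists (J 0); exists 0|exists (- C ^+ 2) => _ [x _ <-]].
pose mJ := inf (range J).
have mJle x : mJ <= J x by apply: ge_inf; [case: infJ|exists x].
(* The parallelogram law; the linear part of [J] cancels, so points that nearly minimize [J] are
   close to each other. *)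
have Jpar x y : `|x - y| ^+ 2 = 2 * (J x + J y - 2 * J (2^-1 *: (x + y))).
  rewrite /J lZ lD normrZ exprMn ger0_norm//.
  have -> : `|x + y| ^+ 2 = `|x| ^+ 2 *+ 2 + `|y| ^+ 2 *+ 2 - `|x - y| ^+ 2.
    by rewrite -parallelogram addrK.
  by field.
have /choice[x xP] : forall n : nat, exists x, J x < mJ + n.+1%:R^-1.
  move=> n; have [_ [x _ <-] xlt] := @inf_adherent _ (range J) n.+1%:R^-1 ltac:(by rewrite invr_gt0) infJ.
  by exists x.
have dist n p : `|x n - x p| ^+ 2 <= 2 * (n.+1%:R^-1 + p.+1%:R^-1).
  rewrite Jpar; move: (mJle (2^-1 *: (x n + x p))) (xP n) (xP p).
  move: (J (x n)) (J (x p)) (J _) (n.+1%:R^-1) (p.+1%:R^-1) => a b c v w.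
  by move: mJ {mJle xP} => q; lra.
have cx : cvg (x @ \oo).
  apply: cauchy_limit => e e0.
  have [N NP] : exists N : nat, 4 * N.+1%:R^-1 < e ^+ 2.
    have e2 : 0 < e ^+ 2 / 4 by rewrite divr_gt0 ?exprn_gt0.
    by have [N NP] := inv_lt_eps e2; exists N; rewrite mulrC -ltr_pdivlMr.
  exists N => n p Nn Np.
  rewrite -(@ltr_pXn2r _ 2) ?nnegrE ?(ltW e0)//.
  apply: le_lt_trans (dist _ _) _; apply: le_lt_trans NP.
  have : n.+1%:R^-1 <= N.+1%:R^-1 :> R by rewrite lef_pV2 ?posrE// ler_nat ltnS.
  have : p.+1%:R^-1 <= N.+1%:R^-1 :> R by rewrite lef_pV2 ?posrE// ler_nat ltnS.
  have arith (a b c : R) : a <= c -> b <= c -> 2 * (a + b) <= 4 * c by lra.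
  by move=> pN nN; apply: arith.
pose z : H := lim (x @ \oo); exists z => y.
have Jz : J z <= mJ.
  have lcont : continuous l.
    move=> u; apply/cvgrPdist_lt => e e0; near=> v.
    have -> : l u - l v = l (u - v) by rewrite lD -[- v]scaleN1r lZ mulN1r.
    rewrite (le_lt_trans (bnd _))//.
    have x1 : 0 < `|C| + 1 by rewrite ltr_wpDl.
    rewrite (@le_lt_trans _ _ ((`|C| + 1) * `|u - v|))//.
      by rewrite ler_wpM2r// ler_wpDr// ler_norm.
    rewrite mulrC -ltr_pdivlMr//; near: v.
    by apply: near_dist; rewrite divr_gt0.
  have Jx : J (x n) @[n --> \oo] --> J z.
    apply: cvgB; last first.
      by apply: cvgM; [exact: cvg_cst|apply: (cvg_comp _ _ cx); exact: lcont].
    under eq_cvg do rewrite expr2; rewrite expr2.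
    by apply: cvgM; apply: cvg_norm.
  apply: ler_cvg_to Jx _ _.
    rewrite -[X in _ --> X]addr0; apply: cvgD; first exact: cvg_cst.
    exact: cvg_harmonic.
  by near=> n; apply/ltW/xP.
have zP t : 0 <= t * (2 * (ip z y - l y)) + t ^+ 2 * `|y| ^+ 2.
  have := le_trans Jz (mJle (z + t *: y)); rewrite /J lD lZ -!ip_sq.
  by rewrite !(ipDl, ipDr, ipZl, ipZr) (ipC y z); lra.
have [->|y0] := eqVneq y 0; first by rewrite l0 ip0r.
set a := ip z y - l y in zP; apply/eqP; rewrite eq_sym -subr_eq0 -/a; apply/eqP.
have ny : 0 < `|y| ^+ 2 by rewrite exprn_gt0// normr_gt0.
(* The vertex of the quadratic polynomial in [zP]. *)
have := zP (- a / `|y| ^+ 2).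
have -> : - a / `|y| ^+ 2 * (2 * a) + (- a / `|y| ^+ 2) ^+ 2 * `|y| ^+ 2
  = - (a ^+ 2 / `|y| ^+ 2) by field; rewrite normr_eq0.
rewrite oppr_ge0 ler_pdivrMr// mul0r => a2.
by apply/eqP; rewrite -sqrf_eq0 eq_le a2 sqr_ge0.
Unshelve. all: end_near. Qed.

Lemma adjoint_exists (T : H -> H) (C : R) : linear T ->
  (forall x, `|T x| <= C * `|x|) ->
  exists T' : H -> H, forall eta x, ip (T' eta) x = ip eta (T x).
Proof.
move=> lin bnd.
suff /choice[T' T'P] : forall eta, exists z, forall x, ip eta (T x) = ip z x.
  by exists T' => eta x; rewrite T'P.
move=> eta; apply: (@riesz _ (`|eta| * C)) => [a x y|x].
  by rewrite lin ipDr ipZr.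
by rewrite (le_trans (cauchy_schwarz _ _))// -mulrA ler_wpM2l.
Qed.

End inner.

(** * Cadlag functions *)

Section cadlag_real.
Context {R : realType}.
Notation mu := (@lebesgue_measure R).
Implicit Types (f g : R -> R).

Lemma cadlag_right (V : normedModType R) (x : R -> V) t : cadlag x -> 0 <= t ->
  forall e : R, 0 < e -> exists2 d : R, 0 < d &
     forall u, t <= u -> u < t + d -> `|x u - x t| < e.
Proof.
move=> cx t0 e e0; have [/right_limP /(_ e e0)[d d0 dP] _] := cx t t0.
exists d => // u; rewrite le_eqVlt => /predU1P[<-|tu utd]; last exact: dP.
by rewrite subrr normr0.
Qed.

(** Consider the supremum of the times up to which the path is bounded: the left limit shows that it
    is attained, right continuity that it can be exceeded as long as it is below [T]. *)
Lemma cadlag_bounded (V : normedModType R) (x : R -> V) (T : R) : cadlag x ->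
  exists2 B : R, 0 <= B & forall t, 0 <= t -> t <= T -> `|x t| <= B.
Proof.
move=> cx; pose E := [set t : R | 0 <= t <= T /\
  exists B : R, forall u, 0 <= u -> u <= t -> `|x u| <= B].
have [T0|T0] := ltP T 0.
  by exists 0 => // t t0 tT; move: (le_trans t0 tT); rewrite leNgt T0.
have E0 : E 0.
  split; first by rewrite lexx.
  by exists `|x 0| => u u0 u0'; have -> : u = 0 by apply/eqP; rewrite eq_le u0 u0'.
have supE : has_sup E by split; [exists 0|exists T => t [/andP[]]].
pose s := sup E.
have s0 : 0 <= s by apply: ub_le_sup => //; case: supE.
have sT : s <= T by apply: ge_sup; [exists 0|move=> t [/andP[]]].
have Es : E s.
  move: s0; rewrite le_eqVlt => /predU1P[<-//|s0].
  have [_ /(_ s0)[l /left_limP /(_ 1 ltr01)[d d0 dP]]] := cx s (ltW s0).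
  have [t [/andP[t0 tT] [B BP]] dt] := @sup_adherent _ E d d0 supE.
  split; first by rewrite (ltW s0) sT.
  exists (Num.max (Num.max B (`|l| + 1)) `|x s|) => u u0 us.
  rewrite !le_max; have [ut|tu] := leP u t; first by rewrite BP.
  move: us; rewrite le_eqVlt => /predU1P[->|us]; first by rewrite lexx !orbT.
  have /dP/(_ (lt_trans dt tu)) ul := us; apply/orP; left; apply/orP; right.
  by rewrite -(subrK l (x u)) (le_trans (ler_normD _ _))// addrC lerD2l ltW.
have [_ [B BP]] := Es.
suff -> : T = s.
  exists (Num.max 0 B); rewrite ?le_max ?lexx// => t t0 ts.
  by rewrite le_max BP ?orbT.
apply/eqP; rewrite eq_sym eq_le sT leNgt; apply/negP => sT'.
have [d d0 dP] := cadlag_right cx s0 ltr01.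
pose s' := Num.min T (s + d / 2).
have ss' : s < s' by rewrite lt_min sT' ltrDl divr_gt0.
have : s' <= s.
  apply: ub_le_sup; first by case: supE.
  split; first by rewrite (le_trans s0 (ltW ss')) ge_min lexx.
  exists (Num.max B (`|x s| + 1)) => u u0 us'.
  rewrite le_max; have [us|su] := leP u s; first by rewrite BP.
  apply/orP; right; rewrite -(subrK (x s) (x u)) (le_trans (ler_normD _ _))// addrC.
  rewrite lerD2l ltW// dP ?(ltW su)// (le_lt_trans us')// /s'.
  by rewrite gt_min; apply/orP; right; rewrite ltrD2l; lra.
by rewrite leNgt ss'.
Qed.

(** A class of integrands closed under sums and products that contains both the cadlag paths and
    their left limits; integrability on compact intervals then comes for free. *)
Definition bounded_measurable f := forall T : R,
  measurable_fun `[0, T] f /\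
  exists B : R, forall t, 0 <= t -> t <= T -> `|f t| <= B.

(** The successor makes the grid point strictly larger than [s], as a limit from the right
    requires. *)
Definition grid_right (n : nat) (s : R) : R := (Num.truncn (s * n.+1%:R)).+1%:R / n.+1%:R.

Lemma grid_rightP n s : 0 <= s -> s < grid_right n s <= s + n.+1%:R^-1.
Proof.
move=> s0; rewrite /grid_right ltr_pdivlMr// truncnS_gt/=.
rewrite ler_pdivrMr// mulrDl mulVf// -natr1 lerD2r.
by rewrite truncn_le// mulr_ge0.
Qed.

Lemma countable_range_measurable (h : nat -> R) (n : nat) (T : R) :
  measurable_fun `[0, T] (fun s : R => h (Num.truncn (s * n.+1%:R))).
Proof.
move=> _ B mB.
rewrite [X in measurable X](_ : _ = \bigcup_(k in [set k | B (h k)])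
   (`[0, T] `&` `[k%:R / n.+1%:R, k.+1%:R / n.+1%:R[ )); last first.
  apply/seteqP; split => [s /= [sT Bs]|s [k Bk [/= sT sk]]].
    exists (Num.truncn (s * n.+1%:R)) => //=; split => //.
    rewrite in_itv/= ler_pdivrMr// ltr_pdivlMr// truncn_itv// mulr_ge0//.
    by move: sT; rewrite in_itv/= => /andP[].
  split => //=; suff -> : Num.truncn (s * n.+1%:R) = k by [].
  by apply/truncn_def; move: sk; rewrite in_itv/= ler_pdivrMr// ltr_pdivlMr.
by apply: bigcup_measurable => k _; exact: measurableI.
Qed.

Lemma right_continuous_measurable f (T : R) :
  (forall t, 0 <= t -> f u @[u --> t^'+] --> f t) -> measurable_fun `[0, T] f.
Proof.
move=> rf; apply: (@measurable_fun_cvg _ _ _ _ (fun n s => f (grid_right n s))).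
  by move=> n; exact: (countable_range_measurable (fun k => f (k.+1%:R / n.+1%:R))).
move=> t /=; rewrite in_itv/= => /andP[t0 _]; apply/seq_limP => e e0.
have /right_limP /(_ e e0)[d d0 dP] := rf t t0.
have [N NP] := inv_lt_eps d0; exists N => n Nn.
have /andP[tg gt] := grid_rightP n t0; apply: dP => //.
rewrite (le_lt_trans gt)// ltrD2l (le_lt_trans _ NP)//.
by rewrite lef_pV2 ?posrE// ler_nat ltnS.
Qed.

Lemma cadlag_bounded_measurable f : cadlag f -> bounded_measurable f.
Proof.
move=> cf T; split; first by apply: right_continuous_measurable => t /cf[].
by have [B _ BP] := cadlag_bounded T cf; exists B.
Qed.

Lemma bounded_measurable_cst (c : R) : bounded_measurable (cst c).
Proof. by move=> T; split; [exact: measurable_cst|exists `|c|]. Qed.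

Lemma bounded_measurableD f g : bounded_measurable f -> bounded_measurable g ->
  bounded_measurable (fun s => f s + g s).
Proof.
move=> mf mg T; have [mfT [B BP]] := mf T; have [mgT [C CP]] := mg T.
split; first exact: measurable_funD.
by exists (B + C) => t t0 tT; rewrite (le_trans (ler_normD _ _))// lerD ?BP ?CP.
Qed.

Lemma bounded_measurableM f g : bounded_measurable f -> bounded_measurable g ->
  bounded_measurable (fun s => f s * g s).
Proof.
move=> mf mg T; have [mfT [B BP]] := mf T; have [mgT [C CP]] := mg T.
split; first exact: measurable_funM.
by exists (B * C) => t t0 tT; rewrite normrM ler_pM ?BP ?CP.
Qed.

Lemma bounded_measurableZ (c : R) f : bounded_measurable f ->
  bounded_measurable (fun s => c * f s).
Proof. by move=> mf; apply: bounded_measurableM => //; exact: bounded_measurable_cst. Qed.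

Lemma bounded_measurableN f : bounded_measurable f ->
  bounded_measurable (fun s => - f s).
Proof.
move=> mf; have := bounded_measurableZ (-1) mf.
by under [fun _ => _ * _]eq_fun do rewrite mulN1r.
Qed.

Lemma bounded_measurable_norm f : bounded_measurable f ->
  bounded_measurable (fun s => `|f s|).
Proof.
move=> mf T; have [mfT [B BP]] := mf T.
by split; [exact: measurableT_comp|exists B => t t0 tT; rewrite normr_id BP].
Qed.

Lemma bounded_measurable_sum n (F : 'I_n -> R -> R) :
  (forall i, bounded_measurable (F i)) ->
  bounded_measurable (fun s => \sum_i F i s).
Proof.
move=> mF; elim: n F mF => [|n IH] F mF.
  under eq_fun do rewrite big_ord0; exact: bounded_measurable_cst.
under eq_fun do rewrite big_ord_recr/=.
by apply: bounded_measurableD => //; exact: IH.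
Qed.

Lemma bounded_measurable_integrable f a b : bounded_measurable f -> 0 <= a ->
  mu.-integrable `[a, b] (EFin \o f).
Proof.
move=> mf a0; have [mfb [B BP]] := mf b.
have sub : `[a, b]%classic `<=` `[0, b]%classic.
  by move=> u /=; rewrite !in_itv/= => /andP[au ->]; rewrite (le_trans a0 au).
apply: measurable_bounded_integrable => //.
- rewrite [ltLHS](lebesgue_measure_itv `[a, b])/=.
  by case: ifP => // _; rewrite -EFinB ltry.
- exact: measurable_funS sub mfb.
exists B; split; first exact: num_real.
move=> M BM u /= /sub /=; rewrite in_itv/= => /andP[u0 ub].
by rewrite (le_trans (BP _ u0 ub))// ltW.
Qed.

Lemma integral_split f s t : bounded_measurable f -> 0 <= s -> s <= t ->
  \int[mu]_(u in `[0, t]) f u =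
  \int[mu]_(u in `[0, s]) f u + \int[mu]_(u in `[s, t]) f u.
Proof.
move=> mf s0 st; have := @Rintegral_itvB R f (BLeft 0) (BRight t) s.
rewrite bounded_measurable_integrable// => /(_ isT).
rewrite !bnd_simp => /(_ s0 st) split_.
rewrite -(Rintegral_itv_obnd_cbnd (r := s) (b := BRight t)).
  by rewrite -split_ addrC subrK.
apply: integrableS (bounded_measurable_integrable t mf s0) => //.
by apply: subset_itvr; rewrite bnd_simp.
Qed.

Lemma Rintegral_itv_cst (c a b : R) : a <= b ->
  \int[mu]_(u in `[a, b]) (c : R) = c * (b - a).
Proof.
move=> ab; rewrite Rintegral_cst// [X in fine X](lebesgue_measure_itv `[a, b])/=.
rewrite lte_fin; case: ltrP => [//|ba].
have -> : a = b by apply/eqP; rewrite eq_le ab.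
by rewrite subrr.
Qed.

Lemma Rintegral_itv_bound f a b (B : R) : bounded_measurable f -> 0 <= a -> a <= b ->
  (forall u, a <= u -> u <= b -> `|f u| <= B) ->
  `|\int[mu]_(u in `[a, b]) f u| <= B * (b - a).
Proof.
move=> mf a0 ab fB; rewrite -Rintegral_itv_cst//.
have im g : bounded_measurable g -> mu.-integrable `[a, b] (EFin \o g).
  by move=> mg; exact: bounded_measurable_integrable.
apply: le_trans (le_normr_Rintegral _ (im _ mf)) _ => //.
apply: le_Rintegral => //; first exact/im/bounded_measurable_norm.
  exact/im/bounded_measurable_cst.
by move=> u /=; rewrite in_itv/= => /andP[au ub]; exact: fB.
Qed.

Lemma Rintegral_itv_close f a b (c e : R) : bounded_measurable f -> 0 <= a -> a <= b ->
  (forall u, a <= u -> u <= b -> `|f u - c| <= e) ->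
  `|\int[mu]_(u in `[a, b]) f u - c * (b - a)| <= e * (b - a).
Proof.
move=> mf a0 ab fc; rewrite -Rintegral_itv_cst// -RintegralB//.
- apply: Rintegral_itv_bound => //; apply: bounded_measurableD => //.
  exact: bounded_measurable_cst.
- exact: bounded_measurable_integrable.
- exact: (bounded_measurable_integrable _ (bounded_measurable_cst c)).
Qed.

Lemma Rintegral_right_lim f t : bounded_measurable f -> 0 <= t ->
  f u @[u --> t^'+] --> f t ->
  h^-1 * (\int[mu]_(u in `[0, t + h]) f u - \int[mu]_(u in `[0, t]) f u)
    @[h --> 0^'+] --> f t.
Proof.
move=> mf t0 /right_limP ft; apply/right_limP => e e0.
have [|d d0 dP] := ft (e / 2); first by rewrite divr_gt0.
exists d => // h h0; rewrite add0r => hd.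
rewrite (integral_split mf t0 (_ : t <= t + h)) ?lerDl ?ltW// addrAC subrr add0r.
have tth : t <= t + h by rewrite lerDl ltW.
have : `|\int[mu]_(u in `[t, t + h]) f u - f t * (t + h - t)| <= e / 2 * (t + h - t).
  apply: Rintegral_itv_close => // u; rewrite le_eqVlt => /predU1P[<- _|tu uth].
    by rewrite subrr normr0 divr_ge0// ltW.
  by apply/ltW/dP => //; rewrite (le_lt_trans uth)// ltrD2l.
have -> : t + h - t = h by rewrite addrAC subrr add0r.
move: (\int[mu]_(u in _) _) => I Ih.
have -> : h^-1 * I - f t = h^-1 * (I - f t * h) by field; rewrite gt_eqF.
rewrite normrM gtr0_norm ?invr_gt0// mulrC ltr_pdivrMr//.
by rewrite (le_lt_trans Ih)// ltr_pM2r//; lra.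
Qed.

(** Cut [[0, T]] into equal steps shorter than [d] and add up the increments. This stands in for the
    vanishing of a derivative: it applies to functions known only through integrals and semigroup
    identities, whose increments are easy to compare to first order. *)
Lemma locally_flat_constant (F : R -> R) (T : R) : 0 <= T ->
  (forall e, 0 < e -> exists2 d : R, 0 < d & forall s h, 0 <= s -> 0 <= h ->
     h < d -> s + h <= T -> `|F (s + h) - F s| <= e * h) ->
  F T = F 0.
Proof.
move=> T0 flat; apply/eqP; rewrite -subr_eq0 -normr_eq0 eq_le normr_ge0 andbT.
have [->|T0'] := eqVneq T 0; first by rewrite subrr normr0.
have Tp : 0 < T by rewrite lt_neqAle eq_sym T0'.
apply/ler_addgt0Pr => e e0; rewrite add0r.
have [|d d0 dP] := flat (e / T); first by rewrite divr_gt0.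
have [N NP] : exists N : nat, N.+1%:R^-1 < d / T by apply: inv_lt_eps; rewrite divr_gt0.
pose h := T / N.+1%:R.
have h0 : 0 <= h by rewrite divr_ge0.
have hd : h < d by rewrite /h mulrC -ltr_pdivlMr.
have step k : (k <= N.+1)%N -> `|F (k%:R * h) - F 0| <= e / T * (k%:R * h).
  elim: k => [_|k IH kN]; first by rewrite !mul0r subrr normr0 mulr0.
  rewrite -natr1 mulrDl mul1r mulrDr.
  have -> : F (k%:R * h + h) - F 0 = (F (k%:R * h + h) - F (k%:R * h)) + (F (k%:R * h) - F 0).
    by rewrite addrA subrK.
  rewrite (le_trans (ler_normD _ _))// addrC lerD// ?IH// 1?ltnW//.
  apply: dP => //; first by rewrite mulr_ge0.
  rewrite -[X in _ + X]mul1r -mulrDl natr1 mulrCA -ler_pdivlMl// mulVf ?gt_eqF//.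
  by rewrite ler_pdivrMr// mul1r ler_nat.
have := step N.+1 (leqnn _); rewrite /h mulrCA mulfV// mulr1.
by rewrite -mulrA mulVf ?mulr1// gt_eqF.
Qed.

End cadlag_real.

(** * Semigroups and their generators *)

Section kernel.
Context {R : realType} {U : lmodType R}.

Definition functional (l : U -> R) := forall a x y, l (a *: x + y) = a * l x + l y.

Lemma functional0 l : functional l -> l 0 = 0.
Proof. by move=> L; have := L 1 0 0; rewrite scaler0 addr0 mul1r; lra. Qed.
Definition linear_set (E : set U) :=
  E 0 /\ forall (a : R) x y, E x -> E y -> E (a *: x + y).

Lemma widen_ord_lift n (i : 'I_n) : widen_ord (leqnSn n) i = lift ord_max i.
Proof. by apply: val_inj; rewrite /= /bump leqNgt ltn_ord. Qed.

(** Induction on the number of functionals: pass to the kernel of the last one, then correct by a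
    multiple of it. Linearity of [l] is asked on [E] only, because later [l] is a coordinate
    obtained by choice, or is considered on the graph of an adjoint. *)
Lemma functional_combination n (E : set U) (l : U -> R) (ls : 'I_n -> U -> R) :
  linear_set E -> (forall a x y, E x -> E y -> l (a *: x + y) = a * l x + l y) ->
  (forall i, functional (ls i)) -> (forall x, E x -> (forall i, ls i x = 0) -> l x = 0) ->
  exists c : 'I_n -> R, forall x, E x -> l x = \sum_i c i * ls i x.
Proof.
elim: n E ls l => [|n IH] E ls l linE linl linls ker.
  exists (fun=> 0) => x Ex; rewrite big_ord0; apply: ker => // i.
  by case: i.
pose E' := [set x | E x /\ ls ord_max x = 0].
have linE' : linear_set E'.
  case: linE => E0 EL; split; first by split=> //; rewrite functional0.
  move=> a x y [Ex lx] [Ey ly]; split; first exact: EL.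
  by rewrite linls lx ly mulr0 addr0.
have [|||c cP] := IH E' (fun i => ls (widen_ord (leqnSn n) i)) l linE'.
- by move=> a x y [Ex _] [Ey _]; exact: linl.
- by move=> i; exact: linls.
- move=> x [Ex lx] lsx; apply: ker => // i.
  case: (unliftP ord_max i) => [j ->|->//].
  by rewrite -(lsx j) -widen_ord_lift.
pose l' x := l x - \sum_i c i * ls (widen_ord (leqnSn n) i) x.
have linl' a x y : E x -> E y -> l' (a *: x + y) = a * l' x + l' y.
  move=> Ex Ey; rewrite /l' linl//.
  under eq_bigr do rewrite linls mulrDr mulrCA.
  by rewrite big_split/= -mulr_sumr; ring.
(* If the last functional is not zero on [E], a point [x0] where it does not vanish serves to move
   any [x] into its kernel. *)
have [alll|/existsNP[x0 /not_implyP[Ex0 /eqP lx0]]] :=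
    pselect (forall x, E x -> ls ord_max x = 0).
  exists (fun i => if unlift ord_max i is Some j then c j else 0) => x Ex.
  rewrite (cP x) ?big_ord_recr/=; last by split=> //; exact: alll.
  rewrite alll// mulr0 addr0; apply: eq_bigr => i _; congr (_ * _).
  by rewrite widen_ord_lift liftK.
exists (fun i => if unlift ord_max i is Some j then c j else l' x0 / ls ord_max x0) => x Ex.
rewrite big_ord_recr/= unlift_none.
under eq_bigr => i _.
  rewrite {1}widen_ord_lift liftK; over.
have : l' (- (ls ord_max x / ls ord_max x0) *: x0 + x) = 0.
  apply/eqP; rewrite /l' subr_eq0; apply/eqP/cP; case: linE => _ EL; split; first exact: EL.
  by rewrite linls mulNr mulfVK// addNr.
rewrite linl'// => h.
have lx : l' x = ls ord_max x / ls ord_max x0 * l' x0.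
  by move: h; move: (ls _ x / _) (l' x) (l' x0) => p q r h; lra.
have -> : l x = l' x + \sum_i c i * ls (widen_ord (leqnSn n) i) x by rewrite /l' subrK.
by rewrite lx addrC; congr (_ + _); rewrite mulrC mulrA [RHS]mulrAC.
Qed.

End kernel.

Section semigroup.
Context {R : realType} {H : completeNormedModType R}.
Notation mu := (@lebesgue_measure R).
Variable ip : H -> H -> R.
Hypothesis ipH : inner_product ip.
Variable S : R -> H -> H.
Hypotheses (semiS : C0_semigroup S) (pcS : pseudo_contractive S).

Lemma ip_functional (x : H) : functional (ip x).
Proof. by move=> a y z; rewrite (ipDr ipH) (ipZr ipH). Qed.

Lemma ip_functionall (x : H) : functional (ip^~ x).
Proof. by move=> a y z; rewrite (ipDl ipH) (ipZl ipH). Qed.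

Lemma cadlag_ip (x : R -> H) (eta : H) : cadlag x -> cadlag (fun s => ip eta (x s)).
Proof.
move=> cx t t0; have [xr xl] := cx t t0; split.
  by apply: cvg_comp xr _; exact: ip_continuous.
move=> t0'; have [l xl'] := xl t0'; exists (ip eta l).
by apply: cvg_comp xl' _; exact: ip_continuous.
Qed.

Lemma ip_bm (x : R -> H) (eta : H) : cadlag x ->
  bounded_measurable (fun s => ip eta (x s)).
Proof. by move=> cx; apply/cadlag_bounded_measurable/cadlag_ip. Qed.

Lemma S0 h : S 0 h = h. Proof. by case: semiS. Qed.
Lemma S_linear t : 0 <= t -> linear (S t).
Proof. by case: semiS => L _ _ _ t0; case: (L t t0). Qed.
Lemma S_add s t h : 0 <= s -> 0 <= t -> S (s + t) h = S s (S t h).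
Proof. by case: semiS => _ _ L _; exact: L. Qed.
Lemma SD t x y : 0 <= t -> S t (x + y) = S t x + S t y.
Proof. by move=> t0; have := S_linear t0 1 x y; rewrite !scale1r. Qed.
Lemma S_0 t : 0 <= t -> S t 0 = 0.
Proof. by move=> t0; apply: (addrI (S t 0)); rewrite -SD// !addr0. Qed.
Lemma SZ t (a : R) x : 0 <= t -> S t (a *: x) = a *: S t x.
Proof. by move=> t0; have := S_linear t0 a x 0; rewrite !addr0 S_0// addr0. Qed.
Lemma SB t x y : 0 <= t -> S t (x - y) = S t x - S t y.
Proof. by move=> t0; rewrite SD// -scaleN1r SZ// scaleN1r. Qed.

Lemma S_bound (T : R) : exists2 C : R, 0 < C &
  forall t h, 0 <= t -> t <= T -> `|S t h| <= C * `|h|.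
Proof.
have [w wP] := pcS; exists (expR (`|w| * `|T|)); first exact: expR_gt0.
move=> t h t0 tT; rewrite (le_trans (wP _ _ t0))// ler_wpM2r// ler_expR.
rewrite (le_trans (ler_norm _))// normrM ler_wpM2l// ger0_norm//.
by rewrite (le_trans tT)// ler_norm.
Qed.

Lemma S_right0 h (e : R) : 0 < e -> exists2 d : R, 0 < d &
  forall u, 0 <= u -> u < d -> `|S u h - h| < e.
Proof.
move=> e0; have [_ _ _ /(_ h) /right_limP /(_ e e0)[d d0 dP]] := semiS.
exists d => // u; rewrite le_eqVlt => /predU1P[<- _|u0 ud].
  by rewrite S0 subrr normr0.
by apply: dP => //; rewrite add0r.
Qed.

Lemma orbit_unif (T e : R) h : 0 < e -> exists2 d : R, 0 < d &
  forall s u, 0 <= s -> s <= T -> 0 <= u -> u < d -> `|S (s + u) h - S s h| <= e.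
Proof.
move=> e0; have [C C0 CP] := S_bound T.
have [|d d0 dP] := @S_right0 h (e / C); first by rewrite divr_gt0.
exists d => // s u s0 sT u0 ud; rewrite S_add// -SB// (le_trans (CP _ _ s0 sT))//.
by rewrite mulrC -ler_pdivlMr// ltW// dP.
Qed.

Lemma orbit_cadlag h : cadlag (S ^~ h).
Proof.
move=> t t0; split.
  apply/right_limP => e e0; have [|d d0 dP] := @orbit_unif t (e / 2) h; first by rewrite divr_gt0.
  exists d => // u tu utd; rewrite (@le_lt_trans _ _ (e / 2))//; last by lra.
  have := dP t (u - t) t0 (lexx _); rewrite addrCA subrr addr0; apply; lra.
move=> t0'; exists (S t h); apply/left_limP => e e0.
have [|d d0 dP] := @orbit_unif t (e / 2) h; first by rewrite divr_gt0.
exists (Num.min d t); rewrite ?lt_min ?d0// => u ut; rewrite ltrBlDr -ltrBlDl lt_min => /andP[tud tut].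
rewrite distrC (@le_lt_trans _ _ (e / 2))//; last by lra.
have := dP u (t - u); rewrite addrCA subrr addr0; apply; lra.
Qed.

Lemma orbit_bm h eta : bounded_measurable (fun s => ip eta (S s h)).
Proof. exact/ip_bm/orbit_cadlag. Qed.

(** The integral of the orbit of [h] over [[0, t]], as the vector representing the weak integrals.
    The value [0] is only a default: existence is the content of [JE]. *)
Definition J (t : R) (h : H) : H :=
  xget 0 [set z | forall eta, ip eta z = \int[mu]_(s in `[0, t]) ip eta (S s h)].

Lemma JE t h eta : 0 <= t -> ip eta (J t h) = \int[mu]_(s in `[0, t]) ip eta (S s h).
Proof.
move=> t0; move: eta; rewrite /J; case: xgetP => [z _ //|/(_ _)/= noz].
have [C C0 CP] := S_bound t; exfalso.
have [z zP] : exists z, forall eta,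
    \int[mu]_(s in `[0, t]) ip eta (S s h) = ip z eta.
  have intip eta : mu.-integrable `[0, t] (EFin \o (fun s => ip eta (S s h))).
    by apply: bounded_measurable_integrable => //; exact: orbit_bm.
  apply: (riesz ipH (C := C * `|h| * t)) => [a x y|x].
    rewrite -RintegralZl// -RintegralD//.
      by apply: eq_Rintegral => s _; rewrite (ipDl ipH) (ipZl ipH).
    apply: bounded_measurable_integrable => //.
    exact/bounded_measurableZ/orbit_bm.
  rewrite -[X in C * _ * X]subr0 mulrAC -/(_ * _).
  apply: Rintegral_itv_bound => // [|u u0 ut]; first exact: orbit_bm.
  rewrite (le_trans (cauchy_schwarz ipH _ _))// mulrC ler_wpM2r//.
  exact: CP.
by apply: (noz z) => eta; rewrite zP (ipC ipH).
Qed.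

Lemma J_linear t : 0 <= t -> linear (J t).
Proof.
move=> t0 a x y; apply: (ip_injr ipH) => eta.
have intip h : mu.-integrable `[0, t] (EFin \o (fun s => ip eta (S s h))).
  by apply: bounded_measurable_integrable => //; exact: orbit_bm.
rewrite (ipDr ipH) (ipZr ipH) !JE// -RintegralZl// -RintegralD//.
  apply: eq_Rintegral => s; rewrite inE/= in_itv/= => /andP[s0 _].
  by rewrite S_linear// (ipDr ipH) (ipZr ipH).
apply: bounded_measurable_integrable => //.
exact/bounded_measurableZ/orbit_bm.
Qed.

Lemma J_bound (T : R) : exists2 C : R, 0 < C &
  forall t h, 0 <= t -> t <= T -> `|J t h| <= C * t * `|h|.
Proof.
have [C C0 CP] := S_bound T; exists C => // t h t0 tT.
apply: (norm_le_ip ipH); first by rewrite !mulr_ge0// ltW.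
move=> eta; rewrite (ipC ipH) JE// (le_trans (ler_norm _))//.
have -> : C * t * `|h| * `|eta| = C * `|h| * `|eta| * (t - 0) by ring.
apply: Rintegral_itv_bound => // [|u u0 ut]; first exact: orbit_bm.
rewrite (le_trans (cauchy_schwarz ipH _ _))// mulrC ler_wpM2r//.
by apply: CP => //; exact: le_trans ut tT.
Qed.

Lemma J_small h (e : R) : 0 < e -> exists2 d : R, 0 < d &
  forall u, 0 <= u -> u < d -> `|J u h - u *: h| <= e * u.
Proof.
move=> e0; have [d d0 dP] := S_right0 h e0; exists d => // u u0 ud.
apply: (norm_le_ip ipH) => [|eta]; first by rewrite mulr_ge0// ltW.
rewrite (ipC ipH) (ipBr ipH) JE// (ipZr ipH) (le_trans (ler_norm _))//.
have -> : u * ip eta h = ip eta h * (u - 0) by ring.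
have -> : e * u * `|eta| = e * `|eta| * (u - 0) by ring.
apply: Rintegral_itv_close => // [|v v0 vu]; first exact: orbit_bm.
rewrite -(ipBr ipH) (le_trans (cauchy_schwarz ipH _ _))//.
by rewrite mulrC ler_wpM2r// ltW// dP// (le_lt_trans vu).
Qed.

(** Substitution in the integral, by flatness: over a short step both sides grow by the value of the
    same uniformly continuous function, up to a small multiple of the length. *)
Lemma orbit_shift t d h eta : 0 <= t -> 0 <= d ->
  \int[mu]_(s in `[0, t]) ip eta (S (d + s) h) =
  \int[mu]_(s in `[0, d + t]) ip eta (S s h) - \int[mu]_(s in `[0, d]) ip eta (S s h).
Proof.
move=> t0 d0; pose phi s := ip eta (S s h).
have bphi : bounded_measurable phi by exact: orbit_bm.
have phid s : 0 <= s -> phi (d + s) = ip eta (S s (S d h)).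
  by move=> s0; rewrite /phi addrC S_add.
have bphid : bounded_measurable (fun s => ip eta (S s (S d h))) by exact: orbit_bm.
have -> : \int[mu]_(s in `[0, t]) ip eta (S (d + s) h) =
    \int[mu]_(s in `[0, t]) ip eta (S s (S d h)).
  by apply: eq_Rintegral => s; rewrite inE/= in_itv/= => /andP[s0 _]; exact: phid.
pose F t := \int[mu]_(s in `[0, t]) ip eta (S s (S d h)) - \int[mu]_(s in `[0, d + t]) phi s.
suff : F t = F 0.
  rewrite /F addr0 set_itv1 Rintegral_set1 sub0r => /eqP.
  by rewrite subr_eq addrC => /eqP.
apply: locally_flat_constant => // e e0.
have [|r r0 rP] := @orbit_unif (d + t) (e / 2 / (`|eta| + 1)) h.
  by rewrite !divr_gt0// ltr_wpDl.
have phir s u : 0 <= s -> s <= d + t -> 0 <= u -> u < r -> `|phi (s + u) - phi s| <= e / 2.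
  move=> s0 st u0 ur; rewrite /phi -(ipBr ipH) (le_trans (cauchy_schwarz ipH _ _))//.
  have e1 : 0 < `|eta| + 1 by rewrite ltr_wpDl.
  rewrite (@le_trans _ _ ((`|eta| + 1) * (e / 2 / (`|eta| + 1))))//.
    by rewrite ler_pM// ?lerDl// rP.
  by rewrite mulrC divfK// gt_eqF.
exists r => // s k s0 k0 kr skt.
have dsk : d + (s + k) = (d + s) + k by rewrite addrA.
rewrite /F (integral_split bphid s0 (_ : s <= s + k)) ?lerDl// dsk.
rewrite (integral_split bphi (_ : 0 <= d + s) (_ : d + s <= d + s + k)) ?lerDl ?addr_ge0//.
set a := \int[mu]_(u in `[0, s]) _; set b := \int[mu]_(u in `[s, s + k]) _.
set a' := \int[mu]_(u in `[0, d + s]) _; set b' := \int[mu]_(u in _) _.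
have bk : `|b - phi (d + s) * k| <= e / 2 * k.
  have := @Rintegral_itv_close _ _ s (s + k) (phi (d + s)) (e / 2) bphid s0.
  have -> : s + k - s = k by rewrite addrAC subrr add0r.
  apply; first by rewrite lerDl.
  move=> u su usk; rewrite -phid ?(le_trans s0)//.
  have -> : d + u = d + s + (u - s) by ring.
  by apply: phir; [exact: addr_ge0|lra|lra|lra].
have b'k : `|b' - phi (d + s) * k| <= e / 2 * k.
  have := @Rintegral_itv_close _ _ (d + s) (d + s + k) (phi (d + s)) (e / 2) bphi.
  have -> : d + s + k - (d + s) = k by rewrite addrAC subrr add0r.
  apply; rewrite ?addr_ge0 ?lerDl//.
  move=> u su usk; have -> : u = d + s + (u - (d + s)) by ring.
  by apply: phir; [exact: addr_ge0|lra|lra|lra].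
have -> : a + b - (a' + b') - (a - a') = (b - phi (d + s) * k) - (b' - phi (d + s) * k) by ring.
by rewrite (le_trans (ler_normB _ _))// (le_trans (lerD bk b'k))//; lra.
Qed.

Variables (D : set H) (A : H -> H).
Hypothesis genA : generator S D A.

Lemma gen_small h (e : R) : D h -> 0 < e -> exists2 d : R, 0 < d &
  forall u, 0 <= u -> u < d -> `|S u h - h - u *: A h| <= e * u.
Proof.
move=> Dh e0; have [/(_ (conj Dh erefl)) /right_limP /(_ e e0)[d d0 dP] _] := genA h (A h).
exists d => // u; rewrite le_eqVlt => /predU1P[<- _|u0 ud].
  by rewrite S0 scale0r subrr subr0 normr0 mulr0.
have -> : S u h - h - u *: A h = u *: (u^-1 *: (S u h - h) - A h).
  by rewrite scalerBr scalerA mulfV ?scale1r// gt_eqF.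
rewrite normrZ gtr0_norm// mulrC ler_wpM2r// ltW//.
by apply: dP => //; rewrite add0r.
Qed.

Lemma gen_intro h g : (forall e : R, 0 < e -> exists2 d : R, 0 < d &
  forall u, 0 < u -> u < d -> `|S u h - h - u *: g| <= e * u) -> D h /\ A h = g.
Proof.
move=> hg; apply/genA/right_limP => e e0.
have [|d d0 dP] := hg (e / 2); first by rewrite divr_gt0.
exists d => // u u0; rewrite add0r => ud.
have -> : u^-1 *: (S u h - h) - g = u^-1 *: (S u h - h - u *: g).
  by rewrite [RHS]scalerBr scalerA mulVf ?scale1r// gt_eqF.
rewrite normrZ gtr0_norm ?invr_gt0// mulrC ltr_pdivrMr//.
by rewrite (le_lt_trans (dP _ u0 ud))// ltr_pM2r//; lra.
Qed.

Lemma gen_orbit h t : D h -> 0 <= t -> D (S t h) /\ A (S t h) = S t (A h).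
Proof.
move=> Dh t0; apply: gen_intro => e e0; have [C C0 CP] := S_bound t.
have [|d d0 dP] := @gen_small h (e / C) Dh; first by rewrite divr_gt0.
exists d => // u u0 ud; have u0' := ltW u0.
rewrite -S_add// [u + t]addrC S_add// -SB// -SZ// -SB// (le_trans (CP _ _ t0 (lexx _)))//.
rewrite mulrC -ler_pdivlMr// (le_trans (dP _ (ltW u0) ud))//.
by rewrite mulrAC.
Qed.

(** The fundamental theorem for the orbit, again by flatness: [d1] controls the difference quotient
    at [h], carried along the orbit by the bound on the semigroup, and [d2] the oscillation of the
    orbit of [A h]. *)
Lemma J_A h t : D h -> 0 <= t -> J t (A h) = S t h - h.
Proof.
move=> Dh t0; apply: (ip_injr ipH) => eta; rewrite JE// (ipBr ipH).
pose F t := ip eta (S t h) - \int[mu]_(s in `[0, t]) ip eta (S s (A h)).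
suff : F t = F 0.
  rewrite /F set_itv1 Rintegral_set1 S0 subr0 => <-.
  by rewrite opprB addrC subrK.
apply: locally_flat_constant => // e e0.
have [C C0 CP] := S_bound t; have eta0 : 0 < `|eta| + 1 by rewrite ltr_wpDl.
have [|d1 d10 d1P] := @gen_small h (e / 2 / C / (`|eta| + 1)) Dh; first by rewrite !divr_gt0.
have [|d2 d20 d2P] := @orbit_unif t (e / 2 / (`|eta| + 1)) (A h); first by rewrite !divr_gt0.
exists (Num.min d1 d2); rewrite ?lt_min ?d10// => s k s0 k0.
rewrite lt_min => /andP[kd1 kd2] skt.
rewrite /F (integral_split (orbit_bm _ _) s0 (_ : s <= s + k)) ?lerDl//.
have st : s <= t by rewrite (le_trans _ skt)// lerDl.
set I := \int[mu]_(u in `[s, s + k]) _; set I' := \int[mu]_(u in `[0, s]) _.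
have Ik : `|I - ip eta (S s (A h)) * k| <= e / 2 * k.
  have := @Rintegral_itv_close _ _ s (s + k) (ip eta (S s (A h))) (e / 2) (orbit_bm (A h) eta) s0.
  have -> : s + k - s = k by rewrite addrAC subrr add0r.
  apply; first by rewrite lerDl.
  move=> u su usk; rewrite -(ipBr ipH) (le_trans (cauchy_schwarz ipH _ _))//.
  rewrite (@le_trans _ _ ((`|eta| + 1) * (e / 2 / (`|eta| + 1))))//.
    rewrite ler_pM// ?lerDl//; have := d2P s (u - s) s0 st.
    by rewrite addrCA subrr addr0; apply; lra.
  by rewrite mulrC divfK// gt_eqF.
have Sk : `|ip eta (S (s + k) h - S s h - k *: S s (A h))| <= e / 2 * k.
  rewrite (le_trans (cauchy_schwarz ipH _ _))// S_add// -SB// -SZ// -SB//.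
  rewrite (@le_trans _ _ ((`|eta| + 1) * (C * (e / 2 / C / (`|eta| + 1) * k))))//.
    rewrite ler_pM// ?lerDl// (le_trans (CP _ _ s0 st))// ler_wpM2l// ?(ltW C0)//.
    exact: d1P.
  by rewrite le_eqVlt; apply/orP; left; apply/eqP; field; rewrite !gt_eqF.
move: Sk; rewrite !(ipBr ipH) (ipZr ipH).
set a := ip eta _; set b := ip eta (S s h); set c := ip eta _ => Sk.
have -> : a - (I' + I) - (b - I') = (a - b - k * c) - (I - c * k) by ring.
by rewrite (le_trans (ler_normB _ _))// (le_trans (lerD Sk Ik))//; lra.
Qed.

(** By commutation, [S u (J t h) - J t h = J u (S t h - h)], and [J u z / u] tends to [z] as [u]
    decreases to 0. *)
Lemma J_dom h t : 0 <= t -> D (J t h) /\ A (J t h) = S t h - h.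
Proof.
move=> t0; apply: gen_intro => e e0.
have [d d0 dP] := J_small (S t h - h) e0; exists d => // u u0 ud.
suff -> : S u (J t h) - J t h = J u (S t h - h) by exact: dP (ltW u0) ud.
apply: (ip_injr ipH) => eta; have u0' := ltW u0.
have [T TP] : exists T : H -> H, forall eta x, ip (T eta) x = ip eta (S u x).
  have [C _ CP] := S_bound u.
  by apply: (adjoint_exists ipH (S_linear u0') (C := C)) => x; exact: CP.
rewrite !(ipBr ipH) -TP !JE//.
have -> : \int[mu]_(s in `[0, t]) ip (T eta) (S s h) = \int[mu]_(s in `[0, t]) ip eta (S (u + s) h).
  by apply: eq_Rintegral => s; rewrite inE/= in_itv/= => /andP[s0 _]; rewrite TP S_add.
rewrite orbit_shift//.
have -> : S t h - h = (-1) *: h + S t h by rewrite scaleN1r addrC.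
have -> : \int[mu]_(s in `[0, u]) ip eta (S s (-1 *: h + S t h)) =
    - ip eta (J u h) + ip eta (J u (S t h)).
  by rewrite -JE// J_linear// (ipDr ipH) (ipZr ipH) mulN1r.
rewrite !JE//.
have -> : \int[mu]_(s in `[0, u]) ip eta (S s (S t h)) = \int[mu]_(s in `[0, u]) ip eta (S (t + s) h).
  by apply: eq_Rintegral => s; rewrite inE/= in_itv/= => /andP[s0 _]; rewrite addrC S_add.
by rewrite orbit_shift// [t + u]addrC; ring.
Qed.

(** [J d z / d] tends to [z]. Since [J d z] lies in the domain of [A], this takes the place of
    density arguments below. *)
Lemma J_separates (eta z : H) :
  (forall d : R, 0 < d -> ip eta (J d z) = 0) -> ip eta z = 0.
Proof.
move=> Jz; apply/eqP; rewrite -normr_eq0 eq_le normr_ge0 andbT.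
apply/ler_addgt0Pr => e e0; rewrite add0r.
have eta0 : 0 < `|eta| + 1 by rewrite ltr_wpDl.
have [|d d0 dP] := @J_small z (e / (`|eta| + 1)); first by rewrite divr_gt0.
have d2 : 0 < d / 2 by rewrite divr_gt0.
have := dP (d / 2) (ltW d2) ltac:(lra); have := Jz _ d2.
move: (d / 2) d2 => u u0 Ju uP.
rewrite -(ler_pM2l u0) -[u in leLHS]gtr0_norm// -normrM -(ipZr ipH).
have -> : ip eta (u *: z) = - ip eta (J u z - u *: z) by rewrite (ipBr ipH) Ju sub0r opprK.
rewrite normrN (le_trans (cauchy_schwarz ipH _ _))//.
rewrite (@le_trans _ _ ((`|eta| + 1) * (e / (`|eta| + 1) * u)))//.
  by rewrite ler_pM// lerDl.
by rewrite le_eqVlt; apply/orP; left; apply/eqP; field; rewrite gt_eqF.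
Qed.

Definition adjS (t : R) (eta : H) : H := xget 0 [set z | forall x, ip z x = ip eta (S t x)].
Definition adjJ (t : R) (eta : H) : H := xget 0 [set z | forall x, ip z x = ip eta (J t x)].

Lemma adjSE t eta x : 0 <= t -> ip (adjS t eta) x = ip eta (S t x).
Proof.
move=> t0; rewrite /adjS; case: xgetP => [z _ /(_ x)//|/(_ _)/= noz].
have [C _ CP] := S_bound t.
have [T TP] := adjoint_exists ipH (S_linear t0) (fun x => CP t x t0 (lexx t)).
by exfalso; apply: (noz (T eta)) => y; exact: TP.
Qed.

Lemma adjJE t eta x : 0 <= t -> ip (adjJ t eta) x = ip eta (J t x).
Proof.
move=> t0; rewrite /adjJ; case: xgetP => [z _ /(_ x)//|/(_ _)/= noz].
have [C _ CP] := J_bound t.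
have [T TP] := adjoint_exists ipH (J_linear t0) (fun x => CP t x t0 (lexx t)).
by exfalso; apply: (noz (T eta)) => y; exact: TP.
Qed.

Lemma adjS_bound (T : R) : exists2 C : R, 0 < C &
  forall t eta, 0 <= t -> t <= T -> `|adjS t eta| <= C * `|eta|.
Proof.
have [C C0 CP] := S_bound T; exists C => // t eta t0 tT.
apply: (norm_le_ip ipH) => [|x]; first by rewrite mulr_ge0// ltW.
rewrite adjSE// (le_trans (ler_norm _))// (le_trans (cauchy_schwarz ipH _ _))//.
by rewrite mulrC mulrAC ler_wpM2r// CP.
Qed.

Local Notation adj := (adjoint_at ip D A).

(** The adjoint of [J t] smooths: it maps every vector into the domain of the adjoint of [A]. All
    test functionals used later can be produced in this way. *)
Lemma adj_adjJ t eta : 0 <= t -> adj (adjJ t eta) (adjS t eta - eta).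
Proof.
by move=> t0 h Dh; rewrite adjJE// J_A// (ipBr ipH) (ipBl ipH) adjSE.
Qed.

Lemma adj_adjS t xi zeta : 0 <= t -> adj xi zeta -> adj (adjS t xi) (adjS t zeta).
Proof.
move=> t0 xz h Dh; rewrite !adjSE//.
by have [DS AS] := gen_orbit Dh t0; rewrite -AS xz.
Qed.

Lemma adj_separates v : (forall xi zeta, adj xi zeta -> ip xi v = 0) -> v = 0.
Proof.
move=> vP; apply: (ip_inj ipH) => eta; rewrite (ipC ipH); apply: J_separates => d d0.
by rewrite -adjJE ?ltW//; apply: vP; apply: adj_adjJ; exact: ltW.
Qed.

(** Testing with [adjJ t eta] gives [S t w - w = J t g], and division by [t] yields the derivative
    at 0. This is the fact that [A] is the adjoint of its adjoint, in the form of a weak criterion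
    for membership in the domain. *)
Lemma adj_closed w g : (forall xi zeta, adj xi zeta -> ip zeta w = ip xi g) ->
  D w /\ A w = g.
Proof.
move=> wg.
have Sw t : 0 <= t -> S t w - w = J t g.
  move=> t0; apply: (ip_injr ipH) => eta.
  by rewrite -adjJE// -(wg _ _ (adj_adjJ eta t0)) (ipBl ipH) (ipBr ipH) adjSE.
apply: gen_intro => e e0; have [d d0 dP] := J_small g e0.
by exists d => // u u0 ud; rewrite (Sw u (ltW u0)); exact: dP (ltW u0) ud.
Qed.

(** On the domain this is the integrated orbit equation. Both sides are given by a fixed vector
    applied to [h], so it is enough to check it on the smoothed vectors [J d h]. *)
Lemma weak_orbit xi zeta t h : adj xi zeta -> 0 <= t ->
  ip xi (S t h) - ip xi h = ip zeta (J t h).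
Proof.
move=> xz t0; pose F h := ip xi (S t h) - ip xi h - ip zeta (J t h).
have FD u : D u -> F u = 0.
  move=> Du; rewrite /F -(ipBr ipH) -J_A// !JE//; apply/eqP; rewrite subr_eq0; apply/eqP.
  apply: eq_Rintegral => s; rewrite inE/= in_itv/= => /andP[s0 _].
  by have [DS <-] := gen_orbit Du s0; exact: xz.
suff : F h = 0 by move=> /eqP; rewrite subr_eq0 => /eqP.
rewrite /F -adjSE// -adjJE// -!(ipBl ipH); set eta := adjS t xi - xi - _.
apply: J_separates => d d0; rewrite !(ipBl ipH) adjSE// adjJE//.
by apply: FD; case: (J_dom h (ltW d0)).
Qed.

(* For xi in the domain of the square of the adjoint, <xi, S_(c-s) y_s> has zero
   derivative in s; the mollifiers [adjJ] reduce any functional to this case. *)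
Lemma weak_uniqueness (Q : set H) (y : R -> H) : cadlag y ->
  (forall xi zeta, Q xi -> adj xi zeta -> Q zeta) ->
  (forall t xi, 0 <= t -> Q xi -> Q (adjS t xi)) ->
  (forall t xi, 0 <= t -> Q xi -> Q (adjJ t xi)) ->
  (forall xi zeta, Q xi -> adj xi zeta -> forall t, 0 <= t ->
     ip xi (y t) = ip xi (y 0) + \int[mu]_(s in `[0, t]) ip zeta (y s)) ->
  forall eta c, Q eta -> 0 <= c -> ip eta (y c) = ip eta (S c (y 0)).
Proof.
move=> cy Qadj QS QJ yeq.
have yinc xi zeta s t : Q xi -> adj xi zeta -> 0 <= s -> s <= t ->
    ip xi (y t) - ip xi (y s) = \int[mu]_(v in `[s, t]) ip zeta (y v).
  move=> Qxi xz s0 st; rewrite (yeq _ _ Qxi xz t (le_trans s0 st)) (yeq _ _ Qxi xz s s0).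
  by rewrite (integral_split (ip_bm zeta cy) s0 st); ring.
have smooth xi xi1 xi2 c : Q xi -> adj xi xi1 -> adj xi1 xi2 -> 0 <= c ->
    ip xi (y c) = ip xi (S c (y 0)).
  move=> Qxi xi01 xi12 c0.
  have Qxi1 := Qadj _ _ Qxi xi01.
  pose F s := ip xi (S (c - s) (y s)).
  suff : F c = F 0 by rewrite /F subrr subr0 S0.
  have [B B0 BP] := cadlag_bounded c cy.
  have [C C0 CP] := adjS_bound c; have [C' C'0 C'P] := J_bound c.
  (* [xi2] bounds how fast [ip (adjS u xi1)] varies along [y] (the term [B]) and along the orbit of
     [y s] (the term [C' * B]). The increment of [F] is then at most [K * k * k], whence the choice
     of the step below. *)
  pose K := C * `|xi2| * (B + C' * B).
  have K0 : 0 <= K by rewrite !mulr_ge0 ?addr_ge0 ?mulr_ge0// ltW.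
  apply: locally_flat_constant => // e e0.
  exists (e / (K + 1)); first by rewrite divr_gt0// ltr_wpDl.
  move=> s k s0 k0 kd skc; pose u := c - s - k.
  have u0 : 0 <= u by rewrite /u; lra.
  have uc : u <= c by rewrite /u; lra.
  have kc : k <= c by lra.
  have sc : s <= c by lra.
  have xi01u := adj_adjS u0 xi01; have xi12u := adj_adjS u0 xi12.
  have Fsk : F (s + k) = ip (adjS u xi) (y (s + k)) by rewrite adjSE// /F opprD addrA.
  have Fs : F s = ip (adjS u xi) (S k (y s)).
    by rewrite adjSE// -S_add// /F /u subrK.
  (* The weak equation for [y] and the one for the orbit of [y s] have the same first-order term,
     which is inserted here and cancels. *)
  have -> : F (s + k) - F s =
      (\int[mu]_(v in `[s, s + k]) ip (adjS u xi1) (y v) - ip (adjS u xi1) (y s) * k)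
      - (\int[mu]_(v in `[0, k]) ip (adjS u xi1) (S v (y s)) - ip (adjS u xi1) (y s) * k).
    rewrite -(yinc _ _ s (s + k) (QS _ _ u0 Qxi) xi01u)// ?lerDl// -JE//.
    by rewrite -(weak_orbit (y s) xi01u k0) Fsk Fs; ring.
  have xi2u : `|adjS u xi2| <= C * `|xi2| by exact: CP.
  have ys : `|y s| <= B by exact: BP.
  have b1 : `|\int[mu]_(v in `[s, s + k]) ip (adjS u xi1) (y v) - ip (adjS u xi1) (y s) * k|
      <= (C * `|xi2| * B * k) * k.
    have ksk : k = s + k - s by rewrite addrAC subrr add0r.
    rewrite [X in _ * X]ksk [X in _ <= _ * X]ksk.
    apply: Rintegral_itv_close => //; [exact: ip_bm|by rewrite lerDl|].
    move=> v sv vsk; rewrite (yinc _ _ s v (QS _ _ u0 Qxi1) xi12u)//.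
    rewrite (@le_trans _ _ (C * `|xi2| * B * (v - s)))//; last first.
      by rewrite ler_wpM2l ?mulr_ge0 ?(ltW C0)//; lra.
    apply: Rintegral_itv_bound => //; first exact: ip_bm.
    move=> w sw wv; rewrite (le_trans (cauchy_schwarz ipH _ _))// ler_pM//.
    by apply: BP; lra.
  have b2 : `|\int[mu]_(v in `[0, k]) ip (adjS u xi1) (S v (y s)) - ip (adjS u xi1) (y s) * k|
      <= (C * `|xi2| * (C' * k * B)) * k.
    have := @Rintegral_itv_close _ (fun v => ip (adjS u xi1) (S v (y s))) 0 k
      (ip (adjS u xi1) (y s)) (C * `|xi2| * (C' * k * B)) (orbit_bm _ _) (lexx 0) k0.
    rewrite subr0; apply => v v0 vk; rewrite (weak_orbit (y s) xi12u v0).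
    rewrite (le_trans (cauchy_schwarz ipH _ _))// ler_pM//.
    rewrite (le_trans (C'P _ _ v0 (le_trans vk kc)))//.
    by rewrite ler_pM ?mulr_ge0 ?(ltW C'0)// ler_wpM2l// ltW.
  rewrite (le_trans (ler_normB _ _))// (le_trans (lerD b1 b2))//.
  have -> : C * `|xi2| * B * k * k + C * `|xi2| * (C' * k * B) * k = K * k * k by rewrite /K; ring.
  rewrite ler_wpM2r// (@le_trans _ _ ((K + 1) * k))// ?ler_wpM2r ?lerDl//.
  by rewrite mulrC -ler_pdivlMr ?ltW// ltr_wpDl.
move=> eta c Qeta c0; apply/eqP; rewrite -subr_eq0 -(ipBr ipH); apply/eqP.
set z := y c - _.
apply: J_separates => d d0; have d0' := ltW d0; rewrite -adjJE//.
apply: J_separates => d1 d10; have d10' := ltW d10; rewrite -adjJE//.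
set xi := adjJ d1 _.
have QJd := QJ _ _ d0' Qeta.
have xi01 : adj xi (adjS d1 (adjJ d eta) - adjJ d eta) by exact: adj_adjJ.
have xi12 : adj (adjS d1 (adjJ d eta) - adjJ d eta)
   (adjS d1 (adjS d eta - eta) - (adjS d eta - eta)).
  move=> h Dh; rewrite !(ipBl ipH (adjS d1 _)).
  by rewrite (adj_adjS d10' (adj_adjJ eta d0') Dh) (adj_adjJ eta d0' Dh).
by rewrite (ipBr ipH) (smooth _ _ _ _ (QJ _ _ d10' QJd) xi01 xi12 c0) subrr.
Qed.

(** The functions [ip xi (S t (b i))] solve a linear system with zero initial values. On an interval
    of length [T0] the integral equation halves every bound, so they vanish there; the adjoint
    semigroup carries the annihilating functional over to the next interval. *)
Lemma orthogonal_orbit n (b : 'I_n -> H) (a : 'I_n -> 'I_n -> R) xi t i :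
  (forall i, D (b i) /\ A (b i) = \sum_j a i j *: b j) ->
  (forall i, ip xi (b i) = 0) -> 0 <= t -> ip xi (S t (b i)) = 0.
Proof.
move=> bP; pose K := \sum_i \sum_j `|a i j| + 1.
have K0 : 0 < K by rewrite ltr_wpDl// sumr_ge0// => ? _; exact: sumr_ge0.
pose T0 := (2 * K)^-1; have T00 : 0 < T0 by rewrite invr_gt0 mulr_gt0.
have orb xi' t' i' : (forall i, ip xi' (b i) = 0) -> 0 <= t' ->
    ip xi' (S t' (b i')) = \int[mu]_(s in `[0, t']) (\sum_j a i' j * ip xi' (S s (b j))).
  move=> xib t0; have [Db Ab] := bP i'.
  have := J_A Db t0; rewrite Ab => /(congr1 (ip xi')).
  rewrite (ipBr ipH) xib subr0 => <-; rewrite JE//.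
  apply: eq_Rintegral => s; rewrite inE/= in_itv/= => /andP[s0 _].
  rewrite (_ : S s _ = \sum_j a i' j *: S s (b j)) ?(ip_sumr ipH)//.
  elim/big_rec2: _ => [|j u v _ <-]; first by rewrite S_0.
  by rewrite SD// SZ.
have small xi' : (forall i, ip xi' (b i) = 0) -> forall t i, 0 <= t -> t <= T0 ->
    ip xi' (S t (b i)) = 0.
  move=> xib; have [C C0 CP] := S_bound T0.
  pose B := C * `|xi'| * \sum_i `|b i|.
  have B0 : 0 <= B by rewrite !mulr_ge0 ?(ltW C0)// sumr_ge0.
  have bnd m : forall t i, 0 <= t -> t <= T0 -> `|ip xi' (S t (b i))| <= B * 2^-1 ^+ m.
    elim: m => [|m IH] t' i' t0 tT.
      rewrite expr0 mulr1 (le_trans (cauchy_schwarz ipH _ _))//.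
      rewrite /B -mulrA mulrCA ler_wpM2l//.
      rewrite (le_trans (CP _ _ t0 tT))// ler_wpM2l ?(ltW C0)//.
      by rewrite (bigD1 i')//= lerDl sumr_ge0.
    have Bm : 0 <= B * 2^-1 ^+ m by apply: mulr_ge0 => //; exact: exprn_ge0.
    rewrite orb//.
    apply: (@le_trans _ _ (K * (B * 2^-1 ^+ m) * (t' - 0))).
      apply: Rintegral_itv_bound => //.
        by apply: bounded_measurable_sum => j; apply: bounded_measurableZ; exact: orbit_bm.
      move=> s s0 st; rewrite (le_trans (ler_norm_sum _ _ _))//.
      apply: (@le_trans _ _ (\sum_j `|a i' j| * (B * 2^-1 ^+ m))).
        by apply: ler_sum => j _; rewrite normrM ler_wpM2l// IH// (le_trans st).
      rewrite -mulr_suml ler_wpM2r//.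
      rewrite /K ler_wpDr// [leRHS](bigD1 i')//= lerDl.
      by apply: sumr_ge0 => ? _; exact: sumr_ge0.
    rewrite subr0 exprSr.
    rewrite (@le_trans _ _ (K * (B * 2^-1 ^+ m) * T0))//.
      by rewrite ler_wpM2l// mulr_ge0// ltW.
    rewrite le_eqVlt; apply/orP; left; apply/eqP; rewrite /T0; field.
    by rewrite gt_eqF.
  move=> t' i' t0 tT; apply/eqP; rewrite -normr_eq0 eq_le normr_ge0 andbT.
  have cB : B * 2^-1 ^+ m @[m --> \oo] --> (0 : R).
    rewrite -[X in _ --> X](mulr0 B); apply: cvgM; first exact: cvg_cst.
    by apply: cvg_expr; rewrite ger0_norm ?invr_ge0//; lra.
  by apply: ler_cvg_to (cvg_cst _) cB _; near=> m; exact: bnd.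
move=> xib t0.
have [N NP] : exists N : nat, t <= N%:R * T0.
  exists (Num.truncn (t / T0)).+1; rewrite -ler_pdivrMr//; exact/ltW/truncnS_gt.
elim: N t xi xib i t0 NP => [|N IH] t' xi' xib' i' t0 tN.
  have -> : t' = 0 by apply/eqP; rewrite eq_le t0 andbT (le_trans tN)// mul0r.
  by rewrite S0 xib'.
have [tT|Tt] := leP t' T0; first exact: small.
have -> : t' = T0 + (t' - T0) by rewrite addrCA subrr addr0.
have tT0 : 0 <= t' - T0 by rewrite subr_ge0 ltW.
rewrite S_add ?(ltW T00)// -adjSE ?(ltW T00)//; apply: IH => //.
  by move=> j; rewrite adjSE ?(ltW T00)// small// ltW.
by rewrite lerBlDr; move: tN; rewrite -natr1 mulrDl mul1r.
Unshelve. all: end_near. Qed.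

End semigroup.

(** * Processes with orthogonal increments *)

Lemma borel_R (R : realType) : <<s (@open R) >> = (@measurable _ R).
Proof.
apply/seteqP; split.
  apply: smallest_sub; first exact: sigma_algebra_measurable.
  by move=> A; exact: open_measurable.
have -> : (@measurable _ R : set (set R)) = <<s @RGenOpens.G R >>.
  exact: RGenOpens.measurableE.
apply: smallest_sub.
  exact: smallest_sigma_algebra.
by move=> _ [x [y ->]]; apply: sub_sigma_algebra; exact: interval_open.
Qed.

Lemma continuous_preimage (R : realType) (T : topologicalType) (f : T -> R) (B : set R) :
  continuous f -> measurable B -> <<s (@open T) >> (f @^-1` B).
Proof.
move=> cf; rewrite -borel_R => /(_ [set B | <<s (@open T) >> (f @^-1` B)]); apply.
split; last by move=> U oU; apply: sub_sigma_algebra; apply: open_comp => // x _; exact: cf.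
have [s0 sC sU] := smallest_sigma_algebra setT (@open T); split.
- by rewrite /= preimage_set0.
- by move=> A /= sA; rewrite setTD preimage_setC -setTD; exact: sC.
- by move=> A /= sA; rewrite preimage_bigcup; exact: sU.
Qed.

(** * Integrable and square-integrable random variables *)

Section expectation.
Context {R : realType} {d : measure_display} {Omega : measurableType d}.
Variable P : probability Omega R.
Implicit Types (f g : Omega -> R) (A B : set Omega).

Definition expect f := \int[P]_w f w.
Definition L1 f := P.-integrable setT (EFin \o f).
Definition L2 f := measurable_fun setT f /\ L1 (fun w => f w ^+ 2).
Definition pr A := fine (P A).

Lemma L1_measurable f : L1 f -> measurable_fun setT f.
Proof. by move=> /measurable_int/measurable_EFinP. Qed.

Lemma L1D f g : L1 f -> L1 g -> L1 (fun w => f w + g w).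
Proof. by move=> If Ig; have := integrableD measurableT If Ig. Qed.

Lemma L1Z (c : R) f : L1 f -> L1 (fun w => c * f w).
Proof. by move=> If; have := integrableZl measurableT c If. Qed.

Lemma L1N f : L1 f -> L1 (fun w => - f w).
Proof.
by move=> /(L1Z (-1)); under [fun _ => -1 * _]eq_fun do rewrite mulN1r.
Qed.

Lemma L1B f g : L1 f -> L1 g -> L1 (fun w => f w - g w).
Proof. by move=> If Ig; apply: L1D => //; exact: L1N. Qed.

Lemma L1_cst (c : R) : L1 (cst c).
Proof. exact: finite_measure_integrable_cst. Qed.

Lemma L1_sum I (s : seq I) (Q : pred I) (F : I -> Omega -> R) :
  (forall i, L1 (F i)) -> L1 (fun w => \sum_(i <- s | Q i) F i w).
Proof.
move=> IF; elim: s => [|i s IH].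
  by under eq_fun do rewrite big_nil; exact: L1_cst.
under eq_fun do rewrite big_cons.
by case: (Q i) => //; exact: L1D.
Qed.

Lemma L1_le f g : measurable_fun setT f -> (forall w, `|f w| <= g w) -> L1 g -> L1 f.
Proof.
move=> mf fg Ig; apply: le_integrable Ig => //; first exact/measurable_EFinP.
by move=> w _ /=; rewrite lee_fin (le_trans (fg w))// ler_norm.
Qed.

Lemma L1_norm f : L1 f -> L1 (fun w => `|f w|).
Proof. by move=> /integrable_norm. Qed.

Lemma expectD f g : L1 f -> L1 g ->
  expect (fun w => f w + g w) = expect f + expect g.
Proof. by move=> If Ig; rewrite /expect RintegralD. Qed.

Lemma expectZ (c : R) f : L1 f -> expect (fun w => c * f w) = c * expect f.
Proof. by move=> If; rewrite /expect RintegralZl. Qed.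

Lemma expectB f g : L1 f -> L1 g ->
  expect (fun w => f w - g w) = expect f - expect g.
Proof. by move=> If Ig; rewrite /expect RintegralB. Qed.

Lemma expect_cst (c : R) : expect (cst c) = c.
Proof. by rewrite /expect Rintegral_cst// [X in fine X](probability_setT P) mulr1. Qed.

Lemma expect_sum I (s : seq I) (Q : pred I) (F : I -> Omega -> R) :
  (forall i, L1 (F i)) ->
  expect (fun w => \sum_(i <- s | Q i) F i w) = \sum_(i <- s | Q i) expect (F i).
Proof.
move=> IF; elim: s => [|i s IH].
  by under eq_fun do rewrite big_nil; rewrite big_nil expect_cst.
rewrite big_cons; under eq_fun do rewrite big_cons.
by case: (Q i) => //; rewrite expectD ?IH//; exact: L1_sum.
Qed.

Lemma le_expect f g : L1 f -> L1 g -> (forall w, f w <= g w) ->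
  expect f <= expect g.
Proof. by move=> If Ig fg; apply: le_Rintegral. Qed.

Lemma expect_ge0 f : (forall w, 0 <= f w) -> 0 <= expect f.
Proof. by move=> f0; apply: Rintegral_ge0. Qed.

Lemma le_norm_expect f : L1 f -> `|expect f| <= expect (fun w => `|f w|).
Proof. by move=> If; exact: le_normr_Rintegral. Qed.

Lemma eq_expect f g : f =1 g -> expect f = expect g.
Proof. by move=> fg; congr expect; apply/funext. Qed.

Lemma prE A : measurable A -> P A = (pr A)%:E.
Proof. by move=> mA; rewrite /pr fineK// fin_num_measure. Qed.

Lemma pr_ge0 A : 0 <= pr A. Proof. by rewrite /pr fine_ge0. Qed.

Lemma pr_setT : pr setT = 1. Proof. by rewrite /pr probability_setT. Qed.
Lemma le_pr A B : measurable A -> measurable B -> A `<=` B -> pr A <= pr B.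
Proof. by move=> mA mB AB; rewrite -lee_fin -!prE// le_measure ?inE. Qed.

Lemma prU_le A B : measurable A -> measurable B -> pr (A `|` B) <= pr A + pr B.
Proof.
move=> mA mB; rewrite -lee_fin EFinD -!prE//; last exact: measurableU.
exact: measureU2.
Qed.

Lemma prC A : measurable A -> pr (~` A) = 1 - pr A.
Proof.
move=> mA; apply: EFin_inj; rewrite -prE; last exact: measurableC.
by rewrite probability_setC// prE// EFinB.
Qed.

Lemma pr_expect A : measurable A -> expect (\1_A) = pr A.
Proof. by move=> mA; rewrite /expect /Rintegral integral_indic// setIT. Qed.

Lemma L1_indic A : measurable A -> L1 (\1_A).
Proof. exact: integrable_indic. Qed.

Lemma indic_01 A w : 0 <= (\1_A w : R) <= 1.
Proof. by rewrite indicE; case: (_ \in _); rewrite ?lexx ?ler01. Qed.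

Lemma L1_bounded f (c : R) : measurable_fun setT f -> (forall w, `|f w| <= c) -> L1 f.
Proof. by move=> mf fc; apply: L1_le mf fc (L1_cst c). Qed.

Lemma L1M_bounded f g (c : R) : L1 f -> measurable_fun setT g ->
  (forall w, `|g w| <= c) -> L1 (fun w => g w * f w).
Proof.
move=> If mg gc; have c0 : 0 <= c by exact: le_trans (normr_ge0 _) (gc point).
apply: (@L1_le _ (fun w => c * `|f w|)).
- by apply: measurable_funM => //; exact: L1_measurable.
- by move=> w; rewrite normrM ler_wpM2r.
- exact/L1Z/L1_norm.
Qed.

Lemma L2_measurable f : L2 f -> measurable_fun setT f. Proof. by case. Qed.

Lemma L2_sqr f : L2 f -> L1 (fun w => f w ^+ 2). Proof. by case. Qed.

Lemma L2M f g : L2 f -> L2 g -> L1 (fun w => f w * g w).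
Proof.
move=> [mf If] [mg Ig]; apply: L1_le (L1D If Ig); first exact: measurable_funM.
move=> w; rewrite normrM -[f w ^+ 2]real_normK ?num_real// -[g w ^+ 2]real_normK ?num_real//.
by move: (`|f w|) (`|g w|) (normr_ge0 (f w)) (normr_ge0 (g w)) => x y x0 y0;
  have := sqr_ge0 (x - y); have := mulr_ge0 x0 y0; nra.
Qed.

Lemma L2_cst (c : R) : L2 (cst c).
Proof. by split => //; exact: (L1_cst (c ^+ 2)). Qed.

Lemma L2_L1 f : L2 f -> L1 f.
Proof.
by move=> Lf; have := L2M (L2_cst 1) Lf; under [fun _ => _ * _]eq_fun do rewrite mul1r.
Qed.

Lemma L2D f g : L2 f -> L2 g -> L2 (fun w => f w + g w).
Proof.
move=> Lf Lg; split; first by apply: measurable_funD; exact: L2_measurable.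
under [fun _ => _ ^+ 2]eq_fun do rewrite sqrrD.
by apply: L1D; [apply: L1D|]; [exact: L2_sqr|rewrite -/(L1 _);
  under [fun _ => _ *+ 2]eq_fun do rewrite -mulr_natl; exact/L1Z/L2M|exact: L2_sqr].
Qed.

Lemma L2Z (c : R) f : L2 f -> L2 (fun w => c * f w).
Proof.
move=> [mf If]; split; first by apply: measurable_funM.
by under [fun _ => _ ^+ 2]eq_fun do rewrite exprMn; exact: L1Z.
Qed.

Lemma L2B f g : L2 f -> L2 g -> L2 (fun w => f w - g w).
Proof.
move=> Lf Lg; apply: L2D => //.
by have := L2Z (-1) Lg; under [fun _ => -1 * _]eq_fun do rewrite mulN1r.
Qed.

Lemma L2_sum I (s : seq I) (Q : pred I) (F : I -> Omega -> R) :
  (forall i, L2 (F i)) -> L2 (fun w => \sum_(i <- s | Q i) F i w).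
Proof.
move=> IF; elim: s => [|i s IH].
  by under eq_fun do rewrite big_nil; exact: L2_cst.
under eq_fun do rewrite big_cons.
by case: (Q i) => //; exact: L2D.
Qed.

Lemma L2_le f g : measurable_fun setT f -> (forall w, `|f w| <= `|g w|) -> L2 g -> L2 f.
Proof.
move=> mf fg [mg Ig]; split => //; apply: L1_le Ig; first exact: measurable_funX.
by move=> w; rewrite normrX -[leRHS]real_normK ?num_real// lerXn2r ?nnegrE.
Qed.

Lemma L2M_bounded f g (c : R) : L2 f -> measurable_fun setT g ->
  (forall w, `|g w| <= c) -> L2 (fun w => g w * f w).
Proof.
move=> Lf mg gc; apply: L2_le (L2Z c Lf).
  by apply: measurable_funM => //; exact: L2_measurable.
by move=> w; rewrite !normrM ler_wpM2r// (le_trans (gc w))// ler_norm.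
Qed.

Lemma L2_bounded f (c : R) : measurable_fun setT f -> (forall w, `|f w| <= c) -> L2 f.
Proof.
move=> mf fc; have := L2M_bounded (L2_cst 1) mf fc.
by under [fun _ => _ * _]eq_fun do rewrite mulr1.
Qed.

Lemma L2_norm f : L2 f -> L2 (fun w => `|f w|).
Proof.
move=> Lf; apply: (L2_le _ _ Lf); last by move=> w; rewrite normr_id.
by apply: measurableT_comp => //; exact: L2_measurable Lf.
Qed.

Lemma measurable_norm_ge f (e : R) : measurable_fun setT f ->
  measurable [set w | e <= `|f w|].
Proof.
move=> mf; rewrite -[X in measurable X]setTI.
have mg : measurable_fun setT (fun w => `|f w|) by exact: measurableT_comp.
have := mg measurableT _ (measurable_itv `[e, +oo[).
by congr (measurable (_ `&` _)); apply/seteqP; split => w /=; rewrite in_itv/= andbT.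
Qed.

Lemma measurable_ge f (e : R) : measurable_fun setT f -> measurable [set w | e <= f w].
Proof.
move=> mf; rewrite -[X in measurable X]setTI.
have := mf measurableT _ (measurable_itv `[e, +oo[).
by congr (measurable (_ `&` _)); apply/seteqP; split => w /=; rewrite in_itv/= andbT.
Qed.

Lemma markov1 f (e : R) : 0 < e -> L1 f -> (forall w, 0 <= f w) ->
  pr [set w | e <= f w] <= expect f / e.
Proof.
move=> e0 If f0; have mA := measurable_ge e (L1_measurable If).
rewrite ler_pdivlMr// mulrC -pr_expect// -expectZ ?le_expect//.
- exact/L1Z/L1_indic.
- move=> w; rewrite indicE; case: (boolP (w \in _)) => [|_]; last by rewrite mulr0.
  by rewrite inE/= mulr1.
- exact: L1_indic.
Qed.

Lemma markov2 f (e : R) : 0 < e -> L2 f ->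
  pr [set w | e <= `|f w|] <= expect (fun w => f w ^+ 2) / e ^+ 2.
Proof.
move=> e0 [mf If].
have -> : [set w | e <= `|f w|] = [set w | e ^+ 2 <= f w ^+ 2].
  apply/seteqP; split => w /=; rewrite -[f w ^+ 2]real_normK ?num_real//.
    by rewrite ler_pXn2r// nnegrE ltW.
  by rewrite ler_pXn2r// nnegrE ltW.
by apply: markov1 => // [|w]; [exact: exprn_gt0|exact: sqr_ge0].
Qed.

Lemma expect_dct (F : nat -> Omega -> R) f g :
  (forall n, measurable_fun setT (F n)) -> measurable_fun setT f ->
  {ae P, forall w, F n w @[n --> \oo] --> f w} ->
  L1 g -> (forall n w, `|F n w| <= g w) ->
  expect (F n) @[n --> \oo] --> expect f.
Proof.
move=> mF mf Ff Ig Fg.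
have [] := @dominated_convergence _ _ _ P setT measurableT
   (fun n => EFin \o F n) (EFin \o f) (EFin \o g).
- by move=> n; exact/measurable_EFinP.
- exact/measurable_EFinP.
- by apply: filterS Ff => w Fw _; apply: cvg_EFin => //; exact: nearW.
- exact: Ig.
- by apply: aeW => w n _ /=; rewrite lee_fin.
move=> If _ cvgI; rewrite /expect /Rintegral.
apply: fine_cvg; rewrite fineK//; exact: integrable_fin_num.
Qed.

(** Split [f] at the height [N]: the part above has a small expectation by dominated convergence,
    the part below contributes at most a constant times the probability of [A]. *)
Lemma absolute_continuity f (e : R) : L1 f -> (forall w, 0 <= f w) -> 0 < e ->
  exists2 del : R, 0 < del & forall A, measurable A -> pr A < del ->
    expect (fun w => \1_A w * f w) < e.
Proof.
move=> If f0 e0; have mf := L1_measurable If.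
pose B n := [set w | n%:R <= f w].
have mB n : measurable (B n) by exact: measurable_ge.
have m1 A : measurable A -> measurable_fun setT (fun w => \1_A w * f w : R).
  by move=> mA; apply: measurable_funM => //; exact: measurable_indic.
have b1 A w : `|\1_A w * f w| <= f w.
  have /andP[i0 i1] := indic_01 A w.
  by rewrite normrM (ger0_norm i0) (ger0_norm (f0 w)) ler_piMl.
have I1 A : measurable A -> L1 (fun w => \1_A w * f w).
  by move=> mA; apply: L1_le If; [exact: m1|exact: b1].
have cB : expect (fun w => \1_(B n) w * f w) @[n --> \oo] --> (0 : R).
  rewrite -(expect_cst 0); apply: (@expect_dct _ _ f) => //.
  - by move=> n; exact: m1.
  - apply: aeW => w; apply/seq_limP => r r0; exists (Num.truncn (f w)).+1 => n Nn.
    rewrite indicE memNset ?mul0r ?subrr ?normr0//= /B/=; apply/negP; rewrite -ltNge.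
    by rewrite (lt_le_trans (truncnS_gt _))// ler_nat.
have [N /(_ N (leqnn _))] := (seq_limP _ _).1 cB (e / 2) ltac:(by rewrite divr_gt0).
rewrite subr0 => NP; exists (e / 2 / N.+1%:R); first by rewrite !divr_gt0.
move=> A mA prA.
apply: (@le_lt_trans _ _ (expect (fun w => \1_(B N) w * f w + N.+1%:R * \1_A w))).
  apply: le_expect; [exact: I1| |].
    by apply: L1D; [exact: I1|exact/L1Z/L1_indic].
  move=> w; rewrite [\1_(B N) w]indicE; case: (boolP (w \in B N)) => wB.
    have /andP[i0 i1] := indic_01 A w.
    by rewrite mul1r ler_wpDr ?mulr_ge0// ler_piMl.
  move: wB; rewrite mul0r add0r notin_setE/= => /negP; rewrite -ltNge => fN.
  have /andP[i0 i1] := indic_01 A w.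
  by rewrite mulrC ler_wpM2r// (le_trans (ltW fN))// ler_nat.
rewrite expectD ?expectZ ?pr_expect//; [|exact: L1_indic|exact: I1|exact/L1Z/L1_indic].
move: NP; rewrite ltr_norml => /andP[_ NP].
by move: prA; rewrite ltr_pdivlMr// mulrC; lra.
Qed.

Lemma pr_bigcup_cvg (B : nat -> set Omega) : (forall n, measurable (B n)) ->
  nondecreasing_seq B -> pr (B n) @[n --> \oo] --> pr (\bigcup_n B n).
Proof.
move=> mB ndB.
have := @nondecreasing_cvg_mu _ _ _ P B mB (bigcupT_measurable _ mB) ndB.
rewrite [X in _ --> X -> _](prE (bigcupT_measurable _ mB)).
exact: fine_cvg.
Qed.

Hypothesis completeP : measure_is_complete P.

(** Paths are regular only almost surely; completeness of the measure keeps the events defined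
    through them measurable. *)
Lemma ae_eq_set A B : measurable B -> {ae P, forall w, A w <-> B w} ->
  measurable A /\ pr A = pr B.
Proof.
move=> mB [N [mN N0 AB]].
have sub C : C `<=` N -> measurable C /\ P C = 0%E.
  move=> CN; have mC : measurable C by apply: completeP; exists N.
  by split=> //; apply/eqP; rewrite -measure_le0 -N0 le_measure ?inE.
have ABn w : ~ N w -> A w <-> B w.
  by move=> Nw; apply: contrapT => AB'; apply: Nw; exact: AB.
have AE : A = (B `\` N) `|` (A `&` N).
  apply/seteqP; split => w.
    by move=> Aw; have [Nw|Nw] := pselect (N w); [right|left; split=> //; exact/ABn].
  by move=> [[Bw /ABn [_ /(_ Bw)]]|[]].
have [mAN AN0] := sub (A `&` N) ltac:(by move=> w []).
have [mBN BN0] := sub (B `&` N) ltac:(by move=> w []).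
have mBN' : measurable (B `\` N) by exact: measurableD.
have mA : measurable A by rewrite AE; exact: measurableU.
split=> //; rewrite /pr; congr fine.
rewrite AE measureU//; last by rewrite predeqE => w; split=> // -[[_ ?] [_ ?]].
rewrite [X in (_ + X)%E]AN0 adde0.
have BE : B = (B `\` N) `|` (B `&` N) by rewrite setUC setUIDK.
rewrite [in RHS]BE measureU//; last by rewrite predeqE => w; split=> // -[[_ ?] [_ ?]].
by rewrite [X in (_ = _ + X)%E]BN0 adde0.
Qed.

Lemma ae_eq_measurable f g : measurable_fun setT g -> {ae P, forall w, f w = g w} ->
  measurable_fun setT f.
Proof.
move=> mg fg _ B mB; rewrite setTI.
have := mg measurableT B mB; rewrite setTI => mgB.
apply: (@ae_eq_set _ (g @^-1` B) mgB _).1.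
by apply: filterS fg => w; rewrite /preimage/= => ->.
Qed.

End expectation.

Section independence.
Context {R : realType} {d : measure_display} {Omega : measurableType d}.
Variable P : probability Omega R.
Local Open Scope ereal_scope.

(** Independence identifies the joint law with the product of the laws, and the theorem of Fubini
    factorizes the integral. *)
Lemma expect_independent (U W : Omega -> R) : L1 P U -> L1 P W ->
  (forall A B : set R, measurable A -> measurable B ->
    P (U @^-1` A `&` W @^-1` B) = P (U @^-1` A) * P (W @^-1` B)) ->
  L1 P (fun w => U w * W w)%R /\
  expect P (fun w => U w * W w)%R = (expect P U * expect P W)%R.
Proof.
move=> IU IW ind; have mU := L1_measurable IU; have mW := L1_measurable IW.
pose U' : {RV P >-> R} := HB.pack U (isMeasurableFun.Build _ _ _ _ U mU).
pose W' : {RV P >-> R} := HB.pack W (isMeasurableFun.Build _ _ _ _ W mW).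
have mUW : measurable_fun setT (fun w => (U w, W w)).
  exact: measurable_fun_pair.
pose V' : {RV P >-> (R * R)%type} :=
  HB.pack (fun w => (U w, W w)) (isMeasurableFun.Build _ _ _ _ _ mUW).
have mabs : measurable_fun setT (fun x : R => `|x|%:E).
  by apply/measurable_EFinP; exact: normr_measurable.
pose m1 := distribution P U'; pose m2 := distribution P W'.
have mE X : measurable X -> (m1 \x m2) X = distribution P V' X.
  by apply: product_measure_unique => A B mA mB; exact: ind.
pose f (z : R * R) := (z.1 * z.2)%:E.
have mf : measurable_fun setT f.
  by apply/measurable_EFinP; apply: measurable_funM.
have IfUW : (m1 \x m2).-integrable setT f.
  apply/integrableP; split=> //.
  rewrite fubini_tonelli1; [|exact: measurableT_comp|by []].
  rewrite /fubini_F.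
  have -> : (fun x => \int[m2]_y `|f (x, y)|) = (fun x : R => `|x|%:E * \int[m2]_y `|y|%:E).
    apply/funext => x; rewrite -ge0_integralZl//=.
    - by apply: eq_integral => y _; rewrite /f/= normrM EFinM.
  rewrite ge0_integralZr//=; last exact: integral_ge0.
  rewrite !ge0_integral_distribution//=.
  move: IU IW => /integrableP[_ IU] /integrableP[_ IW].
  by apply: lte_mul_pinfty => //; [exact: integral_ge0|rewrite ge0_fin_numE//; exact: integral_ge0].
have IfV : (distribution P V').-integrable setT f.
  apply/integrableP; split=> //; move/integrableP : IfUW => [_].
  congr (_ < _); apply: eq_measure_integral => X mX _; exact: mE.
have IUW : L1 P (fun w => U w * W w)%R.
  apply/integrableP; split.
    by apply/measurable_EFinP; exact: measurable_funM.
  move/integrableP : IfV => [_]; congr (_ < _).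
  by rewrite ge0_integral_distribution//; exact: measurableT_comp.
split=> //; rewrite /expect /Rintegral.
transitivity (fine (\int[distribution P V']_z f z)).
  by congr fine; rewrite integral_distribution.
transitivity (fine (\int[m1 \x m2]_z f z)).
  by congr fine; apply: eq_measure_integral => X mX _; apply/esym/mE.
rewrite -integral12_prod_meas1// /fubini_F.
have IW' : m2.-integrable setT (EFin \o @id R).
  by apply: integrable_pushforward => //; exact: measurableT_comp.
have -> : (fun x => \int[m2]_y f (x, y)) = (fun x : R => x%:E * \int[m2]_y y%:E).
  apply/funext => x; rewrite -integralZl//.
have IU' : m1.-integrable setT (EFin \o @id R).
  by apply: integrable_pushforward => //; exact: measurableT_comp.
have finW : \int[m2]_y y%:E \is a fin_num by exact: (integrable_fin_num _ IW').
rewrite -(fineK finW) integralZr//= fineM//; last exact: (integrable_fin_num _ IU').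
by rewrite !integral_distribution.
Qed.

End independence.

(** * Random variables known at a given time *)

Section filtration.
Context {R : realType} {d : measure_display} {Omega : measurableType d}.
Variables (P : probability Omega R) (F : R -> set (set Omega)).
Hypothesis usualF : usual_conditions P F.
Implicit Types (f g : Omega -> R).

Lemma F_sigma t : 0 <= t -> sigma_algebra setT (F t).
Proof. by move=> t0; case: usualF => /(_ t t0)[]. Qed.
Lemma F_measurable t A : 0 <= t -> F t A -> measurable A.
Proof. by move=> t0; case: usualF => /(_ t t0)[_ +] _ _ _ _; exact. Qed.
Lemma F_mono s t A : 0 <= s -> s <= t -> F s A -> F t A.
Proof. by move=> s0 st; case: usualF => _ /(_ s t s0 st) + _ _ _; exact. Qed.
Lemma complete_P : measure_is_complete P. Proof. by case: usualF. Qed.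
Lemma F_null t N : 0 <= t -> P.-negligible N -> F t N.
Proof.
by move=> t0 nN; apply: (F_mono (lexx 0) t0); case: usualF => _ _ _ _; exact.
Qed.

(** For [t >= 0] the generated sigma-algebra is [F t] itself. In this form the closure properties of
    measurable functions apply directly. *)
Definition Fm (t : R) f :=
  measurable_fun (setT : set (g_sigma_algebraType (F t))) f.

Lemma Fm_setE t (A : set Omega) : 0 <= t ->
  F t A <-> (F t).-sigma.-measurable (A : set (g_sigma_algebraType (F t))).
Proof.
move=> t0; split=> [|FA]; first exact: sub_sigma_algebra.
by rewrite -(sigma_algebra_id (F_sigma t0)); exact: FA.
Qed.

Lemma FmP t f : 0 <= t -> Fm t f <-> forall B, measurable B -> F t (f @^-1` B).
Proof.
move=> t0; split=> [mf B mB|mf _ B mB].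
  by apply/(Fm_setE _ t0); rewrite -[X in _ X]setTI; exact: mf.
by rewrite setTI; apply/(Fm_setE _ t0); exact: mf.
Qed.

Lemma Fm_mono s t f : 0 <= s -> s <= t -> Fm s f -> Fm t f.
Proof.
move=> s0 st /(FmP _ s0) mf; apply/FmP; first exact: le_trans st.
by move=> B mB; apply: F_mono st _ => //; exact: mf.
Qed.

Lemma Fm_measurable t f : 0 <= t -> Fm t f -> measurable_fun setT f.
Proof.
by move=> t0 /(FmP _ t0) mf _ B mB; rewrite setTI; apply: (F_measurable t0); exact: mf.
Qed.

Lemma Fm_cst t (c : R) : Fm t (cst c). Proof. exact: measurable_cst. Qed.

Lemma FmD t f g : Fm t f -> Fm t g -> Fm t (fun w => f w + g w).
Proof. exact: measurable_funD. Qed.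
Lemma FmB t f g : Fm t f -> Fm t g -> Fm t (fun w => f w - g w).
Proof. exact: measurable_funB. Qed.
Lemma FmM t f g : Fm t f -> Fm t g -> Fm t (fun w => f w * g w).
Proof. exact: measurable_funM. Qed.
Lemma FmX t f n : Fm t f -> Fm t (fun w => f w ^+ n).
Proof. exact: measurable_funX. Qed.
Lemma Fm_sum t I (s : seq I) (h : I -> Omega -> R) :
  (forall i, Fm t (h i)) -> Fm t (fun w => \sum_(i <- s) h i w).
Proof. exact: measurable_sum. Qed.
Lemma Fm_comp t (k : R -> R) f : measurable_fun setT k -> Fm t f -> Fm t (k \o f).
Proof. exact: measurableT_comp. Qed.
Lemma Fm_indic t A : 0 <= t -> F t A -> Fm t (\1_A).
Proof. by move=> t0 /(Fm_setE _ t0); exact: measurable_indic. Qed.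
Lemma Fm_cvg t (h : nat -> Omega -> R) f : (forall n, Fm t (h n)) ->
  (forall w, h n w @[n --> \oo] --> f w) -> Fm t f.
Proof. by move=> mh hf; apply: measurable_fun_cvg mh _ => w _; exact: hf. Qed.

Lemma F_setI t A B : 0 <= t -> F t A -> F t B -> F t (A `&` B).
Proof. by move=> t0 /(Fm_setE _ t0) ? /(Fm_setE _ t0) ?; apply/(Fm_setE _ t0)/measurableI. Qed.
Lemma F_setU t A B : 0 <= t -> F t A -> F t B -> F t (A `|` B).
Proof. by move=> t0 /(Fm_setE _ t0) ? /(Fm_setE _ t0) ?; apply/(Fm_setE _ t0)/measurableU. Qed.
Lemma F_setC t A : 0 <= t -> F t A -> F t (~` A).
Proof. by move=> t0 /(Fm_setE _ t0) ?; apply/(Fm_setE _ t0)/measurableC. Qed.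
Lemma F_setT t : 0 <= t -> F t setT.
Proof. by move=> t0; apply/(Fm_setE _ t0). Qed.
Lemma F_bigcup t (A : nat -> set Omega) : 0 <= t -> (forall n, F t (A n)) ->
  F t (\bigcup_n A n).
Proof.
by move=> t0 FA; apply/(Fm_setE _ t0)/bigcupT_measurable => n; apply/Fm_setE.
Qed.
Lemma F_bigcap t (A : nat -> set Omega) : 0 <= t -> (forall n, F t (A n)) ->
  F t (\bigcap_n A n).
Proof.
by move=> t0 FA; apply/(Fm_setE _ t0)/bigcapT_measurable => n; apply/Fm_setE.
Qed.

Lemma F_lt t f (c : R) : 0 <= t -> Fm t f -> F t [set w | f w < c].
Proof.
move=> t0 /(FmP _ t0)/(_ _ (measurable_itv `]-oo, c[)).
by congr (F t _); apply/seteqP; split => w /=; rewrite in_itv/=.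
Qed.

Lemma F_le t f (c : R) : 0 <= t -> Fm t f -> F t [set w | f w <= c].
Proof.
move=> t0 /(FmP _ t0)/(_ _ (measurable_itv `]-oo, c])).
by congr (F t _); apply/seteqP; split => w /=; rewrite in_itv/=.
Qed.

Lemma F_ae t A B : 0 <= t -> F t B -> {ae P, forall w, A w <-> B w} -> F t A.
Proof.
move=> t0 FB [N [mN N0 AB]].
have FS C : C `<=` N -> F t C by move=> CN; apply: F_null => //; exists N.
have ABn w : ~ N w -> A w <-> B w.
  by move=> Nw; apply: contrapT => AB'; apply: Nw; exact: AB.
have -> : A = (B `&` ~` N) `|` (A `&` N).
  apply/seteqP; split => w.
    by move=> Aw; have [Nw|Nw] := pselect (N w); [right|left; split=> //; exact/ABn].
  by move=> [[Bw /ABn [_ /(_ Bw)]]|[]].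
apply: F_setU => //; last by apply: FS => w [].
by apply: F_setI => //; apply: F_setC => //; exact: FS.
Qed.

Lemma Fm_ae t f g : 0 <= t -> Fm t g -> {ae P, forall w, f w = g w} -> Fm t f.
Proof.
move=> t0 /(FmP _ t0) mg fg; apply/(FmP _ t0) => B mB; apply: F_ae (mg B mB) _ => //.
by apply: filterS fg => w; rewrite /preimage/= => ->.
Qed.

Lemma adapted_FmP (Y : R -> Omega -> R) : adapted F Y <-> forall t, 0 <= t -> Fm t (Y t).
Proof.
rewrite /adapted borel_R; split=> aY t t0; first by apply/(FmP _ t0); exact: aY.
by apply/(FmP _ t0); exact: aY.
Qed.

(* W is a martingale with predictable quadratic variation v t. *)
Definition orthogonal_increments (W : R -> Omega -> R) (v : R) :=
  [/\ 0 <= v, forall t, 0 <= t -> Fm t (W t),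
      forall s t, 0 <= s -> s <= t -> L2 P (fun w => W t w - W s w),
      forall s t G, 0 <= s -> s <= t -> Fm s G -> L1 P G ->
        expect P (fun w => G w * (W t w - W s w)) = 0 &
      forall s t G, 0 <= s -> s <= t -> Fm s G -> L1 P G ->
        L1 P (fun w => G w * (W t w - W s w) ^+ 2) /\
        expect P (fun w => G w * (W t w - W s w) ^+ 2) = expect P G * (v * (t - s))].

(** * Stochastic sums on a grid *)

Section grid.
Variables (W : R -> Omega -> R) (v : R).
Hypothesis orthW : orthogonal_increments W v.
Variable tau : nat -> R.
Hypotheses (tau0 : 0 <= tau 0) (tauS : forall j, tau j <= tau j.+1).

Let v0 : 0 <= v. Proof. by case: orthW. Qed.

Lemma tau_homo i j : (i <= j)%N -> tau i <= tau j.
Proof. by move=> ij; apply: (nondecreasing_seqP _).1. Qed.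

Lemma tau_ge0 j : 0 <= tau j. Proof. exact: le_trans (tau_homo (leq0n _)). Qed.

Definition grid_integral (zeta : nat -> Omega -> R) (n : nat) (w : Omega) : R :=
  \sum_(j < n) zeta j w * (W (tau j.+1) w - W (tau j) w).

Lemma grid_integralS zeta n w : grid_integral zeta n.+1 w =
  grid_integral zeta n w + zeta n w * (W (tau n.+1) w - W (tau n) w).
Proof. by rewrite /grid_integral big_ord_recr. Qed.

Lemma increment_Fm j : Fm (tau j.+1) (fun w => W (tau j.+1) w - W (tau j) w).
Proof.
have [_ FW _ _ _] := orthW; apply: FmB; first by apply: FW; exact: tau_ge0.
by apply: (Fm_mono (tau_ge0 j) (tauS j)); apply: FW; exact: tau_ge0.
Qed.

Lemma grid_Fm zeta n : (forall j, Fm (tau j) (zeta j)) -> Fm (tau n) (grid_integral zeta n).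
Proof.
move=> Fz; elim: n => [|n IH].
  by rewrite /grid_integral; under eq_fun do rewrite big_ord0; exact: Fm_cst.
rewrite [X in Fm _ X](funext (grid_integralS zeta n)).
apply: FmD; first exact: Fm_mono (tau_ge0 n) (tauS n) IH.
apply: FmM; first exact: Fm_mono (tau_ge0 n) (tauS n) (Fz n).
exact: increment_Fm.
Qed.

Lemma increment_L2 zeta j : Fm (tau j) zeta -> L2 P zeta ->
  L2 P (fun w => zeta w * (W (tau j.+1) w - W (tau j) w)).
Proof.
move=> Fz Lz; have [_ _ L2W _ +] := orthW.
move=> /(_ _ _ (fun w => zeta w ^+ 2) (tau_ge0 j) (tauS j)).
move=> /(_ (FmX _ Fz) (L2_sqr Lz))[I2 _].
split; last by under [fun _ => _ ^+ 2]eq_fun do rewrite exprMn.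
apply: measurable_funM; first exact: L2_measurable Lz.
by apply: L2_measurable; exact: L2W (tau_ge0 j) (tauS j).
Qed.

Lemma grid_L2 zeta n : (forall j, Fm (tau j) (zeta j)) -> (forall j, L2 P (zeta j)) ->
  L2 P (grid_integral zeta n).
Proof.
move=> Fz Lz; elim: n => [|n IH].
  by rewrite /grid_integral; under eq_fun do rewrite big_ord0; exact: L2_cst.
rewrite [X in L2 _ X](funext (grid_integralS zeta n)).
by apply: L2D => //; exact: increment_L2.
Qed.

Lemma increment_orthogonal zeta j G : Fm (tau j) zeta -> L2 P zeta ->
  Fm (tau j) G -> L2 P G ->
  expect P (fun w => G w * (zeta w * (W (tau j.+1) w - W (tau j) w))) = 0.
Proof.
move=> Fz Lz FG LG; have [_ _ _ + _] := orthW.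
move=> /(_ _ _ (fun w => G w * zeta w) (tau_ge0 j) (tauS j)) <-.
- by apply: eq_expect => w; rewrite mulrA.
- exact: FmM.
- exact: L2M.
Qed.

Lemma grid_variance zeta n : (forall j, Fm (tau j) (zeta j)) -> (forall j, L2 P (zeta j)) ->
  expect P (fun w => grid_integral zeta n w ^+ 2) =
  \sum_(j < n) expect P (fun w => zeta j w ^+ 2) * (v * (tau j.+1 - tau j)).
Proof.
move=> Fz Lz; elim: n => [|n IH].
  rewrite big_ord0 -(expect_cst P 0); apply: eq_expect => w.
  by rewrite /grid_integral big_ord0 expr0n.
rewrite big_ord_recr/= -IH.
pose a := grid_integral zeta n.
pose b := fun w => zeta n w * (W (tau n.+1) w - W (tau n) w).
have La : L2 P a by exact: grid_L2.
have Lb : L2 P b by exact: increment_L2.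
rewrite (@eq_expect _ _ _ _ _ (fun w => (a w ^+ 2 + 2 * (a w * b w)) + b w ^+ 2)); last first.
  by move=> w; rewrite grid_integralS -/(a w) -/(b w); ring.
have Ia := L2_sqr La; have Ib := L2_sqr Lb; have Iab := L2M La Lb.
have I2ab := L1Z 2 Iab; have Ia2 := L1D Ia I2ab.
rewrite expectD// expectD// expectZ// increment_orthogonal//; last exact: grid_Fm.
rewrite mulr0 addr0.
congr (_ + _); have [_ _ _ _ +] := orthW.
move=> /(_ _ _ (fun w => zeta n w ^+ 2) (tau_ge0 n) (tauS n)).
move=> /(_ (FmX _ (Fz n)) (L2_sqr (Lz n)))[_ <-].
by apply: eq_expect => w; rewrite exprMn.
Qed.

(** [c j] is 1 as long as none of the sums [s 0, ..., s j] has reached the level, so [s'] freezes at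
    the first passage. None of these sums contains the increment [x j], which makes the coefficient
    [c j] known before that increment. *)
Lemma stopped_sum (x : nat -> R) (e : R) n :
  let s (i : nat) : R := \sum_(j < i) x j in
  let c (j : nat) : R := \prod_(i < j.+1) (`|s i| < e)%R%:R in
  let s' (i : nat) : R := \sum_(j < i) c j * x j in
  ((forall i, (i < n)%N -> `|s i| < e) -> s' n = s n) /\
  ((exists2 i, (i <= n)%N & e <= `|s i|) -> e <= `|s' n|).
Proof.
move=> s c s'; have eqs k : (forall i, (i < k)%N -> `|s i| < e) -> s' k = s k.
  move=> sk; apply: eq_bigr => j _; rewrite /c big1 ?mul1r// => i _.
  by rewrite sk// (leq_trans (ltn_ord i)).
split; first exact: eqs.
elim: n => [|n IH] [i].
  by rewrite leqn0 => /eqP ->; rewrite (eqs 0).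
have [allk|/existsNP[k /not_implyP[kn /negP]]] := pselect (forall k, (k < n.+1)%N -> `|s k| < e).
  rewrite leq_eqVlt => /predU1P[-> es|/allk]; first by rewrite eqs.
  by rewrite ltNge => /negP nes es.
rewrite -leNgt => ek _ _; rewrite /s' big_ord_recr/= -/(s' n).
rewrite (_ : c n = 0) ?mul0r ?addr0; first by apply: IH; exists k.
by rewrite /c (bigD1 (Ordinal kn))//= ltNge ek mul0r.
Qed.

(* Kolmogorov's inequality: Markov's inequality for the integral stopped when it
   first exceeds [e]. *)
Lemma grid_maximal zeta n (e : R) : 0 < e ->
  (forall j, Fm (tau j) (zeta j)) -> (forall j, L2 P (zeta j)) ->
  pr P [set w | exists2 i, (i <= n)%N & e <= `|grid_integral zeta i w|] <=
  \sum_(j < n) expect P (fun w => zeta j w ^+ 2) * (v * (tau j.+1 - tau j)) / e ^+ 2.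
Proof.
move=> e0 Fz Lz.
pose ind (x : R) : R := (`|x| < e)%R%:R.
have mind : measurable_fun setT ind.
  rewrite (_ : ind = \1_[set x : R | `|x| < e]); last first.
    by apply/funext => x; rewrite indicE; congr (nat_of_bool _)%:R; apply/idP/idP; rewrite inE.
  apply: measurable_indic; have := (@normr_measurable R setT) measurableT _ (measurable_itv `]-oo, e[).
  by rewrite setTI; congr measurable; apply/seteqP; split => x /=; rewrite in_itv.
pose c j w := \prod_(i < j.+1) ind (grid_integral zeta i w).
have c01 j w : 0 <= c j w <= 1.
  rewrite /c; elim/big_ind: _ => [|x y /andP[x0 x1] /andP[y0 y1]|i _].
  - by rewrite ler01 lexx.
  - by rewrite mulr_ge0//= mulr_ile1.
  - by rewrite /ind; case: (_ < _); rewrite ?lexx ?ler01.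
have Fc j : Fm (tau j) (c j).
  apply: measurable_prod => i _; apply: Fm_comp => //.
  apply: (Fm_mono (tau_ge0 i)); last exact: grid_Fm.
  by apply: tau_homo; rewrite -ltnS.
pose zeta' j w := c j w * zeta j w.
have Fz' j : Fm (tau j) (zeta' j) by exact: FmM.
have c1 j w : `|c j w| <= 1 by have /andP[x0 x1] := c01 j w; rewrite ger0_norm.
have Lz' j : L2 P (zeta' j).
  apply: L2M_bounded (c1 j) => //; exact: (Fm_measurable (tau_ge0 j) (Fc j)).
apply: (@le_trans _ _ (pr P [set w | e <= `|grid_integral zeta' n w|])).
  have mm (A : set Omega) : F (tau n) A -> measurable A by apply: F_measurable; exact: tau_ge0.
  apply: le_pr.
  - have -> : [set w | exists2 i, (i <= n)%N & e <= `|grid_integral zeta i w|] =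
       \bigcup_(i in [set i | (i <= n)%N]) [set w | e <= `|grid_integral zeta i w|].
      by apply/seteqP; split => w [i]; exists i.
    apply: bigcup_measurable => i _; apply: measurable_norm_ge.
    exact: (Fm_measurable (tau_ge0 i) (grid_Fm (n := i) Fz)).
  - by apply: measurable_norm_ge; exact: (Fm_measurable (tau_ge0 n) (grid_Fm (n := n) Fz')).
  - move=> w /= ex; have [_ /(_ ex)] := stopped_sum (fun j => zeta j w * (W (tau j.+1) w - W (tau j) w)) e n.
    rewrite /grid_integral; congr (_ <= `|_|).
    by apply: eq_bigr => j _; rewrite mulrA.
apply: le_trans (markov2 e0 (grid_L2 n Fz' Lz')) _.
rewrite grid_variance// -mulr_suml ler_wpM2r ?invr_ge0 ?exprn_ge0 ?(ltW e0)//.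
apply: ler_sum => j _; rewrite ler_wpM2r ?mulr_ge0 ?subr_ge0//.
apply: le_expect; [exact: L2_sqr|exact: L2_sqr|].
move=> w; rewrite exprMn ler_piMl ?sqr_ge0// exprn_ile1//; by case/andP: (c01 j w).
Qed.

(* Lenglart's domination: truncate the integrand when its energy reaches [del]. *)
Lemma grid_lenglart zeta n (e del : R) : 0 < e -> 0 < del ->
  (forall j, Fm (tau j) (zeta j)) ->
  pr P [set w | e <= `|grid_integral zeta n w|] <=
  pr P [set w | del <= \sum_(j < n) zeta j w ^+ 2 * (tau j.+1 - tau j)] + v * del / e ^+ 2.
Proof.
move=> e0 del0 Fz.
have mz j : measurable_fun setT (zeta j) by exact: (Fm_measurable (tau_ge0 j) (Fz j)).
pose q i w := \sum_(j < i) zeta j w ^+ 2 * (tau j.+1 - tau j).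
have qS i w : q i.+1 w = q i w + zeta i w ^+ 2 * (tau i.+1 - tau i) by rewrite /q big_ord_recr.
have term0 j w : 0 <= zeta j w ^+ 2 * (tau j.+1 - tau j).
  by rewrite mulr_ge0 ?sqr_ge0// subr_ge0.
have q0 i w : 0 <= q i w by apply: sumr_ge0.
have qmono i j w : (i <= j)%N -> q i w <= q j w.
  move=> ij; rewrite -(subnKC ij); elim: (j - i)%N => [|k IH]; first by rewrite addn0.
  by rewrite addnS qS (le_trans IH)// lerDl.
have Fq i : Fm (tau i) (q i.+1).
  apply: Fm_sum => j; apply: FmM; last exact: Fm_cst.
  by apply: FmX; apply: (Fm_mono (tau_ge0 j)) (Fz j); apply: tau_homo; rewrite -ltnS.
have mq i : measurable_fun setT (q i).
  by apply: measurable_sum => j; apply: measurable_funM => //; exact: measurable_funX.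
(* The energy up to the end of the cell [j] is already known at its beginning. Testing [q j.+1] and
   not [q j] drops the cell that would exceed [del], so the truncated energy never does. *)
pose c j : Omega -> R := \1_[set w | q j.+1 w < del].
have Fc j : Fm (tau j) (c j) by apply: Fm_indic; [|apply: F_lt]; rewrite ?tau_ge0.
have cE j w : c j w = (q j.+1 w < del)%R%:R.
  by rewrite /c indicE; congr (nat_of_bool _)%:R; apply/idP/idP; rewrite inE.
(* On a cell of length zero the energy does not control the coefficient; such a cell contributes
   nothing to the integral, and the first factor removes it so that every [zeta' j] is bounded. *)
pose zeta' j w := (tau j < tau j.+1)%R%:R * c j w * zeta j w.
have Fz' j : Fm (tau j) (zeta' j) by do 2 apply: FmM => //; exact: Fm_cst.
have z'q j w : zeta' j w ^+ 2 * (tau j.+1 - tau j) <= del.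
  rewrite /zeta'; case: ltP => jj; last by rewrite !mul0r expr0n mul0r ltW.
  rewrite mul1r cE; case: ltP => qd; last by rewrite mul0r expr0n mul0r ltW.
  by rewrite mul1r (le_trans _ (ltW qd))// qS lerDr.
have Lz' j : L2 P (zeta' j).
  split; first exact: (Fm_measurable (tau_ge0 j) (Fz' j)).
  have [jj|jj] := ltP (tau j) (tau j.+1); last first.
    have -> : (fun w => zeta' j w ^+ 2) = cst 0.
      by apply/funext => w; rewrite /zeta' ltNge jj !mul0r expr0n.
    exact: L1_cst.
  apply: (@L1_bounded _ _ _ _ _ (del / (tau j.+1 - tau j))).
    by apply: measurable_funX; apply: Fm_measurable (Fz' j); exact: tau_ge0.
  by move=> w; rewrite ger0_norm ?sqr_ge0// ler_pdivlMr ?subr_gt0.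
have sum' k w : \sum_(j < k) zeta' j w ^+ 2 * (tau j.+1 - tau j) <= del.
  have le' i u : zeta' i u ^+ 2 * (tau i.+1 - tau i) <= zeta i u ^+ 2 * (tau i.+1 - tau i).
    rewrite ler_wpM2r ?subr_ge0// /zeta' cE.
    case: (tau i < _); case: (_ < del); rewrite ?mulr1 ?mul1r ?mulr0 ?mul0r// expr0n sqr_ge0//.
  elim: k => [|k IH]; first by rewrite big_ord0 ltW.
  have [qk|qk] := ltP (q k.+1 w) del.
    by apply: le_trans (ltW qk); apply: ler_sum.
  have ck : c k w = 0 by rewrite cE ltNge qk.
  rewrite big_ord_recr/= {2}/zeta' ck mulr0 mul0r expr0n mul0r addr0.
  exact: IH.
have mN z : (forall j, Fm (tau j) (z j)) -> measurable_fun setT (grid_integral z n).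
  by move=> Fz0; exact: (Fm_measurable (tau_ge0 n) (grid_Fm (n := n) Fz0)).
apply: (@le_trans _ _ (pr P ([set w | del <= q n w] `|` [set w | e <= `|grid_integral zeta' n w|]))).
  apply: le_pr.
  - exact/measurable_norm_ge/mN.
  - by apply: measurableU; [exact: measurable_ge|exact/measurable_norm_ge/mN].
  - move=> w /= ew; have [qd|dq] := ltP (q n w) del; [right|by left].
    rewrite (_ : grid_integral zeta' n w = grid_integral zeta n w)//.
    apply: eq_bigr => j _; rewrite /zeta' cE (le_lt_trans (qmono _ _ _ (ltn_ord j)) qd).
    rewrite mulr1; case: ltP => jj; first by rewrite mul1r.
    have -> : tau j.+1 = tau j by apply/eqP; rewrite eq_le jj tauS.
    by rewrite subrr !mulr0.
apply: le_trans (prU_le _ _ _) _.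
- exact: measurable_ge.
- exact/measurable_norm_ge/mN.
rewrite lerD2l; apply: le_trans (markov2 e0 (grid_L2 n Fz' Lz')) _.
rewrite ler_wpM2r ?invr_ge0 ?exprn_ge0 ?(ltW e0)// grid_variance//.
have -> : \sum_(j < n) expect P (fun w => zeta' j w ^+ 2) * (v * (tau j.+1 - tau j)) =
   v * expect P (fun w => \sum_(j < n) zeta' j w ^+ 2 * (tau j.+1 - tau j)).
  rewrite expect_sum; last first.
    by move=> j; under eq_fun do rewrite mulrC; exact/L1Z/L2_sqr.
  rewrite mulr_sumr; apply: eq_bigr => j _; rewrite mulrCA; congr (_ * _).
  rewrite mulrC -expectZ; last exact: L2_sqr.
  by apply: eq_expect => w; rewrite mulrC.
rewrite ler_wpM2l// -[leRHS](expect_cst P); apply: le_expect => //.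
- by apply: L1_sum => j; under eq_fun do rewrite mulrC; exact/L1Z/L2_sqr.
- exact: L1_cst.
Qed.

End grid.
End filtration.

(** Nonnegativity and additivity give monotonicity, which squeezes [q t] between its values at
    neighbouring multiples of [1 / (N + 1)]. *)
Lemma additive_linear (R : realType) (q : R -> R) :
  (forall t, 0 <= t -> 0 <= q t) ->
  (forall s t, 0 <= s -> 0 <= t -> q (s + t) = q s + q t) ->
  forall t, 0 <= t -> q t = q 1 * t.
Proof.
move=> q0 qD t t0.
have qmono s u : 0 <= s -> s <= u -> q s <= q u.
  by move=> s0 su; rewrite -(subrKC s u) qD ?subr_ge0// lerDl q0// subr_ge0.
have q_0 : q 0 = 0 by have := qD 0 0 (lexx _) (lexx _); rewrite addr0; lra.
have qn n s : 0 <= s -> q (n%:R * s) = n%:R * q s.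
  move=> s0; elim: n => [|n IH]; first by rewrite !mul0r.
  by rewrite -natr1 !mulrDl !mul1r qD ?mulr_ge0// IH.
have q1n n : q n.+1%:R^-1 = q 1 / n.+1%:R.
  have := qn n.+1 n.+1%:R^-1; rewrite mulfV// => ->; last by rewrite invr_ge0.
  by rewrite mulrAC mulfV// mul1r.
apply/eqP; rewrite -subr_eq0 -normr_eq0 eq_le normr_ge0 andbT.
apply/ler_addgt0Pr => e e0; rewrite add0r.
have [N NP] : exists N : nat, N.+1%:R^-1 < e / (q 1 + 1).
  by apply: inv_lt_eps; rewrite divr_gt0// ltr_wpDl// q0.
pose k := Num.truncn (t * N.+1%:R).
have /andP[k1 k2] : k%:R <= t * N.+1%:R < k.+1%:R by apply: truncn_itv; rewrite mulr_ge0.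
have qk j : q (j%:R / N.+1%:R) = q 1 * (j%:R / N.+1%:R).
  by rewrite qn ?invr_ge0// q1n mulrCA.
have l1 : q 1 * (k%:R / N.+1%:R) <= q t.
  by rewrite -qk qmono ?divr_ge0// ler_pdivrMr.
have l2 : q t <= q 1 * (k.+1%:R / N.+1%:R).
  by rewrite -qk qmono// ler_pdivlMr// ltW.
have l3 : q 1 * (k%:R / N.+1%:R) <= q 1 * t by rewrite ler_wpM2l ?q0// ler_pdivrMr.
have l4 : q 1 * t <= q 1 * (k.+1%:R / N.+1%:R) by rewrite ler_wpM2l ?q0// ler_pdivlMr// ltW.
have l5 : q 1 * (k.+1%:R / N.+1%:R) = q 1 * (k%:R / N.+1%:R) + q 1 * N.+1%:R^-1.
  by rewrite -natr1 mulrDl mul1r mulrDr.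
have l6 : q 1 * N.+1%:R^-1 <= e.
  rewrite (@le_trans _ _ ((q 1 + 1) * N.+1%:R^-1))//; first by rewrite ler_wpM2r ?invr_ge0// lerDl.
  by rewrite mulrC -ler_pdivlMr ?ltW// ltr_wpDl// q0.
rewrite l5 in l2 l4; move: l1 l2 l3 l4 l6; rewrite ler_norml.
move: (q 1 * (k%:R / _)) (q 1 / _) (q 1 * t) (q t) => a b c x *.
by apply/andP; split; lra.
Qed.

(** * Combinations of the components of a Levy martingale *)

Section levy.
Context {R : realType} {d : measure_display} {Omega : measurableType d}.
Variables (P : probability Omega R) (F : R -> set (set Omega)).
Hypothesis usualF : usual_conditions P F.
Variables (m : nat) (X : R -> Omega -> 'rV[R]_m).
Hypotheses (levyX : levy_process P F X)
  (martX : forall k, square_integrable_martingale P F (component X k)).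

Definition combination (u : 'I_m -> R) (x : 'rV[R]_m) : R := \sum_k u k * x ord0 k.

Lemma combination_continuous u : continuous (combination u).
Proof.
move=> x; rewrite /combination; elim: (index_enum _) => [|k s IH].
  rewrite [X in continuous_at _ X](_ : _ = cst 0); first exact: cst_continuous.
  by apply/funext => y; rewrite big_nil.
rewrite [X in continuous_at _ X](_ : _ = (fun y : 'rV[R]_m => u k * y ord0 k + \sum_(j <- s) u j * y ord0 j)).
  have ck : continuous_at x (fun y : 'rV[R]_m => u k * y ord0 k).
    have cx : (fun y : 'rV[R]_m => y ord0 k) @ (x : 'rV[R]_m) --> x ord0 k by exact: coord_continuous.
    exact: (cvgM (cvg_cst (u k)) cx).
  exact: (@cvgD _ _ 'rV[R]_m (nbhs (x : 'rV[R]_m)) _ _ _ _ _ ck IH).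
by apply/funext => y; rewrite big_cons.
Qed.

Lemma combinationB u x y : combination u (x - y) = combination u x - combination u y.
Proof.
by rewrite /combination -sumrB; apply: eq_bigr => k _; rewrite !mxE mulrBr.
Qed.

Lemma combination_preimage u (B : set R) : measurable B ->
  <<s (@open 'rV[R]_m) >> (combination u @^-1` B).
Proof. by move=> mB; apply: continuous_preimage mB; exact: combination_continuous. Qed.

Definition levy_combination (u : 'I_m -> R) (t : R) (w : Omega) : R :=
  combination u (X t w).

Lemma levy_combination_Fm u t : 0 <= t -> Fm F t (levy_combination u t).
Proof.
move=> t0; apply/(FmP usualF _ t0) => B mB.
case: levyX => -[aX _] _ _ _; apply: (aX t t0 (combination u @^-1` B)).
exact: combination_preimage.
Qed.

Definition levy_increment u s t w := levy_combination u t w - levy_combination u s w.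

Lemma component_L2 k t : 0 <= t -> L2 P (component X k t).
Proof.
move=> t0; have [_ /(_ t t0) L _] := martX k.
split; first by move/sub_Lfun_mfun : (L); rewrite inE.
exact: (Lfun2_integrable_sqr L).
Qed.

Lemma levy_combination_L2 u t : 0 <= t -> L2 P (levy_combination u t).
Proof. by move=> t0; apply: L2_sum => k; apply: L2Z; exact: component_L2. Qed.

Lemma increment_law u s t (B : set R) : 0 <= s -> s <= t -> measurable B ->
  P (levy_increment u s t @^-1` B) =
  P (levy_combination u (t - s) @^-1` B).
Proof.
move=> s0 st mB; case: levyX => _ _ _ /(_ s t _ s0 st (combination_preimage u mB)) <-.
by congr (P _); apply/seteqP; split => w /=; rewrite /preimage/= combinationB.
Qed.

Lemma increment_independent u s t E (B : set R) : 0 <= s -> s <= t -> F s E ->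
  measurable B ->
  P (E `&` levy_increment u s t @^-1` B) =
  (P E * P (levy_increment u s t @^-1` B))%E.
Proof.
move=> s0 st FE mB.
case: levyX => _ _ /(_ s t _ _ s0 st FE (combination_preimage u mB)) + _.
have -> : levy_increment u s t @^-1` B =
  [set w | (combination u @^-1` B) (X t w - X s w)]; last by [].
by apply/seteqP; split => w /=; rewrite /preimage/= combinationB.
Qed.

Lemma increment_centered u s t : 0 <= s -> s <= t ->
  expect P (fun w => levy_combination u t w - levy_combination u s w) = 0.
Proof.
move=> s0 st; have t0 := le_trans s0 st.
have IE r : 0 <= r -> expect P (levy_combination u r) =
    \sum_k u k * expect P (component X k r).
  move=> r0; have I k : L1 P (component X k r) by apply: L2_L1; exact: component_L2.
  rewrite expect_sum => [|k]; last exact/L1Z/I.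
  by apply: eq_bigr => k _; exact: (expectZ (u k) (I k)).
rewrite expectB; try by apply: L2_L1; exact: levy_combination_L2.
rewrite !IE// -sumrB big1// => k _; rewrite -mulrBr.
have [_ _ /(_ s t setT s0 st (F_setT usualF s0)) e] := martX k.
by rewrite /expect e subrr mulr0.
Qed.

Lemma eq_law_expect (U W : Omega -> R) (g : R -> R) : measurable_fun setT U ->
  measurable_fun setT W -> measurable_fun setT g -> (forall x, 0 <= g x) ->
  (forall B, measurable B -> P (U @^-1` B) = P (W @^-1` B)) ->
  expect P (g \o U) = expect P (g \o W).
Proof.
move=> mU mW mg g0 UW.
pose U' : {RV P >-> R} := HB.pack U (isMeasurableFun.Build _ _ _ _ U mU).
pose W' : {RV P >-> R} := HB.pack W (isMeasurableFun.Build _ _ _ _ W mW).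
have mg' : measurable_fun setT (EFin \o g) by exact/measurable_EFinP.
rewrite /expect /Rintegral; congr fine.
transitivity (\int[distribution P U']_x (g x)%:E)%E.
  by rewrite ge0_integral_distribution// => x; rewrite lee_fin.
transitivity (\int[distribution P W']_x (g x)%:E)%E; last first.
  by rewrite ge0_integral_distribution// => x; rewrite lee_fin.
by apply: eq_measure_integral => B mB _; exact: UW.
Qed.

Definition levy_variance u := expect P (fun w => levy_combination u 1 w ^+ 2).

(** By stationarity the variance depends on [t - s] alone; independent centred increments make it
    additive in the length, hence linear. *)
Lemma increment_variance u s t : 0 <= s -> s <= t ->
  expect P (fun w => (levy_combination u t w - levy_combination u s w) ^+ 2) =
  levy_variance u * (t - s).
Proof.
have Lu r : 0 <= r -> L2 P (levy_combination u r) by exact: levy_combination_L2.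
pose q r := expect P (fun w => levy_combination u r w ^+ 2).
have qE a b : 0 <= a -> a <= b ->
    expect P (fun w => (levy_combination u b w - levy_combination u a w) ^+ 2) = q (b - a).
  move=> a0 ab; have b0 := le_trans a0 ab.
  apply: (@eq_law_expect (fun w => levy_combination u b w - levy_combination u a w)
     (levy_combination u (b - a)) (fun x => x ^+ 2)).
  - by apply: L2_measurable; apply: L2B; exact: Lu.
  - by apply: L2_measurable; apply: Lu; rewrite subr_ge0.
  - exact: measurable_funX.
  - by move=> x; exact: sqr_ge0.
  - by move=> B mB; exact: increment_law.
move=> s0 st; rewrite qE//.
suff : q (t - s) = q 1 * (t - s) by [].
apply: additive_linear; rewrite ?subr_ge0//.
  by move=> r r0; apply: expect_ge0 => w; exact: sqr_ge0.
move=> a b a0 b0; have ab0 : 0 <= a + b by exact: addr_ge0.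
pose U w := levy_combination u a w - levy_combination u 0 w.
pose W w := levy_combination u (a + b) w - levy_combination u a w.
have LU : L2 P U by apply: L2B; exact: Lu.
have LW : L2 P W by apply: L2B; exact: Lu.
have -> : q (a + b) = expect P (fun w => (U w + W w) ^+ 2).
  rewrite -[a + b in LHS]subr0 -qE//; apply: eq_expect => w.
  by rewrite /U /W; congr (_ ^+ 2); ring.
have -> : q a = expect P (fun w => U w ^+ 2) by rewrite -[a in LHS]subr0 -qE.
have -> : q b = expect P (fun w => W w ^+ 2).
  have -> : b = a + b - a by rewrite addrAC subrr add0r.
  by rewrite -qE// lerDl.
have [IUW EUW] := @expect_independent _ _ _ P U W (L2_L1 LU) (L2_L1 LW) ltac:(
  move=> A B mA mB; apply: increment_independent => //; [by rewrite lerDl|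
  apply: (FmP usualF _ a0).1 => //; apply: FmB; [exact: levy_combination_Fm|
  by apply: (Fm_mono usualF (lexx 0) a0); exact: levy_combination_Fm]]).
have {}EUW : expect P (fun w => U w * W w) = 0.
  by rewrite EUW (_ : expect P W = 0) ?mulr0//; apply: increment_centered => //; rewrite lerDl.
have I2 := L1Z 2 IUW; have IU2 := L2_sqr LU; have IW2 := L2_sqr LW.
rewrite (@eq_expect _ _ _ _ _ (fun w => (U w ^+ 2 + 2 * (U w * W w)) + W w ^+ 2)); last first.
  by move=> w; ring.
have Is := L1D IU2 I2.
by rewrite expectD// expectD// expectZ// EUW mulr0 addr0.
Qed.

Lemma levy_orthogonal u : orthogonal_increments P F (levy_combination u) (levy_variance u).
Proof.
have LW s t : 0 <= s -> s <= t -> L2 P (fun w => levy_combination u t w - levy_combination u s w).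
  by move=> s0 st; apply: L2B; apply: levy_combination_L2 => //; exact: le_trans st.
split=> //.
- by apply: expect_ge0 => w; exact: sqr_ge0.
- exact: levy_combination_Fm.
- move=> s t G s0 st FG LG.
  have [_ ->] := @expect_independent _ _ _ P G _ LG (L2_L1 (LW s t s0 st)) ltac:(
    move=> A B mA mB; apply: increment_independent => //; exact: (FmP usualF _ s0).1).
  by rewrite increment_centered// mulr0.
- move=> s t G s0 st FG LG.
  have [IGW ->] := @expect_independent _ _ _ P G _ LG (L2_sqr (LW s t s0 st)) ltac:(
    move=> A B mA mB; have mB' : measurable ((fun x : R => x ^+ 2) @^-1` B) by
      [rewrite -[X in measurable X]setTI; exact: (@measurable_funX _ _ R setT id 2 (@measurable_id _ _ setT))];
    apply: (increment_independent u s0 st _ mB'); exact: (FmP usualF _ s0).1).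
  by split=> //; rewrite increment_variance.
Qed.

(** If the variance vanished, the combination would almost surely keep its initial value 0 at every
    time; nontriviality in every direction excludes this. *)
Lemma levy_variance_gt0 u : nontrivial_components P X -> (exists k, u k != 0) ->
  0 < levy_variance u.
Proof.
move=> ntX u0; have [v0 _ _ _ _] := levy_orthogonal u.
rewrite lt_neqAle v0 andbT; apply/negP => /eqP vu.
apply: (ntX u u0) => t t0.
have X0 : {ae P, forall w, X 0 w = 0} by case: levyX.
have LI : L2 P (fun w => levy_combination u t w - levy_combination u 0 w).
  by apply: L2B; exact: levy_combination_L2.
have := increment_variance u (lexx 0) t0; rewrite -vu mul0r => E0.
have IE : (\int[P]_w ((levy_combination u t w - levy_combination u 0 w) ^+ 2)%:E = 0)%E.
  rewrite -[LHS]fineK; first by rewrite [fine _]E0.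
  exact: (integrable_fin_num _ (L2_sqr LI)).
have mI := measurable_int P (L2_sqr LI).
have /(ae_eq_integral_abs P measurableT mI) h :
    (\int[P]_w `|(EFin \o (fun w => (levy_combination u t w - levy_combination u 0 w) ^+ 2)%R) w| = 0)%E.
  by rewrite -[RHS]IE; apply: eq_integral => w _; rewrite /= ger0_norm ?sqr_ge0.
apply: filterS2 X0 h => w X0w /(_ Logic.I) [] /eqP.
rewrite sqrf_eq0 subr_eq0 => /eqP; rewrite /levy_combination X0w.
by rewrite [RHS]big1// => k _; rewrite mxE mulr0.
Qed.

End levy.

(** * Stochastic integrals of left limits *)

Section energy.
Context {R : realType}.
Notation mu := (@lebesgue_measure R).
Implicit Types (f g : R -> R).

Definition energy (T : R) f := \int[mu]_(s in `[0, T]) f s ^+ 2.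

Lemma bounded_measurable_sqr f : bounded_measurable f ->
  bounded_measurable (fun s => f s ^+ 2).
Proof.
by move=> mf; have := bounded_measurableM mf mf; under eq_fun do rewrite -expr2.
Qed.

Lemma energy_ge0 T f : 0 <= energy T f.
Proof. by apply: Rintegral_ge0 => s _; exact: sqr_ge0. Qed.

Lemma energyE (T : R) f : bounded_measurable f ->
  (\int[mu]_(s in `[0%R, T]) (f s ^+ 2)%:E)%E = (energy T f)%:E.
Proof.
move=> mf; rewrite /energy /Rintegral fineK//; apply: integrable_fin_num => //.
exact: (bounded_measurable_integrable T (bounded_measurable_sqr mf) (lexx 0)).
Qed.

Lemma energy_le2 T f g h : bounded_measurable f -> bounded_measurable g ->
  bounded_measurable h -> (forall s, `|f s| <= `|g s| + `|h s|) ->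
  energy T f <= 2 * energy T g + 2 * energy T h.
Proof.
move=> mf mg mh fgh.
have I k : bounded_measurable k -> mu.-integrable `[0, T] (EFin \o (fun s => k s ^+ 2)).
  by move=> mk; apply: bounded_measurable_integrable => //; exact: bounded_measurable_sqr.
have I2 k : bounded_measurable k -> mu.-integrable `[0, T] (EFin \o (fun s => 2 * k s ^+ 2)).
  move=> mk; apply: bounded_measurable_integrable => //.
  exact/bounded_measurableZ/bounded_measurable_sqr.
rewrite /energy -!RintegralZl//; [|exact: I|exact: I].
rewrite -RintegralD//; [|exact: I2|exact: I2].
apply: le_Rintegral => //; first exact: I.
  apply: bounded_measurable_integrable => //.
  by apply: bounded_measurableD; apply/bounded_measurableZ/bounded_measurable_sqr.
move=> s _; rewrite -[f s ^+ 2]real_normK ?num_real//.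
rewrite -[g s ^+ 2]real_normK ?num_real// -[h s ^+ 2]real_normK ?num_real//.
have := fgh s; have := normr_ge0 (f s).
move: `|f s| `|g s| `|h s| => x y z x0 xyz.
have : x ^+ 2 <= (y + z) ^+ 2 by rewrite lerXn2r ?nnegrE//; exact: le_trans xyz.
by have := sqr_ge0 (y - z); nra.
Qed.

Lemma indic_itv_bm (a b : R) : bounded_measurable (\1_(`]a, b]%classic) : R -> R).
Proof.
move=> T; split; first exact/measurable_funTS/measurable_indic.
by exists 1 => t _ _; rewrite indicE; case: (_ \in _); rewrite ?normr1 ?normr0.
Qed.

Lemma indic_ocE (a b s : R) : (\1_(`]a, b]%classic) s : R) = ((a < s) && (s <= b))%R%:R.
Proof.
rewrite indicE; congr (nat_of_bool _)%:R.
by apply/idP/idP; rewrite inE/= in_itv.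
Qed.

Lemma Rintegral_indic_oc (a b T : R) : 0 <= a -> a <= b -> b <= T ->
  \int[mu]_(s in `[0, T]) (\1_(`]a, b]%classic) s : R) = b - a.
Proof.
move=> a0 ab bT; rewrite /Rintegral integral_indic//.
rewrite (_ : _ `&` _ = `]a, b]%classic); last first.
  apply/seteqP; split => s /=; rewrite !in_itv/=; first by case.
  move=> /andP[sa sb]; split; first by rewrite sa sb.
  by rewrite (le_trans a0 (ltW sa)) (le_trans sb bT).
rewrite [X in fine X](lebesgue_measure_itv `]a, b])/= lte_fin.
case: ltP => [//|ba]; have -> : a = b by apply/eqP; rewrite eq_le ab.
by rewrite subrr.
Qed.

(** Dominated convergence on []0, T]]. The point 0 is left out because left limits are available at
    positive times only. *)
Lemma energy_cvg0 (T : R) (phi : nat -> R -> R) f (B : R) :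
  (forall n, bounded_measurable (phi n)) -> bounded_measurable f ->
  (forall n s, 0 < s -> s <= T -> `|phi n s| <= B) ->
  (forall s, 0 < s -> s <= T -> phi n s @[n --> \oo] --> f s) ->
  energy T (fun s => phi n s - f s) @[n --> \oo] --> (0 : R).
Proof.
move=> mphi mf phiB phif.
have fB s : 0 < s -> s <= T -> `|f s| <= B.
  move=> s0 sT; have := phif s s0 sT => /cvg_norm /ler_cvg_to; apply.
    exact: cvg_cst.
  by apply: nearW => n; exact: phiB.
have mdiff n : bounded_measurable (fun s => (phi n s - f s) ^+ 2).
  by apply/bounded_measurable_sqr/bounded_measurableD => //; exact: bounded_measurableN.
have sub : `]0, T]%classic `<=` `[0, T]%classic.
  by move=> s /=; rewrite !in_itv/= => /andP[/ltW -> ->].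
have IE g : bounded_measurable g ->
    mu.-integrable `]0, T] (EFin \o g) /\
    \int[mu]_(s in `[0, T]) g s = \int[mu]_(s in `]0, T]) g s.
  move=> mg; have Ig : mu.-integrable `]0, T] (EFin \o g).
    by apply: integrableS (bounded_measurable_integrable T mg (lexx 0)) => //.
  by split=> //; rewrite -(Rintegral_itv_obnd_cbnd (r := 0) (b := BRight T)).
under eq_cvg do rewrite /energy (IE _ (mdiff _)).2.
have [] := @dominated_convergence _ _ _ mu `]0, T]%classic (measurable_itv _)
  (fun n => EFin \o (fun s => (phi n s - f s) ^+ 2)) (cst 0%E)
  (EFin \o cst ((B + B) ^+ 2)).
- by move=> n; have [/measurable_int] := IE _ (mdiff n).
- exact: measurable_cst.
- apply: aeW => s /=; rewrite in_itv/= => /andP[s0 sT].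
  apply: cvg_EFin; first exact: nearW.
  rewrite -[X in _ --> X](mulr0 0); under eq_cvg do rewrite /= expr2.
  have h : phi n s - f s @[n --> \oo] --> (0 : R).
    by rewrite -(subrr (f s)); apply: cvgB; [exact: phif|exact: cvg_cst].
  exact: cvgM.
- exact: (IE _ (bounded_measurable_cst _)).1.
- apply: aeW => s n /=; rewrite in_itv/= => /andP[s0 sT].
  rewrite lee_fin normrX lerXn2r ?nnegrE ?addr_ge0//.
  + exact: le_trans (phiB 0%N s s0 sT).
  + exact: le_trans (phiB 0%N s s0 sT).
  + by rewrite (le_trans (ler_normB _ _))// lerD ?phiB ?fB.
move=> _ _; rewrite integral0 => h.
exact: (fine_cvg h).
Qed.

End energy.

(** * Simple processes and Lenglart's inequality *)

Section simple.
Context {R : realType} {d : measure_display} {Omega : measurableType d}.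
Notation mu := (@lebesgue_measure R).
Variables (P : probability Omega R) (F : R -> set (set Omega)).
Hypothesis usualF : usual_conditions P F.

Section fin.
Variables (I : finType) (a b : I -> R) (c : I -> Omega -> R).

(** The index type is an arbitrary finite type: differences of simple processes and processes cut
    along a grid are indexed by sums and products of types. *)
Definition fin_value (s : R) (w : Omega) : R :=
  \sum_i c i w * \1_(`]a i, b i]%classic) s.

Definition fin_integral (M : R -> Omega -> R) (t : R) (w : Omega) : R :=
  \sum_i c i w * (M (Num.min (b i) t) w - M (Num.min (a i) t) w).

Lemma fin_value_bm w : bounded_measurable (fin_value ^~ w).
Proof.
rewrite /fin_value; elim: (index_enum I) => [|i s IH].
  by under eq_fun do rewrite big_nil; exact: bounded_measurable_cst.
under eq_fun do rewrite big_cons; apply: bounded_measurableD => //.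
by apply: bounded_measurableZ; exact: indic_itv_bm.
Qed.

(** Squaring out, the energy is a quadratic form in the coefficients with deterministic weights. *)
Lemma energy_fin_value_measurable T : (forall i, measurable_fun setT (c i)) ->
  measurable_fun setT (fun w => energy T (fin_value ^~ w)).
Proof.
move=> mc.
have Iij i j : bounded_measurable (fun s : R =>
    (\1_(`]a i, b i]%classic) s * \1_(`]a j, b j]%classic) s)).
  by apply: bounded_measurableM; exact: indic_itv_bm.
pose k i j := \int[mu]_(s in `[0, T]) (\1_(`]a i, b i]%classic) s * \1_(`]a j, b j]%classic) s).
suff -> : (fun w => energy T (fin_value ^~ w)) =
    (fun w => \sum_i \sum_j c i w * c j w * k i j).
  apply: measurable_sum => i; apply: measurable_sum => j.
  by apply: measurable_funM => //; exact: measurable_funM.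
apply/funext => w; rewrite /energy.
pose g (q : I * I) (s : R) := c q.1 w * c q.2 w *
  (\1_(`]a q.1, b q.1]%classic) s * \1_(`]a q.2, b q.2]%classic) s).
have mg q : bounded_measurable (g q) by exact: bounded_measurableZ.
have sumg (s : seq (I * I)) :
    bounded_measurable (fun u => \sum_(q <- s) g q u) /\
    \int[mu]_(u in `[0, T]) (\sum_(q <- s) g q u) = \sum_(q <- s) \int[mu]_(u in `[0, T]) g q u.
  elim: s => [|q s [IH1 IH2]].
    split; first by under eq_fun do rewrite big_nil; exact: bounded_measurable_cst.
    rewrite big_nil; under eq_Rintegral do rewrite big_nil.
    by rewrite Rintegral_cst// mul0r.
  split; first by under eq_fun do rewrite big_cons; exact: bounded_measurableD.
  rewrite big_cons; under eq_Rintegral do rewrite big_cons.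
  by rewrite RintegralD ?IH2//; exact: bounded_measurable_integrable.
transitivity (\int[mu]_(s in `[0, T]) \sum_q g q s).
  apply: eq_Rintegral => s _; rewrite /fin_value expr2 mulr_suml -(pair_bigA _ (fun i j => g (i, j) s))/=.
  by apply: eq_bigr => i _; rewrite mulr_sumr; apply: eq_bigr => j _; rewrite /g/=; ring.
rewrite (sumg _).2 -(pair_bigA _ (fun i j => \int[mu]_(s in `[0, T]) g (i, j) s))/=.
apply: eq_bigr => i _; apply: eq_bigr => j _; rewrite /g/= RintegralZl//.
exact: bounded_measurable_integrable.
Qed.

Section lenglart.
Variables (W : R -> Omega -> R) (v : R).
Hypothesis orthW : orthogonal_increments P F W v.
Hypotheses (a0 : forall i, 0 <= a i) (ab : forall i, a i <= b i)
  (Fc : forall i, Fm F (a i) (c i)).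
Variable T : R.
Hypothesis T0 : 0 <= T.

(** The common refinement of all the intervals. Since [T] is the default value of [nth] below, the
    grid [tau] reaches [T] and stays there. *)
Let points : seq R := sort <=%R (0 :: [seq Num.min (a i) T | i <- index_enum I] ++
  [seq Num.min (b i) T | i <- index_enum I]).
Let tau j := nth T points j.

Lemma points_bound x : x \in points -> 0 <= x <= T.
Proof.
rewrite mem_sort inE mem_cat => /predU1P[->|]; first by rewrite lexx T0.
move=> /orP[] /mapP[i _ ->]; rewrite ge_min lexx orbT andbT le_min T0 andbT//.
exact: le_trans (a0 i) (ab i).
Qed.

Lemma tau_bound j : 0 <= tau j <= T.
Proof.
have [js|js] := ltnP j (size points).
  exact/points_bound/mem_nth.
by rewrite /tau nth_default// T0 lexx.
Qed.

Lemma tauS j : tau j <= tau j.+1.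
Proof.
have [js|js] := ltnP j.+1 (size points).
  by apply: (sorted_leq_nth le_trans lexx) => //; [exact: sort_le_sorted|rewrite inE ltnW].
by rewrite [leRHS]nth_default//; case/andP: (tau_bound j).
Qed.

Lemma tau_0 : tau 0 = 0.
Proof.
apply/eqP; rewrite eq_le; have /andP[-> _] := tau_bound 0; rewrite andbT.
have : 0 \in points by rewrite mem_sort inE eqxx.
move=> /(nthP T)[k ks <-].
exact: (nondecreasing_seqP tau).1 tauS 0%N k (leq0n k).
Qed.

Let tau_homo' := (nondecreasing_seqP tau).1 tauS.

Lemma tau_point x j : x \in points -> (x <= tau j) || (tau j.+1 <= x).
Proof.
move=> /(nthP T)[k ks <-]; have [kj|jk] := leqP k j.
  by rewrite (tau_homo' kj).
by rewrite (tau_homo' jk) orbT.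
Qed.

(* A function of time evaluated at the clamped times max a (min s b) telescopes
   over the grid. *)
Lemma clamp_telescope (M : R -> R) i :
  M (Num.min (b i) T) - M (Num.min (a i) T) =
  \sum_(j < size points) ((a i <= tau j) && (tau j.+1 <= b i))%R%:R *
     (M (tau j.+1) - M (tau j)).
Proof.
set a' := Num.min (a i) T; set b' := Num.min (b i) T.
have ab' : a' <= b' by rewrite /a' /b' le_min !ge_min ab lexx orbT.
pose cl u := Num.max a' (Num.min u b').
have pa : a' \in points.
  by rewrite mem_sort inE mem_cat; apply/orP; right; apply/orP; left; apply/mapP; exists i; rewrite ?mem_index_enum.
have pb : b' \in points.
  by rewrite mem_sort inE mem_cat; apply/orP; right; apply/orP; right; apply/mapP; exists i; rewrite ?mem_index_enum.
have a'0 : 0 <= a' by case/andP: (points_bound pa).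
have b'T : b' <= T by case/andP: (points_bound pb).
transitivity (\sum_(j < size points) (M (cl (tau j.+1)) - M (cl (tau j)))).
  rewrite -(big_mkord xpredT (fun j => M (cl (tau j.+1)) - M (cl (tau j)))) telescope_sumr//.
  rewrite tau_0 /tau nth_default// /cl.
  by rewrite (min_r b'T) (max_r ab') (min_l (le_trans a'0 ab')) (max_l a'0).
apply: eq_bigr => j _; have tS := tauS j; have /andP[_ tT] := tau_bound j.+1.
have /orP[taj|tja] := tau_point j pa; last first.
  have tj' : tau j <= a' by exact: le_trans tja.
  have -> : cl (tau j) = a' by rewrite /cl (min_l (le_trans tj' ab')) max_l.
  have -> : cl (tau j.+1) = a' by rewrite /cl (min_l (le_trans tja ab')) max_l.
  (* The cell lies to the left of [a']. If the condition on the right holds nevertheless, the cell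
     is degenerate and its increment vanishes. *)
  rewrite subrr; case: (boolP ((a i <= tau j) && _)) => [/andP[aj _]|_]; last by rewrite mul0r.
  have -> : tau j.+1 = tau j; last by rewrite subrr mulr0.
  by apply/eqP; rewrite eq_le tS andbT (le_trans tja)// /a' ge_min aj.
have [tjT|tjT] := eqVneq (tau j) (tau j.+1); first by rewrite tjT !subrr mulr0.
have tjlt : tau j < tau j.+1 by rewrite lt_neqAle tjT.
have aj : a i <= tau j.
  move: taj; rewrite /a' ge_min => /orP[//|Tj].
  by move: (lt_le_trans tjlt tT); rewrite ltNge Tj.
have -> : cl (tau j) = Num.min (tau j) b'.
  by rewrite /cl max_r// le_min taj ab'.
have -> : cl (tau j.+1) = Num.min (tau j.+1) b'.
  by rewrite /cl max_r// le_min ab' (le_trans taj).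
have /orP[tbj|tjb] := tau_point j pb; last first.
  rewrite (min_l tjb) (min_l (le_trans tS tjb)) aj.
  by move: tjb; rewrite /b' le_min => /andP[-> _]; rewrite mul1r.
rewrite (min_r tbj) (min_r (le_trans tbj tS)) subrr aj/=.
case: leP => [tjb|]; last by rewrite mul0r.
have : tau j.+1 <= b' by rewrite /b' le_min tjb.
by move=> /le_trans/(_ tbj); rewrite leNgt tjlt.
Qed.

Let zeta j w := \sum_i c i w * ((a i <= tau j) && (tau j.+1 <= b i))%R%:R.

Lemma fin_integral_grid (M : R -> Omega -> R) w : fin_integral M T w =
  \sum_(j < size points) zeta j w * (M (tau j.+1) w - M (tau j) w).
Proof.
rewrite /fin_integral; under eq_bigr do rewrite (clamp_telescope (M^~ w)) mulr_sumr.
rewrite exchange_big/=; apply: eq_bigr => j _; rewrite /zeta mulr_suml.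
by apply: eq_bigr => i _; rewrite mulrA.
Qed.

Lemma fin_value_grid s w : s <= T ->
  fin_value s w = \sum_(j < size points) zeta j w * \1_(`]tau j, tau j.+1]%classic) s.
Proof.
(* The value at [s] is the integral against the unit jump at time [s], so the decomposition of
   integrals over the grid applies to values as well. *)
move=> sT; transitivity (fin_integral (fun t _ => (s <= t)%R%:R) T w).
  apply: eq_bigr => i _; congr (_ * _); rewrite indic_ocE !le_min sT !andbT ltNge.
  by case: leP => //= sa; rewrite ?subrr ?subr0// (le_trans sa (ab i)) subrr.
rewrite fin_integral_grid; apply: eq_bigr => j _; congr (_ * _).
rewrite indic_ocE; have [s1|s1] := leP s (tau j).
  by rewrite (le_trans s1 (tauS j)) subrr.
by rewrite subr0.
Qed.

Lemma energy_grid w : energy T (fin_value ^~ w) =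
  \sum_(j < size points) zeta j w ^+ 2 * (tau j.+1 - tau j).
Proof.
pose g (j : nat) (s : R) := zeta j w ^+ 2 * \1_(`]tau j, tau j.+1]%classic) s.
have mg j : bounded_measurable (g j) by apply: bounded_measurableZ; exact: indic_itv_bm.
transitivity (\int[mu]_(s in `[0, T]) \sum_(j < size points) g j s).
  apply: eq_Rintegral => s; rewrite inE/= in_itv/= => /andP[_ sT].
  rewrite fin_value_grid// expr2 mulr_suml; apply: eq_bigr => j _.
  rewrite mulr_sumr (bigD1 j)//= big1 ?addr0 => [|i ij].
    by rewrite /g !indic_ocE; case: (_ && _); rewrite ?mulr1 ?mulr0// -expr2.
  rewrite !indic_ocE.
  have [/andP[s1 s2]|] := boolP (tau j < s <= tau j.+1); last by rewrite mulr0 mul0r.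
  have [/andP[s3 s4]|] := boolP (tau i < s <= tau i.+1); last by rewrite !mulr0.
  exfalso; move/negP: ij; apply; rewrite -val_eqE/= eqn_leq.
  apply/andP; split; rewrite leqNgt; apply/negP => /tau_homo' h.
    by move: (lt_le_trans s3 s2); rewrite ltNge h.
  by move: (lt_le_trans s1 s4); rewrite ltNge h.
have sumg n : bounded_measurable (fun u => \sum_(j < n) g j u) /\
    \int[mu]_(u in `[0, T]) (\sum_(j < n) g j u) = \sum_(j < n) \int[mu]_(u in `[0, T]) g j u.
  elim: n => [|n [IH1 IH2]].
    split; first by under eq_fun do rewrite big_ord0; exact: bounded_measurable_cst.
    rewrite big_ord0; under eq_Rintegral do rewrite big_ord0.
    by rewrite Rintegral_cst// mul0r.
  split; first by under eq_fun do rewrite big_ord_recr; exact: bounded_measurableD.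
  rewrite big_ord_recr; under eq_Rintegral do rewrite big_ord_recr.
  by rewrite RintegralD ?IH2//; exact: bounded_measurable_integrable.
rewrite (sumg _).2; apply: eq_bigr => j _; rewrite RintegralZl//; last first.
  exact: (bounded_measurable_integrable _ (indic_itv_bm _ _)).
have /andP[tj0 _] := tau_bound j; have /andP[_ tjT] := tau_bound j.+1.
by rewrite Rintegral_indic_oc// tauS.
Qed.

(** The intervals of a simple process may overlap and come in any order. On the common refinement
    its coefficients become the sums [zeta], known at the left ends of the cells, and the discrete
    inequality applies. *)
Lemma lenglart (e del : R) : 0 < e -> 0 < del ->
  pr P [set w | e <= `|fin_integral W T w|] <=
  pr P [set w | del <= energy T (fin_value ^~ w)] + v * del / e ^+ 2.
Proof.
move=> e0 del0.
have t0 : 0 <= tau 0 by rewrite tau_0.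
have Fz j : Fm F (tau j) (zeta j).
  apply: Fm_sum => i; have [aj|] := leP (a i) (tau j).
    apply: (@FmM _ _ _ F (tau j) (c i) (cst _)); last exact: Fm_cst.
    by apply: (Fm_mono usualF (a0 i) aj); exact: Fc.
  by move=> _ /=; under eq_fun do rewrite mulr0; exact: Fm_cst.
have := @grid_lenglart _ _ _ P F usualF W v orthW tau t0 tauS zeta (size points) e del e0 del0 Fz.
under eq_set do rewrite /grid_integral -fin_integral_grid.
by under [X in _ <= pr P X + _]eq_set do rewrite -energy_grid.
Qed.

End lenglart.
End fin.
End simple.

(** * Convergence to zero in probability *)

Section in_probability.
Context {R : realType} {d : measure_display} {Omega : measurableType d}.
Variables (P : probability Omega R).
Hypothesis completeP : measure_is_complete P.

Lemma ae_cvg_measurable (h : nat -> Omega -> R) (f : Omega -> R) :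
  (forall n, measurable_fun setT (h n)) ->
  {ae P, forall w, h n w @[n --> \oo] --> f w} -> measurable_fun setT f.
Proof.
move=> mh hf; have hf' := hf; move: hf' => [N [mN N0 hN]].
apply: (@ae_eq_measurable _ _ _ P completeP _ (fun w => \1_(~` N) w * f w)).
  apply: (@measurable_fun_cvg _ _ _ _ (fun n w => \1_(~` N) w * h n w)).
    by move=> n; apply: measurable_funM => //; apply: measurable_indic; exact: measurableC.
  move=> w _; rewrite indicE; have [wN|wN] := pselect (N w).
    rewrite memNset//= mul0r; apply: cvg_near_cst; apply: nearW => n.
    by rewrite mul0r.
  have hw : h n w @[n --> \oo] --> f w by apply: contrapT => nh; apply: wN; exact: hN.
  rewrite mem_set//= mul1r.
  rewrite (_ : (fun n => _) = h^~ w)//.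
  by apply/funext => n; rewrite mul1r.
exists N; split=> // w /= nfw; apply: contrapT => Nw; apply: nfw.
by rewrite indicE mem_set//= mul1r.
Qed.

Definition cvgP0 (h : nat -> Omega -> R) :=
  (forall n, measurable_fun setT (h n)) /\
  forall e del : R, 0 < e -> 0 < del -> exists N, forall n, (N <= n)%N ->
    pr P [set w | e <= `|h n w|] < del.

Lemma cvgP0_ae (h : nat -> Omega -> R) : (forall n, measurable_fun setT (h n)) ->
  {ae P, forall w, h n w @[n --> \oo] --> (0 : R)} -> cvgP0 h.
Proof.
move=> mh h0; split=> // e del e0 del0.
have mA n : measurable [set w | e <= `|h n w|] by exact: measurable_norm_ge.
have : expect P (\1_[set w | e <= `|h n w|]) @[n --> \oo] --> expect P (cst 0).
  apply: (@expect_dct _ _ _ P _ _ (cst 1)) => //.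
  - apply: filterS h0 => w /seq_limP /(_ e e0)[N NP].
    apply: cvg_near_cst; exists N => // n /= Nn; rewrite indicE memNset//=.
    by apply/negP; rewrite -ltNge; have := NP n Nn; rewrite subr0.
  - exact: L1_cst.
  - by move=> n w; have /andP[i0 i1] := indic_01 (R := R) [set w | e <= `|h n w|] w; rewrite ger0_norm.
rewrite expect_cst => /seq_limP /(_ del del0)[N NP]; exists N => n Nn.
by have := NP n Nn; rewrite subr0 pr_expect// ger0_norm// pr_ge0.
Qed.

Lemma cvgP0_le (h k : nat -> Omega -> R) : cvgP0 k -> (forall n, measurable_fun setT (h n)) ->
  (forall n w, `|h n w| <= `|k n w|) -> cvgP0 h.
Proof.
move=> [mk kP] mh hk; split=> // e del e0 del0; have [N NP] := kP e del e0 del0.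
exists N => n Nn; apply: le_lt_trans (NP n Nn); apply: le_pr; try exact: measurable_norm_ge.
by move=> w /= /le_trans; apply.
Qed.

Lemma cvgP0D (h k : nat -> Omega -> R) : cvgP0 h -> cvgP0 k -> cvgP0 (fun n w => h n w + k n w).
Proof.
move=> [mh hP] [mk kP]; split=> [n|e del e0 del0]; first exact: measurable_funD.
have e2 : 0 < e / 2 by rewrite divr_gt0.
have del2 : 0 < del / 2 by rewrite divr_gt0.
have [N NP] := hP _ _ e2 del2; have [M MP] := kP _ _ e2 del2.
exists (maxn N M) => n; rewrite geq_max => /andP[Nn Mn].
apply: (@le_lt_trans _ _ (pr P ([set w | e / 2 <= `|h n w|] `|` [set w | e / 2 <= `|k n w|]))).
  apply: le_pr.
  - by apply: measurable_norm_ge; exact: measurable_funD.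
  - by apply: measurableU; exact: measurable_norm_ge.
  - move=> w /= ew; have [|] := leP (e / 2) `|h n w|; [by left|right].
    by have := ler_normD (h n w) (k n w); lra.
apply: le_lt_trans (prU_le _ _ _) _; try exact: measurable_norm_ge.
by have := NP n Nn; have := MP n Mn; lra.
Qed.

Lemma cvgP0_cst0 : cvgP0 (fun _ _ => 0).
Proof. by apply: cvgP0_ae => //; apply: aeW => w; exact: cvg_cst. Qed.

Lemma cvgP0_sum n (h : 'I_n -> nat -> Omega -> R) : (forall i, cvgP0 (h i)) ->
  cvgP0 (fun p w => \sum_i h i p w).
Proof.
elim: n h => [|n IH] h hP.
  by under eq_fun do under eq_fun do rewrite big_ord0; exact: cvgP0_cst0.
under eq_fun do under eq_fun do rewrite big_ord_recr/=.
by apply: cvgP0D => //; exact: IH.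
Qed.

Lemma cvgP0_const (f : Omega -> R) : cvgP0 (fun=> f) -> {ae P, forall w, f w = 0}.
Proof.
move=> [mf fP]; have {}mf := mf 0%N.
have B0 n : P [set w | n.+1%:R^-1 <= `|f w|] = 0%E.
  have mB : measurable [set w | n.+1%:R^-1 <= `|f w|] by exact: measurable_norm_ge.
  rewrite (prE P mB); congr EFin; apply/eqP; rewrite eq_le pr_ge0 andbT.
  apply/ler_addgt0Pr => e e0; rewrite add0r.
  by have [N /(_ N (leqnn _))/ltW] := fP n.+1%:R^-1 e ltac:(by rewrite invr_gt0) e0.
exists (\bigcup_n [set w | n.+1%:R^-1 <= `|f w|]); split.
- by apply: bigcupT_measurable => n; exact: measurable_norm_ge.
- apply: (measure_negligible (mu := P)).
    by apply: bigcupT_measurable => n; exact: measurable_norm_ge.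
  apply: negligible_bigcup => n; apply/negligibleP; last exact: B0.
  exact: measurable_norm_ge.
- move=> w /= /eqP fw; have fw0 : 0 < `|f w| by rewrite normr_gt0.
  by have [n /ltW nP] := inv_lt_eps fw0; exists n.
Qed.

Lemma cvg0_in_probabilityP (Z : nat -> Omega -> \bar R) (h : nat -> Omega -> R) :
  (forall n, measurable_fun setT (h n)) ->
  (forall n, {ae P, forall w, Z n w = (h n w)%:E}) ->
  cvg0_in_probability P Z <-> cvgP0 h.
Proof.
move=> mh Zh.
have PE n (e : R) : P [set w | e%:E <= `|Z n w|]%E = (pr P [set w | e <= `|h n w|])%:E.
  have mB : measurable [set w | e <= `|h n w|] by exact: measurable_norm_ge.
  have [mA <-] := @ae_eq_set _ _ _ P completeP [set w | (e%:E <= `|Z n w|)%E] _ mB ltac:(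
    apply: filterS (Zh n) => w /= ->; by rewrite lee_fin).
  by rewrite prE.
split=> [ZP|[_ hP] e e0].
  split=> // e del e0 del0; have := ZP e e0.
  under eq_cvg do rewrite PE; move=> /fine_cvg /seq_limP /(_ del del0)[N NP].
  by exists N => n Nn; have := NP n Nn; rewrite subr0 ger0_norm// pr_ge0.
under eq_cvg do rewrite PE; apply: cvg_EFin; first exact: nearW.
apply/seq_limP => del del0; have [N NP] := hP e del e0 del0.
by exists N => n Nn; rewrite /= subr0 ger0_norm ?pr_ge0// NP.
Qed.

End in_probability.

(** * Step functions with values taken at left ends *)

Section step.
Context {R : realType}.
Implicit Types (f g : R -> R).

Lemma grid_cell (sigma : nat -> R) n s : sigma 0 < s -> s <= sigma n ->
  exists2 j, (j < n)%N & sigma j < s <= sigma j.+1.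
Proof.
move=> s0; elim: n => [|n IH] sn; first by move: (lt_le_trans s0 sn); rewrite ltxx.
have [/IH[j jn jP]|ns] := leP s (sigma n); last by exists n => //; rewrite ns sn.
by exists j => //; exact: ltnW.
Qed.

Lemma grid_step (sigma : nat -> R) (x : nat -> R) n j s :
  (forall i, sigma i <= sigma i.+1) -> (j < n)%N -> sigma j < s <= sigma j.+1 ->
  \sum_(i < n) x i * \1_(`]sigma i, sigma i.+1]%classic) s = x j.
Proof.
move=> /nondecreasing_seqP hs jn /andP[s1 s2].
rewrite (bigD1 (Ordinal jn))//= big1 ?addr0 => [|i ij].
  by rewrite indic_ocE s1 s2 mulr1.
rewrite indic_ocE; case: (boolP (_ && _)) => [/andP[s3 s4]|]; last by rewrite mulr0.
exfalso; move/negP: ij; apply; rewrite -val_eqE/= eqn_leq.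
apply/andP; split; rewrite leqNgt; apply/negP => /hs h.
  by move: (lt_le_trans s3 s2); rewrite ltNge h.
by move: (lt_le_trans s1 s4); rewrite ltNge h.
Qed.

Definition uniform (T : R) (n : nat) (i : nat) : R := T * i%:R / n.+1%:R.

Lemma uniformS T n i : 0 <= T -> uniform T n i <= uniform T n i.+1.
Proof. by move=> T0; rewrite /uniform ler_wpM2r// ler_wpM2l// ler_nat. Qed.

Lemma uniform0 T n : uniform T n 0 = 0. Proof. by rewrite /uniform mulr0 mul0r. Qed.

Lemma uniform_last T n : uniform T n n.+1 = T.
Proof. by rewrite /uniform mulfK. Qed.

Lemma uniform_ge0 T n i : 0 <= T -> 0 <= uniform T n i.
Proof. by move=> T0; rewrite /uniform divr_ge0// mulr_ge0. Qed.

Lemma uniform_mesh T n i : uniform T n i.+1 - uniform T n i = T / n.+1%:R.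
Proof. by rewrite /uniform -mulrBl -mulrBr -natr1 addrAC subrr add0r mulr1. Qed.

Lemma uniform_le T n i : 0 <= T -> (i <= n.+1)%N -> uniform T n i <= T.
Proof.
move=> T0 iN; rewrite -[leRHS](uniform_last T n) /uniform ler_wpM2r// ler_wpM2l//.
by rewrite ler_nat.
Qed.

(** The cells are open on the left, so the time at which [f] is evaluated lies strictly before [s]:
    refining the grid leads to the left limit at [s] and not to the value there. *)
Definition step (T : R) (n : nat) f (s : R) : R :=
  \sum_(i < n.+1) f (uniform T n i) * \1_(`]uniform T n i, uniform T n i.+1]%classic) s.

Lemma step_cell T n f s : 0 < s -> s <= T ->
  exists u, [/\ 0 <= u, u < s, s - T / n.+1%:R <= u & step T n f s = f u].
Proof.
move=> s0 sT; have T0 : 0 <= T by rewrite ltW// (lt_le_trans s0).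
have [||j jn jP] := @grid_cell (uniform T n) n.+1 s.
- by rewrite uniform0.
- by rewrite uniform_last.
exists (uniform T n j); split.
- exact: uniform_ge0.
- by case/andP: jP.
- case/andP: jP => _; rewrite -(subrK (uniform T n j) (uniform T n j.+1)).
  by rewrite uniform_mesh lerBlDl.
- rewrite /step (grid_step (fun i => f (uniform T n i)) _ jn jP)// => i.
  exact: uniformS.
Qed.

Lemma step_bm T n f : bounded_measurable (step T n f).
Proof.
rewrite /step; apply: bounded_measurable_sum => i.
by apply: bounded_measurableZ; exact: indic_itv_bm.
Qed.

Lemma step_cvg T f g s : 0 < s -> s <= T -> f u @[u --> s^'-] --> g s ->
  step T n f s @[n --> \oo] --> g s.
Proof.
move=> s0 sT /left_limP fg; apply/seq_limP => e /fg[del del0 delP].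
have T0 : 0 < T by exact: lt_le_trans sT.
have [|N NP] := @inv_lt_eps _ (del / T); first by rewrite divr_gt0.
exists N => n Nn; have [u [u0 us su ->]] := step_cell n f s0 sT.
apply: delP => //; apply: lt_le_trans su; rewrite ltrD2l ltrN2.
rewrite mulrC -ltr_pdivlMr// (le_lt_trans _ NP)//.
by rewrite lef_pV2 ?posrE// ler_nat ltnS.
Qed.

Definition left_limits f g := forall s, 0 < s -> f u @[u --> s^'-] --> g s.

Lemma left_limits_bm f g : cadlag f -> left_limits f g -> bounded_measurable g.
Proof.
move=> cf fg T; split.
  apply/measurable_fun_itv_obnd_cbndP.
  apply: (@measurable_fun_cvg _ _ _ _ (fun n => step T n f)).
    move=> n; have [+ _] := step_bm T n f T; apply: measurable_funS => //.
    by move=> s /=; rewrite !in_itv/= => /andP[/ltW -> ->].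
  move=> s /=; rewrite in_itv/= => /andP[s0 sT].
  by apply: step_cvg => //; exact: fg.
have [B B0 BP] := cadlag_bounded T cf.
exists (Num.max B `|g 0|) => s; rewrite le_eqVlt => /predU1P[<- _|s0 sT].
  by rewrite le_max lexx orbT.
rewrite le_max; apply/orP; left.
have := step_cvg s0 sT (fg s s0) => /cvg_norm /ler_cvg_to; apply; first exact: cvg_cst.
apply: nearW => n; have [u [u0 us _ ->]] := step_cell n f s0 sT.
by apply: BP => //; exact: le_trans (ltW us) sT.
Qed.

Lemma step_energy T f g : 0 <= T -> cadlag f -> left_limits f g ->
  energy T (fun s => step T n f s - g s) @[n --> \oo] --> (0 : R).
Proof.
move=> T0 cf fg; have [B B0 BP] := cadlag_bounded T cf.
apply: (@energy_cvg0 _ T (fun n => step T n f) g B).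
- by move=> n; exact: step_bm.
- exact: left_limits_bm cf fg.
- move=> n s s0 sT; have [u [u0 us _ ->]] := step_cell n f s0 sT.
  by apply: BP => //; exact: le_trans (ltW us) sT.
- by move=> s s0 sT; apply: step_cvg => //; exact: fg.
Qed.

(** The energy is a squared norm. The inequality with a free parameter [r] avoids square roots: a
    small [r] makes the first term small, after which the second one tends to zero. *)
Lemma energy_continuous T (phi : nat -> R -> R) g h :
  (forall n, bounded_measurable (phi n)) -> bounded_measurable g -> bounded_measurable h ->
  energy T (fun s => phi n s - g s) @[n --> \oo] --> (0 : R) ->
  energy T (fun s => h s - phi n s) @[n --> \oo] --> energy T (fun s => h s - g s).
Proof.
move=> mphi mg mh phig.
have mB k l : bounded_measurable k -> bounded_measurable l ->
    bounded_measurable (fun s => k s - l s).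
  by move=> mk ml; apply: bounded_measurableD => //; exact: bounded_measurableN.
have I k : bounded_measurable k ->
    (@lebesgue_measure R).-integrable `[0, T] (EFin \o k).
  by move=> mk; exact: bounded_measurable_integrable.
pose E0 := energy T (fun s => h s - g s).
have E00 : 0 <= E0 by exact: energy_ge0.
(* a^2 - b^2 with a = h - phi, b = h - g: |a^2 - b^2| <= r b^2 + (1 + 1/r) (a - b)^2 *)
have key n (r : R) : 0 < r ->
    `|energy T (fun s => h s - phi n s) - E0| <= r * E0 + (1 + r^-1) * energy T (fun s => phi n s - g s).
  move=> r0; have mq := bounded_measurable_sqr.
  rewrite /E0 /energy -RintegralB//; [|exact/I/mq/mB|exact/I/mq/mB].
  rewrite -!RintegralZl//; [|exact/I/mq/mB|exact/I/mq/mB].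
  rewrite -RintegralD//; [|exact/I/bounded_measurableZ/mq/mB|exact/I/bounded_measurableZ/mq/mB].
  apply: le_trans (le_normr_Rintegral _ _) _ => //; first by apply/I/mB; apply/mq/mB.
  apply: le_Rintegral => //.
  - by apply/I/bounded_measurable_norm/mB; apply/mq/mB.
  - by apply/I/bounded_measurableD; apply/bounded_measurableZ/mq/mB.
  move=> s _; set a := h s - phi n s; set b := h s - g s.
  have -> : phi n s - g s = b - a by rewrite /a /b; ring.
  have r1 : 0 <= (r * b - (b - a)) ^+ 2 / r by rewrite divr_ge0 ?sqr_ge0// ltW.
  have r2 : 0 <= (r * b + (b - a)) ^+ 2 / r by rewrite divr_ge0 ?sqr_ge0// ltW.
  have e1 : (r * b - (b - a)) ^+ 2 / r = r * b ^+ 2 - 2 * b * (b - a) + r^-1 * (b - a) ^+ 2.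
    by field; rewrite gt_eqF.
  have e2 : (r * b + (b - a)) ^+ 2 / r = r * b ^+ 2 + 2 * b * (b - a) + r^-1 * (b - a) ^+ 2.
    by field; rewrite gt_eqF.
  rewrite e1 in r1; rewrite e2 in r2; have c0 := sqr_ge0 (b - a).
  have -> : a ^+ 2 - b ^+ 2 = (b - a) ^+ 2 - 2 * b * (b - a) by ring.
  rewrite ler_norml mulrDl mul1r.
  by move: (r * b ^+ 2) (2 * b * (b - a)) (r^-1 * (b - a) ^+ 2) ((b - a) ^+ 2) r1 r2 c0 => x y z u *; apply/andP; split; lra.
apply/seq_limP => e e0; pose r := e / 2 / (E0 + 1).
have r0 : 0 < r by rewrite !divr_gt0// ltr_wpDl.
have c0 : 0 < 1 + r^-1 by rewrite addr_gt0// invr_gt0.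
have [|N NP] := (seq_limP _ _).1 phig (e / 2 / (1 + r^-1)); first by rewrite !divr_gt0.
exists N => n Nn; apply: le_lt_trans (key n r r0) _.
have h1 : r * E0 <= e / 2.
  rewrite (@le_trans _ _ (r * (E0 + 1)))//; first by rewrite ler_wpM2l ?(ltW r0)// lerDl.
  by rewrite /r divfK// gt_eqF// ltr_wpDl.
have h2 : (1 + r^-1) * energy T (fun s => phi n s - g s) < e / 2.
  have := NP n Nn; rewrite subr0 ger0_norm ?energy_ge0// => h2.
  by rewrite mulrC -ltr_pdivlMr.
by lra.
Qed.

End step.

#[local] Arguments simple_left {R d Omega} _ _.
#[local] Arguments simple_right {R d Omega} _ _.

(** * Riemann sums for stochastic integrals of left limits *)

#[local] Arguments simple_coef {R d Omega} _ _ _.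

Section approximation.
Context {R : realType} {d : measure_display} {Omega : measurableType d}.
Variables (P : probability Omega R) (F : R -> set (set Omega)).
Hypothesis usualF : usual_conditions P F.
Let completeP := complete_P usualF.
Local Notation simple := (@simple R d Omega).

(** The integrand [Y] comes with its adapted source [y], whose values at grid points are the
    coefficients of the Riemann sums; [Y] itself is tied to [y] only almost surely. *)
Definition left_limit_process (y Y : R -> Omega -> R) :=
  (forall s, 0 <= s -> Fm F s (y s)) /\
  {ae P, forall w, cadlag (y ^~ w) /\ left_limits (y ^~ w) (Y ^~ w)}.

Definition step_process (y : R -> Omega -> R) (T : R) (n : nat) (s : R) (w : Omega) : R :=
  step T n (y ^~ w) s.

Lemma simple_value_bm (Z : simple) w : bounded_measurable (simple_value Z ^~ w).
Proof. exact: (fin_value_bm (simple_left Z) (simple_right Z) (simple_coef Z) w). Qed.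

Lemma simple_coef_Fm (Z : simple) i : simple_predictable F Z ->
  Fm F (simple_left Z i) (simple_coef Z i).
Proof.
move=> /(_ i)[l0 lr _ cF]; apply/(FmP usualF _ l0) => B.
by rewrite -borel_R; exact: cF.
Qed.

(* The energy of the difference of two step functions is a polynomial in their
   coefficients. *)
Lemma energy_step_measurable (I : finType) (a b : I -> R) (c : I -> Omega -> R)
    (y : R -> Omega -> R) T n : 0 <= T ->
  (forall i, measurable_fun setT (c i)) -> (forall s, 0 <= s -> measurable_fun setT (y s)) ->
  measurable_fun setT (fun w => energy T (fun s => fin_value a b c s w - step_process y T n s w)).
Proof.
move=> T0 mc my.
pose a' (x : I + 'I_n.+1) := match x with inl i => a i | inr j => uniform T n j end.
pose b' (x : I + 'I_n.+1) := match x with inl i => b i | inr j => uniform T n j.+1 end.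
pose c' (x : I + 'I_n.+1) w :=
  match x with inl i => c i w | inr j => - y (uniform T n j) w end.
have mc' x : measurable_fun setT (c' x).
  by case: x => [i|j]; [exact: mc|apply: measurable_funN; apply: my; exact: uniform_ge0].
have := energy_fin_value_measurable a' b' T mc'.
rewrite (_ : (fun w => energy T (fin_value a' b' c' ^~ w)) =
  (fun w => energy T (fun s => fin_value a b c s w - step_process y T n s w)))//.
apply/funext => w; congr energy; apply/funext => s.
rewrite /fin_value big_sumType/= /step_process /step -sumrN; congr (_ + _).
by apply: eq_bigr => j _; rewrite mulNr.
Qed.

Section left_limit.
Variables (y Y : R -> Omega -> R).
Hypothesis llY : left_limit_process y Y.

Lemma ll_ae : {ae P, forall w, [/\ cadlag (y ^~ w), left_limits (y ^~ w) (Y ^~ w) &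
  bounded_measurable (Y ^~ w)]}.
Proof.
have [_] := llY; apply: filterS => w [cy ly]; split=> //.
exact: left_limits_bm cy ly.
Qed.

Lemma ll_measurable s : 0 <= s -> measurable_fun setT (y s).
Proof. by move=> s0; apply: (Fm_measurable usualF s0); have [+ _] := llY; exact. Qed.

Lemma energy_measurable (I : finType) (a b : I -> R) (c : I -> Omega -> R) T : 0 <= T ->
  (forall i, measurable_fun setT (c i)) ->
  measurable_fun setT (fun w => energy T (fun s => fin_value a b c s w - Y s w)).
Proof.
move=> T0 mc; apply: (ae_cvg_measurable completeP
  (h := fun n w => energy T (fun s => fin_value a b c s w - step_process y T n s w))).
  by move=> n; apply: energy_step_measurable => // s s0; exact: ll_measurable.
apply: filterS ll_ae => w [cy ly mY]; apply: energy_continuous => //.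
- by move=> n; exact: step_bm.
- exact: fin_value_bm.
- exact: step_energy.
Qed.

Lemma energy_step_ll_measurable T n : 0 <= T ->
  measurable_fun setT (fun w => energy T (fun s => step_process y T n s w - Y s w)).
Proof.
move=> T0; have := @energy_measurable _ (fun i : 'I_n.+1 => uniform T n i)
  (fun i : 'I_n.+1 => uniform T n i.+1) (fun i : 'I_n.+1 => y (uniform T n i)) T T0.
by apply=> i; apply: ll_measurable; exact: uniform_ge0.
Qed.

Lemma step_process_cvgP0 T : 0 <= T ->
  cvgP0 P (fun n w => energy T (fun s => step_process y T n s w - Y s w)).
Proof.
move=> T0; apply: cvgP0_ae; first by move=> n; exact: energy_step_ll_measurable.
by apply: filterS ll_ae => w [cy ly mY]; exact: step_energy.
Qed.

End left_limit.

(** The outer maximum keeps the right end from falling before the left one when the two intervals do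
    not meet. *)
Lemma restricted_indic (a b s s' u : R) :
  (\1_(`]Num.max a s, Num.max (Num.max a s) (Num.min b s')]%classic) u : R) =
  \1_(`]a, b]%classic) u * \1_(`]s, s']%classic) u.
Proof.
rewrite !indic_ocE !le_max le_min gt_max ltNge [s < u]ltNge.
by case: (u <= a); case: (u <= s); case: (u <= b); case: (u <= s');
  rewrite ?orbT ?orbF ?andbT ?andbF/= ?mulr0 ?mul0r ?mulr1.
Qed.

Lemma restricted_increment (M : R -> R) (a b s s' T : R) : a <= b -> s <= s' -> s' <= T ->
  M (Num.min (Num.max (Num.max a s) (Num.min b s')) T) - M (Num.min (Num.max a s) T) =
  (M (Num.min b s') - M (Num.min a s')) - (M (Num.min b s) - M (Num.min a s)).
Proof.
move=> ab ss sT; have [s'a|as'] := leP s' a.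
  have sa := le_trans ss s'a; have s'b := le_trans s'a ab; have sb := le_trans sa ab.
  by rewrite (max_l sa) (min_r s'b) (max_l s'a) subrr (min_r sb) (min_r sa) !subrr.
have [bs|sb] := leP b s.
  have as_ := le_trans ab bs; have bs' := le_trans bs ss.
  by rewrite (max_r as_) (min_l bs') (max_l bs) subrr (min_l as_) subrr.
have le1 : Num.max a s <= Num.min b s' by rewrite ge_max !le_min ab (ltW as') (ltW sb) ss.
have le2 : Num.min b s' <= T by rewrite ge_min sT orbT.
rewrite (max_r le1) (min_l le2) (min_l (le_trans le1 le2)).
have [as_|sa] := leP a s; rewrite ?subrr ?subr0 //; first by ring.
Qed.

Variables (W : R -> Omega -> R) (v : R).
Hypothesis orthW : orthogonal_increments P F W v.

Let FW t : 0 <= t -> Fm F t (W t). Proof. by case: orthW => _ FW _ _ _; exact: FW. Qed.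
Let mW t : 0 <= t -> measurable_fun setT (W t).
Proof. by move=> t0; apply: (Fm_measurable usualF t0); exact: FW. Qed.

Variables (y Y I : R -> Omega -> R).
Hypothesis llY : left_limit_process y Y.
Hypothesis intI : stochastic_integral P F W Y I.

Lemma integral_Fm t : 0 <= t -> Fm F t (I t).
Proof. by case: intI => -[/(adapted_FmP usualF) aI _] _; exact: aI. Qed.

Lemma simple_integral_measurable (Z : simple) t : simple_predictable F Z -> 0 <= t ->
  measurable_fun setT (simple_integral Z W t).
Proof.
move=> pZ t0; apply: measurable_sum => i; have [l0 lr _ _] := pZ i.
apply: measurable_funM; first exact: (Fm_measurable usualF l0 (simple_coef_Fm pZ)).
by apply: measurable_funB; apply: mW; rewrite le_min t0 ?l0 ?(le_trans l0 lr).
Qed.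

Lemma integral_approximants : exists Z : nat -> simple,
  [/\ forall n, simple_predictable F (Z n),
      forall t, 0 <= t -> cvgP0 P (fun n w => energy t (fun s => simple_value (Z n) s w - Y s w)) &
      forall t, 0 <= t -> cvgP0 P (fun n w => simple_integral (Z n) W t w - I t w)].
Proof.
have [_ [Z [pZ ZP]]] := intI; exists Z; split=> // t t0; have [Z1 Z2] := ZP t t0.
- apply/(cvg0_in_probabilityP completeP _ _).1: Z1.
  + move=> n; apply: (energy_measurable llY) => // i.
    have [l0 _ _ _] := pZ n i.
    exact: (Fm_measurable usualF l0 (simple_coef_Fm (pZ n))).
  + move=> n; apply: filterS (ll_ae llY) => w [_ _ mY].
    apply: energyE; apply: bounded_measurableD; first exact: simple_value_bm.
    exact: bounded_measurableN.
- apply/(cvg0_in_probabilityP completeP _ _).1: Z2 => n; last exact: aeW.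
  apply: measurable_funB; first exact: simple_integral_measurable.
  exact: (Fm_measurable usualF t0 (integral_Fm t0)).
Qed.

(* Both integrands are restricted to the events [A i] on the cells of the grid. *)
Lemma grid_comparison (Z : simple) (T : R) (n : nat) (A : nat -> set Omega) (e del : R) :
  0 <= T -> 0 < e -> 0 < del -> simple_predictable F Z ->
  (forall i, F (uniform T n i) (A i)) ->
  pr P [set w | e <= `|\sum_(i < n.+1) \1_(A i) w *
     (y (uniform T n i) w * (W (uniform T n i.+1) w - W (uniform T n i) w) -
     (simple_integral Z W (uniform T n i.+1) w - simple_integral Z W (uniform T n i) w))|] <=
  pr P [set w | del / 4 <= energy T (fun s => step_process y T n s w - Y s w)] +
  pr P [set w | del / 4 <= energy T (fun s => simple_value Z s w - Y s w)] +
  v * del / e ^+ 2.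
Proof.
move=> T0 e0 del0 pZ FA; set N := simple_size Z.
pose sg := uniform T n.
have sg0 i : 0 <= sg i by exact: uniform_ge0.
have sgS i : sg i <= sg i.+1 by exact: uniformS.
(* The difference of the two integrals is a single simple integral, indexed by the cells and by the
   intervals of [Z] cut along the cells. A cut interval begins at the later of the two left ends,
   where both the event [A i] and the coefficient of [Z] are known. *)
pose K := ('I_n.+1 + 'I_n.+1 * 'I_N)%type.
pose a (x : K) := match x with inl i => sg i | inr q => Num.max (simple_left Z q.2) (sg q.1) end.
pose b (x : K) := match x with inl i => sg i.+1
  | inr q => Num.max (Num.max (simple_left Z q.2) (sg q.1)) (Num.min (simple_right Z q.2) (sg q.1.+1)) end.
pose c (x : K) w := match x with inl i => \1_(A i) w * y (sg i) w
  | inr q => - (\1_(A q.1) w * simple_coef Z q.2 w) end.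
have a0 x : 0 <= a x by case: x => [i|[i j]] //=; rewrite le_max sg0 orbT.
have ab x : a x <= b x by case: x => [i|[i j]] //=; rewrite le_max lexx.
have Fc x : Fm F (a x) (c x).
  have FAi i : Fm F (sg i) (\1_(A i)) by apply: (Fm_indic usualF).
  case: x => [i|[i j]] /=.
    by apply: FmM => //; have [+ _] := llY; exact.
  have [l0 _ _ _] := pZ j.
  rewrite (_ : c _ = fun w => (-1) * (\1_(A i) w * simple_coef Z j w)); last first.
    by apply/funext => w; rewrite /c mulN1r.
  apply: FmM; first exact: Fm_cst.
  apply: FmM.
    by apply: (Fm_mono usualF (sg0 i)); [rewrite le_max lexx orbT|exact: FAi].
  by apply: (Fm_mono usualF l0); [rewrite le_max lexx|exact: simple_coef_Fm].
have intE w : fin_integral a b c W T w = \sum_(i < n.+1) \1_(A i) w *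
     (y (sg i) w * (W (sg i.+1) w - W (sg i) w) -
     (simple_integral Z W (sg i.+1) w - simple_integral Z W (sg i) w)).
  rewrite /fin_integral big_sumType/= -(pair_bigA _ (fun i j => c (inr (i, j)) w *
    (W (Num.min (b (inr (i, j))) T) w - W (Num.min (a (inr (i, j))) T) w)))/=.
  rewrite -big_split/=; apply: eq_bigr => i _.
  have sgT : sg i.+1 <= T by exact: uniform_le.
  rewrite (min_l sgT) (min_l (le_trans (sgS i) sgT)) [RHS]mulrBr [in RHS]mulrA; congr (_ + _).
  rewrite /simple_integral -sumrB mulr_sumr -sumrN; apply: eq_bigr => j _.
  have [_ lr _ _] := pZ j.
  by rewrite (restricted_increment (W ^~ w) lr (sgS i) sgT); ring.
have valE w s : 0 < s -> s <= T -> `|fin_value a b c s w| <=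
    `|step_process y T n s w - simple_value Z s w|.
  move=> s0 sT; have [||j jn jP] := @grid_cell R sg n.+1 s.
  - by rewrite /sg uniform0.
  - by rewrite /sg uniform_last.
  have -> : fin_value a b c s w = \sum_(i < n.+1) (\1_(A i) w * (y (sg i) w - simple_value Z s w)) *
      \1_(`]sg i, sg i.+1]%classic) s.
    rewrite /fin_value big_sumType/= -(pair_bigA _ (fun i j => c (inr (i, j)) w *
      \1_(`]a (inr (i, j)), b (inr (i, j))]%classic) s))/=.
    rewrite -big_split/=; apply: eq_bigr => i _.
    rewrite mulrBr mulrBl; congr (_ + _).
    rewrite /simple_value !(mulr_sumr, mulr_suml) -sumrN; apply: eq_bigr => k _.
    by rewrite restricted_indic; ring.
  rewrite (grid_step (fun i => \1_(A i) w * (y (sg i) w - simple_value Z s w)) sgS jn jP).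
  rewrite /step_process /step (grid_step (fun i => y (sg i) w) sgS jn jP).
  rewrite normrM ler_piMl//; have /andP[i0 i1] := indic_01 (R := R) (A j) w.
  by rewrite ger0_norm.
have val0 w s : ~ (0 < s /\ s <= T) -> fin_value a b c s w = 0.
  move=> sT; rewrite /fin_value big1// => x _.
  rewrite indic_ocE; case: (boolP (_ && _)) => [/andP[s1 s2]|]; last by rewrite mulr0.
  exfalso; apply: sT; split; first exact: le_lt_trans (a0 x) s1.
  move: s1 s2; case: x => [i|[i j]] /=.
    by move=> _ /le_trans; apply; exact: uniform_le.
  move=> s1; rewrite le_max leNgt s1/= le_min => /andP[_ /le_trans]; apply.
  exact: uniform_le.
have {}valE w s : `|fin_value a b c s w| <= `|step_process y T n s w - Y s w| +
    `|simple_value Z s w - Y s w|.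
  have [[s0 sT]|sT] := pselect (0 < s /\ s <= T); last by rewrite val0// normr0 addr_ge0.
  apply: le_trans (valE w s s0 sT) _; rewrite (le_trans _ (ler_normB _ _))//.
  by rewrite opprB addrA subrK.
have mc x : measurable_fun setT (c x) by exact: (Fm_measurable usualF (a0 x) (Fc x)).
have mZ i : measurable_fun setT (simple_coef Z i).
  by have [l0 _ _ _] := pZ i; exact: (Fm_measurable usualF l0 (simple_coef_Fm pZ)).
have := lenglart usualF orthW a0 ab Fc T0 e0 del0.
under eq_set do rewrite intE; move=> /le_trans; apply; rewrite lerD2r.
have mE1 := energy_step_ll_measurable llY n T0.
have mE2 := energy_measurable llY (simple_left Z) (simple_right Z) T0 mZ.
apply: le_trans (prU_le _ (measurable_ge _ mE1) (measurable_ge _ mE2)).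
have [N0 [mN0 N00 goodN]] := ll_ae llY.
have mE3 : measurable [set w | del <= energy T (fin_value a b c ^~ w)].
  by apply: measurable_ge; exact: energy_fin_value_measurable.
have pN0 : pr P N0 = 0 by rewrite /pr N00.
set B := _ `|` _.
have mB : measurable B by apply: measurableU; exact: measurable_ge.
apply: (@le_trans _ _ (pr P (B `|` N0))); last first.
  by apply: le_trans (prU_le _ mB mN0) _; rewrite pN0 addr0.
apply: le_pr => //; first exact: measurableU.
move=> w /= delw; have [wN|wN] := pselect (N0 w); [by right|left].
have [cy ly mY] : [/\ cadlag (y ^~ w), left_limits (y ^~ w) (Y ^~ w) & bounded_measurable (Y ^~ w)].
  by apply: contrapT => ngood; apply: wN; exact: goodN.
(* If both energies were below [del / 4], the energy of the difference would be below [del]. *)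
have := @energy_le2 _ T (fin_value a b c ^~ w) (fun s => step_process y T n s w - Y s w)
   (fun s => simple_value Z s w - Y s w) (fin_value_bm _ _ _ _).
move=> /(_ (bounded_measurableD (step_bm _ _ _) (bounded_measurableN mY))).
move=> /(_ (bounded_measurableD (simple_value_bm _ _) (bounded_measurableN mY)) (valE w)) le4.
have [|] := leP (del / 4) (energy T (fun s => step_process y T n s w - Y s w)); first by left.
by move=> lt1; right => /=; rewrite leNgt; apply/negP => lt2; move: delw; lra.
Qed.

(** The approximant of the integral is chosen after the grid and the events, and [grid_comparison]
    removes it again. Hence [N] does not depend on the events [A], which later stop the sums. *)
Lemma integral_approximation (T e del : R) : 0 <= T -> 0 < e -> 0 < del ->
  exists N, forall n, (N <= n)%N -> forall A : nat -> set Omega,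
  (forall i, F (uniform T n i) (A i)) ->
  pr P [set w | e <= `|\sum_(i < n.+1) \1_(A i) w *
     (y (uniform T n i) w * (W (uniform T n i.+1) w - W (uniform T n i) w) -
     (I (uniform T n i.+1) w - I (uniform T n i) w))|] < del.
Proof.
move=> T0 e0 del0; have [Z [pZ Z1 Z2]] := integral_approximants.
have v0 : 0 <= v by case: orthW.
(* Chosen so that the Lenglart term [v * dl / (e / 2) ^+ 2] is at most [del / 4]; the three
   remaining probabilities also get [del / 4] each. *)
pose dl := del / 4 * (e / 2) ^+ 2 / (v + 1).
have v1 : 0 < v + 1 by rewrite ltr_wpDl.
have e20 : 0 < e / 2 by rewrite divr_gt0.
have dl0 : 0 < dl by rewrite !(mulr_gt0, divr_gt0, exprn_gt0, invr_gt0).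
have dl4 : 0 < dl / 4 by rewrite divr_gt0.
have del4 : 0 < del / 4 by rewrite divr_gt0.
have vdl : v * dl / (e / 2) ^+ 2 <= del / 4.
  rewrite (@le_trans _ _ ((v + 1) * dl / (e / 2) ^+ 2))//.
    by rewrite ler_wpM2r ?invr_ge0 ?exprn_ge0 ?(ltW e20)// ler_wpM2r ?(ltW dl0)// lerDl.
  rewrite /dl le_eqVlt; apply/orP; left; apply/eqP; field.
  by rewrite !gt_eqF.
have [_ /(_ _ _ dl4 del4)[N NP]] := step_process_cvgP0 llY T0.
exists N => n Nn A FA; pose sg := uniform T n.
have sg0 i : 0 <= sg i by exact: uniform_ge0.
have mA i : measurable_fun setT (\1_(A i) : Omega -> R).
  by apply: measurable_indic; exact: (F_measurable usualF (sg0 i) (FA i)).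
have my i : measurable_fun setT (y (sg i)) by exact: (ll_measurable llY).
have mI i : measurable_fun setT (I (sg i)).
  exact: (Fm_measurable usualF (sg0 i) (integral_Fm (sg0 i))).
have cI : cvgP0 P (fun p w => \sum_(i < n.+1) \1_(A i) w *
    ((simple_integral (Z p) W (sg i.+1) w - I (sg i.+1) w) -
     (simple_integral (Z p) W (sg i) w - I (sg i) w))).
  apply: cvgP0_sum => i.
  have c1 := Z2 _ (sg0 i.+1); have c2 := Z2 _ (sg0 i).
  have {}c2 : cvgP0 P (fun p w => - (simple_integral (Z p) W (sg i) w - I (sg i) w)).
    apply: (cvgP0_le c2) => [p|p w]; last by rewrite normrN.
    by apply: measurable_funN; case: c2.
  have c12 := cvgP0D c1 c2; apply: (cvgP0_le c12) => [p|p w].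
    by apply: measurable_funM => //; case: c12.
  rewrite normrM ler_piMl//; have /andP[i0 i1] := indic_01 (R := R) (A i) w.
  by rewrite ger0_norm.
have [_ /(_ _ _ e20 del4)[p1 p1P]] := cI.
have [_ /(_ _ _ dl4 del4)[p2 p2P]] := Z1 _ T0.
pose p := maxn p1 p2.
have {p1P} P1 := p1P p (leq_maxl _ _); have {p2P} P2 := p2P p (leq_maxr _ _).
have P3 := NP n Nn.
have absE (g : Omega -> R) : (forall w, 0 <= g w) -> forall r : R,
    [set w | r <= `|g w|] = [set w | r <= g w].
  by move=> g0 r; apply/seteqP; split => w /=; rewrite ger0_norm.
rewrite absE in P2; last by move=> w; exact: energy_ge0.
rewrite absE in P3; last by move=> w; exact: energy_ge0.
have P4 := grid_comparison T0 e20 dl0 (pZ p) FA.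
set B1 := [set w | e / 2 <= _] in P4; set B2 := [set w | e / 2 <= _] in P1.
have mB1 : measurable B1.
  apply: measurable_norm_ge; apply: measurable_sum => i; apply: measurable_funM => //.
  apply: measurable_funB; last by apply: measurable_funB; exact: simple_integral_measurable.
  by apply: measurable_funM => //; apply: measurable_funB; exact: mW.
have mB2 : measurable B2 by apply: measurable_norm_ge; case: cI.
apply: (@le_lt_trans _ _ (pr P (B1 `|` B2))).
  apply: le_pr; last first.
  - move=> w /=; set S1 := \sum_(i < n.+1) _ => eS.
    have [|lt1] := leP (e / 2) `|\sum_(i < n.+1) \1_(A i) w *
     (y (uniform T n i) w * (W (uniform T n i.+1) w - W (uniform T n i) w) -
     (simple_integral (Z p) W (uniform T n i.+1) w - simple_integral (Z p) W (uniform T n i) w))|;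
      [by left|right].
    rewrite /B2/= leNgt; apply/negP => lt2; move: eS; rewrite leNgt => /negP; apply.
    rewrite [e]splitr; apply: le_lt_trans (ltrD lt1 lt2).
    apply: le_trans (ler_normD _ _); rewrite -big_split/= /S1 le_eqVlt.
    by apply/orP; left; apply/eqP; congr (`|_|); apply: eq_bigr => i _; rewrite /sg; ring.
  - exact: measurableU.
  - apply: measurable_norm_ge; apply: measurable_sum => i; apply: measurable_funM => //.
    apply: measurable_funB; last by apply: measurable_funB; exact: mI.
    by apply: measurable_funM => //; apply: measurable_funB; exact: mW.
apply: le_lt_trans (prU_le _ mB1 mB2) _.
by lra.
Qed.

Lemma integral_at0 : {ae P, forall w, I 0 w = 0}.
Proof.
have [Z [pZ _ /(_ 0 (lexx _)) Z2]] := integral_approximants.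
have SI0 n w : simple_integral (Z n) W 0 w = 0.
  rewrite /simple_integral big1// => i _; have [l0 lr _ _] := pZ n i.
  by rewrite (min_r l0) (min_r (le_trans l0 lr)) subrr mulr0.
apply: cvgP0_const; apply: (cvgP0_le Z2) => [n|n w].
  exact: (Fm_measurable usualF (lexx 0) (integral_Fm (lexx 0))).
by rewrite SI0 sub0r normrN.
Qed.

End approximation.

Section rational_times.
Context {R : realType}.

Definition rational_time (q : nat * nat) : R := q.1%:R / q.2.+1%:R.

Lemma rational_time_ge0 q : 0 <= rational_time q.
Proof. by rewrite divr_ge0. Qed.

Lemma rational_time_right (t del : R) : 0 <= t -> 0 < del ->
  exists2 q, t < rational_time q & rational_time q < t + del.
Proof.
move=> t0 del0; have [N NP] := inv_lt_eps del0.
exists ((Num.truncn (t * N.+1%:R)).+1, N); rewrite /rational_time/=.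
  by rewrite ltr_pdivlMr// truncnS_gt.
have tr : (Num.truncn (t * N.+1%:R))%:R <= t * N.+1%:R by rewrite truncn_le mulr_ge0.
by rewrite -natr1 mulrDl mul1r ler_ltD// ler_pdivrMr.
Qed.

Lemma ae_countable {d : measure_display} {Omega : measurableType d} (P : probability Omega R)
    (T : countType) (Q : T -> Omega -> Prop) :
  (forall x, {ae P, forall w, Q x w}) -> {ae P, forall w x, Q x w}.
Proof.
move=> aeQ.
suff : {ae P, forall w, forall n, if unpickle n is Some x then Q x w else True}.
  by apply: filterS => w + x => /(_ (pickle x)); rewrite pickleK.
by apply/ae_foralln => n; case: unpickle => [x|]; [exact: aeQ|exact: aeW].
Qed.

End rational_times.

Section null_integrand.
Context {R : realType} {d : measure_display} {Omega : measurableType d}.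
Variables (P : probability Omega R) (F : R -> set (set Omega)).
Hypothesis usualF : usual_conditions P F.
Variables (W : R -> Omega -> R) (v : R).
Hypothesis orthW : orthogonal_increments P F W v.

(** The Riemann sums vanish, so the telescoping increments of [I] are small in probability. Right
    continuity passes from rational times to all times. *)
Lemma integral_zero (I : R -> Omega -> R) :
  stochastic_integral P F W (fun _ _ => 0) I -> {ae P, forall w t, 0 <= t -> I t w = 0}.
Proof.
move=> intI.
have ll0 : left_limit_process P F (fun _ _ => 0) (fun _ _ => 0 : R).
  split=> [s _|]; first exact: Fm_cst.
  apply: aeW => w; split=> [t t0|s s0]; last exact: cvg_cst.
  by split=> [|_]; [exact: cvg_cst|exists 0; exact: cvg_cst].
have It t : 0 <= t -> {ae P, forall w, I t w = 0}.
  move=> t0.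
  have mI s : 0 <= s -> measurable_fun setT (I s).
    by move=> s0; exact: (Fm_measurable usualF s0 (integral_Fm usualF intI s0)).
  have dI : {ae P, forall w, I t w - I 0 w = 0}.
    apply: cvgP0_const; split=> [_|e del e0 del0].
      by apply: measurable_funB; exact: mI.
    have [N NP] := integral_approximation usualF orthW ll0 intI t0 e0 del0.
    exists N => n _; have := NP N (leqnn N) (fun=> setT) (fun i => F_setT usualF (uniform_ge0 N i t0)).
    have E w : \sum_(i < N.+1) \1_(setT : set Omega) w * (0 * (W (uniform t N i.+1) w - W (uniform t N i) w) -
        (I (uniform t N i.+1) w - I (uniform t N i) w)) = - (I t w - I 0 w).
      under eq_bigr do rewrite indicT mul1r mul0r sub0r.
      by rewrite sumrN -(big_mkord xpredT (fun i => I (uniform t N i.+1) w - I (uniform t N i) w))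
        telescope_sumr// uniform_last uniform0.
    by under eq_set do rewrite E normrN.
  apply: filterS2 dI (integral_at0 usualF orthW ll0 intI) => w.
  by move=> /eqP; rewrite subr_eq0 => /eqP -> ->.
have [[_ cI] _] := intI.
have Iq : {ae P, forall w q, I (rational_time q) w = 0}.
  by apply: ae_countable => q; apply: It; exact: rational_time_ge0.
apply: filterS2 cI Iq => w cw Iqw t t0; have [cr _] := cw t t0.
apply/eqP; rewrite -normr_le0; apply/ler_addgt0Pr => e e0; rewrite add0r.
have [del del0 delP] := (right_limP _ _ _).1 cr e e0.
have [q tq qt] := rational_time_right t0 del0.
by have := delP _ tq qt; rewrite Iqw sub0r normrN => /ltW.
Qed.

End null_integrand.

(** * From realizations to quasi-exponential volatility *)

Lemma sqr_sum_le (R : realType) (I : finType) (x : I -> R) :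
  (\sum_k x k) ^+ 2 <= #|I|%:R * \sum_k x k ^+ 2.
Proof.
rewrite expr2 big_distrlr/=.
apply: (@le_trans _ _ (\sum_k \sum_l (x k ^+ 2 / 2 + x l ^+ 2 / 2))).
  by apply: ler_sum => k _; apply: ler_sum => l _; have := sqr_ge0 (x k - x l); nra.
rewrite le_eqVlt; apply/orP; left; apply/eqP.
transitivity (\sum_k (#|I|%:R * (x k ^+ 2 / 2) + \sum_l x l ^+ 2 / 2)).
  by apply: eq_bigr => k _; rewrite big_split/= sumr_const mulr_natl.
rewrite big_split/= sumr_const -(mulr_natl (\sum_l x l ^+ 2 / 2) #|I|) -mulr_sumr -mulrDr -mulr_suml.
by congr (_ * _); lra.
Qed.

(** * A deterministic path driven by noise *)

Section projection.
Context {R : realType} {d : measure_display} {Omega : measurableType d}.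
Variables (P : probability Omega R) (F : R -> set (set Omega)).
Hypothesis usualF : usual_conditions P F.
Let completeP := complete_P usualF.
Variables (m : nat) (W : 'I_m -> R -> Omega -> R) (v : 'I_m -> R).
Hypothesis orthW : forall k, orthogonal_increments P F (W k) (v k).
Variables (y Y I : 'I_m -> R -> Omega -> R).
Hypothesis llY : forall k, left_limit_process P F (y k) (Y k).
Hypothesis intI : forall k, stochastic_integral P F (W k) (Y k) (I k).
Variables (B : R -> set Omega) (c : 'I_m -> R) (rho C : R) (b : R -> Omega -> R) (g : R -> R).
Hypothesis FB : forall s, 0 <= s -> F s (B s).
Hypothesis Bdec : forall s u, 0 <= s -> s <= u -> B u `<=` B s.
Hypothesis yB : forall s u w k, 0 <= u -> u <= s -> B s w -> `|y k u w - c k| <= rho.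
Hypothesis bB : forall s u w, 0 <= u -> u <= s -> B s w -> `|b u w| <= C.
Hypothesis C0 : 0 <= C.
Hypothesis g0 : g 0 = 0.
Hypothesis eqn : {ae P, forall w, bounded_measurable (b ^~ w) /\
  forall t, 0 <= t -> g t = \int[lebesgue_measure]_(s in `[0, t]) b s w + \sum_k I k t w}.

Let v0 k : 0 <= v k. Proof. by case: (orthW k). Qed.
Let mW k t : 0 <= t -> measurable_fun setT (W k t).
Proof. by move=> t0; apply: (Fm_measurable usualF t0); case: (orthW k) => _ + _ _ _; exact. Qed.

Section horizon.
Variables (t : R).
Hypothesis t0 : 0 <= t.
Let sg := uniform t.
Let sg0 n i : 0 <= sg n i. Proof. exact: uniform_ge0. Qed.
Let sgS n i : sg n i <= sg n i.+1. Proof. exact: uniformS. Qed.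
Let sg_homo n i j : (i <= j)%N -> sg n i <= sg n j.
Proof. by move=> ij; apply: (nondecreasing_seqP _).1. Qed.
Let mB s : 0 <= s -> measurable (B s).
Proof. by move=> s0; apply: (F_measurable usualF s0); exact: FB. Qed.

Let sg_L2 n k Z : (forall i, Fm F (sg n i) (Z i)) -> (forall i, L2 P (Z i)) ->
  L2 P (grid_integral (W k) (sg n) Z n.+1).
Proof. exact: (grid_L2 (orthW k) (sg0 n 0) (sgS n)). Qed.

(** The indicator at the left end of the cell stops the sum once the path has left the ball. The
    coefficient becomes bounded, so the sums have moments although the integrals [I k] need not have
    any. *)
Definition stopped_coef n k i w : R := \1_(B (sg n i)) w * y k (sg n i) w.
Definition stopped_integral n w : R :=
  \sum_k grid_integral (W k) (sg n) (stopped_coef n k) n.+1 w.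
Definition stopped_path n w : R :=
  \sum_(i < n.+1) \1_(B (sg n i)) w * (g (sg n i.+1) - g (sg n i)).

Lemma stopped_coef_Fm n k i : Fm F (sg n i) (stopped_coef n k i).
Proof.
apply: FmM; first by apply: (Fm_indic usualF) => //; exact: FB.
by have [+ _] := llY k; exact.
Qed.

Lemma stopped_coef_bound n k i w : `|stopped_coef n k i w| <= `|c k| + `|rho|.
Proof.
rewrite /stopped_coef indicE; case: (boolP (w \in _)) => [|_]; last first.
  by rewrite mul0r normr0 addr_ge0.
rewrite inE mul1r => Bw; have := yB k (sg0 n i) (lexx _) Bw => h.
rewrite -[y k _ w](subrK (c k)); apply: le_trans (ler_normD _ _) _.
by rewrite addrC lerD2l (le_trans h)// ler_norm.
Qed.

Lemma stopped_coef_L2 n k i : L2 P (stopped_coef n k i).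
Proof.
apply: (L2_bounded _ _ (stopped_coef_bound n k i)).
by apply: (Fm_measurable usualF (sg0 n i)); exact: stopped_coef_Fm.
Qed.

Lemma stopped_integral_L2 n : L2 P (stopped_integral n).
Proof.
by apply: L2_sum => k; apply: sg_L2 => i; [exact: stopped_coef_Fm|exact: stopped_coef_L2].
Qed.

Lemma stopped_integral_centered n : expect P (stopped_integral n) = 0.
Proof.
rewrite expect_sum => [|k]; last first.
  by apply/L2_L1/sg_L2 => i; [exact: stopped_coef_Fm|exact: stopped_coef_L2].
rewrite big1// => k _; have [_ _ LW oW _] := orthW k.
rewrite /grid_integral expect_sum => [|i]; last first.
  by apply: L2M; [exact: stopped_coef_L2|exact: LW].
rewrite big1// => i _; apply: oW => //; first exact: stopped_coef_Fm.
exact/L2_L1/stopped_coef_L2.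
Qed.

Let total_mesh n : \sum_(i < n.+1) (sg n i.+1 - sg n i) = t.
Proof.
rewrite -(big_mkord xpredT (fun i => sg n i.+1 - sg n i)) telescope_sumr//.
by rewrite /sg uniform_last uniform0 subr0.
Qed.

Let sum_grid_le n (Z : 'I_m -> nat -> Omega -> R) (K : 'I_m -> R) :
  (forall k i, Fm F (sg n i) (Z k i)) -> (forall k i, L2 P (Z k i)) ->
  (forall k i, (i < n.+1)%N -> expect P (fun w => Z k i w ^+ 2) <= K k) ->
  expect P (fun w => (\sum_k grid_integral (W k) (sg n) (Z k) n.+1 w) ^+ 2) <=
  m%:R * (\sum_k K k * v k) * t.
Proof.
move=> FZ LZ ZK.
have LG k : L2 P (grid_integral (W k) (sg n) (Z k) n.+1).
  exact: sg_L2.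
apply: (@le_trans _ _ (expect P (fun w => m%:R * \sum_k grid_integral (W k) (sg n) (Z k) n.+1 w ^+ 2))).
  apply: le_expect => [||w]; last by have := sqr_sum_le (fun k => grid_integral (W k) (sg n) (Z k) n.+1 w); rewrite card_ord.
  - exact/L2_sqr/L2_sum.
  - by apply/L1Z/L1_sum => k; exact: L2_sqr.
rewrite expectZ; last by apply/L1_sum => k; exact: L2_sqr.
rewrite -mulrA ler_wpM2l// expect_sum => [|k]; last exact: L2_sqr.
rewrite mulr_suml; apply: ler_sum => k _.
rewrite (grid_variance usualF (orthW k) (sg0 n 0) (sgS n) _ (FZ k) (LZ k)).
rewrite -[X in _ <= _ * X](total_mesh n) mulr_sumr; apply: ler_sum => i _.
by rewrite mulrA ler_wpM2r ?subr_ge0// ler_wpM2r// ZK.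
Qed.

Lemma stopped_integral_variance n : expect P (fun w => stopped_integral n w ^+ 2) <=
  m%:R * (\sum_k (`|c k| + `|rho|) ^+ 2 * v k) * t.
Proof.
apply: sum_grid_le => [k i|k i|k i _]; [exact: stopped_coef_Fm|exact: stopped_coef_L2|].
rewrite -[leRHS](expect_cst P); apply: le_expect => [||w].
- exact/L2_sqr/stopped_coef_L2.
- exact: L1_cst.
rewrite -[stopped_coef _ _ _ _ ^+ 2]real_normK ?num_real// lerXn2r ?nnegrE ?addr_ge0//.
exact: stopped_coef_bound.
Qed.

Definition terminal w : R := \sum_k c k * (W k t w - W k 0 w).

Lemma terminal_L2 : L2 P terminal.
Proof. by apply: L2_sum => k; apply: L2Z; case: (orthW k) => _ _ LW _ _; exact: LW. Qed.

(** While [B] holds, the coefficient is within [rho] of [c k]; afterwards it is zero and the error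
    is [c k] itself. These are the two terms of the bound. *)
Lemma terminal_stopped n : expect P (fun w => (terminal w - stopped_integral n w) ^+ 2) <=
  m%:R * (\sum_k (rho ^+ 2 + c k ^+ 2 * pr P (~` B t)) * v k) * t.
Proof.
pose Z k i w := c k - stopped_coef n k i w.
have E w : terminal w - stopped_integral n w =
    \sum_k grid_integral (W k) (sg n) (Z k) n.+1 w.
  rewrite /terminal /stopped_integral -sumrB; apply: eq_bigr => k _.
  rewrite /grid_integral /Z; under [RHS]eq_bigr do rewrite mulrBl.
  rewrite sumrB -mulr_sumr; congr (_ * _ - _).
  rewrite -(big_mkord xpredT (fun i => W k (sg n i.+1) w - W k (sg n i) w)) telescope_sumr//.
  by rewrite /sg uniform_last uniform0.
under eq_fun do rewrite E.
have LZ k i : L2 P (Z k i).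
  by apply: L2B; [exact: L2_cst|exact: stopped_coef_L2].
apply: sum_grid_le => [k i|//|k i il].
  by apply: FmB; [exact: Fm_cst|exact: stopped_coef_Fm].
have mC : measurable (~` B (sg n i)) by apply: measurableC; exact: mB.
apply: (@le_trans _ _ (expect P (fun w => rho ^+ 2 + c k ^+ 2 * \1_(~` B (sg n i)) w))).
  apply: le_expect => [||w].
  - exact: L2_sqr.
  - by apply: L1D; [exact: L1_cst|exact/L1Z/L1_indic].
  rewrite /Z /stopped_coef !indicE in_setC; case: (boolP (w \in _)) => [|_].
    rewrite inE mul1r mulr0 addr0 => Bw; have := yB k (sg0 n i) (lexx _) Bw => h.
    rewrite -[leLHS]real_normK ?num_real// -[leRHS]real_normK ?num_real// distrC.
    by rewrite lerXn2r ?nnegrE// (le_trans h)// ler_norm.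
  by rewrite mul0r subr0 mulr1 lerDr sqr_ge0.
rewrite expectD; [|exact: L1_cst|exact/L1Z/L1_indic].
rewrite (expect_cst P) lerD2l expectZ; last exact: L1_indic.
rewrite pr_expect// ler_wpM2l ?sqr_ge0// le_pr//; first by apply: measurableC; exact: mB.
by apply: subsetC; apply: Bdec => //; apply: uniform_le => //; exact: ltnW.
Qed.

(** As the events decrease, the indicators along the grid form a block of ones followed by zeros,
    and the sum telescopes up to the first zero. The exit is noticed at grid points only: the last
    cell may leave the ball, and [B] is guaranteed just at [j.-1]. *)
Lemma stopping_index n w : exists j, [/\ (j <= n.+1)%N,
  forall f : R -> R, \sum_(i < n.+1) \1_(B (sg n i)) w * (f (sg n i.+1) - f (sg n i)) =
    f (sg n j) - f 0,
  (0 < j)%N -> B (sg n j.-1) w & B t w -> j = n.+1].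
Proof.
suff H k : exists j, [/\ (j <= k)%N,
    forall f : R -> R, \sum_(i < k) \1_(B (sg n i)) w * (f (sg n i.+1) - f (sg n i)) =
      f (sg n j) - f 0,
    (0 < j)%N -> B (sg n j.-1) w & (j < k)%N -> ~ B (sg n j) w].
  have [j [jn sumj jB jlt]] := H n.+1; exists j; split=> // Bt.
  apply/eqP; rewrite eqn_leq jn/= leqNgt; apply/negP => /[dup] jlt' /jlt; apply.
  by apply: Bdec Bt => //; exact: uniform_le.
elim: k => [|k [j [jk sumj jB jlt]]].
  by exists 0%N; split=> // f; rewrite big_ord0 /sg uniform0 subrr.
have [Bk|Bk] := pselect (B (sg n k) w); last first.
  exists j; split=> //; first exact: leqW.
    move=> f; rewrite big_ord_recr/= indicE (_ : (w \in _) = false) ?mul0r ?addr0//.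
    by apply/negbTE; rewrite notin_setE.
  by rewrite ltnS leq_eqVlt => /orP[/eqP ->//|/jlt].
have ej : j = k.
  apply/eqP; rewrite eqn_leq jk/= leqNgt; apply/negP => /[dup] jlt' /jlt; apply.
  by apply: Bdec Bk => //; exact: sg_homo.
exists k.+1; split=> //; last by rewrite ltnn.
move=> f; rewrite big_ord_recr/= sumj ej indicE (_ : (w \in _)) ?mul1r ?inE//.
by rewrite addrC addrA subrK.
Qed.

Lemma stopped_path_value n w : exists j, [/\ (j <= n.+1)%N, stopped_path n w = g (sg n j) &
  B t w -> stopped_path n w = g t].
Proof.
have [j [jn sumj _ jB]] := stopping_index n w; exists j.
have E : stopped_path n w = g (sg n j) by rewrite /stopped_path sumj g0 subr0.
by split=> // /jB jE; rewrite E jE /sg uniform_last.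
Qed.

Lemma stopped_path_measurable n : measurable_fun setT (stopped_path n).
Proof.
apply: measurable_sum => i; apply: measurable_funM => //.
by apply: measurable_indic; exact: mB.
Qed.

(** Up to the last grid point in the ball the drift is at most [C * t]; over the one cell that may
    overshoot it is a random bound times the mesh. Hence it is the excess over [C * t], and not the
    difference itself, that tends to zero in probability. *)
Lemma stopped_close : cvgP0 P (fun n w =>
  Num.max 0 (`|stopped_integral n w - stopped_path n w| - C * t)).
Proof.
pose J n k w : R := \sum_(i < n.+1) \1_(B (sg n i)) w * (I k (sg n i.+1) w - I k (sg n i) w).
have mI k s : 0 <= s -> measurable_fun setT (I k s).
  by move=> s0; exact: (Fm_measurable usualF s0 (integral_Fm usualF (intI k) s0)).
have mJ n k : measurable_fun setT (J n k).
  apply: measurable_sum => i; apply: measurable_funM.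
    by apply: measurable_indic; exact: mB.
  by apply: measurable_funB; exact: mI.
have mN n : measurable_fun setT (stopped_integral n) by exact: L2_measurable (stopped_integral_L2 n).
have c1 : cvgP0 P (fun n w => \sum_k
    (grid_integral (W k) (sg n) (stopped_coef n k) n.+1 w - J n k w)).
  apply: cvgP0_sum => k; split=> [n|e del e0 del0].
    apply: measurable_funB => //; apply: (@L2_measurable _ _ _ P).
    apply: sg_L2 => i; [exact: stopped_coef_Fm|exact: stopped_coef_L2].
  have [N0 NP] := integral_approximation usualF (orthW k) (llY k) (intI k) t0 e0 del0.
  exists N0 => n Nn; have := NP n Nn (fun i => B (sg n i)) (fun i => FB (sg0 n i)).
  congr (pr P _ < _); apply/seteqP; split => w /=; rewrite /J /grid_integral -sumrB;
    by congr (_ <= `|_|); apply: eq_bigr => i _; rewrite /stopped_coef; ring.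
have c2 : cvgP0 P (fun n w => Num.max 0 (`|stopped_path n w - \sum_k J n k w| - C * t)).
  apply: cvgP0_ae => [n|].
    apply: measurable_maxr => //; apply: measurable_funB => //; apply: measurableT_comp => //.
    apply: measurable_funB; first exact: stopped_path_measurable.
    exact: measurable_sum.
  apply: filterS eqn => w [mb eq]; have [_ [bd' bdP']] := mb t.
  have [bd bd0 bdP] : exists2 bd, 0 <= bd & forall u, 0 <= u -> u <= t -> `|b u w| <= bd.
    by exists `|bd'| => // u u0 ut; rewrite (le_trans (bdP' u u0 ut))// ler_norm.
  pose be s := \int[lebesgue_measure]_(u in `[0, s]) b u w.
  have E n : stopped_path n w - \sum_k J n k w =
      \sum_(i < n.+1) \1_(B (sg n i)) w * (be (sg n i.+1) - be (sg n i)).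
    rewrite /stopped_path /J exchange_big/= -sumrB; apply: eq_bigr => i _.
    rewrite -mulr_sumr -mulrBr sumrB; congr (_ * _).
    by rewrite !eq// /be; ring.
  have bound n : `|stopped_path n w - \sum_k J n k w| - C * t <= bd * t / n.+1%:R.
    rewrite E; have [j [jn -> jB _]] := stopping_index n w.
    have be0 : be 0 = 0 by rewrite /be set_itv1 Rintegral_set1.
    rewrite be0 subr0; case: j jn jB => [|j] jn jB.
      by rewrite /sg uniform0 be0 normr0 sub0r (@le_trans _ _ 0)// ?oppr_le0 ?mulr_ge0 ?divr_ge0.
    have jt : sg n j <= t by apply: uniform_le => //; exact: ltnW.
    rewrite /be (integral_split mb (sg0 n j) (sgS n j)) -/(be _).
    have h1 : `|be (sg n j)| <= C * t.
      apply: (@le_trans _ _ (C * (sg n j - 0))); last by rewrite subr0 ler_wpM2l.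
      by apply: Rintegral_itv_bound => // u u0 uj; exact: bB (jB isT).
    have h2 : `|\int[lebesgue_measure]_(u in `[sg n j, sg n j.+1]) b u w| <= bd * t / n.+1%:R.
      rewrite -mulrA -(uniform_mesh t n j); apply: Rintegral_itv_bound => // u ju uj.
      apply: bdP; first exact: (le_trans (sg0 n j)).
      by apply: (le_trans uj); exact: uniform_le.
    by rewrite lerBlDr; apply: le_trans (ler_normD _ _) _; rewrite [leRHS]addrC; exact: lerD.
  apply/seq_limP => e e0.
  have bdt : 0 < bd * t + 1 by rewrite ltr_wpDl// mulr_ge0.
  have [N0 NP] := inv_lt_eps (divr_gt0 e0 bdt).
  exists N0 => n Nn; rewrite subr0 ger0_norm ?le_max ?lexx// gt_max e0/=.
  apply: le_lt_trans (bound n) _.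
  have ninv : n.+1%:R^-1 < e / (bd * t + 1) :> R.
    by apply: le_lt_trans NP; rewrite lef_pV2 ?posrE// ler_nat.
  rewrite ltr_pdivlMr// mulrC in ninv; apply: le_lt_trans ninv.
  by rewrite ler_wpM2r// lerDl.
have {}c1 : cvgP0 P (fun n w => `|\sum_k
    (grid_integral (W k) (sg n) (stopped_coef n k) n.+1 w - J n k w)|).
  apply: (cvgP0_le c1) => [n|n w]; last by rewrite normr_id.
  by apply: measurableT_comp => //; case: c1.
have c3 := cvgP0D c1 c2; apply: (cvgP0_le c3) => [n|n w].
  apply: measurable_maxr => //; apply: measurable_funB => //; apply: measurableT_comp => //.
  by apply: measurable_funB => //; exact: stopped_path_measurable.
rewrite sumrB -/(stopped_integral n w); set N := stopped_integral n w; set U := stopped_path n w.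
set S := \sum_k J n k w; have max0 x : 0 <= Num.max 0 x :> R by rewrite le_max lexx.
rewrite (ger0_norm (max0 _)) [leRHS]ger0_norm ?addr_ge0// ge_max addr_ge0//=.
have h1 := ler_normD (N - S) (S - U); rewrite addrA subrK distrC in h1.
have h2 : `|U - S| - C * t <= Num.max 0 (`|U - S| - C * t) by rewrite le_max lexx orbT.
by rewrite (distrC U S) in h2 *; move: h1; rewrite (distrC U N); lra.
Qed.

(** Convergence in probability has to be turned into a statement on expectations. On the exceptional
    event the product is split by the Young inequality: the second moments of the stopped sums are
    bounded uniformly in [n], and the expectation of the square of [Z] over a small event is
    small. *)
Lemma stopped_pairing (G e : R) Z : (forall s, 0 <= s -> s <= t -> `|g s| <= G) -> L2 P Z -> 0 < e ->
  exists n, `|expect P (fun w => stopped_path n w * Z w) - expect P (fun w => stopped_integral n w * Z w)| <=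
    C * t * expect P (fun w => `|Z w|) + e.
Proof.
move=> gG LZ e0.
have G0 : 0 <= G by apply: le_trans (gG 0 (lexx _) t0); rewrite normr_ge0.
pose K := m%:R * (\sum_k (`|c k| + `|rho|) ^+ 2 * v k) * t.
have K0 : 0 <= K.
  by rewrite !mulr_ge0// sumr_ge0// => k _; rewrite mulr_ge0 ?sqr_ge0.
pose EZ := expect P (fun w => `|Z w|).
have EZ0 : 0 <= EZ by apply: expect_ge0 => w; exact: normr_ge0.
(* With [a] the tolerance in probability and [lam] the weight in the Young inequality, each of the
   three error terms is at most [e / 3]. *)
pose a := e / 3 / (EZ + 1); pose lam := e / 3 / (K + G ^+ 2 + 1).
have a0 : 0 < a by rewrite !divr_gt0// ltr_wpDl.
have KG : 0 < K + G ^+ 2 + 1 by rewrite ltr_wpDl// addr_ge0// sqr_ge0.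
have lam0 : 0 < lam by rewrite !divr_gt0.
have lam20 : 0 < lam * 2 by rewrite mulr_gt0.
have e30 : 0 < e / 3 by rewrite divr_gt0.
have [del del0 delP] := absolute_continuity (L2_sqr LZ) (fun w => sqr_ge0 (Z w)) (mulr_gt0 e30 lam20).
have [mE /(_ a del a0 del0)[n /(_ n (leqnn n)) En]] := stopped_close.
exists n; set N := stopped_integral n; set U := stopped_path n.
set E := [set w | _] in En.
have LN : L2 P N by exact: stopped_integral_L2.
have UG w : `|U w| <= G.
  rewrite /U; have [j [jn -> _]] := stopped_path_value n w.
  by apply: (gG _ (sg0 n j)); exact: uniform_le.
have LU : L2 P U by apply: (L2_bounded _ _ UG); exact: stopped_path_measurable.
have mEn : measurable E by apply: measurable_norm_ge.
have mZ := L2_measurable LZ.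
have Lc : L1 P (fun w => \1_E w * Z w ^+ 2).
  apply: (@L1M_bounded _ _ _ P _ _ 1); first exact: L2_sqr.
    exact: measurable_indic.
  by move=> w; have /andP[i0 i1] := indic_01 (R := R) E w; rewrite ger0_norm.
have LnZ := L1_norm (L2_L1 LZ).
have LUN := L2B LU LN.
rewrite -expectB; [|exact: L2M|exact: L2M].
apply: le_trans (le_norm_expect (L1B (L2M LU LZ) (L2M LN LZ))) _.
apply: (@le_trans _ _ (expect P (fun w => (C * t + a) * `|Z w| +
   (lam * N w ^+ 2 + lam * G ^+ 2 + (lam * 2)^-1 * (\1_E w * Z w ^+ 2))))).
  apply: le_expect => [||w].
  - by apply: L1_norm; apply: L1B; exact: L2M.
  - apply: L1D; first exact: L1Z.
    apply: L1D; last exact: L1Z.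
    by apply: L1D; [exact/L1Z/L2_sqr|exact: L1_cst].
  rewrite -mulrBl normrM distrC.
  have aux0 : 0 <= lam * N w ^+ 2 + lam * G ^+ 2 + (lam * 2)^-1 * (\1_E w * Z w ^+ 2).
    have /andP[i0 _] := indic_01 (R := R) E w.
    have lam0' := ltW lam0.
    apply: addr_ge0; first by apply: addr_ge0; apply: mulr_ge0 => //; exact: sqr_ge0.
    by rewrite mulr_ge0 ?invr_ge0 ?(ltW lam20)// mulr_ge0 ?sqr_ge0.
  case: (boolP (w \in E)) => wE; last first.
    apply: (@le_trans _ _ ((C * t + a) * `|Z w|)); last by rewrite lerDl.
    rewrite ler_wpM2r//; move: wE; rewrite notin_setE /E/= => /negP.
    rewrite -ltNge ger0_norm ?le_max ?lexx// gt_max => /andP[_].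
    by rewrite -/N -/U => h; lra.
  apply: (@le_trans _ _ (lam * N w ^+ 2 + lam * G ^+ 2 + (lam * 2)^-1 * (\1_E w * Z w ^+ 2))); last first.
    by rewrite lerDr; apply: mulr_ge0 => //; apply: addr_ge0; [exact: mulr_ge0|exact: ltW].
  rewrite indicE wE mul1r.
  have NU : `|N w - U w| <= `|N w| + G by apply: le_trans (ler_normB _ _) _; rewrite lerD2l.
  apply: le_trans (ler_wpM2r (normr_ge0 _) NU) _.
  rewrite -[N w ^+ 2]real_normK ?num_real// -[Z w ^+ 2]real_normK ?num_real//.
  move: (`|N w|) (`|Z w|) (normr_ge0 (N w)) => x z x0.
  have h1 : (x + G) * z <= lam / 2 * (x + G) ^+ 2 + (lam * 2)^-1 * z ^+ 2.
    have := sqr_ge0 (lam * (x + G) - z) => h.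
    have -> : lam / 2 * (x + G) ^+ 2 + (lam * 2)^-1 * z ^+ 2 =
      (x + G) * z + (lam * 2)^-1 * (lam * (x + G) - z) ^+ 2.
      by field; rewrite gt_eqF.
    by rewrite lerDl mulr_ge0// invr_ge0 mulr_ge0// ltW.
  apply: le_trans h1 _; rewrite lerD2r.
  have h2 : (x + G) ^+ 2 <= 2 * (x ^+ 2 + G ^+ 2) by have := sqr_ge0 (x - G); nra.
  apply: (@le_trans _ _ (lam / 2 * (2 * (x ^+ 2 + G ^+ 2)))); last by rewrite le_eqVlt; apply/orP; left; apply/eqP; field.
  by rewrite ler_wpM2l// divr_ge0// ltW.
rewrite expectD; [|exact: L1Z|]; last first.
  apply: L1D; last exact: L1Z.
  by apply: L1D; [exact/L1Z/L2_sqr|exact: L1_cst].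
rewrite expectZ// expectD; [|by apply: L1D; [exact/L1Z/L2_sqr|exact: L1_cst]|exact: L1Z].
rewrite expectD; [|exact/L1Z/L2_sqr|exact: L1_cst].
rewrite (expect_cst P) !expectZ//; last exact: L2_sqr.
rewrite -/EZ mulrDl -addrA lerD2l.
have h1 : a * EZ <= e / 3.
  rewrite (@le_trans _ _ (a * (EZ + 1)))// ?ler_wpM2l ?(ltW a0) ?lerDl//.
  by rewrite /a divfK// gt_eqF// ltr_wpDl.
have h2 : lam * expect P (fun w => N w ^+ 2) + lam * G ^+ 2 <= e / 3.
  rewrite -mulrDr (@le_trans _ _ (lam * (K + G ^+ 2 + 1)))//; last first.
    by rewrite /lam divfK// gt_eqF.
  rewrite ler_wpM2l ?(ltW lam0)// ler_wpDr// lerD2r; exact: stopped_integral_variance.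
have h3 : (lam * 2)^-1 * expect P (fun w => \1_E w * Z w ^+ 2) <= e / 3.
  by rewrite ler_pdivrMl// [leRHS]mulrC; apply/ltW/delP.
by lra.
Qed.

End horizon.

(** Pairing with the constant 1 removes the centred stochastic sum, and on [B t] the stopped path
    has the value [g t]. *)
Lemma path_estimate t (G : R) : 0 <= t -> (forall s, 0 <= s -> s <= t -> `|g s| <= G) ->
  `|g t| <= C * t + (`|g t| + G) * pr P (~` B t).
Proof.
move=> t0 gG; apply/ler_addgt0Pr => e e0.
have G0 : 0 <= G by apply: le_trans (gG 0 (lexx _) t0); rewrite normr_ge0.
have [n] := stopped_pairing t0 gG (L2_cst P 1) e0.
set U := stopped_path t n; set N := stopped_integral t n.
have -> : expect P (fun w => U w * cst 1 w) = expect P U by apply: eq_expect => w; rewrite mulr1.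
have -> : expect P (fun w => N w * cst 1 w) = 0.
  by rewrite -(stopped_integral_centered t0 n); apply: eq_expect => w; rewrite mulr1.
have -> : expect P (fun w => `|cst 1 w|) = 1.
  by rewrite -[RHS](expect_cst P); apply: eq_expect => w; rewrite /= normr1.
rewrite subr0 mulr1 => EU.
have mC : measurable (~` B t) by apply/measurableC/(F_measurable usualF t0)/FB.
have UG w : `|U w| <= G.
  rewrite /U; have [j [jn -> _]] := stopped_path_value t0 n w.
  by apply: gG; [exact: uniform_ge0|exact: uniform_le].
have LU : L1 P U by apply: (L1_bounded _ _ UG); exact: stopped_path_measurable.
have h : `|g t - expect P U| <= (`|g t| + G) * pr P (~` B t).
  rewrite -[X in `|X - _|](expect_cst P) -expectB; [|exact: L1_cst|by []].
  apply: le_trans (le_norm_expect _) _; first by apply: L1B => //; exact: L1_cst.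
  rewrite -pr_expect// -expectZ; last exact: L1_indic.
  apply: le_expect => [||w].
  - by apply/L1_norm/L1B => //; exact: L1_cst.
  - exact/L1Z/L1_indic.
  rewrite indicE in_setC; case: (boolP (w \in _)) => [|_].
    rewrite inE mulr0 => Bw; rewrite /U; have [j [_ _ ->//]] := stopped_path_value t0 n w.
    by rewrite /= subrr normr0.
  by rewrite mulr1; apply: le_trans (ler_normB _ _) _; rewrite /= lerD2l.
have := ler_normD (g t - expect P U) (expect P U); rewrite subrK.
by move: EU h; set p := (_ * pr _ _); lra.
Qed.

(** The supremum of [|g|], finite by the crude bound [G], appears on both sides of the estimate and
    is absorbed: with probability at most 1/4 of leaving, [3/4 |g s| <= C t + 1/4 sup], so that
    [sup <= 4/3 C t + 1/3 sup]. *)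
Lemma path_small t (G : R) : 0 <= t -> (forall s, 0 <= s -> s <= t -> `|g s| <= G) ->
  pr P (~` B t) <= 4^-1 -> forall s, 0 <= s -> s <= t -> `|g s| <= 2 * C * t.
Proof.
move=> t0 gG Bt.
pose E := [set x | exists2 s, 0 <= s <= t & x = `|g s|].
have supE : has_sup E.
  split; first by exists `|g 0|, 0; rewrite ?lexx.
  by exists G => x [s /andP[s0 st] ->]; exact: gG.
have gsup s : 0 <= s -> s <= t -> `|g s| <= sup E.
  by move=> s0 st; apply: ub_le_sup; [exact: supE.2|exists s; rewrite ?s0].
suff le : sup E <= 2 * C * t by move=> s s0 st; exact: le_trans (gsup s s0 st) le.
have sup0 : 0 <= sup E by apply: le_trans (gsup 0 (lexx _) t0); rewrite normr_ge0.
suff : sup E <= 4 / 3 * C * t + sup E / 3 by lra.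
apply: ge_sup; first exact: supE.1.
move=> x [s /andP[s0 st] ->].
have := path_estimate s0 (fun u u0 us => gsup u u0 (le_trans us st)).
have Cs : C * s <= C * t by rewrite ler_wpM2l.
have ps : pr P (~` B s) <= 4^-1.
  apply: le_trans Bt; apply: le_pr; [exact/measurableC/(F_measurable usualF s0)/FB|
    exact/measurableC/(F_measurable usualF t0)/FB|].
  by apply: subsetC; exact: Bdec.
have p0 := ler_wpM2l (addr_ge0 (normr_ge0 (g s)) sup0) ps.
by lra.
Qed.

(* Stop the equation on leaving [B] and pair it with the martingale [terminal t],
   of variance q t. The path g is deterministic, so taking expectations shows
   g = O(t), and the drift is O(t): their pairings are O(t sqrt t), whereas that of
   the stochastic integral is at least q t / 4. *)
Lemma projection_degenerate (q G : R) : 0 < q ->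
  (forall t, 0 <= t -> expect P (fun w => terminal t w ^+ 2) = q * t) ->
  (forall s, 0 <= s -> s <= 1 -> `|g s| <= G) ->
  m%:R * (\sum_k rho ^+ 2 * v k) <= q / 4 ->
  (forall e : R, 0 < e -> exists2 t, 0 < t & pr P (~` B t) <= e) -> False.
Proof.
move=> q0 varq gG rhoq Bsmall.
pose S := m%:R * (\sum_k c k ^+ 2 * v k).
have S0 : 0 <= S by rewrite mulr_ge0// sumr_ge0// => k _; rewrite mulr_ge0 ?sqr_ge0.
(* The bound [4^-1] is the hypothesis of [path_small]; the other one keeps the contribution of the
   paths that have left the ball below [q / 4]. *)
pose del := Num.min 4^-1 (q / 4 / (S + 1)).
have S1 : 0 < S + 1 by rewrite ltr_wpDl.
have del0 : 0 < del by rewrite lt_min invr_gt0 ltr0n/= !divr_gt0.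
have [t1 t10 pt1] := Bsmall del del0.
pose C1 := C + 1; have C10 : 0 < C1 by rewrite ltr_wpDl.
have C1C1 : 0 < 400 * C1 ^+ 2 by rewrite mulr_gt0 ?ltr0n ?exprn_gt0.
have t1_ge0 := ltW t10.
(* The last bound makes the quadratic term [18 * C1 ^+ 2 * t * t] of [h2] at most [18 / 400] of
   [q * t]; together with [1/8] and [1/16] this stays below the fraction [1/4] in [ENZ]. *)
pose t := Num.min (Num.min t1 1) (q / (400 * C1 ^+ 2)).
have t_gt0 : 0 < t by rewrite !lt_min t10 ltr01 divr_gt0.
have t0 := ltW t_gt0.
have tt1 : t <= t1 by rewrite !ge_min lexx.
have t_1 : t <= 1 by rewrite !ge_min lexx orbT.
have tq : t * (400 * C1 ^+ 2) <= q by rewrite -ler_pdivlMr// !ge_min lexx orbT.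
have pt : pr P (~` B t) <= del.
  apply: le_trans pt1; apply: le_pr; [exact/measurableC/(F_measurable usualF t0)/FB|
    exact/measurableC/(F_measurable usualF t1_ge0)/FB|].
  by apply: subsetC; exact: Bdec.
have p0 : 0 <= pr P (~` B t) by exact: pr_ge0.
have small : forall s, 0 <= s -> s <= t -> `|g s| <= 2 * C * t.
  apply: (@path_small t G) => //; first by move=> s s0 st; apply: gG => //; exact: le_trans t_1.
  by apply: le_trans pt _; rewrite ge_min lexx.
have LZ := terminal_L2 t0.
have LnZ := L1_norm (L2_L1 LZ).
have e0 : 0 < q * t / 16 by rewrite divr_gt0// mulr_gt0.
have [n] := stopped_pairing t0 small LZ e0.
set U := stopped_path t n; set N := stopped_integral t n; set Z := terminal t => UZ.
have LN : L2 P N by exact: stopped_integral_L2.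
have UG w : `|U w| <= 2 * C * t.
  rewrite /U; have [j [jn -> _]] := stopped_path_value t0 n w.
  by apply: small; [exact: uniform_ge0|exact: uniform_le].
have mU : measurable_fun setT U by exact: stopped_path_measurable.
have LUZ : L1 P (fun w => U w * Z w) by exact: L1M_bounded (L2_L1 LZ) mU UG.
have EUZ : `|expect P (fun w => U w * Z w)| <= 2 * C * t * expect P (fun w => `|Z w|).
  apply: le_trans (le_norm_expect LUZ) _; rewrite -expectZ//.
  apply: le_expect => [||w]; [exact: L1_norm|exact: L1Z|].
  by rewrite normrM ler_wpM2r.
have ENZ : q * t / 4 <= expect P (fun w => N w * Z w).
  have V := terminal_stopped t0 n; rewrite -/Z -/N in V.
  (* Polarization: with the variance [q * t] of [Z] and a distance of at most [q / 2 * t] in mean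
     square, the pairing is at least [q * t / 4]. *)
  have -> : expect P (fun w => N w * Z w) =
      2^-1 * (expect P (fun w => N w ^+ 2) + expect P (fun w => Z w ^+ 2) - expect P (fun w => (Z w - N w) ^+ 2)).
    rewrite -expectD; [|exact: L2_sqr|exact: L2_sqr].
    rewrite -expectB; [|by apply: L1D; exact: L2_sqr|exact/L2_sqr/L2B].
    rewrite -expectZ; last by apply: L1B; [by apply: L1D; exact: L2_sqr|exact/L2_sqr/L2B].
    by apply: eq_expect => w; field.
  have N0 : 0 <= expect P (fun w => N w ^+ 2) by apply: expect_ge0 => w; exact: sqr_ge0.
  rewrite varq//.
  suff : expect P (fun w => (Z w - N w) ^+ 2) <= q / 2 * t by lra.
  apply: le_trans V _; rewrite ler_wpM2r//.
  under eq_bigr do rewrite mulrDl; rewrite big_split/= mulrDr.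
  under [X in _ + _ * X]eq_bigr do rewrite mulrAC; rewrite -mulr_suml mulrA -/S.
  suff : S * pr P (~` B t) <= q / 4 by lra.
  apply: (@le_trans _ _ ((S + 1) * del)).
    by apply: ler_pM => //; rewrite lerDl.
  by rewrite mulrC -ler_pdivlMr// ge_min lexx orbT.
have kap0 : 0 < 12 * C1 * t by rewrite !mulr_gt0.
(* Arithmetic-geometric mean at the scale [12 * C1 * t], chosen so that multiplication by
   [3 * C1 * t] turns the second term into [q * t / 8]. The factor 3 adds the bound [2 * C * t] of
   the path and [C * t] of the drift. *)
have EZ : expect P (fun w => `|Z w|) <= 6 * C1 * t + q / (24 * C1).
  have -> : 6 * C1 * t + q / (24 * C1) = 6 * C1 * t + (24 * C1 * t)^-1 * expect P (fun w => Z w ^+ 2).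
    by rewrite varq//; field; rewrite !gt_eqF.
  rewrite -expectZ; last exact: L2_sqr.
  rewrite -[X in X + _](expect_cst P) -expectD; [|exact: L1_cst|exact/L1Z/L2_sqr].
  apply: le_expect => [//||w]; first by apply: L1D; [exact: L1_cst|exact/L1Z/L2_sqr].
  rewrite -[Z w ^+ 2]real_normK ?num_real//=; move: `|Z w| => z.
  have -> : 6 * C1 * t + (24 * C1 * t)^-1 * z ^+ 2 = z + (24 * C1 * t)^-1 * (z - 12 * C1 * t) ^+ 2.
    by field; rewrite !gt_eqF.
  by rewrite lerDl mulr_ge0 ?sqr_ge0// invr_ge0 !mulr_ge0// ltW.
have EZ0 : 0 <= expect P (fun w => `|Z w|) by apply: expect_ge0.
have h1 : 3 * C * t * expect P (fun w => `|Z w|) <= 3 * C1 * t * (6 * C1 * t + q / (24 * C1)).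
  apply: ler_pM => //; first by rewrite !mulr_ge0.
  by rewrite ler_wpM2r// ler_wpM2l// /C1 lerDl.
have h2 : 3 * C1 * t * (6 * C1 * t + q / (24 * C1)) = 18 * C1 ^+ 2 * t * t + q * t / 8.
  by field; rewrite gt_eqF.
have h3 : t * (400 * C1 ^+ 2) * t <= q * t by rewrite ler_wpM2r.
have qt0 : 0 < q * t by rewrite mulr_gt0.
have h4 : expect P (fun w => N w * Z w) <= `|expect P (fun w => U w * Z w)| +
   (C * t * expect P (fun w => `|Z w|) + q * t / 16).
  have := ler_normB (expect P (fun w => U w * Z w)) (expect P (fun w => U w * Z w) - expect P (fun w => N w * Z w)).
  rewrite opprB addrC subrK => h; apply: le_trans (ler_norm _) _; apply: le_trans h _.
  by rewrite lerD2l.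
rewrite h2 in h1.
move: h1 h3 h4 EUZ ENZ qt0.
move: (expect P _) `|expect P _| (expect P _) => x1 x2 x3 *.
by lra.
Qed.

End projection.

Lemma lipschitz_bound (R : realType) (V W : normedModType R) (f : V -> W) : lipschitz f ->
  exists2 L : R, 0 < L & forall x y, `|f x - f y| <= L * `|x - y|.
Proof.
move=> /pinfty_ex_gt0[L L0 fL]; exists L => // x y.
by have := fL (x, y); apply; split.
Qed.

Lemma common_lipschitz (R : realType) (V W : normedModType R) m (f : 'I_m -> V -> W) :
  (forall k, lipschitz (f k)) ->
  exists2 L : R, 0 < L & forall k x y, `|f k x - f k y| <= L * `|x - y|.
Proof.
move=> lf; have /choice[Ls LsP] : forall k, exists L : R,
    0 < L /\ forall x y, `|f k x - f k y| <= L * `|x - y|.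
  by move=> k; have [L ? ?] := lipschitz_bound (lf k); exists L.
have Ls0 k : 0 <= Ls k by apply/ltW; case: (LsP k).
exists (1 + \sum_k Ls k) => [|k x y]; first by rewrite ltr_wpDr// sumr_ge0.
apply: le_trans (proj2 (LsP k) x y) _; rewrite ler_wpM2r//.
by rewrite (bigD1 k)//= addrCA lerDl addr_ge0// sumr_ge0.
Qed.

Lemma lipschitz_continuous (R : realType) (V W : normedModType R) (f : V -> W) :
  lipschitz f -> continuous f.
Proof.
move=> /lipschitz_bound[L L0 fL] x; apply/cvgrPdist_lt => e e0.
near=> z; apply: le_lt_trans (fL x z) _.
by rewrite mulrC -ltr_pdivlMr//; near: z; apply: near_dist; rewrite divr_gt0.
Unshelve. all: by end_near. Qed.

(** For each pair of points of a dense sequence and each radius, pick a point of [G] nearby whenever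
    there is one. The approximating points thus belong to [G] itself, and uncountably many test
    functionals can be reduced to countably many null sets. *)
Lemma dense_sequence (R : realType) (H : completeNormedModType R) (G : set (H * H)) x0 :
  separable H -> G x0 -> exists p : nat -> H * H, (forall n, G (p n)) /\
  forall x (e : R), G x -> 0 < e -> exists n, `|x.1 - (p n).1| < e /\ `|x.2 - (p n).2| < e.
Proof.
move=> [Q cQ dQ] Gx0.
have [q qQ] : exists q : nat -> H, forall x (e : R), 0 < e -> exists n, `|x - q n| < e.
  have dist x (e : R) : 0 < e -> exists2 z, Q z & `|x - z| < e.
    move=> e0; have [||z [Bz Qz]] := dQ (ball x e).
    - by exists x; exact: ballxx.
    - exact: ball_open.
    by exists z => //; move: Bz; rewrite -ball_normE.
  have [z0 Qz0 _] := dist 0 1 ltr01.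
  have /pfcard_geP[Q0|[q]] := cQ; first by rewrite Q0 in Qz0.
  exists q => x e e0; have [z Qz zx] := dist x e e0.
  by have [n _ qn] := @surj _ _ _ _ q z Qz; exists n; rewrite qn.
pose close i j (e : R) (y : H * H) := `|y.1 - q i| < e /\ `|y.2 - q j| < e.
have [p pP] : exists p : nat * nat * nat -> H * H, forall i j N, G (p (i, j, N)) /\
    ((exists2 y, G y & close i j N.+1%:R^-1 y) -> close i j N.+1%:R^-1 (p (i, j, N))).
  suff /choice[p pP] : forall x : nat * nat * nat, exists y, G y /\
      ((exists2 z, G z & close x.1.1 x.1.2 x.2.+1%:R^-1 z) -> close x.1.1 x.1.2 x.2.+1%:R^-1 y).
    by exists p => i j N; exact: (pP (i, j, N)).
  move=> x; have [[y Gy yc]|no] := pselect (exists2 z, G z & close x.1.1 x.1.2 x.2.+1%:R^-1 z).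
    by exists y.
  by exists x0.
exists (fun n => if unpickle n is Some x then p x else x0); split.
  by move=> n; case: unpickle => [[[i j] N]|//]; exact: (pP i j N).1.
move=> x e Gx e0; have [N NP] := inv_lt_eps (divr_gt0 e0 (ltr0n R 2)).
have N0 : 0 < N.+1%:R^-1 :> R by rewrite invr_gt0.
have [i qi] := qQ x.1 _ N0; have [j qj] := qQ x.2 _ N0.
exists (pickle (i, j, N)); rewrite pickleK.
have [_ /(_ _)[|c1 c2]] := pP i j N; first by exists x.
have h1 := ler_normD (x.1 - q i) (q i - (p (i, j, N)).1).
have h2 := ler_normD (x.2 - q j) (q j - (p (i, j, N)).2).
rewrite addrA subrK (distrC (q i)) in h1; rewrite addrA subrK (distrC (q j)) in h2.
by split; [apply: le_lt_trans h1 _|apply: le_lt_trans h2 _]; rewrite [e]splitr ltrD// ?(lt_trans c1) ?(lt_trans c2)// ?(lt_trans qi) ?(lt_trans qj).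
Qed.

(** If the last [b] cannot be dropped, some [eta0] outside [N] is annihilated by all the others.
    Induction applies to [N] plus the line of [eta0], inside which [N] is the kernel of the
    coordinate along [eta0]; this coordinate is a combination of the functionals [ip (b i)]. No
    continuity is assumed: that [N] is closed is part of the outcome. *)
Lemma finite_codimension (R : realType) (H : completeNormedModType R) (ip : H -> H -> R)
    (ipH : inner_product ip) n (b : 'I_n -> H) (N : set H) : linear_set N ->
  (forall eta, (forall i, ip (b i) eta = 0) -> N eta) ->
  exists (n' : nat) (v : 'I_n' -> H), forall eta, N eta <-> forall i, ip (v i) eta = 0.
Proof.
elim: n b N => [|n IH] b N linN bN.
  by exists 0%N, b => eta; split=> _; [case|apply: bN; case].
have [bN'|/existsNP[eta0 /not_implyP[beta0 Neta0]]] :=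
    pselect (forall eta, (forall i : 'I_n, ip (b (lift ord_max i)) eta = 0) -> N eta).
  exact: IH bN'.
have [N0 NL] := linN.
pose N' := [set x | exists a, N (x - a *: eta0)].
have linN' : linear_set N'.
  split; first by exists 0; rewrite scale0r subr0.
  move=> a x y [ax Nx] [ay Ny]; exists (a * ax + ay).
  have -> : a *: x + y - (a * ax + ay) *: eta0 = a *: (x - ax *: eta0) + (y - ay *: eta0).
    by rewrite scalerDl scalerBr scalerA opprD addrACA.
  exact: NL.
have b0 : ip (b ord_max) eta0 != 0.
  apply/eqP => b0; apply: Neta0; apply: bN => i.
  by case: (unliftP ord_max i) => [j ->|->].
have [|n' [v vP]] := IH (fun i => b (lift ord_max i)) N' linN'.
  move=> eta beta; exists (ip (b ord_max) eta / ip (b ord_max) eta0); apply: bN => i.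
  rewrite (ipBr ipH) (ipZr ipH); case: (unliftP ord_max i) => [j ->|->].
    by rewrite beta beta0 mulr0 subr0.
  by rewrite divfK// subrr.
pose l x := xget 0 [set a | N (x - a *: eta0)].
have lN x : N' x -> N (x - l x *: eta0) by move=> N'x; exact: (xgetPex 0 N'x).
have NZ a x : N x -> N (a *: x) by move=> Nx; rewrite -[_ *: _]addr0; exact: NL.
have lU x a : N (x - a *: eta0) -> l x = a.
  move=> Na; have Nl : N (x - l x *: eta0) by apply: lN; exists a.
  apply/eqP; rewrite -subr_eq0; apply/negPn/negP => la; apply: Neta0.
  have -> : eta0 = (l x - a)^-1 *: (-1 *: (x - l x *: eta0) + (x - a *: eta0)).
    rewrite scaleN1r opprB addrA subrK -scalerBl.
    by rewrite scalerA mulVf// scale1r.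
  by apply: NZ; exact: NL.
have linl a x y : N' x -> N' y -> l (a *: x + y) = a * l x + l y.
  move=> Nx Ny; apply: lU.
  have -> : a *: x + y - (a * l x + l y) *: eta0 = a *: (x - l x *: eta0) + (y - l y *: eta0).
    by rewrite scalerDl scalerBr scalerA opprD addrACA.
  by apply: NL; exact: lN.
have [x N'x bx|c cP] := functional_combination linN' linl (fun i => ip_functional ipH (b i)).
  by apply: lU; rewrite scale0r subr0; exact: bN.
exists n'.+1, (fun i => if unlift ord_max i is Some j then v j else \sum_i c i *: b i) => eta.
split=> [Neta i|h].
  have N'eta : N' eta by exists 0; rewrite scale0r subr0.
  case: unliftP => [j _|_]; first exact: (vP eta).1.
  by rewrite (ip_suml ipH) -cP//; apply: lU; rewrite scale0r subr0.
have N'eta : N' eta.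
  by apply/vP => i; have := h (lift ord_max i); rewrite liftK.
have := h ord_max; rewrite unlift_none (ip_suml ipH) -cP// => l0.
by have := lN eta N'eta; rewrite l0 scale0r subr0.
Qed.

(** * The equation tested with functionals *)

Section equation.
Context {R : realType} {d : measure_display} {Omega : measurableType d}.
Variables (P : probability Omega R) (F : R -> set (set Omega)).
Hypothesis usualF : usual_conditions P F.
Variables (m : nat) (X : R -> Omega -> 'rV[R]_m).
Hypotheses (levyX : levy_process P F X)
  (martX : forall k, square_integrable_martingale P F (component X k)).
Context {H : completeNormedModType R}.
Variable ip : H -> H -> R.
Hypotheses (ipH : inner_product ip) (sepH : separable H).
Variable S : R -> H -> H.
Hypotheses (semiS : C0_semigroup S) (pcS : pseudo_contractive S).
Variables (D : set H) (A : H -> H).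
Hypothesis genA : generator S D A.
Variables (alpha : H -> H) (a : H).
Hypothesis alphaE : forall h, alpha h = a.
Variable sigma : 'I_m -> H -> H.
Hypothesis lip_sigma : forall k, lipschitz (sigma k).
Local Notation mu := (@lebesgue_measure R).
Local Notation adj := (adjoint_at ip D A).
Local Notation weak := (weak_solution P F X ip D A alpha sigma).

Definition unit_coef (k : 'I_m) : 'I_m -> R := fun l => (l == k)%:R.

Lemma component_combination k : component X k = levy_combination X (unit_coef k).
Proof.
apply/funext => t; apply/funext => w; rewrite /levy_combination /combination.
rewrite (bigD1 k)//= /unit_coef eqxx mul1r big1 ?addr0// => l /negbTE ->.
by rewrite mul0r.
Qed.

Lemma component_orthogonal k :
  orthogonal_increments P F (component X k) (levy_variance P X (unit_coef k)).
Proof. by rewrite component_combination; exact: levy_orthogonal. Qed.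

Lemma adapted_comp (r : R -> Omega -> H) (phi : H -> R) t : adapted F r -> continuous phi ->
  0 <= t -> Fm F t (fun w => phi (r t w)).
Proof.
move=> ar cphi t0; apply/(FmP usualF _ t0) => B mB.
by apply: (ar t t0 (phi @^-1` B)); exact: continuous_preimage.
Qed.

Lemma cadlag_comp (x : R -> H) (phi : H -> R) : cadlag x -> continuous phi ->
  cadlag (fun t => phi (x t)).
Proof.
move=> cx cphi t t0; have [xr xl] := cx t t0; split; first exact: continuous_cvg (cphi _) xr.
by move=> /xl[l xl']; exists (phi l); exact: continuous_cvg (cphi _) xl'.
Qed.

Lemma coefficient_continuous k xi : continuous (fun h => ip xi (sigma k h)).
Proof.
move=> h; apply: continuous_comp; first exact: (lipschitz_continuous (lip_sigma k)).
exact: ip_continuous.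
Qed.

Lemma coefficient_left_limit (r : R -> Omega -> H) k xi : adapted_cadlag P F r ->
  left_limit_process P F (fun s w => ip xi (sigma k (r s w)))
    (fun s w => ip xi (sigma k (left_limit r s w))).
Proof.
move=> [ar cr]; have cphi := @coefficient_continuous k xi; split.
  by move=> s s0; exact: (adapted_comp ar cphi).
apply: filterS cr => w cw; split; first exact: (cadlag_comp cw cphi).
move=> s s0; have [_ /(_ s0)[l rl]] := cw s (ltW s0).
rewrite /left_limit (cvg_lim (@norm_hausdorff _ _) rl).
exact: continuous_cvg (cphi _) rl.
Qed.

Lemma solution_equation h0 r xi zeta : weak h0 r -> adj xi zeta ->
  exists I : 'I_m -> R -> Omega -> R,
    (forall k, stochastic_integral P F (component X k)
         (fun s w => ip xi (sigma k (left_limit r s w))) (I k)) /\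
    {ae P, forall w, [/\ cadlag (r ^~ w), bounded_measurable (fun s => ip zeta (r s w) + ip xi a) &
      forall t, 0 <= t -> ip xi (r t w) - ip xi h0 =
         \int[mu]_(s in `[0, t]) (ip zeta (r s w) + ip xi a) + \sum_k I k t w]}.
Proof.
move=> [[ar cr] /(_ xi zeta)eq] /eq[I [intI eqI]]; exists I; split=> //.
apply: filterS2 cr eqI => w cw eqw; split=> //.
  apply: bounded_measurableD; [exact: ip_bm|exact: bounded_measurable_cst].
move=> t t0; rewrite eqw// addrAC [ip xi h0 + _]addrC addrK; congr (_ + _).
by apply: eq_Rintegral => s _; rewrite alphaE.
Qed.

Lemma adj0 : adj 0 0.
Proof. by move=> h _; rewrite !(ip0l ipH). Qed.

Lemma adjoint_sequence (Q : set H) : Q 0 -> exists p : nat -> H * H,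
  (forall n, adj (p n).1 (p n).2 /\ Q (p n).1) /\
  forall xi zeta (e : R), adj xi zeta -> Q xi -> 0 < e ->
    exists n, `|xi - (p n).1| < e /\ `|zeta - (p n).2| < e.
Proof.
move=> Q0; have [|p [pG pd]] := @dense_sequence _ _ [set x | adj x.1 x.2 /\ Q x.1] (0, 0) sepH.
  by split=> //; exact: adj0.
exists p; split=> // xi zeta e Ax Qx e0.
exact: (pd (xi, zeta)).
Qed.

Lemma Rintegral_itv0 (f : R -> R) : \int[mu]_(s in `[0, 0]) f s = 0.
Proof. by rewrite set_itv1 Rintegral_set1. Qed.

Lemma ip_dense (p : nat -> H * H) xi zeta x :
  (forall e : R, 0 < e -> exists n, `|xi - (p n).1| < e /\ `|zeta - (p n).2| < e) ->
  (forall n, ip (p n).1 x = 0) -> ip xi x = 0.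
Proof.
move=> pd p0; apply/eqP; rewrite -normr_le0; apply/ler_addgt0Pr => e e0; rewrite add0r.
have x1 : 0 < `|x| + 1 by rewrite ltr_wpDl.
have [n [pn _]] := pd _ (divr_gt0 e0 x1).
rewrite -(subrK (p n).1 xi) (ipDl ipH) p0 addr0; apply: le_trans (cauchy_schwarz ipH _ _) _.
rewrite ltr_pdivlMr// in pn; apply: le_trans (ltW pn).
by rewrite ler_wpM2l// lerDl.
Qed.

(** At time 0 both integrals vanish; countably many test functionals give one null set, and the
    domain of the adjoint separates points. *)
Lemma solution_initial h0 r : weak h0 r -> {ae P, forall w, r 0 w = h0}.
Proof.
move=> wr; have [p [padj pd]] := @adjoint_sequence setT I.
have E n : {ae P, forall w, ip (p n).1 (r 0 w - h0) = 0}.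
  have [J [intJ eqJ]] := solution_equation wr (padj n).1.
  have J0 : {ae P, forall w k, J k 0 w = 0}.
    apply: ae_countable => k.
    exact: (integral_at0 usualF (component_orthogonal k) (coefficient_left_limit k _ wr.1) (intJ k)).
  apply: filterS2 J0 eqJ => w J0w [_ _ /(_ 0 (lexx _))].
  by rewrite (ipBr ipH) => ->; rewrite Rintegral_itv0 add0r big1.
have /ae_countable := E; apply: filterS => w Ew.
apply/eqP; rewrite -subr_eq0; apply/eqP; apply: (adj_separates ipH semiS pcS genA) => xi zeta xz.
by apply: (@ip_dense p xi zeta) => // e e0; exact: pd.
Qed.

Section deterministic.

(** The null set may depend on the time, which makes linear combinations immediate;
    [deterministic_path] later removes this dependence. *)
Definition deterministic (eta : H) := forall h0 r, weak h0 r -> exists f : R -> R,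
  forall t, 0 <= t -> {ae P, forall w, ip eta (r t w) = f t}.

Lemma deterministic_linear : linear_set deterministic.
Proof.
split=> [h0 r wr|c x y dx dy h0 r wr].
  by exists (fun=> 0) => t t0; apply: aeW => w; rewrite (ip0l ipH).
have [f fP] := dx h0 r wr; have [g gP] := dy h0 r wr.
exists (fun t => c * f t + g t) => t t0; apply: filterS2 (fP t t0) (gP t t0) => w <- <-.
by rewrite (ipDl ipH) (ipZl ipH).
Qed.

Lemma ae_exists (Q : Omega -> Prop) : {ae P, forall w, Q w} -> exists w, Q w.
Proof.
move=> aeQ; apply: contrapT => noQ.
have [N [mN N0 QN]] := aeQ.
have NT : N = setT by apply/seteqP; split=> // w _; apply: QN => Qw; apply: noQ; exists w.
by move: N0; rewrite NT probability_setT => /eqP; rewrite onee_eq0.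
Qed.

(** One typical path serves as the deterministic function. The others agree with it at rational
    times and therefore, by right continuity, at all times. *)
Lemma deterministic_path eta h0 r : deterministic eta -> weak h0 r ->
  exists2 f : R -> R, cadlag f & {ae P, forall w t, 0 <= t -> ip eta (r t w) = f t}.
Proof.
move=> /[swap] wr /(_ h0 r wr)[f fP]; have [_ cr] := wr.1.
have fQ : {ae P, forall w q, ip eta (r (rational_time q) w) = f (rational_time q)}.
  by apply: ae_countable => q; apply: fP; exact: rational_time_ge0.
have both : {ae P, forall w, cadlag (r ^~ w) /\ forall q, ip eta (r (rational_time q) w) = f (rational_time q)}.
  by apply: filterS2 cr fQ => w.
have [w0 [cw0 fw0]] := ae_exists both.
exists (fun t => ip eta (r t w0)); first exact: cadlag_ip.
apply: filterS both => w [cw fw] t t0.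
have cd : cadlag (fun s => ip eta (r s w - r s w0)).
  have := cadlag_ip ipH eta cw; have := cadlag_ip ipH eta cw0 => c0 c1 s s0.
  have [c0r c0l] := c0 s s0; have [c1r c1l] := c1 s s0.
  split; first by under eq_fun do rewrite (ipBr ipH); rewrite (ipBr ipH); exact: cvgB.
  move=> s1; have [l0 c0l'] := c0l s1; have [l1 c1l'] := c1l s1.
  by exists (l1 - l0); under eq_fun do rewrite (ipBr ipH); exact: cvgB.
apply/eqP; rewrite -subr_eq0 -(ipBr ipH) -normr_le0; apply/ler_addgt0Pr => e e0; rewrite add0r.
have [del del0 delP] := cadlag_right cd t0 e0.
have [q tq qt] := rational_time_right t0 del0.
have E : ip eta (r (rational_time q) w - r (rational_time q) w0) = 0.
  by rewrite (ipBr ipH) fw fw0 subrr.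
by have := delP _ (ltW tq) qt; rewrite E sub0r normrN => /ltW.
Qed.

Lemma ball_event (r : R -> Omega -> H) h0 (rho s : R) : adapted_cadlag P F r -> 0 <= s ->
  F s [set w | forall u, 0 <= u -> u <= s -> `|r u w - h0| <= rho].
Proof.
move=> [ar cr] s0.
(* Rational times are capped at [s] instead of being discarded, so that [s] itself is enumerated and
   also the times just before it have a neighbour on the right. *)
pose q n : R := if unpickle n is Some x then Num.min (rational_time x) s else 0.
have q0 n : 0 <= q n <= s.
  rewrite /q; case: unpickle => [x|]; last by rewrite lexx.
  by rewrite le_min rational_time_ge0 s0 ge_min lexx orbT.
apply: (@F_ae _ _ _ P _ usualF _ _ (\bigcap_n [set w | `|r (q n) w - h0| <= rho])) => //.
  apply: (F_bigcap usualF s0) => n; have /andP[qn qs] := q0 n.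
  apply: (F_mono usualF qn qs); apply: (F_le usualF _ qn).
  apply: (@adapted_comp r (fun x => `|x - h0|) _ ar _ qn) => x.
   by apply: cvg_norm; apply: cvgB; [exact: cvg_id|exact: cvg_cst].
apply: filterS cr => w cw; split=> [ball n _|ball u u0 us].
  by have /andP[? ?] := q0 n; exact: ball.
 apply/ler_addgt0Pr => e e0.
have [del del0 delP] := cadlag_right cw u0 e0.
have [x ux xu] := rational_time_right u0 del0.
have := ball (pickle x) I; rewrite /= /q pickleK => ballx.
have umin : u <= Num.min (rational_time x) s by rewrite le_min (ltW ux) us.
have minu : Num.min (rational_time x) s < u + del by rewrite gt_min xu.
have := delP _ umin minu; set y := r (Num.min _ _) w in ballx * => yu.
have -> : r u w - h0 = (y - h0) - (y - r u w) by rewrite opprB [RHS]addrC addrA subrK.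
by apply: le_trans (ler_normB _ _) _; rewrite lerD// ltW.
Qed.

Lemma ball_event_small (r : R -> Omega -> H) h0 (rho e : R) :
  adapted_cadlag P F r -> {ae P, forall w, r 0 w = h0} ->
  0 < rho -> 0 < e -> exists2 t, 0 < t &
  pr P (~` [set w | forall u, 0 <= u -> u <= t -> `|r u w - h0| <= rho]) <= e.
Proof.
move=> acr r0 rho0 e0.
pose B t := [set w | forall u, 0 <= u -> u <= t -> `|r u w - h0| <= rho].
have mB t : 0 <= t -> measurable (B t).
  by move=> t0; apply: (F_measurable usualF t0); exact: ball_event.
have inv0 n : 0 <= n.+1%:R^-1 :> R by rewrite invr_ge0.
have ndB : nondecreasing_seq (fun n => B n.+1%:R^-1).
  move=> n n' nn'; apply/subsetPset => w Bw u u0 un.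
  by apply: Bw => //; apply: le_trans un _; rewrite lef_pV2 ?posrE// ler_nat.
have cB := pr_bigcup_cvg (P := P) (fun n => mB _ (inv0 n)) ndB.
have B1 : pr P (\bigcup_n B n.+1%:R^-1) = 1.
  rewrite -[RHS](pr_setT P).
  have [|_ ->//] := @ae_eq_set _ _ _ P (complete_P usualF) (\bigcup_n B n.+1%:R^-1) setT measurableT.
  have [_ cr] := acr; apply: filterS2 r0 cr => w r0w cw; split=> // _.
  have [del del0 delP] := cadlag_right cw (lexx 0) rho0.
  have [n nP] := inv_lt_eps del0; exists n => // u u0 un.
  by rewrite -r0w; apply/ltW/delP => //; rewrite add0r; exact: le_lt_trans nP.
rewrite B1 in cB; have [n nP] := (seq_limP _ _).1 cB e e0.
exists n.+1%:R^-1; first by rewrite invr_gt0.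
rewrite (prC P (mB _ (inv0 n))); have := nP n (leqnn n).
by rewrite distrC => /ltW; apply: le_trans; exact: ler_norm.
Qed.

Hypothesis ntX : nontrivial_components P X.

(* Otherwise the martingale part of the equation for [eta] has a positive
   variance. *)
Lemma deterministic_orthogonal eta zeta h0 r k : adj eta zeta -> deterministic eta ->
  weak h0 r -> ip eta (sigma k h0) = 0.
Proof.
move=> ez deta wr; apply/eqP/negPn/negP => ck.
have [f cf fP] := deterministic_path deta wr.
have [J [intJ eqJ]] := solution_equation wr ez.
have r0 := solution_initial wr.
pose c l := ip eta (sigma l h0).
pose q := levy_variance P X c.
have q0 : 0 < q by apply: (levy_variance_gt0 usualF levyX martX ntX); exists k.
pose v l := levy_variance P X (unit_coef l).
have v0 l : 0 <= v l by have [] := component_orthogonal l.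
pose SV := m%:R * \sum_l v l.
have SV0 : 0 <= SV by rewrite mulr_ge0// sumr_ge0.
(* The tolerance [rho] must be small against the variance [q] of the martingale with the
   coefficients frozen at [h0]. *)
have [rho rho0 rhoP] : exists2 rho : R, 0 < rho & rho ^+ 2 * SV <= q / 4.
  exists (Num.min 1 (q / 4 / (SV + 1))).
    by rewrite lt_min ltr01/= !divr_gt0// ltr_wpDl.
  set x := Num.min _ _.
  have x1 : x <= 1 by rewrite ge_min lexx.
  have x2 : x <= q / 4 / (SV + 1) by rewrite ge_min lexx orbT.
  have x0 : 0 <= x by rewrite le_min ler01 !divr_ge0 ?addr_ge0// ltW.
  rewrite ler_pdivlMr ?ltr_wpDl// in x2; apply: le_trans x2.
  by rewrite expr2 -mulrA ler_wpM2l// (@le_trans _ _ SV) ?ler_piMl ?lerDl.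
have [L L0 LP] := common_lipschitz lip_sigma.
(* On the ball of this radius around [h0] the Lipschitz coefficients [ip eta (sigma l _)] vary by at
   most [rho]. *)
pose radius := rho / (`|eta| * L + 1).
have rad0 : 0 < radius by rewrite divr_gt0// ltr_wpDl// mulr_ge0// ltW.
pose C := `|zeta| * (`|h0| + radius) + `|ip eta a|.
pose B t := [set w | forall u, 0 <= u -> u <= t -> `|r u w - h0| <= radius].
pose g t := f t - ip eta h0.
have [G _ GP] := cadlag_bounded 1 cf.
apply: (@projection_degenerate _ _ _ P F usualF m (component X) v component_orthogonal
  (fun l s w => ip eta (sigma l (r s w))) _ J (fun l => coefficient_left_limit l eta wr.1) intJ
  B c rho C (fun s w => ip zeta (r s w) + ip eta a) g _ _ _ _ _ _ _ q (G + `|ip eta h0|)) => //.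
- by move=> s s0; apply: ball_event => //; exact: wr.1.
- by move=> s u s0 su w Bw x x0 xs; apply: Bw => //; exact: le_trans su.
- move=> s u w l u0 us /(_ u u0 us) Bw; rewrite /c -(ipBr ipH).
  apply: le_trans (cauchy_schwarz ipH _ _) _.
  apply: (@le_trans _ _ (`|eta| * (L * radius))).
    by rewrite ler_wpM2l//; apply: le_trans (LP _ _ _) _; rewrite ler_wpM2l// ltW.
  rewrite mulrA /radius mulrA ler_pdivrMr; last by rewrite ltr_wpDl ?mulr_ge0 ?(ltW L0).
  by rewrite [leRHS]mulrC ler_wpM2r ?lerDl// ltW.
- move=> s u w u0 us /(_ u u0 us) Bw; apply: le_trans (ler_normD _ _) _; rewrite lerD2r.
  apply: le_trans (cauchy_schwarz ipH _ _) _; rewrite ler_wpM2l//.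
  by rewrite -(subrK h0 (r u w)) addrC; apply: le_trans (ler_normD _ _) _; rewrite lerD2l.
- by rewrite addr_ge0// mulr_ge0// addr_ge0// ltW.
- have [|w [r0w fw]] := @ae_exists (fun w => r 0 w = h0 /\ forall t, 0 <= t -> ip eta (r t w) = f t).
    by apply: filterS2 r0 fP => w.
  by rewrite /g -(fw 0 (lexx _)) r0w subrr.
- apply: filterS2 eqJ fP => w [_ bm eqw] fw; split=> // t t0.
  by rewrite /g -fw// eqw.
- move=> t t0; rewrite -[t in RHS]subr0 -(increment_variance usualF levyX martX c (lexx 0) t0).
  apply: eq_expect => w; rewrite /terminal /levy_combination /combination -sumrB.
  by congr (_ ^+ 2); apply: eq_bigr => l _; rewrite mulrBr.
- move=> s s0 s1; apply: le_trans (ler_normB _ _) _; rewrite lerD2r; exact: GP.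
- by rewrite -mulr_sumr mulrCA.
- by move=> e e0; apply: ball_event_small => //; exact: wr.1.
Qed.

(** Without a martingale part, [ip zeta r + ip eta a] is the right derivative of the deterministic
    path of [eta], and thus deterministic. *)
Lemma deterministic_adjoint eta zeta : adj eta zeta -> deterministic eta ->
  (forall k h, ip eta (sigma k h) = 0) -> deterministic zeta.
Proof.
move=> ez deta orth h0 r wr.
have [f cf fP] := deterministic_path deta wr.
have [J [intJ eqJ]] := solution_equation wr ez.
have J0 : {ae P, forall w k t, 0 <= t -> J k t w = 0}.
  apply: ae_countable => k; apply: (integral_zero usualF (component_orthogonal k)).
  have := intJ k; congr (stochastic_integral _ _ _ _ _).
  by apply/funext => s; apply/funext => w; rewrite orth.
exists (fun t => lim (h^-1 * (f (t + h) - f t) @[h --> 0^'+]) - ip eta a) => t t0.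
apply: filterS3 fP J0 eqJ => w fw J0w [cw bm eqw].
have E s : 0 <= s -> f s = ip eta h0 + \int[mu]_(u in `[0, s]) (ip zeta (r u w) + ip eta a).
  by move=> s0; rewrite -fw// -[LHS](subrK (ip eta h0)) eqw// big1 ?addr0 1?addrC// => k _; exact: J0w.
have right : ip zeta (r u w) + ip eta a @[u --> t^'+] --> ip zeta (r t w) + ip eta a.
  by apply: cvgD; [have [] := cadlag_ip ipH zeta cw t0|exact: cvg_cst].
have := Rintegral_right_lim bm t0 right => lim1.
suff -> : lim (h^-1 * (f (t + h) - f t) @[h --> 0^'+]) = ip zeta (r t w) + ip eta a by rewrite addrK.
apply: cvg_lim => //; apply: cvg_trans lim1; apply: near_eq_cvg; near=> h.
have h0' : 0 < h by near: h; exact: nbhs_right_gt.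
by rewrite !E ?addr_ge0// ?ltW//; congr (_ * _); ring.
Unshelve. all: end_near. Qed.

Lemma adjoint_combination n (v Av : 'I_n -> H) (c : 'I_n -> R) :
  (forall i, D (v i) /\ A (v i) = Av i) ->
  D (\sum_i c i *: v i) /\ A (\sum_i c i *: v i) = \sum_i c i *: Av i.
Proof.
move=> vP; apply: (adj_closed ipH semiS pcS genA) => xi zeta xz.
rewrite !(ip_sumr ipH); apply: eq_bigr => i _; have [Di <-] := vP i.
by rewrite (xz _ Di).
Qed.

(** On the graph of the adjoint, the functional [ip zeta w - ip xi g] vanishes wherever [xi] is
    orthogonal to all [v i], so it is a combination of the [ip (v i) xi]. Moving the combination
    into [g] leaves the criterion of [adj_closed]. *)
Lemma orthogonal_generator n (v : 'I_n -> H) g w :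
  (forall xi zeta, adj xi zeta -> (forall i, ip (v i) xi = 0) -> ip zeta w = ip xi g) ->
  exists c : 'I_n -> R, D w /\ A w = g + \sum_i c i *: v i.
Proof.
move=> vg; pose G := [set p : H * H | adj p.1 p.2].
have linG : linear_set G.
  split; first exact: adj0.
  by move=> c x y Gx Gy h Dh; rewrite !(ipDl ipH) !(ipZl ipH) Gx// Gy.
have [c p q _ _|i c p q|p Gp vp|c cP] := @functional_combination _ _ n G
  (fun p => ip p.2 w - ip p.1 g) (fun i p => ip (v i) p.1) linG.
- by rewrite !(ipDl ipH) !(ipZl ipH); ring.
- by rewrite (ipDr ipH) (ipZr ipH).
- by rewrite (vg _ _ Gp vp) subrr.
exists c; apply: (adj_closed ipH semiS pcS genA) => xi zeta xz.
rewrite (ipDr ipH) (ip_sumr ipH); have := cP (xi, zeta) xz => /= /eqP.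
rewrite subr_eq addrC => /eqP ->; congr (_ + _); apply: eq_bigr => i _.
by rewrite (ipC ipH).
Qed.

Lemma invariant_quasi_exponential n (v : 'I_n -> H) (W := [set x | exists c, x = \sum_i c i *: v i]) :
  (forall k h, W (sigma k h)) -> (forall i, D (v i) /\ W (A (v i))) -> quasi_exponential D A sigma.
Proof.
move=> Wsigma vD.
have WL I (s : seq I) (Q : pred I) (c : I -> R) (x : I -> H) :
    (forall i, W (x i)) -> W (\sum_(i <- s | Q i) c i *: x i).
  move=> /choice[e eP]; exists (fun j => \sum_(i <- s | Q i) c i * e i j).
  under [RHS]eq_bigr do rewrite scaler_suml; rewrite exchange_big/=.
  by apply: eq_bigr => i _; rewrite {1}eP scaler_sumr; under [RHS]eq_bigr do rewrite -scalerA.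
have DW x : W x -> D x /\ W (A x).
  move=> [c ->]; have [|Dx ->] := adjoint_combination (v := v) (Av := A \o v) c.
    by move=> i; case: (vD i).
  by split=> //; apply: WL => i; case: (vD i).
have WA p x : W x -> W (iter p A x) by elim: p => // p IH Wx; apply: (DW _ _).2; exact: IH.
split=> [k h p _|].
  have := Wsigma k h; elim: p (sigma k h) => //= p IH x Wx; split; first exact: (DW _ Wx).1.
  by apply: IH; exact: (DW _ Wx).2.
exists n, v => _ [u [uP ->]].
have [c ->] : W (\sum_k u k).
  under eq_bigr do rewrite -[u _]scale1r.
  apply: (WL _) => k; have [p [c [b [bP ->]]]] := uP k; apply: WL => i.
  by have [q [h ->]] := bP i; exact: WA.
by exists n, c, v; split=> // i; exists i.
Qed.

Lemma realization_quasi_exponential V : finite_dimensional_subspace V ->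
  affine_realization_by P F X ip D A alpha sigma V -> quasi_exponential D A sigma.
Proof.
move=> [linV [n0 [b0 Vb0]]] real.
have VN eta : (forall i, ip (b0 i) eta = 0) -> deterministic eta.
  move=> b0eta h0 r wr; have [M [[psi [_ Mpsi]] inv M0]] := real h0.
  have [_ /(_ r wr) aeM] := inv 0 h0 (lexx _) M0.
  exists (fun t => ip eta (psi t)) => t t0; apply: filterS aeM => w /(_ t t0).
  rewrite add0r Mpsi// => -[v Vv <-]; rewrite (ipDr ipH).
  suff -> : ip eta v = 0 by rewrite addr0.
  have [k [c [x [xb ->]]]] := Vb0 _ Vv; rewrite (ip_sumr ipH) big1// => i _.
  by have [j _ <-] := xb i; rewrite (ipC ipH) b0eta mulr0.
have [n [v vP]] := finite_codimension ipH deterministic_linear VN.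
have orth xi zeta k h : adj xi zeta -> (forall i, ip (v i) xi = 0) -> ip xi (sigma k h) = 0.
  move=> xz /vP dxi; have [M [_ inv M0]] := real h.
  have [[r wr] _] := inv 0 h (lexx _) M0.
  exact: deterministic_orthogonal xz dxi wr.
apply: (@invariant_quasi_exponential n v) => [k h|i].
  (* Taken with [w = 0]: as [A 0 = 0], the conclusion expresses [sigma k h] through the [v i]. This
     detour is due to orthogonality being known only for functionals in the domain of the
     adjoint. *)
  have [|c [_ cP]] := @orthogonal_generator n v (sigma k h) 0.
    by move=> xi zeta xz vxi; rewrite (ip0r ipH) (orth xi zeta).
  have [_ A0] : D 0 /\ A 0 = 0.
    by apply: (adj_closed ipH semiS pcS genA) => xi zeta _; rewrite !(ip0r ipH).
  exists (fun i => - c i); under eq_bigr do rewrite scaleNr.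
  by rewrite sumrN; apply/eqP; rewrite -addr_eq0 -cP A0.
(* Taken with [g = 0], the same lemma puts [v i] into the domain of [A] and [A (v i)] into the
   span. *)
have [|c [Dv cP]] := @orthogonal_generator n v 0 (v i); last first.
  by split=> //; exists c; rewrite cP add0r.
move=> xi zeta xz vxi; rewrite (ip0r ipH) (ipC ipH); move: i; apply/(vP zeta).
apply: (deterministic_adjoint xz); first exact/vP.
by move=> k h; exact: orth xz vxi.
Qed.

End deterministic.
End equation.

(** * The Euler scheme *)

Lemma weighted_cauchy (R : realType) n (x a : 'I_n -> R) : (forall i, 0 <= a i) ->
  (\sum_i x i * a i) ^+ 2 <= (\sum_i a i) * \sum_i x i ^+ 2 * a i.
Proof.
move=> a0; rewrite expr2 !big_distrlr/=.
apply: (@le_trans _ _ (\sum_i \sum_j (a i * a j * (x i ^+ 2 / 2) + a i * a j * (x j ^+ 2 / 2)))).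
  apply: ler_sum => i _; apply: ler_sum => j _.
  have := mulr_ge0 (mulr_ge0 (a0 i) (a0 j)) (sqr_ge0 (x i - x j)); lra.
rewrite le_eqVlt; apply/orP; left; apply/eqP.
transitivity (\sum_i \sum_j a i * a j * (x i ^+ 2 / 2) + \sum_i \sum_j a i * a j * (x j ^+ 2 / 2)).
  by rewrite -big_split/=; apply: eq_bigr => i _; rewrite big_split.
rewrite [X in X + _]exchange_big/= -big_split/=.
apply: eq_bigr => i _; rewrite -big_split/=; apply: eq_bigr => j _; lra.
Qed.

Lemma gronwall (R : realType) (u : nat -> R) (a b delta : R) n : 0 <= a -> 0 <= b -> 0 <= delta ->
  (forall l, (l <= n)%N -> u l <= a + b * delta * \sum_(j < l) u j) ->
  forall l, (l <= n)%N -> u l <= a * expR (b * delta * l%:R).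
Proof.
move=> a0 b0 d0 H; have bd := mulr_ge0 b0 d0.
have S l : (l <= n)%N -> a + b * delta * \sum_(j < l) u j <= a * expR (b * delta * l%:R).
  elim: l => [|l IH] ln; first by rewrite big_ord0 !mulr0 expR0 addr0 mulr1.
  have {}IH := IH (ltnW ln); have ul := le_trans (H l (ltnW ln)) IH.
  rewrite big_ord_recr/= mulrDr addrA -natr1 mulrDr mulr1 expRD mulrA.
  apply: (@le_trans _ _ (a * expR (b * delta * l%:R) * (1 + b * delta))).
    by rewrite mulrDr mulr1 lerD// mulrC ler_wpM2r.
  by rewrite ler_wpM2l ?expR_ge1Dx// mulr_ge0// expR_ge0.
by move=> l ln; apply: le_trans (H l ln) (S l ln).
Qed.

Section integrators.
Context {R : realType} {d : measure_display} {Omega : measurableType d}.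
Variables (P : probability Omega R) (F : R -> set (set Omega)).
Hypothesis usualF : usual_conditions P F.

(** What the scheme needs of an integrator: a variance bound and a maximal inequality for sums on
    grids. The constant is the variance rate for a martingale and the horizon [T] for time. *)
Definition good_integrator (Z : R -> Omega -> R) :=
  [/\ forall t, 0 <= t -> Fm F t (Z t), {ae P, forall w, cadlag (Z ^~ w)} &
  forall T : R, 0 <= T -> exists2 C : R, 0 <= C & forall (tau : nat -> R) n (zeta : nat -> Omega -> R),
    0 <= tau 0%N -> (forall j, tau j <= tau j.+1) -> tau n <= T ->
    (forall j, Fm F (tau j) (zeta j)) -> (forall j, L2 P (zeta j)) ->
    [/\ L2 P (grid_integral Z tau zeta n),
        expect P (fun w => grid_integral Z tau zeta n w ^+ 2) <=
          C * \sum_(j < n) expect P (fun w => zeta j w ^+ 2) * (tau j.+1 - tau j) &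
        forall e, 0 < e -> pr P [set w | exists2 i, (i <= n)%N & e <= `|grid_integral Z tau zeta i w|] <=
          C * (\sum_(j < n) expect P (fun w => zeta j w ^+ 2) * (tau j.+1 - tau j)) / e ^+ 2]].

Lemma orthogonal_good Z v : orthogonal_increments P F Z v -> {ae P, forall w, cadlag (Z ^~ w)} ->
  good_integrator Z.
Proof.
move=> orthZ cZ; have [v0 FZ _ _ _] := orthZ; split=> // T T0.
exists v => // tau n zeta tau0 tauS _ Fz Lz.
have E : \sum_(j < n) expect P (fun w => zeta j w ^+ 2) * (v * (tau j.+1 - tau j)) =
    v * \sum_(j < n) expect P (fun w => zeta j w ^+ 2) * (tau j.+1 - tau j).
  by rewrite mulr_sumr; apply: eq_bigr => j _; rewrite mulrCA.
split=> [||e e0]; first exact: (grid_L2 orthZ).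
  by rewrite (grid_variance usualF orthZ)// E.
by have := grid_maximal usualF orthZ tau0 tauS n e0 Fz Lz; rewrite -mulr_suml E.
Qed.

(** The variance bound is the Cauchy-Schwarz inequality in time. For the maximal one, all partial
    sums are dominated by the full sum of absolute values, to which Markov's inequality applies. *)
Lemma time_good : good_integrator (fun t _ => t).
Proof.
split=> [t _||T T0]; first exact: Fm_cst.
  apply: aeW => w t t0; split; first exact: cvg_at_right_filter.
  by move=> _; exists t; exact: cvg_at_left_filter.
exists T => // tau n zeta tau0 tauS tauT Fz Lz.
pose a (j : 'I_n) := tau j.+1 - tau j.
have a0 j : 0 <= a j by rewrite subr_ge0.
have tauj j : 0 <= tau j by apply: le_trans tau0 _; exact: (nondecreasing_seqP _).1.
have suma : \sum_j a j <= T.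
  rewrite -(big_mkord xpredT (fun j => tau j.+1 - tau j)) telescope_sumr//.
  by rewrite lerBlDr (le_trans tauT)// lerDl.
have Lg (f : nat -> Omega -> R) : (forall j, L2 P (f j)) -> L2 P (fun w => \sum_(j < n) f j w * a j).
  by move=> Lf; apply: L2_sum => j; under eq_fun do rewrite mulrC; exact: L2Z.
have var (f : nat -> Omega -> R) : (forall j, L2 P (f j)) ->
    expect P (fun w => (\sum_(j < n) f j w * a j) ^+ 2) <=
    T * \sum_(j < n) expect P (fun w => f j w ^+ 2) * a j.
  move=> Lf.
  have L1f (j : 'I_n) : L1 P (fun w => f j w ^+ 2 * a j).
    by under eq_fun do rewrite mulrC; exact/L1Z/L2_sqr.
  apply: (@le_trans _ _ (expect P (fun w => T * \sum_(j < n) f j w ^+ 2 * a j))).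
    apply: le_expect => [||w]; [exact/L2_sqr/Lg|exact/L1Z/L1_sum|].
    apply: le_trans (weighted_cauchy _ a0) _; rewrite ler_wpM2r// sumr_ge0// => j _.
    by rewrite mulr_ge0 ?sqr_ge0.
  rewrite expectZ; last exact: L1_sum.
  rewrite expect_sum// ler_wpM2l//; apply: ler_sum => j _.
  under [X in expect P X]eq_fun do rewrite mulrC.
  by rewrite expectZ 1?mulrC//; exact: L2_sqr.
split=> [||e e0]; [exact: Lg|exact: var|].
pose N w := \sum_(j < n) `|zeta j w| * a j.
have LN : L2 P N by apply: (Lg (fun j w => `|zeta j w|)) => j; exact: L2_norm.
apply: (@le_trans _ _ (pr P [set w | e <= `|N w|])).
  apply: le_pr.
  - rewrite (_ : [set w | _] = \bigcup_(i in `I_n.+1) [set w | e <= `|grid_integral (fun t _ => t) tau zeta i w|]).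
      apply: bigcup_measurable => i _; apply: measurable_norm_ge; apply: measurable_sum => j.
      by apply: measurable_funM => //; exact: L2_measurable (Lz j).
    apply/seteqP; split => w /=.
      by move=> [i ile ei]; exists i => //=; rewrite ltnS.
    by move=> [i /= ile ei]; exists i.
  - by apply: measurable_norm_ge; exact: L2_measurable LN.
  move=> w /= [i ile ei]; apply: le_trans ei _; apply: le_trans (ler_norm_sum _ _ _) _.
  rewrite [leRHS]ger0_norm; last by apply: sumr_ge0 => j _; rewrite mulr_ge0.
  rewrite /N (big_ord_widen n (fun j => `|zeta j w * (tau j.+1 - tau j)|) ile).
  rewrite big_mkcond/=; apply: ler_sum => j _; have := a0 j; rewrite /a => aj.
  by case: ifP => _; rewrite ?mulr_ge0// normrM (ger0_norm aj).
apply: le_trans (markov2 e0 LN) _; rewrite ler_wpM2r ?invr_ge0 ?exprn_ge0 ?(ltW e0)//.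
apply: le_trans (var (fun j w => `|zeta j w|) (fun j => L2_norm (Lz j))) _.
rewrite le_eqVlt; apply/orP; left; apply/eqP; congr (_ * _); apply: eq_bigr => j _.
by congr (_ * _); apply: eq_expect => w; rewrite real_normK ?num_real.
Qed.

Lemma good_grid_Fm Z (tau : nat -> R) zeta n : good_integrator Z ->
  0 <= tau 0%N -> (forall j, tau j <= tau j.+1) ->
  (forall j, Fm F (tau j) (zeta j)) -> Fm F (tau n) (grid_integral Z tau zeta n).
Proof.
move=> [FZ _ _] tau0 tauS Fz.
have taum i j : (i <= j)%N -> tau i <= tau j by exact: (nondecreasing_seqP _).1.
have tauj j : 0 <= tau j by apply: le_trans tau0 _; exact: taum.
apply: Fm_sum => j; apply: FmM.
  by apply: (Fm_mono usualF (tauj j)); [apply: taum; exact: ltnW|exact: Fz].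
by apply: FmB; [apply: (Fm_mono usualF (tauj j.+1)); [exact: taum|]|
  apply: (Fm_mono usualF (tauj j)); [apply: taum; exact: ltnW|]]; exact: FZ.
Qed.

End integrators.

(** * Dyadic grids *)

Section dyadic.
Context {R : realType}.

Definition dyadic (p j : nat) : R := j%:R / (2 ^ p)%:R.
Definition lag (p : nat) (t : R) : nat := Num.truncn (t * (2 ^ p)%:R).

Let two0 p : 0 < (2 ^ p)%:R :> R. Proof. by rewrite ltr0n expn_gt0. Qed.

Lemma dyadic0 p : dyadic p 0 = 0. Proof. by rewrite /dyadic mul0r. Qed.
Lemma dyadic_ge0 p j : 0 <= dyadic p j. Proof. by rewrite divr_ge0. Qed.
Lemma dyadic_le p i j : (dyadic p i <= dyadic p j) = (i <= j)%N.
Proof. by rewrite /dyadic ler_pM2r ?invr_gt0// ler_nat. Qed.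
Lemma dyadicS p j : dyadic p j <= dyadic p j.+1. Proof. by rewrite dyadic_le. Qed.
Lemma dyadic_mesh p j : dyadic p j.+1 - dyadic p j = (2 ^ p)%:R^-1.
Proof. by rewrite /dyadic -mulrBl -natrB// subSnn mul1r. Qed.

Lemma lag_itv p t : 0 <= t -> dyadic p (lag p t) <= t < dyadic p (lag p t).+1.
Proof.
move=> t0; rewrite /dyadic ler_pdivrMr// ltr_pdivlMr//.
by apply: truncn_itv; rewrite mulr_ge0// ltW.
Qed.

Lemma lag_eq p t J : dyadic p J <= t -> t < dyadic p J.+1 -> lag p t = J.
Proof.
rewrite /dyadic ler_pdivrMr// ltr_pdivlMr// => h1 h2.
by apply: truncn_def; rewrite h1.
Qed.

Lemma lag_dyadic p j : lag p (dyadic p j) = j.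
Proof. by apply: lag_eq; rewrite // /dyadic ltr_pM2r ?invr_gt0// ltr_nat. Qed.

Lemma lag_close p t : 0 <= t -> 0 <= t - dyadic p (lag p t) <= (2 ^ p)%:R^-1.
Proof.
move=> t0; have /andP[h1 h2] := lag_itv p t0.
by rewrite subr_ge0 h1/= -(dyadic_mesh p (lag p t)) lerD2r ltW.
Qed.

Lemma dyadic_refine p r j : (p <= r)%N -> dyadic p j = dyadic r (j * 2 ^ (r - p)).
Proof.
move=> pr; rewrite /dyadic -{2}(subnKC pr) expnD !natrM; field.
by rewrite !pnatr_eq0 !expn_eq0.
Qed.

Lemma lag_refine p r j : (p <= r)%N -> dyadic r j.+1 <= dyadic p (lag p (dyadic r j)).+1.
Proof.
move=> pr; rewrite (dyadic_refine _ pr) dyadic_le.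
have /andP[_] := lag_itv p (dyadic_ge0 r j).
by rewrite (dyadic_refine _ pr) /dyadic ltr_pM2r ?invr_gt0// ltr_nat.
Qed.

Lemma dyadic_small (e : R) : 0 < e -> exists N, forall p, (N <= p)%N -> (2 ^ p)%:R^-1 < e.
Proof.
move=> e0; have [N NP] := inv_lt_eps e0; exists N => p Np; apply: le_lt_trans NP.
by rewrite lef_pV2 ?posrE// ler_nat (leq_trans _ (ltn_expl p (isT : 1 < 2)%N)).
Qed.

Lemma dyadic_right (t e : R) : 0 <= t -> 0 < e ->
  exists N, forall p, (N <= p)%N -> exists j, t < dyadic p j < t + e.
Proof.
move=> t0 e0; have [N NP] := dyadic_small e0; exists N => p Np.
exists (lag p t).+1; have /andP[h1 h2] := lag_itv p t0; rewrite h2/=.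
rewrite -(subrK (dyadic p (lag p t)) (dyadic p _.+1)) dyadic_mesh addrC.
by rewrite ler_ltD// NP.
Qed.

End dyadic.

(** * Convergence estimates for Euler schemes *)

Section euler.
Context {R : realType} {d : measure_display} {Omega : measurableType d}.
Variables (P : probability Omega R) (F : R -> set (set Omega)).
Hypothesis usualF : usual_conditions P F.
Variables (K I : finType) (Z : K -> R -> Omega -> R).
Hypothesis goodZ : forall k, good_integrator P F (Z k).
Variables (V : normedModType R) (psi : R -> V) (c : K -> I -> R -> (I -> R) -> R).
Hypothesis cF : forall k i s t (x : I -> Omega -> R), 0 <= t -> (forall j, Fm F t (x j)) ->
  Fm F t (fun w => c k i s (fun j => x j w)).
Hypothesis growth : forall T : R, exists2 B : R, 0 <= B & forall s x, 0 <= s -> s <= T ->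
  \sum_k \sum_i c k i s x ^+ 2 <= B * (1 + \sum_j x j ^+ 2).
Hypothesis lip : exists2 B : R, 0 <= B & forall s s' x x', 0 <= s -> 0 <= s' ->
  \sum_k \sum_i (c k i s x - c k i s' x') ^+ 2 <= B * (`|psi s - psi s'| ^+ 2 + \sum_j (x j - x' j) ^+ 2).
Hypothesis psi_unif : forall T e : R, 0 < e -> exists2 del : R, 0 < del &
  forall s t, 0 <= s -> s <= T -> 0 <= t -> t <= T -> `|s - t| < del -> `|psi s - psi t| < e.

(** The scheme starts at 0, as [psi] will carry the initial value. *)
Fixpoint euler (p j : nat) (i : I) (w : Omega) : R :=
  if j is j'.+1 then euler p j' i w + \sum_k c k i (dyadic p j') (fun l => euler p j' l w) *
    (Z k (dyadic p j'.+1) w - Z k (dyadic p j') w)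
  else 0.

Definition coef p k i j w := c k i (dyadic p j) (fun l => euler p j l w).

(** The contribution of a single integrator, followed in continuous time with the coefficient frozen
    at the last grid point. The contributions are kept apart because each one must converge to an
    integral of its own. *)
Definition euler_int p k i t w :=
  grid_integral (Z k) (dyadic p) (coef p k i) (lag p t) w +
  coef p k i (lag p t) w * (Z k t w - Z k (dyadic p (lag p t)) w).

Definition euler_process p i t w := \sum_k euler_int p k i t w.

(* The coefficient of the scheme of level [p] on the finer grid of level [r]. *)
Definition frozen p r k i j w := coef p k i (lag p (dyadic r j : R)) w.

Lemma euler_grid p j i w : euler p j i w = \sum_k grid_integral (Z k) (dyadic p) (coef p k i) j w.
Proof.
elim: j => [|j IH] /=; first by rewrite big1// => k _; rewrite /grid_integral big_ord0.
by rewrite IH -big_split/=; apply: eq_bigr => k _; rewrite grid_integralS.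
Qed.

Lemma euler_int_cell p k i J t w : dyadic p J <= t -> t <= dyadic p J.+1 ->
  euler_int p k i t w = grid_integral (Z k) (dyadic p) (coef p k i) J w +
    coef p k i J w * (Z k t w - Z k (dyadic p J) w).
Proof.
move=> Jt; rewrite le_eqVlt => /predU1P[->|tJ]; last by rewrite /euler_int (lag_eq Jt tJ).
by rewrite /euler_int lag_dyadic subrr mulr0 addr0 grid_integralS.
Qed.

(** A cell of the fine grid lies within one cell of the coarse grid, so the coarse scheme is also a
    sum on the fine grid. In this way schemes of two levels are compared on a common grid. *)
Lemma euler_int_fine p r k i j w : (p <= r)%N ->
  euler_int p k i (dyadic r j) w = grid_integral (Z k) (dyadic r) (frozen p r k i) j w.
Proof.
move=> pr; elim: j => [|j IH].
  have l0 : lag p (dyadic r 0 : R) = 0%N by rewrite (dyadic0 r) -(dyadic0 p) lag_dyadic.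
  by rewrite /euler_int l0 /grid_integral !big_ord0 !dyadic0 subrr mulr0 addr0.
have /andP[h1 h2] := lag_itv p (@dyadic_ge0 R r j).
rewrite grid_integralS -IH (euler_int_cell _ _ _ h1 (ltW h2)).
rewrite (euler_int_cell _ _ _ (le_trans h1 (dyadicS r j)) (lag_refine j pr)) /frozen.
by rewrite -addrA -mulrDr; congr (_ + _ * _); ring.
Qed.

Lemma euler_int_dyadic p k i j w :
  euler_int p k i (dyadic p j) w = grid_integral (Z k) (dyadic p) (coef p k i) j w.
Proof. by rewrite /euler_int lag_dyadic subrr mulr0 addr0. Qed.

Lemma common_bound (T : R) : 0 <= T -> exists2 C : R, 0 <= C & forall k (tau : nat -> R) n zeta,
  0 <= tau 0%N -> (forall j, tau j <= tau j.+1) -> tau n <= T ->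
  (forall j, Fm F (tau j) (zeta j)) -> (forall j, L2 P (zeta j)) ->
    [/\ L2 P (grid_integral (Z k) tau zeta n),
        expect P (fun w => grid_integral (Z k) tau zeta n w ^+ 2) <=
          C * \sum_(j < n) expect P (fun w => zeta j w ^+ 2) * (tau j.+1 - tau j) &
        forall e, 0 < e -> pr P [set w | exists2 i, (i <= n)%N & e <= `|grid_integral (Z k) tau zeta i w|] <=
          C * (\sum_(j < n) expect P (fun w => zeta j w ^+ 2) * (tau j.+1 - tau j)) / e ^+ 2].
Proof.
move=> T0; have /choice[C CP] : forall k, exists C : R, 0 <= C /\ forall (tau : nat -> R) n zeta,
  0 <= tau 0%N -> (forall j, tau j <= tau j.+1) -> tau n <= T ->
  (forall j, Fm F (tau j) (zeta j)) -> (forall j, L2 P (zeta j)) ->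
    [/\ L2 P (grid_integral (Z k) tau zeta n),
        expect P (fun w => grid_integral (Z k) tau zeta n w ^+ 2) <=
          C * \sum_(j < n) expect P (fun w => zeta j w ^+ 2) * (tau j.+1 - tau j) &
        forall e, 0 < e -> pr P [set w | exists2 i, (i <= n)%N & e <= `|grid_integral (Z k) tau zeta i w|] <=
          C * (\sum_(j < n) expect P (fun w => zeta j w ^+ 2) * (tau j.+1 - tau j)) / e ^+ 2].
  by move=> k; have [_ _ /(_ T T0)[C C0 CP]] := goodZ k; exists C.
exists (\sum_k C k); first by apply: sumr_ge0 => k _; case: (CP k).
move=> k tau n zeta tau0 tauS tauT Fz Lz; have [C0 /(_ tau n zeta tau0 tauS tauT Fz Lz)[L E M]] := CP k.
have Ck : C k <= \sum_k C k by rewrite (bigD1 k)//= lerDl sumr_ge0// => l _; case: (CP l).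
have S0 : 0 <= \sum_(j < n) expect P (fun w => zeta j w ^+ 2) * (tau j.+1 - tau j).
  by apply: sumr_ge0 => j _; rewrite mulr_ge0 ?subr_ge0// expect_ge0// => w; exact: sqr_ge0.
split=> [//||e e0]; first by apply: le_trans E _; rewrite ler_wpM2r.
by apply: le_trans (M e e0) _; rewrite ler_wpM2r ?invr_ge0 ?exprn_ge0 ?(ltW e0)// ler_wpM2r.
Qed.

Lemma coef_L2 p k i j : (forall i, L2 P (euler p j i)) ->
  (forall i, Fm F (dyadic p j) (euler p j i)) -> L2 P (coef p k i j).
Proof.
move=> Lx Fx; have mc : measurable_fun setT (coef p k i j).
  by apply: (Fm_measurable usualF (dyadic_ge0 p j)); apply: cF => //; exact: dyadic_ge0.
split=> //; have [B B0 BP] := growth (dyadic p j).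
apply: (@L1_le _ _ _ P _ (fun w => B * (1 + \sum_j0 euler p j j0 w ^+ 2))).
- exact: measurable_funX.
- move=> w; rewrite ger0_norm ?sqr_ge0//.
  apply: le_trans (BP _ _ (dyadic_ge0 p j) (lexx _)).
  rewrite (bigD1 k)//= (bigD1 i)//= -addrA lerDl addr_ge0// sumr_ge0// => l _.
    exact: sqr_ge0.
  by apply: sumr_ge0 => l' _; exact: sqr_ge0.
- by apply: L1Z; apply: L1D; [exact: L1_cst|apply: L1_sum => l; exact: L2_sqr].
Qed.

Lemma euler_FmL2 p j : forall i, Fm F (dyadic p j) (euler p j i) /\ L2 P (euler p j i).
Proof.
elim: j => [|j IH] i.
  by split; [exact: Fm_cst|exact: L2_cst].
have FZ k t : 0 <= t -> Fm F t (Z k t) by move=> t0; have [+ _ _] := goodZ k; exact.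
have j0 := @dyadic_ge0 R p j.
have Fx l : Fm F (dyadic p j) (euler p j l) by case: (IH l).
have Lx l : L2 P (euler p j l) by case: (IH l).
have Fc k : Fm F (dyadic p j) (coef p k i j) by exact: cF.
have Lc k : L2 P (coef p k i j) by exact: coef_L2.
split.
  have -> : euler p j.+1 i = (fun w => euler p j i w + \sum_k coef p k i j w *
    (Z k (dyadic p j.+1) w - Z k (dyadic p j) w)) by [].
  have Fxi := Fm_mono usualF j0 (dyadicS p j) (Fx i).
  apply: (FmD Fxi); apply: Fm_sum => k; apply: FmM; first exact: (Fm_mono usualF j0 (dyadicS p j) (Fc k)).
  apply: FmB; first by apply: FZ; exact: dyadic_ge0.
  by apply: (Fm_mono usualF j0 (dyadicS p j)); exact: FZ.
apply: L2D => //; apply: L2_sum => k.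
have [C C0 CP] := common_bound (dyadic_ge0 p j.+1).
(* A grid whose first cell is [[dyadic p j, dyadic p j.+1]] and which is constant afterwards: the
   bound for sums then applies to a single product. *)
pose tau (n : nat) : R := if n is 0%N then dyadic p j else dyadic p j.+1.
have tauS n : tau n <= tau n.+1 by case: n => [|n] //=; exact: dyadicS.
have Ft n : Fm F (tau n) (coef p k i j).
  by case: n => [|n] //=; exact: (Fm_mono usualF j0 (dyadicS p j) (Fc k)).
have [+ _ _] := CP k tau 1%N (fun _ => coef p k i j) j0 tauS (lexx _) Ft (fun _ => Lc k).
by rewrite /grid_integral; under eq_fun do rewrite big_ord_recr big_ord0/= add0r; exact.
Qed.

Lemma euler_Fm p j i : Fm F (dyadic p j) (euler p j i). Proof. by case: (euler_FmL2 p j i). Qed.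
Lemma euler_L2 p j i : L2 P (euler p j i). Proof. by case: (euler_FmL2 p j i). Qed.
Lemma coef_Fm p k i j : Fm F (dyadic p j) (coef p k i j).
Proof. by apply: cF => [|l]; [exact: dyadic_ge0|exact: euler_Fm]. Qed.
Lemma coefL2 p k i j : L2 P (coef p k i j).
Proof. by apply: coef_L2 => l; [exact: euler_L2|exact: euler_Fm]. Qed.

Lemma frozen_Fm p r k i j : Fm F (dyadic r j) (frozen p r k i j).
Proof.
have /andP[h _] := lag_itv p (dyadic_ge0 (R := R) r j).
by apply: (Fm_mono usualF _ h); [exact: dyadic_ge0|exact: coef_Fm].
Qed.

(* The sum over the integrators costs a factor [#|K|]. *)
Lemma sum_integrals (T : R) : 0 <= T -> exists2 C : R, 0 <= C & forall (tau : nat -> R) n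
    (zeta : K -> I -> nat -> Omega -> R),
  0 <= tau 0%N -> (forall j, tau j <= tau j.+1) -> tau n <= T ->
  (forall k i j, Fm F (tau j) (zeta k i j)) -> (forall k i j, L2 P (zeta k i j)) ->
  \sum_i expect P (fun w => (\sum_k grid_integral (Z k) tau (zeta k i) n w) ^+ 2) <=
  C * \sum_(j < n) (\sum_k \sum_i expect P (fun w => zeta k i j w ^+ 2)) * (tau j.+1 - tau j).
Proof.
move=> T0; have [C C0 CP] := common_bound T0; exists (#|K|%:R * C); first by rewrite mulr_ge0.
move=> tau n zeta tau0 tauS tauT Fz Lz.
have H k i := CP k tau n (zeta k i) tau0 tauS tauT (Fz k i) (Lz k i).
have LG k i : L2 P (grid_integral (Z k) tau (zeta k i) n) by case: (H k i).
have HE k i := let: And3 _ h _ := H k i in h.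
have -> : #|K|%:R * C * \sum_(j < n) (\sum_k \sum_i expect P (fun w => zeta k i j w ^+ 2)) * (tau j.+1 - tau j) =
    \sum_i #|K|%:R * \sum_k C * \sum_(j < n) expect P (fun w => zeta k i j w ^+ 2) * (tau j.+1 - tau j).
  rewrite -mulr_sumr -mulrA; congr (_ * _); rewrite exchange_big/=.
  under [RHS]eq_bigr do rewrite -mulr_sumr; rewrite -mulr_sumr; congr (_ * _).
  under eq_bigr do rewrite mulr_suml; rewrite exchange_big/=; apply: eq_bigr => k _.
  under eq_bigr do rewrite mulr_suml; rewrite exchange_big/=; apply: eq_bigr => i _.
  by [].
apply: ler_sum => i _.
apply: (@le_trans _ _ (expect P (fun w => #|K|%:R * \sum_k grid_integral (Z k) tau (zeta k i) n w ^+ 2))).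
  apply: le_expect => [||w]; last exact: sqr_sum_le.
  - exact/L2_sqr/L2_sum.
  - by apply/L1Z/L1_sum => k; exact: L2_sqr.
rewrite expectZ; last by apply/L1_sum => k; exact: L2_sqr.
rewrite ler_wpM2l// expect_sum => [|k]; last exact: L2_sqr.
by apply: ler_sum => k _; exact: HE.
Qed.

(** Linear growth bounds the coefficients by the scheme, and the variance bound the scheme by the
    earlier coefficients; the discrete Gronwall inequality closes the circle uniformly in the
    level. *)
Lemma moment_bound (T : R) : 0 <= T -> exists2 B : R, 0 <= B & forall p J, dyadic p J <= T ->
  \sum_k \sum_i expect P (fun w => coef p k i J w ^+ 2) <= B.
Proof.
move=> T0; have [A A0 AP] := growth T; have [C C0 CP] := sum_integrals T0.
exists (A * expR (C * A * T)); first by rewrite mulr_ge0 ?expR_ge0.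
move=> p J JT.
pose u j := \sum_k \sum_i expect P (fun w => coef p k i j w ^+ 2).
pose x j := \sum_i expect P (fun w => euler p j i w ^+ 2).
have jT j : (j <= J)%N -> dyadic p j <= T by move=> jJ; apply: le_trans JT; rewrite dyadic_le.
have ux j : (j <= J)%N -> u j <= A * (1 + x j).
  move=> jJ; rewrite /u /x.
  rewrite -expect_sum => [|i]; last exact/L2_sqr/euler_L2.
  rewrite -[X in X + _](expect_cst P) -expectD; [|exact: L1_cst|by apply: L1_sum => i; exact/L2_sqr/euler_L2].
  rewrite -expectZ; last by apply: L1D; [exact: L1_cst|apply: L1_sum => i; exact/L2_sqr/euler_L2].
  under eq_bigr => k _ do (rewrite -expect_sum; last by move=> i; exact/L2_sqr/coefL2).
  rewrite -expect_sum => [|k]; last by apply: L1_sum => i; exact/L2_sqr/coefL2.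
  apply: le_expect => [||w].
  - by apply: L1_sum => k; apply: L1_sum => i; exact/L2_sqr/coefL2.
  - by apply: L1Z; apply: L1D; [exact: L1_cst|apply: L1_sum => i; exact/L2_sqr/euler_L2].
  - by apply: AP; [exact: dyadic_ge0|exact: jT].
have xu j : (j <= J)%N -> x j <= C * (2 ^ p)%:R^-1 * \sum_(l < j) u l.
  move=> jJ; rewrite /x; under eq_bigr => i _.
    under [fun w => euler p j i w ^+ 2]eq_fun do rewrite euler_grid; over.
  rewrite /=.
  apply: le_trans (CP (dyadic p) j (coef p) _ _ (jT j jJ) _ _) _.
  - by rewrite dyadic0.
  - exact: dyadicS.
  - by move=> k i l; exact: coef_Fm.
  - by move=> k i l; exact: coefL2.
  rewrite -mulrA; apply: ler_wpM2l => //; rewrite mulr_sumr; apply: ler_sum => l _.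
  by rewrite dyadic_mesh mulrC.
have uu j : (j <= J)%N -> u j <= A + (C * A) * (2 ^ p)%:R^-1 * \sum_(l < j) u l.
  move=> jJ; apply: le_trans (ux j jJ) _; rewrite mulrDr mulr1 lerD2l.
  by rewrite -!mulrA mulrCA ler_wpM2l// mulrA; exact: xu.
apply: le_trans (gronwall A0 (mulr_ge0 C0 A0) _ uu (leqnn J)) _; first by rewrite invr_ge0.
rewrite ler_wpM2l// ler_expR -mulrA ler_wpM2l ?mulr_ge0// mulrC.
exact: JT.
Qed.

(** One cell from the last grid point to [t], with frozen coefficient: the variance is at most a
    moment times the mesh. *)
Lemma increment_bound (T : R) : 0 <= T -> exists2 B : R, 0 <= B & forall p t, 0 <= t -> t <= T ->
  (forall i, L2 P (fun w => euler_process p i t w - euler p (lag p t) i w)) /\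
  \sum_i expect P (fun w => (euler_process p i t w - euler p (lag p t) i w) ^+ 2) <= B * (2 ^ p)%:R^-1.
Proof.
move=> T0; have [B B0 BP] := moment_bound T0; have [C C0 CP] := sum_integrals T0.
have [C' C'0 CP'] := common_bound T0.
exists (C * B); first exact: mulr_ge0.
move=> p t t0 tT; set J := lag p t.
have /andP[Jt tJ] := lag_itv p t0.
pose tau (n : nat) := if n is 0%N then dyadic p J else t.
have tau0 : 0 <= tau 0%N by exact: dyadic_ge0.
have tauS j : tau j <= tau j.+1 by case: j => [|j] /=.
have Fz k i j : Fm F (tau j) (coef p k i J).
  by case: j => [|j] /=; [exact: coef_Fm|apply: (Fm_mono usualF _ Jt); [exact: dyadic_ge0|exact: coef_Fm]].
have E i w : euler_process p i t w - euler p J i w =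
    \sum_k grid_integral (Z k) tau (fun _ => coef p k i J) 1 w.
  rewrite euler_grid /euler_process -sumrB; apply: eq_bigr => k _.
  by rewrite (euler_int_cell _ _ _ Jt (ltW tJ)) addrAC subrr add0r /grid_integral big_ord_recr big_ord0/= add0r.
split=> [i|].
  under eq_fun do rewrite E; apply: L2_sum => k.
  by have [] := CP' k tau 1%N (fun _ => coef p k i J) tau0 tauS tT (Fz k i) (fun _ => coefL2 p k i J).
under eq_bigr => i _.
  under [fun w => _ ^+ 2]eq_fun do rewrite E; over.
rewrite /=; apply: le_trans (CP tau 1%N (fun k i _ => coef p k i J) tau0 tauS tT Fz _) _.
  by move=> k i _; exact: coefL2.
rewrite big_ord_recr big_ord0/= add0r -mulrA ler_wpM2l//.
have /andP[h1 h2] := lag_close p t0.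
apply: ler_pM => //; last by apply: BP; exact: le_trans tT.
by apply: sumr_ge0 => k _; apply: sumr_ge0 => i _; apply: expect_ge0 => w; exact: sqr_ge0.
Qed.

Lemma frozen_difference (T e : R) : 0 <= T -> 0 < e -> exists N, forall p q r n,
  (N <= p)%N -> (N <= q)%N -> (p <= r)%N -> (q <= r)%N -> dyadic r n <= T ->
  \sum_(j < n) (\sum_k \sum_i expect P (fun w => (frozen q r k i j w - frozen p r k i j w) ^+ 2)) *
    (dyadic r j.+1 - dyadic r j) <= e.
Proof.
move=> T0 e0; have [B1 B10 lipB] := lip; have [B2 B20 incr] := increment_bound T0.
have [C C0 CP] := sum_integrals T0.
(* The factor 3 comes from squaring a sum of three terms, and [a] is such that the Gronwall bound
   [a * expR (b * T)] equals [e / (T + 1)]. Half of [a] is spent on [psi] through [om], the other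
   half on the two mesh terms, whose constants [3 * B1 * B2] add up to [6 * B1 * B2]. *)
pose b := 3 * B1 * C; have b0 : 0 <= b by rewrite !mulr_ge0.
pose a := e / ((T + 1) * expR (b * T)).
have T1 : 0 < T + 1 by rewrite ltr_wpDl.
have a0 : 0 < a by rewrite divr_gt0// mulr_gt0// expR_gt0.
have a20 : 0 < a / 2 by rewrite divr_gt0.
pose om := Num.min 1 (a / 2 / (B1 + 1)).
have B11 : 0 < B1 + 1 by rewrite ltr_wpDl.
have om0 : 0 < om by rewrite lt_min ltr01 divr_gt0.
have omP : B1 * om ^+ 2 <= a / 2.
  have o1 : om <= 1 by rewrite ge_min lexx.
  have o2 : om * (B1 + 1) <= a / 2 by rewrite -ler_pdivlMr// ge_min lexx orbT.
  apply: le_trans o2; rewrite mulrC; apply: ler_pM => //; first by rewrite exprn_ge0// ltW.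
    by rewrite expr2 ler_piMl// ltW.
  by rewrite lerDl.
have [del del0 delP] := psi_unif T om0.
have B3 : 0 < 6 * B1 * B2 + 1 by rewrite ltr_wpDl// !mulr_ge0.
have [N1 N1P] := dyadic_small del0.
have [N2 N2P] := dyadic_small (divr_gt0 a20 B3).
exists (maxn N1 N2) => p q r n; rewrite !geq_max => /andP[p1 p2] /andP[q1 q2] pr qr nT.
pose z j := \sum_k \sum_i expect P (fun w => (frozen q r k i j w - frozen p r k i j w) ^+ 2).
have z0 j : 0 <= z j by apply: sumr_ge0 => k _; apply: sumr_ge0 => i _; apply: expect_ge0 => w; exact: sqr_ge0.
have Lf k i j : L2 P (fun w => frozen q r k i j w - frozen p r k i j w).
  by apply: L2B; exact: coefL2.
have zP j : (j <= n)%N -> z j <= a + b * (2 ^ r)%:R^-1 * \sum_(l < j) z l.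
  move=> jn; pose t : R := dyadic r j.
  have t0 : 0 <= t by exact: dyadic_ge0.
  have tT : t <= T by apply: le_trans nT; rewrite dyadic_le.
  have [Lp Ep] := incr p t t0 tT; have [Lq Eq] := incr q t t0 tT.
  have dP : \sum_i expect P (fun w => (euler_process q i t w - euler_process p i t w) ^+ 2) <=
      C * (2 ^ r)%:R^-1 * \sum_(l < j) z l.
    under eq_bigr => i _.
      under [fun w => _ ^+ 2]eq_fun => w.
        rewrite (_ : euler_process q i t w - euler_process p i t w = \sum_k grid_integral (Z k) (dyadic r)
          (fun l w => frozen q r k i l w - frozen p r k i l w) j w); last first.
          rewrite /euler_process -sumrB; apply: eq_bigr => k _.
          rewrite (euler_int_fine _ _ _ _ pr) (euler_int_fine _ _ _ _ qr) /grid_integral -sumrB.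
          by apply: eq_bigr => l _; rewrite mulrBl.
        over.
      over.
    rewrite /=.
    apply: le_trans (CP (dyadic r) j (fun k i l w => frozen q r k i l w - frozen p r k i l w) _ _ tT _ Lf) _.
    - by rewrite dyadic0.
    - exact: dyadicS.
    - by move=> k i l; apply: FmB; exact: frozen_Fm.
    rewrite -mulrA; apply: ler_wpM2l => //; rewrite mulr_sumr; apply: ler_sum => l _.
    by rewrite dyadic_mesh mulrC.
  have Ld i : L2 P (fun w => euler_process q i t w - euler_process p i t w).
    have -> : (fun w => euler_process q i t w - euler_process p i t w) = (fun w =>
        (euler_process q i t w - euler q (lag q t) i w) + euler q (lag q t) i w -
        ((euler_process p i t w - euler p (lag p t) i w) + euler p (lag p t) i w)).
      by apply/funext => w; rewrite !subrK.
    by apply: L2B; apply: L2D => //; exact: euler_L2.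
  have Lx i : L2 P (fun w => euler q (lag q t) i w - euler p (lag p t) i w).
    by apply: L2B; exact: euler_L2.
  have ps : `|psi (dyadic q (lag q t)) - psi (dyadic p (lag p t))| <= om.
    have /andP[c1 c2] := lag_close p t0; have /andP[c3 c4] := lag_close q t0.
    have d1 := N1P p p1; have d2 := N1P q q1.
    apply/ltW/delP; [exact: dyadic_ge0| |exact: dyadic_ge0| |]; try lra.
    by rewrite ltr_norml; apply/andP; split; lra.
  have step : z j <= B1 * (om ^+ 2 + \sum_i expect P (fun w => (euler q (lag q t) i w - euler p (lag p t) i w) ^+ 2)).
    rewrite /z -expect_sum => [|i]; last exact: L2_sqr.
    rewrite -[X in X + _](expect_cst P) -expectD; [|exact: L1_cst|by apply: L1_sum => i; exact: L2_sqr].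
    rewrite -expectZ; last by apply: L1D; [exact: L1_cst|apply: L1_sum => i; exact: L2_sqr].
    under eq_bigr => k _ do (rewrite -expect_sum; last by move=> i; exact: L2_sqr).
    rewrite -expect_sum => [|k]; last by apply: L1_sum => i; exact: L2_sqr.
    apply: le_expect => [||w].
    - by apply: L1_sum => k; apply: L1_sum => i; exact: L2_sqr.
    - by apply: L1Z; apply: L1D; [exact: L1_cst|apply: L1_sum => i; exact: L2_sqr].
    apply: le_trans (lipB _ _ _ _ (dyadic_ge0 _ _) (dyadic_ge0 _ _)) _.
    by rewrite ler_wpM2l// lerD2r lerXn2r ?nnegrE// ltW.
  have sq3 : \sum_i expect P (fun w => (euler q (lag q t) i w - euler p (lag p t) i w) ^+ 2) <=
      3 * (B2 * (2 ^ q)%:R^-1) + 3 * (C * (2 ^ r)%:R^-1 * \sum_(l < j) z l) + 3 * (B2 * (2 ^ p)%:R^-1).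
    apply: le_trans (lerD (lerD (ler_wpM2l _ Eq) (ler_wpM2l _ dP)) (ler_wpM2l _ Ep)) => //.
    rewrite !mulr_sumr -!big_split/=; apply: ler_sum => i _.
    rewrite -!expectZ; [|exact: L2_sqr|exact: L2_sqr|exact: L2_sqr].
    rewrite -expectD; [|exact/L1Z/L2_sqr|exact/L1Z/L2_sqr].
    rewrite -expectD; [|by apply: L1D; exact/L1Z/L2_sqr|exact/L1Z/L2_sqr].
    apply: le_expect => [||w]; first exact: L2_sqr.
      by apply: L1D; [apply: L1D|]; exact/L1Z/L2_sqr.
    move: (euler_process q i t w) (euler_process p i t w) (euler q _ i w) (euler p _ i w) => x1 x2 x3 x4.
    have := sqr_ge0 ((x1 - x3) + (x1 - x2)); have := sqr_ge0 ((x1 - x2) - (x2 - x4)).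
    have := sqr_ge0 ((x1 - x3) + (x2 - x4)); lra.
  apply: le_trans step _.
  apply: le_trans (ler_wpM2l B10 (lerD (lexx _) sq3)) _.
  have small : B1 * (3 * (B2 * (2 ^ q)%:R^-1) + 3 * (B2 * (2 ^ p)%:R^-1)) <= a / 2.
    have e1 := N2P p p2; have e2 := N2P q q2.
    move: ((2 ^ p)%:R^-1) ((2 ^ q)%:R^-1) e1 e2 (invr_ge0 ((2 ^ p)%:R : R)) (invr_ge0 ((2 ^ q)%:R : R)) => dp dq e1 e2 _ _.
    have e3 : 3 * B1 * B2 * (dp + dq) <= 3 * B1 * B2 * (2 * (a / 2 / (6 * B1 * B2 + 1))).
      by rewrite ler_wpM2l ?mulr_ge0//; move: e1 e2; move: (a / 2 / _) => y; lra.
    have e4 : (6 * B1 * B2 + 1) * (a / 2 / (6 * B1 * B2 + 1)) = a / 2 by rewrite mulrC divfK// gt_eqF.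
    have e5 : 0 < a / 2 / (6 * B1 * B2 + 1) by exact: divr_gt0.
    by move: e3 e4 e5; move: (a / 2 / _) => y; lra.
  have {}ps := ps; rewrite /b.
  move: (\sum_(l < j) z l) ((2 ^ r)%:R^-1) ((2 ^ q)%:R^-1) ((2 ^ p)%:R^-1) small => s1 s2 s3 s4 small.
  lra.
have zb j : (j < n)%N -> z j <= e / (T + 1).
  move=> jn; have d0 : 0 <= (2 ^ r)%:R^-1 :> R by rewrite invr_ge0.
  apply: le_trans (gronwall (ltW a0) b0 d0 zP (ltnW jn)) _.
  have -> : e / (T + 1) = a * expR (b * T).
    by rewrite /a; field; rewrite !gt_eqF// expR_gt0.
  rewrite ler_wpM2l ?(ltW a0)// ler_expR -mulrA ler_wpM2l// mulrC.
  by apply: le_trans nT; rewrite -/(dyadic r j) dyadic_le ltnW.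
apply: (@le_trans _ _ (\sum_(j < n) e / (T + 1) * (dyadic r j.+1 - dyadic r j))).
  by apply: ler_sum => j _; rewrite ler_wpM2r ?subr_ge0 ?dyadicS//; exact: zb.
rewrite -mulr_sumr -(big_mkord xpredT (fun j => dyadic r j.+1 - dyadic r j)) telescope_sumr//.
rewrite dyadic0 subr0 mulrAC ler_pdivrMr// ler_wpM2l ?(ltW e0)//.
by apply: le_trans nT _; rewrite lerDl.
Qed.

(** The maximal inequality turns the mean-square estimate for the coefficients into a bound valid at
    all grid times at once. *)
Lemma euler_comparison (T e del : R) : 0 <= T -> 0 < e -> 0 < del -> exists N, forall p q r n k i,
  (N <= p)%N -> (N <= q)%N -> (p <= r)%N -> (q <= r)%N -> dyadic r n <= T ->
  pr P [set w | exists2 j, (j <= n)%N &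
    e <= `|euler_int q k i (dyadic r j) w - euler_int p k i (dyadic r j) w|] <= del.
Proof.
move=> T0 e0 del0; have [C C0 CP] := common_bound T0.
have C1 : 0 < C + 1 by rewrite ltr_wpDl.
have a0 : 0 < del * e ^+ 2 / (C + 1) by rewrite divr_gt0 ?mulr_gt0 ?exprn_gt0.
have [N NP] := frozen_difference T0 a0; exists N => p q r n k i Np Nq plr qlr nT.
have Fz j : Fm F (dyadic r j) (fun w => frozen q r k i j w - frozen p r k i j w).
  by apply: FmB; exact: frozen_Fm.
have Lz j : L2 P (fun w => frozen q r k i j w - frozen p r k i j w).
  by apply: L2B; exact: coefL2.
have d0 : 0 <= dyadic r 0 :> R by rewrite dyadic0.
have [_ _ /(_ e e0)GP] := CP k (dyadic r) n _ d0 (dyadicS r) nT Fz Lz.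
have Gd j w : grid_integral (Z k) (dyadic r) (fun j w => frozen q r k i j w - frozen p r k i j w) j w =
    euler_int q k i (dyadic r j) w - euler_int p k i (dyadic r j) w.
  rewrite !(euler_int_fine _ _ _ _ plr) !(euler_int_fine _ _ _ _ qlr) /grid_integral -sumrB.
  by apply: eq_bigr => l _; rewrite mulrBl.
rewrite (_ : [set w | _] = [set w | exists2 j, (j <= n)%N & e <= `|grid_integral (Z k) (dyadic r)
    (fun j w => frozen q r k i j w - frozen p r k i j w) j w|]); last first.
  by apply/seteqP; split => w /= [j jn h]; exists j => //; rewrite ?Gd// -?Gd.
apply: le_trans GP _; rewrite ler_pdivrMr ?exprn_gt0//.
apply: (@le_trans _ _ ((C + 1) * (del * e ^+ 2 / (C + 1)))); last by rewrite mulrC divfK// gt_eqF.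
apply: ler_pM => //; last 1 first.
- apply: le_trans (NP p q r n Np Nq plr qlr nT); apply: ler_sum => j _.
  rewrite ler_wpM2r ?subr_ge0 ?dyadicS//.
  have E0 k' i' : 0 <= expect P (fun w => (frozen q r k' i' j w - frozen p r k' i' j w) ^+ 2).
    by apply: expect_ge0 => w; exact: sqr_ge0.
  rewrite (bigD1 k)//= (bigD1 i)//= -addrA lerDl addr_ge0// sumr_ge0// => l _.
  exact: sumr_ge0.
- apply: sumr_ge0 => j _; rewrite mulr_ge0 ?subr_ge0 ?dyadicS// expect_ge0// => w; exact: sqr_ge0.
- by rewrite lerDl.
Qed.

End euler.

(** The left limits of the approximations form a Cauchy sequence, all of them being close to [x]
    just before [t]; their limit is the left limit of [x]. *)
Lemma cadlag_uniform (R : realType) (x : R -> R) :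
  (forall T e : R, 0 < e -> exists2 y : R -> R, cadlag y & forall t, 0 <= t -> t <= T -> `|y t - x t| <= e) ->
  cadlag x.
Proof.
move=> app t t0; split.
  apply/right_limP => e e0; have e3 : 0 < e / 3 by rewrite divr_gt0.
  have [y cy yx] := app (t + 1) (e / 3) e3.
  have [del del0 delP] := cadlag_right cy t0 e3.
  exists (Num.min del 1) => [|u tu]; first by rewrite lt_min del0 ltr01.
  rewrite -ltrBlDl lt_min => /andP[u1 u2].
  have h1 : `|y u - y t| < e / 3 by apply: delP; [exact: ltW|lra].
  have h2 := yx u (le_trans t0 (ltW tu)); have h3 := yx t t0.
  have {}h2 : `|y u - x u| <= e / 3 by apply: h2; lra.
  have {}h3 : `|y t - x t| <= e / 3 by apply: h3; lra.
  move: h1 h2 h3; rewrite !ltr_norml !ler_norml => /andP[? ?] /andP[? ?] /andP[? ?].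
  by apply/andP; split; lra.
move=> t_gt0.
have /choice[y yP] : forall n : nat, exists y : R -> R, cadlag y /\
    forall s, 0 <= s -> s <= t -> `|y s - x s| <= n.+1%:R^-1.
  by move=> n; have [|y cy yx] := app t n.+1%:R^-1; [rewrite invr_gt0|exists y].
have /choice[l lP] : forall n, exists l : R, y n u @[u --> t^'-] --> (l : R).
  by move=> n; have [cy _] := yP n; have [_ /(_ t_gt0)] := cy t t0.
have near_l n (e : R) : 0 < e -> exists2 del : R, 0 < del &
    forall u, 0 <= u -> t - del < u -> u < t -> `|x u - l n| < n.+1%:R^-1 + e.
  move=> e0; have [del del0 delP] := (left_limP _ _ _).1 (lP n) e e0.
  exists del => // u u0 ut tu; have h1 := delP u tu ut.
  have h2 := (yP n).2 u u0 (ltW tu).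
  have := ler_normD (x u - y n u) (y n u - l n); rewrite addrA subrK (distrC (x u) (y n u)) => h.
  by apply: le_lt_trans h _; apply: ler_ltD.
have cl : cvg (l n @[n --> \oo]).
  apply: cauchy_limit => e e0; have e4 : 0 < e / 4 by rewrite divr_gt0.
  have [N NP] := inv_lt_eps e4; exists N => n p Nn Np.
  have [d1 d10 d1P] := near_l n _ e4; have [d2 d20 d2P] := near_l p _ e4.
  pose m := Num.min t (Num.min d1 d2).
  have m0 : 0 < m by rewrite !lt_min t_gt0 d10.
  have mt : m <= t by rewrite ge_min lexx.
  have m1 : m <= d1 by rewrite !ge_min lexx orbT.
  have m2 : m <= d2 by rewrite !ge_min lexx !orbT.
  pose u := t - m / 2.
  have h1 : `|x u - l n| < n.+1%:R^-1 + e / 4 by apply: d1P; rewrite /u; lra.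
  have h2 : `|x u - l p| < p.+1%:R^-1 + e / 4 by apply: d2P; rewrite /u; lra.
  have Ninv i : (N <= i)%N -> i.+1%:R^-1 < e / 4.
    by move=> Ni; apply: le_lt_trans NP; rewrite lef_pV2 ?posrE// ler_nat.
  have i1 := Ninv n Nn; have i2 := Ninv p Np.
  have := ler_normD (l n - x u) (x u - l p); rewrite addrA subrK (distrC (l n) (x u)).
  move: (n.+1%:R^-1) (p.+1%:R^-1) i1 i2 h1 h2 => a b; lra.
have [L lL] : exists L : R, l n @[n --> \oo] --> (L : R) by exists (lim (l n @[n --> \oo])).
exists L; apply/left_limP => e e0; have e3 : 0 < e / 3 by rewrite divr_gt0.
have [N1 N1P] := (seq_limP _ _).1 lL _ e3; have [N2 N2P] := inv_lt_eps e3.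
pose n := maxn N1 N2.
have h1 := N1P n (leq_maxl _ _).
have h2 : n.+1%:R^-1 < e / 3.
  by apply: le_lt_trans N2P; rewrite lef_pV2 ?posrE// ler_nat ltnS leq_maxr.
have [d1 d10 d1P] := near_l n _ e3.
exists (Num.min t d1) => [|u tu ut]; first by rewrite lt_min t_gt0 d10.
have m1 : Num.min t d1 <= t by rewrite ge_min lexx.
have m2 : Num.min t d1 <= d1 by rewrite ge_min lexx orbT.
have h3 : `|x u - l n| < n.+1%:R^-1 + e / 3.
  by apply: d1P => //; [move: ut m1; lra|move: ut m2; lra].
have := ler_normD (x u - l n) (l n - L); rewrite addrA subrK.
by move: (n.+1%:R^-1) h1 h2 h3 => a; lra.
Qed.

(** * Almost sure uniform convergence along a subsequence *)

Section uniform_limit.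
Context {R : realType} {d : measure_display} {Omega : measurableType d}.
Variables (P : probability Omega R) (F : R -> set (set Omega)).
Hypothesis usualF : usual_conditions P F.

Lemma Fm_ae_cvg t (h : nat -> Omega -> R) f : 0 <= t -> (forall n, Fm F t (h n)) ->
  {ae P, forall w, h n w @[n --> \oo] --> f w} -> Fm F t f.
Proof.
move=> t0 Fh hf; have [N [mN N0 hN]] := hf.
have FN : F t (~` N) by apply: (F_setC usualF t0); apply: (F_null usualF t0); exists N; split.
apply: (Fm_ae usualF t0 (g := fun w => \1_(~` N) w * f w)); last first.
  exists N; split=> // w /= nfw; apply: contrapT => Nw; apply: nfw.
  by rewrite indicE mem_set//= mul1r.
apply: (@Fm_cvg _ _ _ F t (fun n w => \1_(~` N) w * h n w)).
  by move=> n; apply: FmM => //; exact: (Fm_indic usualF t0 FN).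
move=> w; rewrite indicE; have [wN|wN] := pselect (N w).
  by rewrite memNset//= mul0r; apply: cvg_near_cst; apply: nearW => n; rewrite mul0r.
have hw : h n w @[n --> \oo] --> f w by apply: contrapT => nh; apply: wN; exact: hN.
rewrite mem_set//= mul1r (_ : (fun n => _) = h^~ w)//.
by apply/funext => n; rewrite mul1r.
Qed.

Variables (Q : finType) (J : nat -> Q -> R -> Omega -> R).
Hypothesis FJ : forall p q t, 0 <= t -> Fm F t (J p q t).
Hypothesis cJ : forall p q, {ae P, forall w, cadlag (J p q ^~ w)}.
Hypothesis compare : forall T e del : R, 0 <= T -> 0 < e -> 0 < del -> exists N, forall p p' r n q,
  (N <= p)%N -> (N <= p')%N -> (p <= r)%N -> (p' <= r)%N -> dyadic r n <= T ->
  pr P [set w | exists2 j, (j <= n)%N & e <= `|J p' q (dyadic r j) w - J p q (dyadic r j) w|] <= del.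

Let half (l : nat) : R := (2 ^ l.+1)%:R^-1.
Let half0 l : 0 < half l. Proof. by rewrite invr_gt0 ltr0n expn_gt0. Qed.

Let mJ p q t : 0 <= t -> measurable_fun setT (J p q t).
Proof. by move=> t0; apply: (Fm_measurable usualF t0); exact: FJ. Qed.

Let level (nu : nat -> nat) l q (r : nat) := [set w | exists2 j, (j <= l.+1 * 2 ^ r)%N &
  half l <= `|J (nu l.+1) q (dyadic r j) w - J (nu l) q (dyadic r j) w|].

Let level_measurable nu l q r : measurable (level nu l q r).
Proof.
rewrite (_ : level nu l q r = \bigcup_(j in `I_(l.+1 * 2 ^ r).+1)
  [set w | half l <= `|J (nu l.+1) q (dyadic r j) w - J (nu l) q (dyadic r j) w|]).
  apply: bigcup_measurable => j _; apply: measurable_norm_ge.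
  by apply: measurable_funB; apply: mJ; exact: dyadic_ge0.
by apply/seteqP; split => w /= [j jl h]; exists j.
Qed.

(** Borel-Cantelli with the summable bounds [half l]. The comparison concerns one finite grid at a
    time, but the bad events increase under refinement, so the bound passes to their union over all
    fine grids. *)
Lemma fast_subsequence : exists2 nu : nat -> nat, forall l, (l <= nu l)%N &
  {ae P, forall w q, exists l0, forall l r j, (l0 <= l)%N -> (nu l <= r)%N -> (nu l.+1 <= r)%N ->
    dyadic r j <= l.+1%:R :> R ->
    `|J (nu l.+1) q (dyadic r j) w - J (nu l) q (dyadic r j) w| < half l}.
Proof.
have /choice[N NP] : forall l : nat, exists N, forall p p' r n q,
  (N <= p)%N -> (N <= p')%N -> (p <= r)%N -> (p' <= r)%N -> dyadic r n <= l.+1%:R :> R ->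
  pr P [set w | exists2 j, (j <= n)%N & half l <= `|J p' q (dyadic r j) w - J p q (dyadic r j) w|] <= half l.
  by move=> l; apply: compare.
(* A running maximum, because the bound number [l] involves the two levels [nu l] and [nu l.+1],
   both of which must be at least [N l]. *)
pose nu l := (\max_(i < l.+1) maxn (N i) i)%N.
have nuN l l' : (l <= l')%N -> (maxn (N l) l <= nu l')%N.
  move=> ll; have ll' : (l < l'.+1)%N by rewrite ltnS.
  exact: (leq_bigmax (Ordinal ll') (F := fun i : 'I_l'.+1 => maxn (N i) i)).
exists nu => [l|]; first by apply: leq_trans (nuN l l (leqnn _)); exact: leq_maxr.
have nuN' l l' : (l <= l')%N -> (N l <= nu l')%N by move=> ll; apply: leq_trans (nuN _ _ ll); exact: leq_maxl.
pose r0 l := maxn (nu l) (nu l.+1).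
pose B l q s := level nu l q (r0 l + s).
have mB l q s : measurable (B l q s) by exact: level_measurable.
have pB l q s : pr P (B l q s) <= half l.
  apply: (NP l (nu l) (nu l.+1) (r0 l + s)%N).
  - exact: nuN'.
  - exact: nuN'.
  - by apply: leq_trans (leq_maxl _ _) (leq_addr _ _).
  - by apply: leq_trans (leq_maxr _ _) (leq_addr _ _).
  - by rewrite /dyadic natrM mulfK// pnatr_eq0 expn_eq0.
have BS l q : nondecreasing_seq (B l q).
  apply/nondecreasing_seqP => s; apply/subsetPset => w [j jl h].
  have E : dyadic (r0 l + s) j = dyadic (r0 l + s.+1) (j * 2) :> R.
    by rewrite (@dyadic_refine _ _ (r0 l + s.+1)) ?leq_add2l// subnDl subSnn.
  exists (j * 2)%N; last by rewrite -E.
  by rewrite addnS expnSr mulnA leq_mul2r jl orbT.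
pose Bad q l := \bigcup_s B l q s.
have mBad q l : measurable (Bad q l) by exact: bigcupT_measurable.
have pBad q l : pr P (Bad q l) <= half l.
  have cB := pr_bigcup_cvg (P := P) (mB l q) (BS l q).
  apply: (ler_cvg_to cB (cvg_cst (half l))); apply: nearW => s; exact: pB.
apply: ae_countable => q.
have BC : P (lim_sup_set (Bad q)) = 0%E.
  apply: lim_sup_set_cvg0 => //.
  apply: (@le_lt_trans _ _ 1%:E); last exact: ltry.
  apply: le_trans (epsilon_trick0 xpredT (ler01 : 0 <= 1 :> R)).
  apply: lee_nneseries => [l _ _|l _]; first exact: measure_ge0.
  by rewrite [X in (X <= _)%E](prE P (mBad q l)) lee_fin div1r; exact: pBad.
exists (lim_sup_set (Bad q)); split=> //.
  by apply: bigcapT_measurable => n; apply: bigcup_measurable => k _.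
move=> w /= now; apply: contrapT => nlim; apply: now.
have [l0 l0P] : exists l0, forall l, (l0 <= l)%N -> ~ Bad q l w.
  apply: contrapT => /forallNP all; apply: nlim => l _.
  have /existsNP[l' /not_implyP[ll /contrapT Bl]] := all l.
  by exists l'.
exists l0 => l r j l0l nr nr' jl; rewrite ltNge; apply/negP => hJ; apply: (l0P l l0l).
exists (r - r0 l)%N => //; rewrite /B subnKC ?geq_max ?nr//.
exists j => //; move: jl; rewrite /dyadic ler_pdivrMr ?ltr0n ?expn_gt0//.
by rewrite -natrM ler_nat.
Qed.

Lemma uniform_limit : exists (nu : nat -> nat) (Jlim : Q -> R -> Omega -> R),
  [/\ forall l, (l <= nu l)%N, forall q t, 0 <= t -> Fm F t (Jlim q t) &
  {ae P, forall w q, cadlag (Jlim q ^~ w) /\ forall T e : R, 0 < e -> exists N,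
     forall l t, (N <= l)%N -> 0 <= t -> t <= T -> `|J (nu l) q t w - Jlim q t w| < e}].
Proof.
have [nu nul aenu] := fast_subsequence; exists nu, (fun q t w => lim (J (nu l) q t w @[l --> \oo])).
have cad : {ae P, forall w (pq : nat * Q), cadlag (J pq.1 pq.2 ^~ w)}.
  by apply: ae_countable => -[p q]; exact: cJ.
suff main : {ae P, forall w q, forall T e : R, 0 < e -> exists N,
     forall l t, (N <= l)%N -> 0 <= t -> t <= T ->
     [/\ cvg (J (nu l') q t w @[l' --> \oo]) & `|J (nu l) q t w - lim (J (nu l') q t w @[l' --> \oo])| < e]}.
  split=> // [q t t0|].
    apply: (Fm_ae_cvg t0 (h := fun l => J (nu l) q t)) => [n|]; first exact: FJ.
    by apply: filterS main => w /(_ q t 1 ltr01)[N /(_ N t (leqnn _) t0 (lexx _))[]].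
  apply: filterS2 main cad => w mw cw q; split; last first.
    by move=> T e e0; have [N NP] := mw q T e e0; exists N => l t Nl t0 tT; have [] := NP l t Nl t0 tT.
  apply: cadlag_uniform => T e e0; have [N NP] := mw q T e e0.
  exists (J (nu N) q ^~ w); first exact: (cw (nu N, q)).
  by move=> t t0 tT; apply/ltW; have [] := NP N t (leqnn _) t0 tT.
apply: filterS2 aenu cad => w nw cw q T e e0; have [l0 l0P] := nw q.
(* Bounds at the points of fine dyadic grids extend to all times by right continuity. The grid point
   to the right of [t] must still lie below [l.+1], the horizon of number [l]. *)
have step l t : (l0 <= l)%N -> 0 <= t -> t < l.+1%:R -> `|J (nu l.+1) q t w - J (nu l) q t w| <= half l.
  move=> ll t0 tl; apply/ler_addgt0Pr => a a0.
  have cd : cadlag (fun t => J (nu l.+1) q t w - J (nu l) q t w).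
    move=> s s0; have [r1 l1] := cw (nu l.+1, q) s s0; have [r2 l2] := cw (nu l, q) s s0.
    split; first exact: cvgB.
    by move=> s1; have [x1 xl1] := l1 s1; have [x2 xl2] := l2 s1; exists (x1 - x2); exact: cvgB.
  have [del del0 delP] := cadlag_right cd t0 a0.
  have m0 : 0 < Num.min del (l.+1%:R - t) by rewrite lt_min del0 subr_gt0.
  have [N NP] := dyadic_right t0 m0.
  have [j /andP[tj jt]] := NP (maxn N (maxn (nu l) (nu l.+1))) (leq_maxl _ _).
  set r := maxn _ _ in tj jt.
  have jt1 : dyadic r j < t + del by apply: lt_le_trans jt _; rewrite lerD2l ge_min lexx.
  have jt2 : dyadic r j < l.+1%:R :> R.
    by apply: (lt_le_trans jt); rewrite -lerBrDl ge_min lexx orbT.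
  have h1 := delP _ (ltW tj) jt1.
  have h2 : `|J (nu l.+1) q (dyadic r j) w - J (nu l) q (dyadic r j) w| < half l.
    apply: l0P => //; last exact: ltW.
    - by rewrite /r leq_max leq_max leqnn orbT.
    - by rewrite /r leq_max leq_max leqnn !orbT.
  move: h1 h2; set x := J _ _ (dyadic r j) w - _; set y := J _ _ t w - _ => h1 h2.
  by have := ler_normB x (x - y); rewrite opprB addrC subrK; lra.
have tele l l' t : (l0 <= l)%N -> (l <= l')%N -> 0 <= t -> t < l.+1%:R ->
    `|J (nu l') q t w - J (nu l) q t w| <= (2 ^ l)%:R^-1 - (2 ^ l')%:R^-1.
  move=> l0l ll t0 tl; elim: l' ll => [|l' IH].
    by rewrite leqn0 => /eqP ->; rewrite !subrr normr0.
  rewrite leq_eqVlt => /orP[/eqP ->|ll]; first by rewrite !subrr normr0.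
  rewrite ltnS in ll; have {}IH := IH ll.
  have h := step l' t (leq_trans l0l ll) t0.
  have {}h : `|J (nu l'.+1) q t w - J (nu l') q t w| <= half l'.
    by apply: h; apply: lt_le_trans tl _; rewrite ler_nat ltnS.
  have half2 : half l' = (2 ^ l')%:R^-1 - (2 ^ l'.+1)%:R^-1.
    rewrite /half expnS natrM; field.
    by rewrite pnatr_eq0 expn_eq0.
  rewrite half2 in h.
  have := ler_normD (J (nu l'.+1) q t w - J (nu l') q t w) (J (nu l') q t w - J (nu l) q t w).
  by rewrite addrA subrK; lra.
have [N1 N1P] := dyadic_small (divr_gt0 e0 (ltr0n R 2)).
pose N := maxn l0 (maxn N1 (Num.truncn T).+1).
have Nl0 l : (N <= l)%N -> (l0 <= l)%N by apply: leq_trans; exact: leq_maxl.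
have NN1 l : (N <= l)%N -> (N1 <= l)%N.
  by apply: leq_trans; rewrite /N leq_max leq_max leqnn orbT.
have NT l t : (N <= l)%N -> t <= T -> t < l.+1%:R.
  move=> Nl tT; apply: le_lt_trans tT _; apply: lt_le_trans (truncnS_gt T) _.
  by rewrite ler_nat (leq_trans _ (leqW Nl))// /N leq_max leq_max leqnn !orbT.
exists N => l t Nl t0 tT.
have cv : cvg (J (nu l') q t w @[l' --> \oo]).
  apply: cauchy_limit => a a0; have [N2 N2P] := dyadic_small (divr_gt0 a0 (ltr0n R 2)).
  pose M := maxn N N2.
  have h n : (M <= n)%N -> `|J (nu n) q t w - J (nu M) q t w| < a / 2.
    move=> Mn; have MN : (N <= M)%N by exact: leq_maxl.
    apply: le_lt_trans (tele M n t (Nl0 _ MN) Mn t0 (NT _ _ MN tT)) _.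
    by apply: le_lt_trans (N2P M (leq_maxr _ _)); rewrite lerBlDr lerDl invr_ge0.
  exists M => n p Mn Mp; have h1 := h n Mn; have h2 := h p Mp.
  have := ler_normB (J (nu n) q t w - J (nu M) q t w) (J (nu p) q t w - J (nu M) q t w).
  by rewrite opprB addrA subrK; lra.
split=> //.
apply: (@le_lt_trans _ _ (e / 2)); last by lra.
have cvd : `|J (nu l) q t w - J (nu l') q t w| @[l' --> \oo] -->
    `|J (nu l) q t w - lim (J (nu l') q t w @[l' --> \oo])|.
  by apply: cvg_norm; apply: cvgB => //; exact: cvg_cst.
apply: (ler_cvg_to cvd (cvg_cst (e / 2))); near=> l'.
have ll : (l <= l')%N by near: l'; exact: nbhs_infty_ge.
rewrite distrC; apply: le_trans (tele l l' t (Nl0 _ Nl) ll t0 (NT _ _ Nl tT)) _.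
apply: ltW; apply: le_lt_trans (N1P l (NN1 _ Nl)).
by rewrite lerBlDr lerDl invr_ge0.
Unshelve. all: end_near. Qed.

End uniform_limit.

(** * Riemann sums and integrals in time *)

Section riemann.
Context {R : realType}.
Notation mu := (@lebesgue_measure R).
Implicit Types (f g : R -> R).

(** The bound [x <= k / 2 + x ^+ 2 / (2 * k)] replaces the Cauchy-Schwarz inequality; [k] is so
    small that its integral over [[0, T]] is at most [e / 2]. *)
Lemma energy_cvg_integral (T : R) (phi : nat -> R -> R) f : 0 <= T ->
  (forall n, bounded_measurable (phi n)) -> bounded_measurable f ->
  energy T (fun s => phi n s - f s) @[n --> \oo] --> (0 : R) ->
  \int[mu]_(s in `[0, T]) phi n s @[n --> \oo] --> \int[mu]_(s in `[0, T]) f s.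
Proof.
move=> T0 mphi mf phif; apply/seq_limP => e e0.
pose k := e / (T + 1); have T1 : 0 < T + 1 by rewrite ltr_wpDl.
have k0 : 0 < k by exact: divr_gt0.
have [N NP] := (seq_limP _ _).1 phif (e * k) (mulr_gt0 e0 k0).
exists N => n Nn; have := NP n Nn; rewrite subr0 ger0_norm ?energy_ge0// => En.
have md : bounded_measurable (fun s => phi n s - f s).
  by apply: bounded_measurableD => //; exact: bounded_measurableN.
have ms := bounded_measurable_sqr md.
have I h : bounded_measurable h -> mu.-integrable `[0, T] (EFin \o h).
  by move=> mh; exact: bounded_measurable_integrable.
rewrite -RintegralB//; [|exact: I|exact: I].
apply: (@le_lt_trans _ _ (\int[mu]_(s in `[0, T]) (k / 2 + (2 * k)^-1 * (phi n s - f s) ^+ 2))).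
  apply: le_trans (le_normr_Rintegral _ _) _ => //; first exact: I.
  apply: le_Rintegral => //; first exact/I/bounded_measurable_norm.
    apply/I/bounded_measurableD; first exact: bounded_measurable_cst.
    exact: bounded_measurableZ.
  move=> s _; rewrite -[(phi n s - f s) ^+ 2]real_normK ?num_real//.
  move: `|_| => x; have -> : k / 2 + (2 * k)^-1 * x ^+ 2 = x + (2 * k)^-1 * (x - k) ^+ 2.
    by field; rewrite gt_eqF.
  by rewrite lerDl mulr_ge0 ?sqr_ge0// invr_ge0 mulr_ge0// ltW.
rewrite RintegralD//; [|exact/I/bounded_measurable_cst|exact/I/bounded_measurableZ].
rewrite [X in _ + X]RintegralZl//; last exact: I.
rewrite Rintegral_itv_cst// subr0 -/(energy T (fun s => phi n s - f s)).
have h1 : k / 2 * T <= e / 2.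
  rewrite mulrAC ler_wpM2r// /k mulrAC ler_pdivrMr// ler_wpM2l ?(ltW e0)//.
  by rewrite lerDl.
have h2 : (2 * k)^-1 * energy T (fun s => phi n s - f s) < e / 2.
  have -> : e / 2 = (2 * k)^-1 * (e * k) by field; rewrite gt_eqF.
  have k2 : 0 < (2 * k)^-1 by rewrite invr_gt0 mulr_gt0.
  rewrite (ltr_pM2l k2).
  exact: En.
lra.
Qed.

Lemma Rintegral_indic (a b T : R) : 0 <= a -> a <= b -> 0 <= T ->
  \int[mu]_(s in `[0, T]) (\1_(`]a, b]%classic) s : R) = Num.min b T - Num.min a T.
Proof.
move=> a0 ab T0; rewrite -(@Rintegral_indic_oc _ (Num.min a T) (Num.min b T) T).
- apply: eq_Rintegral => s; rewrite inE/= in_itv/= => /andP[s0 sT].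
  rewrite !indic_ocE gt_min le_min sT andbT; congr (nat_of_bool (_ && _))%:R.
  by rewrite [T < s]ltNge sT orbF.
- by rewrite le_min a0.
- by rewrite le_min ge_min ab/= ge_min lexx orbT.
- by rewrite ge_min lexx orbT.
Qed.

Lemma Rintegral_fin (I : finType) (c a b : I -> R) (T : R) : 0 <= T -> (forall i, 0 <= a i) ->
  (forall i, a i <= b i) ->
  \int[mu]_(s in `[0, T]) (\sum_i c i * \1_(`]a i, b i]%classic) s) =
  \sum_i c i * (Num.min (b i) T - Num.min (a i) T).
Proof.
move=> T0 a0 ab; elim: (index_enum I) => [|i s IH].
  by under eq_Rintegral do rewrite big_nil; rewrite big_nil Rintegral_itv_cst// mul0r.
under eq_Rintegral do rewrite big_cons.
have mi j : bounded_measurable (fun s => c j * \1_(`]a j, b j]%classic) s).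
  by apply: bounded_measurableZ; exact: indic_itv_bm.
have ms : bounded_measurable (fun u => \sum_(j <- s) c j * \1_(`]a j, b j]%classic) u).
  elim: s {IH} => [|j s IH]; first by under eq_fun do rewrite big_nil; exact: bounded_measurable_cst.
  by under eq_fun do rewrite big_cons; exact: bounded_measurableD.
rewrite RintegralD//; [|exact: bounded_measurable_integrable|exact: bounded_measurable_integrable].
rewrite IH big_cons; congr (_ + _); rewrite RintegralZl//; first by rewrite Rintegral_indic.
by apply: bounded_measurable_integrable => //; exact: indic_itv_bm.
Qed.

(* The left and the right Riemann sums telescope to the same limit. *)
Lemma left_limits_integral (T : R) f g : 0 <= T -> cadlag f -> left_limits f g ->
  \int[mu]_(s in `[0, T]) g s = \int[mu]_(s in `[0, T]) f s.
Proof.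
move=> T0 cf fg; have mg := left_limits_bm cf fg; have mf := cadlag_bounded_measurable cf.
have c1 := energy_cvg_integral T0 (fun n => step_bm T n f) mg (step_energy T0 cf fg).
pose h n := step T n (fun u => f (u + T / n.+1%:R)).
have hE n i : uniform T n i + T / n.+1%:R = uniform T n i.+1.
  by rewrite -(uniform_mesh T n i) addrC subrK.
have [B B0 BP] := cadlag_bounded T cf.
have hcell n s : 0 < s -> s <= T -> exists u, [/\ s <= u, u <= T, u <= s + T / n.+1%:R & h n s = f u].
  move=> s0 sT; have [||j jn jP] := @grid_cell R (uniform T n) n.+1 s.
  - by rewrite uniform0.
  - by rewrite uniform_last.
  have /andP[j1 j2] := jP.
  exists (uniform T n j.+1); split=> //; first exact: uniform_le.
    by rewrite -hE lerD2r ltW.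
  rewrite /h /step (grid_step (fun i => f (uniform T n i + T / n.+1%:R)) _ jn jP) ?hE// => i.
  exact: uniformS.
have c2 : \int[mu]_(s in `[0, T]) h n s @[n --> \oo] --> \int[mu]_(s in `[0, T]) f s.
  apply: energy_cvg_integral => // [n|]; first exact: step_bm.
  apply: (@energy_cvg0 _ T h f B) => // [n|n s s0 sT|s s0 sT]; first exact: step_bm.
    have [u [su uT _ ->]] := hcell n s s0 sT; apply: BP => //.
    by rewrite (le_trans _ su)// ltW.
  apply/seq_limP => e e0; have [del del0 delP] := cadlag_right cf (ltW s0) e0.
  have T_gt0 : 0 < T by exact: lt_le_trans sT.
  have [N NP] := inv_lt_eps (divr_gt0 del0 T_gt0).
  exists N => n Nn; have [u [su _ us ->]] := hcell n s s0 sT; apply: delP => //.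
  apply: le_lt_trans us _; rewrite ltrD2l mulrC -ltr_pdivlMr//.
  by apply: le_lt_trans NP; rewrite lef_pV2 ?posrE// ler_nat ltnS.
have E n : \int[mu]_(s in `[0, T]) h n s =
    \int[mu]_(s in `[0, T]) step T n f s + (f T - f 0) * T / n.+1%:R.
  have u0 (i : 'I_n.+1) : 0 <= uniform T n i by exact: uniform_ge0.
  have uS (i : 'I_n.+1) : uniform T n i <= uniform T n i.+1 by exact: uniformS.
  rewrite /h /step !Rintegral_fin//.
  have mesh (i : 'I_n.+1) : Num.min (uniform T n i.+1) T - Num.min (uniform T n i) T = T / n.+1%:R.
    have iT : uniform T n i.+1 <= T by exact: uniform_le.
    by rewrite !min_l ?uniform_mesh// (le_trans (uS i)).
  under eq_bigr do rewrite mesh hE; under [in RHS]eq_bigr do rewrite mesh.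
  rewrite -!mulr_suml -mulrA -mulrDl; congr (_ * _).
  apply/eqP; rewrite -subr_eq0 opprD addrA subr_eq0 -sumrB; apply/eqP.
  rewrite -(big_mkord xpredT (fun i => f (uniform T n i.+1) - f (uniform T n i))) telescope_sumr//.
  by rewrite uniform_last uniform0.
have c3 : (f T - f 0) * T / n.+1%:R @[n --> \oo] --> (0 : R).
  rewrite -[X in _ --> X](mulr0 ((f T - f 0) * T)); apply: cvgM; first exact: cvg_cst.
  exact: cvg_harmonic.
have c4 : \int[mu]_(s in `[0, T]) h n s @[n --> \oo] --> \int[mu]_(s in `[0, T]) g s.
  rewrite -[X in _ --> X]addr0; under eq_cvg do rewrite E; exact: cvgD c1 c3.
exact: (cvg_unique (@norm_hausdorff _ _) c4 c2).
Qed.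

Lemma clamp_sum (a : nat -> R) (M : R -> R) p (t : R) n : 0 <= t -> t <= dyadic p n ->
  \sum_(j < n) a j * (M (Num.min (dyadic p j.+1) t) - M (Num.min (dyadic p j) t)) =
  \sum_(j < lag p t) a j * (M (dyadic p j.+1) - M (dyadic p j)) +
    a (lag p t) * (M t - M (dyadic p (lag p t))).
Proof.
move=> t0 tn; have /andP[Jt tJ] := lag_itv p t0; set J := lag p t in Jt tJ *.
have low k : (k <= J)%N ->
    \sum_(j < k) a j * (M (Num.min (dyadic p j.+1) t) - M (Num.min (dyadic p j) t)) =
    \sum_(j < k) a j * (M (dyadic p j.+1) - M (dyadic p j)).
  move=> kJ; apply: eq_bigr => j _.
  have jt : dyadic p j.+1 <= t by apply: le_trans Jt; rewrite dyadic_le (leq_trans (ltn_ord j)).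
  by rewrite (min_l jt) (min_l (le_trans (dyadicS p j) jt)).
have [nJ|Jn] := leqP n J.
  have eJ : n = J by apply/eqP; rewrite eqn_leq nJ -(@dyadic_le R p)// (le_trans Jt).
  have et : t = dyadic p J by apply/eqP; rewrite eq_le -{1}eJ tn.
  by rewrite low// eJ -et subrr mulr0 addr0.
rewrite -(subnKC Jn); elim: (n - J.+1)%N => [|k IH].
  rewrite addn0 big_ord_recr/= low//; congr (_ + _ * (M _ - M _)).
    by rewrite min_r// ltW.
  by rewrite min_l.
rewrite addnS big_ord_recr/= IH.
have tk : t <= dyadic p (J.+1 + k) by apply: (le_trans (ltW tJ)); rewrite dyadic_le leq_addr.
by rewrite (min_r tk) (min_r (le_trans tk (dyadicS p _))) subrr mulr0 addr0.
Qed.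

(** Cells that begin after [t] contribute nothing. This allows for dropping the clipping of
    coefficients, which is under control on compact time intervals only. *)
Lemma clamp_ext (a a' : nat -> R) (M : R -> R) p (t : R) n : 0 <= t -> t <= dyadic p n ->
  (forall j, dyadic p j <= t -> a j = a' j) ->
  \sum_(j < n) a j * (M (Num.min (dyadic p j.+1) t) - M (Num.min (dyadic p j) t)) =
  \sum_(j < n) a' j * (M (Num.min (dyadic p j.+1) t) - M (Num.min (dyadic p j) t)).
Proof.
move=> t0 tn aa; have /andP[Jt _] := lag_itv p t0.
rewrite !clamp_sum// aa//; congr (_ + _); apply: eq_bigr => j _; rewrite aa//.
by apply: le_trans Jt; rewrite dyadic_le ltnW.
Qed.

End riemann.

(** * The limit of the Euler schemes *)

Section euler_limit.
Context {R : realType} {d : measure_display} {Omega : measurableType d}.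
Notation mu := (@lebesgue_measure R).
Variables (P : probability Omega R) (F : R -> set (set Omega)).
Hypothesis usualF : usual_conditions P F.
Variables (K I : finType) (Z : K -> R -> Omega -> R).
Hypothesis goodZ : forall k, good_integrator P F (Z k).
Variables (V : normedModType R) (psi : R -> V) (c : K -> I -> R -> (I -> R) -> R).
Hypothesis cF : forall k i s t (x : I -> Omega -> R), 0 <= t -> (forall j, Fm F t (x j)) ->
  Fm F t (fun w => c k i s (fun j => x j w)).
Hypothesis growth : forall T : R, exists2 B : R, 0 <= B & forall s x, 0 <= s -> s <= T ->
  \sum_k \sum_i c k i s x ^+ 2 <= B * (1 + \sum_j x j ^+ 2).
Hypothesis lip : exists2 B : R, 0 <= B & forall s s' x x', 0 <= s -> 0 <= s' ->
  \sum_k \sum_i (c k i s x - c k i s' x') ^+ 2 <= B * (`|psi s - psi s'| ^+ 2 + \sum_j (x j - x' j) ^+ 2).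
Hypothesis psi_unif : forall T e : R, 0 < e -> exists2 del : R, 0 < del &
  forall s t, 0 <= s -> s <= T -> 0 <= t -> t <= T -> `|s - t| < del -> `|psi s - psi t| < e.
Hypothesis c_cadlag : forall k i (x : I -> R -> R), (forall j, cadlag (x j)) ->
  cadlag (fun s => c k i s (fun j => x j s)).
Local Notation eint := (euler_int Z c).
Local Notation ecoef := (coef Z c).

Let ZF k t : 0 <= t -> Fm F t (Z k t). Proof. by move=> t0; have [+ _ _] := goodZ k; exact. Qed.
Let ecF p k i j : Fm F (dyadic p j) (ecoef p k i j). Proof. exact: (coef_Fm usualF goodZ cF growth). Qed.

Lemma euler_int_clamp p k i t w n : 0 <= t -> t <= dyadic p n -> eint p k i t w =
  \sum_(j < n) ecoef p k i j w * (Z k (Num.min (dyadic p j.+1) t) w - Z k (Num.min (dyadic p j) t) w).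
Proof. by move=> t0 tn; rewrite (clamp_sum (fun j => ecoef p k i j w) (Z k ^~ w) t0 tn). Qed.

Lemma euler_int_Fm p k i t : 0 <= t -> Fm F t (eint p k i t).
Proof.
move=> t0; have /andP[h _] := lag_itv p t0; have d0 := @dyadic_ge0 R p (lag p t).
have d00 : 0 <= dyadic p 0 :> R by rewrite dyadic0.
apply: FmD.
  apply: (Fm_mono usualF d0 h).
  by apply: (good_grid_Fm usualF (goodZ k) d00 (dyadicS p)) => j; exact: ecF.
apply: FmM; first by apply: (Fm_mono usualF d0 h); exact: ecF.
apply: FmB; first exact: ZF.
by apply: (Fm_mono usualF d0 h); exact: ZF.
Qed.

Lemma euler_int_cadlag p k i w : cadlag (Z k ^~ w) -> cadlag (eint p k i ^~ w).
Proof.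
move=> cZ t t0; have /andP[Jt tJ] := lag_itv p t0; set J := lag p t in Jt tJ.
pose A j := grid_integral (Z k) (dyadic p) (ecoef p k i) j w.
pose B j := ecoef p k i j w.
have lim (Fl : set_system R) (FF : Filter Fl) j l : Z k u w @[u --> Fl] --> l ->
    (\forall u \near Fl, dyadic p j <= u /\ u <= dyadic p j.+1) ->
    eint p k i u w @[u --> Fl] --> A j + B j * (l - Z k (dyadic p j) w).
  move=> Zl near_j.
  have cv : A j + B j * (Z k u w - Z k (dyadic p j) w) @[u --> Fl] --> A j + B j * (l - Z k (dyadic p j) w).
    apply: cvgD; first exact: cvg_cst.
    apply: cvgM; first exact: cvg_cst.
    by apply: cvgB => //; exact: cvg_cst.
  apply: cvg_trans cv; apply: near_eq_cvg; apply: filterS near_j => u [u1 u2].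
  by rewrite (euler_int_cell _ _ _ _ _ u1 u2).
have [Zr Zl] := cZ t t0; split.
  rewrite (euler_int_cell _ _ _ _ _ Jt (ltW tJ)); apply: lim => //.
  near=> u; split.
    by apply: (le_trans Jt); apply/ltW; near: u; exact: nbhs_right_gt.
  by apply/ltW; near: u; exact: nbhs_right_lt.
move=> t_gt0; have [l Zl'] := Zl t_gt0.
(* At a grid point the left limit belongs to the preceding cell, whose right end is [t]. *)
have [j j1 j2] : exists2 j, dyadic p j < t & t <= dyadic p j.+1.
  have [e|ne] := eqVneq t (dyadic p J); last by exists J; rewrite ?ltW// lt_neqAle eq_sym ne.
  case: J e Jt tJ => [|J'] e Jt tJ; first by move: t_gt0; rewrite e dyadic0 ltxx.
  exists J'; rewrite e// /dyadic ltr_pM2r ?ltr_nat// invr_gt0 ltr0n expn_gt0//.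
exists (A j + B j * (l - Z k (dyadic p j) w)); apply: lim => //.
near=> u; split; first by apply/ltW; near: u; exact: nbhs_left_gt.
by apply: le_trans j2; apply/ltW; near: u; exact: nbhs_left_lt.
Unshelve. all: end_near. Qed.

Definition clip (b x : R) := Num.max (- b) (Num.min b x).

Lemma clip_bound b x : 0 <= b -> `|clip b x| <= b.
Proof.
move=> b0; rewrite /clip ler_norml le_max lexx/= ge_max ge_min lexx/= andbT.
by rewrite (le_trans _ b0)// oppr_le0.
Qed.

Lemma clip_id b x : `|x| <= b -> clip b x = x.
Proof. by rewrite ler_norml => /andP[h1 h2]; rewrite /clip min_r// max_r. Qed.

Lemma clip_measurable b : measurable_fun setT (clip b).
Proof. by apply: measurable_maxr => //; exact: measurable_minr. Qed.

Section combination.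
Variables (nu : nat -> nat) (theta : I -> R) (k : K).

(* The coefficients of simple processes have to be bounded; on a compact time
   interval, the clipping has no effect for large [l]. *)
Definition euler_simple (l : nat) : @simple R d Omega :=
  @Simple R d Omega (l * 2 ^ nu l) (fun j => dyadic (nu l) j) (fun j => dyadic (nu l) j.+1)
    (fun j w => clip l%:R (\sum_i theta i * ecoef (nu l) k i j w)).

Lemma euler_simple_predictable l : simple_predictable F (euler_simple l).
Proof.
move=> j; split; [exact: dyadic_ge0|exact: dyadicS| |].
  by exists l%:R => w; exact: clip_bound.
rewrite borel_R; apply/(FmP usualF _ (dyadic_ge0 _ _)).
apply: (@Fm_comp _ _ _ F _ (clip l%:R)); first exact: clip_measurable.
by apply: Fm_sum => i; apply: FmM; [exact: Fm_cst|exact: ecF].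
Qed.

End combination.

Definition limit_integrand (Jl : K * I -> R -> Omega -> R) k i s w :=
  c k i s (fun j => \sum_k' Jl (k', j) s w).

Lemma euler_limit : exists (nu : nat -> nat) (Jl : K * I -> R -> Omega -> R),
  [/\ forall l, (l <= nu l)%N, forall q t, 0 <= t -> Fm F t (Jl q t) &
  {ae P, forall w, forall q, cadlag (Jl q ^~ w) /\ forall T e : R, 0 < e -> exists N,
     forall l t, (N <= l)%N -> 0 <= t -> t <= T -> `|eint (nu l) q.1 q.2 t w - Jl q t w| < e}].
Proof.
apply: (uniform_limit usualF (Q := (K * I)%type) (J := fun p q => eint p q.1 q.2)).
- by move=> p q t; exact: euler_int_Fm.
- by move=> p q; have [_ + _] := goodZ q.1; apply: filterS => w; exact: euler_int_cadlag.
- move=> T e del T0 e0 del0.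
  have [N NP] := euler_comparison usualF goodZ cF growth lip psi_unif T0 e0 del0.
  by exists N => p p' r n q *; exact: NP.
Qed.

Section path.
Variables (nu : nat -> nat) (Jl : K * I -> R -> Omega -> R) (w : Omega).
Hypothesis nul : forall l, (l <= nu l)%N.
Hypothesis cJl : forall q, cadlag (Jl q ^~ w).
Hypothesis unif : forall q (T e : R), 0 < e -> exists N,
  forall l t, (N <= l)%N -> 0 <= t -> t <= T -> `|eint (nu l) q.1 q.2 t w - Jl q t w| < e.

Let y k i s := limit_integrand Jl k i s w.

Lemma cadlag_sum (J : finType) (x : J -> R -> R) : (forall j, cadlag (x j)) ->
  cadlag (fun t => \sum_j x j t).
Proof.
move=> cx; elim: (index_enum J) => [|j s IH].
  under eq_fun do rewrite big_nil; move=> t t0.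
  by split=> [|_]; [exact: cvg_cst|exists 0; exact: cvg_cst].
under eq_fun do rewrite big_cons; move=> t t0.
have [r1 l1] := cx j t t0; have [r2 l2] := IH t t0; split; first exact: cvgD.
by move=> s0; have [a1 al1] := l1 s0; have [a2 al2] := l2 s0; exists (a1 + a2); exact: cvgD.
Qed.

Lemma integrand_cadlag k i : cadlag (y k i).
Proof. by apply: c_cadlag => j; apply: cadlag_sum => k'. Qed.

Lemma uniform_all (T e : R) : 0 < e -> exists N, forall l t q, (N <= l)%N -> 0 <= t -> t <= T ->
  `|eint (nu l) q.1 q.2 t w - Jl q t w| < e.
Proof.
move=> e0; have /choice[N NP] : forall q, exists N, forall l t, (N <= l)%N -> 0 <= t -> t <= T ->
  `|eint (nu l) q.1 q.2 t w - Jl q t w| < e by move=> q; exact: unif.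
exists (\max_q N q)%N => l t q Nl; apply: NP; apply: leq_trans Nl; exact: leq_bigmax.
Qed.

(** The Lipschitz condition at equal times, where the term with [psi] disappears; the state is close
    to its limit because each of the finitely many contributions is. *)
Lemma coef_close (T e : R) : 0 < e -> exists N, forall l j k i, (N <= l)%N -> dyadic (nu l) j <= T ->
  `|ecoef (nu l) k i j w - y k i (dyadic (nu l) j)| < e.
Proof.
move=> e0; have [B B0 BP] := lip.
pose C := B * (#|I|%:R * #|K|%:R ^+ 2).
have C0 : 0 <= C by rewrite !mulr_ge0.
have C1 : 0 < C + 1 by rewrite ltr_wpDl.
pose eta := Num.min 1 (e ^+ 2 / (C + 1)).
have eta0 : 0 < eta by rewrite lt_min ltr01 divr_gt0// exprn_gt0.
have etaP : C * eta ^+ 2 < e ^+ 2.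
  have o1 : eta <= 1 by rewrite ge_min lexx.
  have o2 : eta * (C + 1) <= e ^+ 2 by rewrite -ler_pdivlMr// ge_min lexx orbT.
  have o3 : C * eta ^+ 2 <= eta * C.
    by rewrite mulrC ler_wpM2r// expr2 ler_piMl// ltW.
  by move: o2; rewrite mulrDr mulr1; lra.
have [N NP] := uniform_all T eta0; exists N => l j k i Nl jT.
set s := dyadic (nu l) j in jT *.
have s0 : 0 <= s by exact: dyadic_ge0.
have xs i' : `|euler Z c (nu l) j i' w - \sum_k' Jl (k', i') s w| <= #|K|%:R * eta.
  rewrite euler_grid -sumrB; apply: le_trans (ler_norm_sum _ _ _) _.
  rewrite [#|K|%:R * eta]mulr_natl -sumr_const; apply: ler_sum => k' _.
  by rewrite -euler_int_dyadic; apply: ltW; exact: (NP l s (k', i')).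
have h := BP s s (fun i' => euler Z c (nu l) j i' w) (fun i' => \sum_k' Jl (k', i') s w) s0 s0.
rewrite subrr normr0 expr0n/= add0r in h.
have h2 : \sum_i' (euler Z c (nu l) j i' w - \sum_k' Jl (k', i') s w) ^+ 2 <= #|I|%:R * (#|K|%:R * eta) ^+ 2.
  rewrite [#|I|%:R * _]mulr_natl -sumr_const; apply: ler_sum => i' _.
  rewrite -[leLHS]real_normK ?num_real// lerXn2r ?nnegrE ?mulr_ge0 ?(ltW eta0)//.
have h3 : (ecoef (nu l) k i j w - y k i s) ^+ 2 < e ^+ 2.
  apply: le_lt_trans etaP; apply: (@le_trans _ _ (B * (#|I|%:R * (#|K|%:R * eta) ^+ 2))); last first.
    by rewrite exprMn /C !mulrA.
  apply: le_trans (ler_wpM2l B0 h2); apply: le_trans h.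
  rewrite (bigD1 k)//= (bigD1 i)//= -addrA lerDl addr_ge0//; apply: sumr_ge0 => q _; first exact: sqr_ge0.
  by apply: sumr_ge0 => q' _; exact: sqr_ge0.
rewrite ltNge; apply/negP => le_e; move: h3; rewrite ltNge => /negP; apply.
by rewrite -[leRHS]real_normK ?num_real// lerXn2r ?nnegrE// ltW.
Qed.

Variables (theta : I -> R) (k : K).
Let yt s := \sum_i theta i * y k i s.
Let Th := \sum_i `|theta i|.

Lemma combined_cadlag : cadlag yt.
Proof.
apply: cadlag_sum => i t t0; have [r l] := integrand_cadlag k i t0; split.
  by apply: cvgM; [exact: cvg_cst|].
by move=> /l[a al]; exists (theta i * a); apply: cvgM => //; exact: cvg_cst.
Qed.

Lemma combined_close (T e : R) : 0 < e -> exists N, forall l j, (N <= l)%N -> dyadic (nu l) j <= T ->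
  `|\sum_i theta i * ecoef (nu l) k i j w - yt (dyadic (nu l) j)| < e.
Proof.
move=> e0; have Th0 : 0 <= Th by exact: sumr_ge0.
have Th1 : 0 < Th + 1 by rewrite ltr_wpDl.
have [N NP] := coef_close T (divr_gt0 e0 Th1); exists N => l j Nl jT.
rewrite /yt -sumrB; apply: le_lt_trans (ler_norm_sum _ _ _) _.
apply: (@le_lt_trans _ _ (Th * (e / (Th + 1)))).
  rewrite /Th mulr_suml; apply: ler_sum => i _; rewrite -mulrBr normrM ler_wpM2l//.
  exact/ltW/NP.
by rewrite mulrA ltr_pdivrMr// mulrC ltr_pM2l// ltrDl.
Qed.

Lemma no_clipping (T : R) : exists N, forall l j, (N <= l)%N -> dyadic (nu l) j <= T ->
  `|\sum_i theta i * ecoef (nu l) k i j w| <= l%:R.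
Proof.
have [B B0 BP] := cadlag_bounded T combined_cadlag.
have [N NP] := combined_close T ltr01.
exists (maxn N (Num.truncn (B + 1)).+1) => l j; rewrite geq_max => /andP[Nl Bl] jT.
have h1 := NP l j Nl jT; have h2 := BP _ (dyadic_ge0 (nu l) j) jT.
have h3 : B + 1 <= l%:R.
  by apply: le_trans (ltW (truncnS_gt _)) _; rewrite ler_nat.
have := ler_normD (\sum_i theta i * ecoef (nu l) k i j w - yt (dyadic (nu l) j)) (yt (dyadic (nu l) j)).
by rewrite subrK; lra.
Qed.

Lemma horizon l (T : R) : T <= l%:R -> T <= dyadic (nu l) (l * 2 ^ nu l).
Proof. by rewrite /dyadic natrM mulfK// pnatr_eq0 expn_eq0. Qed.

Lemma simple_cell l (s : R) : 0 < s -> s <= l%:R -> exists j,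
  [/\ dyadic (nu l) j < s, s <= dyadic (nu l) j + (2 ^ nu l)%:R^-1 &
  simple_value (euler_simple nu theta k l) s w = clip l%:R (\sum_i theta i * ecoef (nu l) k i j w)].
Proof.
move=> s0 sl; have [||j jn jP] := @grid_cell R (dyadic (nu l)) (l * 2 ^ nu l) s.
- by rewrite dyadic0.
- exact: horizon.
exists j; have /andP[j1 j2] := jP; split=> //.
  by rewrite -(dyadic_mesh (nu l) j) addrC subrK.
rewrite /simple_value/=.
by rewrite (grid_step (fun j => clip l%:R (\sum_i theta i * ecoef (nu l) k i j w)) (dyadicS (nu l)) jn jP).
Qed.

Lemma large_index (T : R) : exists N, forall l, (N <= l)%N -> T <= l%:R.
Proof.
exists (Num.truncn T).+1 => l Nl; apply: le_trans (ltW (truncnS_gt _)) _.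
by rewrite ler_nat.
Qed.

Lemma euler_simple_energy (T : R) Y : 0 <= T -> left_limits yt Y ->
  energy T (fun s => simple_value (euler_simple nu theta k l) s w - Y s) @[l --> \oo] --> (0 : R).
Proof.
move=> T0 ytY; have mY := left_limits_bm combined_cadlag ytY.
have [B B0 BP] := cadlag_bounded T combined_cadlag.
have [N1 N1P] := no_clipping T; have [N2 N2P] := large_index T.
have [N3 N3P] := combined_close T ltr01.
pose N := maxn N1 (maxn N2 N3).
have NN l : [/\ (N1 <= l + N)%N, (N2 <= l + N)%N & (N3 <= l + N)%N].
  by split; apply: leq_trans (leq_addl _ _); rewrite /N !leq_max leqnn ?orbT.
(* Past [N] the horizon exceeds [T], nothing is clipped, and the coefficients are bounded; the shift
   makes this true for every index, as [energy_cvg0] requires. *)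
rewrite -(cvg_shiftn N).
have cell l s : 0 < s -> s <= T -> exists j, [/\ dyadic (nu (l + N)) j < s,
    s <= dyadic (nu (l + N)) j + (2 ^ nu (l + N))%:R^-1 &
    simple_value (euler_simple nu theta k (l + N)) s w = \sum_i theta i * ecoef (nu (l + N)) k i j w].
  move=> s0 sT; have [n1 n2 n3] := NN l.
  have [j [j1 j2 ->]] := simple_cell s0 (le_trans sT (N2P _ n2)); exists j; split=> //.
  by rewrite clip_id//; apply: N1P => //; apply: ltW; exact: lt_le_trans sT.
apply: (@energy_cvg0 _ T (fun l s => simple_value (euler_simple nu theta k (l + N)) s w) Y (B + 1)) => //.
- by move=> l; exact: simple_value_bm.
- move=> l s s0 sT; have [n1 n2 n3] := NN l; have [j [j1 j2 ->]] := cell l s s0 sT.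
  have jT : dyadic (nu (l + N)) j <= T by apply: ltW; exact: lt_le_trans sT.
  have h1 := N3P _ j n3 jT; have h2 := BP _ (dyadic_ge0 _ _) jT.
  have := ler_normD (\sum_i theta i * ecoef (nu (l + N)) k i j w - yt (dyadic (nu (l + N)) j)) (yt (dyadic (nu (l + N)) j)).
  by rewrite subrK; lra.
move=> s s0 sT; apply/seq_limP => e e0; have e2 : 0 < e / 2 by rewrite divr_gt0.
have [del del0 delP] := (left_limP _ _ _).1 (ytY s s0) _ e2.
have [N4 N4P] := combined_close T e2; have [N5 N5P] := dyadic_small del0.
exists (maxn N4 N5) => l; rewrite geq_max => /andP[l4 l5].
have [j [j1 j2 ->]] := cell l s s0 sT.
have jT : dyadic (nu (l + N)) j <= T by apply: ltW; exact: lt_le_trans sT.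
have h1 := N4P (l + N)%N j (leq_trans l4 (leq_addr _ _)) jT.
have h5 := N5P (nu (l + N)) (leq_trans l5 (leq_trans (leq_addr _ _) (nul _))).
have h2 := delP _ j1; have {}h2 : `|yt (dyadic (nu (l + N)) j) - Y s| < e / 2 by apply: h2; lra.
have := ler_normD (\sum_i theta i * ecoef (nu (l + N)) k i j w - yt (dyadic (nu (l + N)) j)) (yt (dyadic (nu (l + N)) j) - Y s).
by rewrite addrA subrK; lra.
Qed.

Lemma euler_simple_integral (t : R) : 0 <= t ->
  simple_integral (euler_simple nu theta k l) (Z k) t w @[l --> \oo] -->
  \sum_i theta i * Jl (k, i) t w.
Proof.
move=> t0; have [N1 N1P] := no_clipping t; have [N2 N2P] := large_index t.
have cv i : eint (nu l) k i t w @[l --> \oo] --> Jl (k, i) t w.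
  apply/seq_limP => e e0; have [N NP] := unif (k, i) t e0.
  by exists N => l Nl; exact: NP.
have cs : \sum_i theta i * eint (nu l) k i t w @[l --> \oo] --> \sum_i theta i * Jl (k, i) t w.
  elim: (index_enum I) => [|i s IH].
    by rewrite big_nil; under eq_cvg do rewrite big_nil; exact: cvg_cst.
  rewrite big_cons; under eq_cvg do rewrite big_cons; apply: cvgD => //.
  by apply: cvgM => //; exact: cvg_cst.
apply: cvg_trans cs; apply: near_eq_cvg; near=> l.
have l1 : (N1 <= l)%N by near: l; exact: nbhs_infty_ge.
have l2 : (N2 <= l)%N by near: l; exact: nbhs_infty_ge.
have tl := horizon (N2P l l2).
rewrite /simple_integral/=.
rewrite (@clamp_ext R (fun j => clip l%:R (\sum_i theta i * ecoef (nu l) k i j w))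
  (fun j => \sum_i theta i * ecoef (nu l) k i j w) (Z k ^~ w) (nu l) t _ t0 tl); last first.
  by move=> j jt; rewrite clip_id// N1P.
under eq_bigr => i _ do rewrite (euler_int_clamp k i w t0 tl) mulr_sumr.
rewrite exchange_big/=; apply: eq_bigr => j _; rewrite mulr_suml; apply: eq_bigr => i _.
by rewrite mulrA.
Unshelve. all: end_near. Qed.

(** For the time integrator, the simple integrals are the ordinary integrals of the simple
    processes. Their limits are known on both sides, and the integral of the left limits is that of
    the path. *)
Lemma time_integral (t : R) : 0 <= t -> (forall s, Z k s w = s) ->
  \sum_i theta i * Jl (k, i) t w = \int[mu]_(s in `[0, t]) yt s.
Proof.
move=> t0 Zs; have cy := combined_cadlag.
have [Y ytY] : exists Y, left_limits yt Y.
  have /choice[Y YP] : forall s, exists l : R, 0 < s -> yt u @[u --> s^'-] --> (l : R).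
    move=> s; have [s0|s0] := ltP 0 s; last by exists 0.
    by have [_ /(_ s0)[l]] := cy s (ltW s0); exists l.
  by exists Y.
rewrite -(left_limits_integral t0 cy ytY).
have c1 := energy_cvg_integral t0 (fun l => simple_value_bm (euler_simple nu theta k l) w)
  (left_limits_bm cy ytY) (euler_simple_energy t0 ytY).
have c2 := euler_simple_integral t0.
rewrite -(cvg_lim (@norm_hausdorff _ _) c2) -(cvg_lim (@norm_hausdorff _ _) c1).
rewrite (_ : (fun l => simple_integral (euler_simple nu theta k l) (Z k) t w) =
  (fun l => \int[mu]_(s in `[0, t]) simple_value (euler_simple nu theta k l) s w))//.
apply/funext => l.
rewrite /simple_value Rintegral_fin//=.
- by rewrite /simple_integral/=; apply: eq_bigr => j _; rewrite !Zs.
- by move=> j; exact: dyadic_ge0.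
- by move=> j; exact: dyadicS.
Qed.

End path.
End euler_limit.

(** * From quasi-exponential volatility to realizations *)

Section frames.
Context {R : realType} {H : completeNormedModType R}.
Variable ip : H -> H -> R.
Hypothesis ipH : inner_product ip.

Definition combinations n (b : 'I_n -> H) : set H := [set x | exists c : 'I_n -> R, x = \sum_i c i *: b i].

Lemma linear_set_sum (E : set H) I (s : seq I) (Q : pred I) (c : I -> R) (x : I -> H) :
  linear_set E -> (forall i, E (x i)) -> E (\sum_(i <- s | Q i) c i *: x i).
Proof.
move=> [E0 EL] Ex; elim: s => [|i s IH]; first by rewrite big_nil.
by rewrite big_cons; case: ifP => // _; exact: EL.
Qed.

Lemma combinations_linear n (b : 'I_n -> H) : linear_set (combinations b).
Proof.
split; first by exists (fun=> 0); rewrite big1// => i _; rewrite scale0r.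
move=> a x y [c ->] [c' ->]; exists (fun i => a * c i + c' i).
by rewrite scaler_sumr -big_split/=; apply: eq_bigr => i _; rewrite scalerDl scalerA.
Qed.

Lemma combinations_gen n (b : 'I_n -> H) i : combinations b (b i).
Proof.
exists (fun j => (j == i)%:R); rewrite (bigD1 i)//= eqxx scale1r big1 ?addr0// => j /negbTE ->.
by rewrite scale0r.
Qed.

Lemma linear_span_sub (B E : set H) : linear_set E -> B `<=` E -> linear_span B `<=` E.
Proof. by move=> linE BE x [n [c [b [bB ->]]]]; apply: linear_set_sum => // i; exact: BE. Qed.

Lemma sub_linear_span (B : set H) : B `<=` linear_span B.
Proof.
move=> x Bx; exists 1%N, (fun=> 1), (fun=> x); split=> //.
by rewrite big_ord_recl big_ord0 addr0 scale1r.
Qed.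

Lemma linear_span_linear (B : set H) : linear_set (linear_span B).
Proof.
split; first by exists 0%N, (fun=> 0), (fun=> 0); split; [case|rewrite big_ord0].
move=> a x y [n [c [b [bB ->]]]] [n' [c' [b' [bB' ->]]]].
exists (n + n')%N, (fun i => match fintype.split i with inl j => a * c j | inr j => c' j end),
  (fun i => match fintype.split i with inl j => b j | inr j => b' j end); split.
  by move=> i; case: (fintype.split i).
rewrite big_split_ord/= scaler_sumr; congr (_ + _); apply: eq_bigr => i _.
  by rewrite (unsplitK (inl i)) scalerA.
by rewrite (unsplitK (inr i)).
Qed.

(** Finite-dimensionality only provides a finite set whose span contains [E]; here generators inside
    [E] are needed, since for [A_sigma] they have to lie in the domain of [A]. Subtracting a
    multiple of [v0], a vector with nonzero last coordinate, reduces to one vector less. *)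
Lemma linear_subset_generators n (b : 'I_n -> H) (E : set H) : linear_set E -> E `<=` combinations b ->
  exists (n' : nat) (v : 'I_n' -> H), (forall i, E (v i)) /\ E `<=` combinations v.
Proof.
elim: n b E => [|n IH] b E linE Eb.
  by exists 0%N, b; split; [case|].
pose b' i := b (lift ord_max i); pose E' := E `&` combinations b'.
have [E0 EL] := linE.
have linE' : linear_set E'.
  have [c0 cL] := combinations_linear b'; split; first by split.
  by move=> a x y [Ex bx] [Ey bY]; split; [exact: EL|exact: cL].
have split_b c : \sum_i c i *: b i = \sum_i c (lift ord_max i) *: b' i + c ord_max *: b ord_max.
  rewrite big_ord_recr/=; congr (_ + _); apply: eq_bigr => i _.
  by rewrite widen_ord_lift.
have [sub|/existsNP[v0 /not_implyP[Ev0 nv0]]] := pselect (forall x, E x -> combinations b' x).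
  by have [n' [v [vE Ev]]] := IH b' E linE sub; exists n', v.
have [n' [v [vE Ev]]] := IH b' E' linE' (fun x => @proj2 _ _).
have [c0 c0P] := Eb _ Ev0; rewrite split_b in c0P.
have c00 : c0 ord_max != 0.
  apply/eqP => c00; apply: nv0; rewrite c0P c00 scale0r addr0.
  by exists (fun i => c0 (lift ord_max i)).
exists n'.+1, (fun i => if unlift ord_max i is Some j then v j else v0); split=> [i|x Ex].
  by case: unlift => [j|//]; exact: (vE j).1.
have [c cP] := Eb _ Ex; rewrite split_b in cP.
pose r := c ord_max / c0 ord_max.
have E'x : E' (- r *: v0 + x).
  split; first exact: EL.
  exists (fun i => - r * c0 (lift ord_max i) + c (lift ord_max i)).
  under eq_bigr do rewrite scalerDl -scalerA; rewrite big_split/= -scaler_sumr.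
  by rewrite c0P cP scalerDr addrACA scalerA mulNr divfK// -scalerDl addNr scale0r addr0.
have [c' c'P] := Ev _ E'x.
exists (fun i => if unlift ord_max i is Some j then c' j else r).
rewrite big_ord_recr/= unlift_none; under eq_bigr do rewrite widen_ord_lift liftK.
by rewrite -c'P scaleNr addrAC addNr add0r.
Qed.

(* Gram-Schmidt without discarding the vectors that become zero. *)
Lemma parseval_frame n (b : 'I_n -> H) : exists e : 'I_n -> H,
  (forall i, combinations b (e i)) /\ forall x, combinations b x -> x = \sum_i ip (e i) x *: e i.
Proof.
suff [e [eb eE eB]] : exists e : 'I_n -> H, [/\ forall i, combinations b (e i),
    forall j, e j = \sum_i ip (e i) (e j) *: e i & forall j, b j = \sum_i ip (e i) (b j) *: e i].
  exists e; split=> // x [c ->].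
  under [RHS]eq_bigr => i _ do rewrite (ip_sumr ipH) scaler_suml.
  rewrite exchange_big/=; apply: eq_bigr => j _; rewrite {1}eB scaler_sumr.
  by apply: eq_bigr => i _; rewrite scalerA.
elim: n b => [|n IH] b; first by exists b; split; case.
pose b' i := b (lift ord_max i); have [e [eb eE eB]] := IH b'.
pose pr x := \sum_i ip (e i) x *: e i.
pose u := b ord_max - pr (b ord_max).
have ue i : ip (e i) u = 0.
  rewrite /u (ipBr ipH) /pr (ip_sumr ipH) {1}(eE i) (ip_suml ipH).
  by apply/eqP; rewrite subr_eq0; apply/eqP; apply: eq_bigr => j _; rewrite mulrC (ipC ipH (e i)).
(* If [u = 0], then [f = 0], and the new vector contributes nothing to the expansion. *)
pose f := `|u|^-1 *: u.
have ff x : `|u| != 0 -> ip f x *: f = (ip u x / `|u| ^+ 2) *: u.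
  by move=> u0; rewrite /f (ipZl ipH) scalerA; congr (_ *: _); field.
have uu : ip u (b ord_max) = `|u| ^+ 2.
  have -> : b ord_max = u + pr (b ord_max) by rewrite subrK.
  rewrite (ipDr ipH) (ip_sq ipH) /pr (ip_sumr ipH) big1 ?addr0// => i _.
  by rewrite (ipC ipH u) ue mulr0.
have fu x : ip f x *: f = if u == 0 then 0 else (ip u x / `|u| ^+ 2) *: u.
  case: eqVneq => [u0|u0]; first by rewrite /f u0 scaler0 scaler0.
  by rewrite ff// normr_eq0.
exists (fun i => if unlift ord_max i is Some j then e j else f).
have sumE x : \sum_i ip (if unlift ord_max i is Some j then e j else f) x *:
    (if unlift ord_max i is Some j then e j else f) = pr x + ip f x *: f.
  rewrite big_ord_recr/= unlift_none; congr (_ + _); apply: eq_bigr => i _.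
  by rewrite widen_ord_lift liftK.
have b'b : combinations b' `<=` combinations b.
  move=> x [c ->]; apply: linear_set_sum; first exact: combinations_linear.
  by move=> i; exact: combinations_gen.
split=> [i|j|j].
- case: unliftP => [j _|_]; first exact/b'b/eb.
  have [_ L] := combinations_linear b.
  rewrite /f -[_ *: u]addr0; apply: (L _); last by case: (combinations_linear b).
  rewrite /u addrC -scaleN1r; apply: (L _); last exact: combinations_gen.
  by apply: linear_set_sum; [exact: combinations_linear|move=> i'; exact/b'b/eb].
- rewrite sumE fu; case: unliftP => [j' _|_].
    rewrite /pr -eE; case: eqVneq => _; rewrite ?addr0//.
    by rewrite (ipC ipH u) ue mul0r scale0r addr0.
  rewrite /pr big1 ?add0r => [|i _]; last by rewrite /f (ipZr ipH) ue mulr0 scale0r.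
  case: eqVneq => [u0|u0]; first by rewrite /f u0 scaler0.
  by rewrite /f (ipZr ipH) (ip_sq ipH) mulfK// expf_eq0/= normr_eq0.
- rewrite sumE fu; case: (unliftP ord_max j) => [j' ->|->].
    rewrite /pr -/(b' j') -eB; case: eqVneq => [_|u0]; rewrite ?addr0//.
    have -> : ip u (b' j') = 0.
      by rewrite eB (ip_sumr ipH) big1// => i _; rewrite (ipC ipH u) ue mulr0.
    by rewrite mul0r scale0r addr0.
  have bu : b ord_max = pr (b ord_max) + u by rewrite addrC subrK.
  rewrite {1}bu; congr (_ + _); case: eqVneq => [//|u0].
  by rewrite uu divff ?scale1r// expf_eq0/= normr_eq0.
Qed.

End frames.

Section processes_in_space.
Context {R : realType} {d : measure_display} {Omega : measurableType d}.
Variables (P : probability Omega R) (F : R -> set (set Omega)).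
Hypothesis usualF : usual_conditions P F.
Context {H : completeNormedModType R}.
Variable ip : H -> H -> R.
Hypotheses (ipH : inner_product ip) (sepH : separable H).

(** It suffices to treat open sets. By separability an open set is a countable union of balls, and
    the squared distance to a centre is a polynomial in the coordinates [x j]. *)
Lemma span_measurable n (e : 'I_n -> H) (h : H) (x : 'I_n -> Omega -> R) t B : 0 <= t ->
  (forall j, Fm F t (x j)) -> <<s (@open H) >> B ->
  F t [set w | B (h + \sum_j x j w *: e j)].
Proof.
move=> t0 Fx /(_ [set B | F t [set w | B (h + \sum_j x j w *: e j)]]); apply; split.
  have [s0 sC sU] := F_sigma usualF t0; split.
  - by rewrite /= [X in F t X](_ : _ = set0)//.
  - move=> A /= FA; have := F_setC usualF t0 FA; congr (F t _).
    by apply/seteqP; split => w /=; [split|case].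
  - move=> A FA /=; rewrite [X in F t X](_ : _ = \bigcup_n [set w | A n (h + \sum_j x j w *: e j)]).
      exact: (F_bigcup usualF t0).
    by apply/seteqP; split.
move=> U oU /=.
have [p [_ pd]] := @dense_sequence _ _ setT (0, 0) sepH I.
pose y w := h + \sum_j x j w *: e j.
pose C (m : nat) := if unpickle m is Some (i, N) then
    if pselect (forall z, `|z - (p i).1| < N.+1%:R^-1 :> R -> U z) then
      [set w | `|y w - (p i).1| ^+ 2 < N.+1%:R^-1 ^+ 2] else set0
  else set0.
have -> : [set w | U (y w)] = \bigcup_m C m.
  apply/seteqP; split => w /=; last first.
    move=> [m _]; rewrite /C; case: (unpickle m) => [[i N]|//].
    case: pselect => [zU|//] /= lt; apply: zU.
    by move: lt; rewrite ltr_pXn2r// nnegrE// invr_ge0.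
  move=> Uy; have /nbhs_ballP[r /= r0 rU] := open_nbhs_nbhs (conj oU Uy).
  have r2 : 0 < r / 2 by rewrite divr_gt0.
  have [N NP] := inv_lt_eps r2; have N0 : 0 < N.+1%:R^-1 :> R by rewrite invr_gt0.
  have [i [yi _]] := pd (y w, 0) _ I N0.
  exists (pickle (i, N)) => //; rewrite /C pickleK.
  case: pselect => [_|nU] /=; first by rewrite ltr_pXn2r ?nnegrE// ltW.
  exfalso; apply: nU => z zi; apply: rU; rewrite -ball_normE/=.
  have := ler_normD (y w - (p i).1) ((p i).1 - z); rewrite addrA subrK (distrC (p i).1).
  by move: yi => /=; move: (N.+1%:R^-1) NP zi => b; lra.
apply: (F_bigcup usualF t0) => m; rewrite /C; case: (unpickle m) => [[i N]|]; last first.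
  by case: (F_sigma usualF t0).
case: pselect => [zU|nzU] /=; last by case: (F_sigma usualF t0).
apply: (F_lt usualF _ t0).
have E w : `|y w - (p i).1| ^+ 2 = `|h - (p i).1| ^+ 2 + \sum_j x j w * (2 * ip (e j) (h - (p i).1)) +
    \sum_j \sum_k x j w * (x k w * ip (e j) (e k)).
  rewrite /y addrAC; move: (h - _) => g; rewrite -!(ip_sq ipH) (ipDl ipH) !(ipDr ipH) !(ip_suml ipH) !(ip_sumr ipH).
  rewrite -!addrA; congr (_ + _); rewrite addrA; congr (_ + _).
    rewrite -big_split/=; apply: eq_bigr => j _; rewrite (ipC ipH g); ring.
  by apply: eq_bigr => j _; rewrite (ip_sumr ipH) mulr_sumr.
under eq_fun do rewrite E; apply: FmD; last first.
  apply: Fm_sum => j; apply: Fm_sum => k; apply: FmM => //; apply: FmM => //; exact: Fm_cst.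
apply: FmD; first exact: Fm_cst.
by apply: Fm_sum => j; apply: FmM => //; exact: Fm_cst.
Qed.

Lemma span_cadlag n (e : 'I_n -> H) (psi : R -> H) (x : 'I_n -> R -> R) : cadlag psi ->
  (forall j, cadlag (x j)) -> cadlag (fun t => psi t + \sum_j x j t *: e j).
Proof.
move=> cpsi cx t t0; have [pr pl] := cpsi t t0.
have cs (Fl : set_system R) (FF : Filter Fl) (l : 'I_n -> R) :
    (forall j, x j u @[u --> Fl] --> l j) ->
    \sum_j x j u *: e j @[u --> Fl] --> \sum_j l j *: e j.
  move=> xl; elim: (index_enum _) => [|j s IH].
    by rewrite big_nil; under eq_fun do rewrite big_nil; exact: cvg_cst.
  rewrite big_cons; under eq_fun do rewrite big_cons; apply: cvgD => //.
  exact: cvgZr_tmp.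
split; first by apply: cvgD => //; apply: cs => j; case: (cx j t t0).
move=> s0; have [l pl'] := pl s0.
have /choice[lx lxP] : forall j, exists l : R, x j u @[u --> t^'-] --> (l : R).
  by move=> j; have [_ /(_ s0)] := cx j t t0.
by exists (l + \sum_j lx j *: e j); apply: cvgD => //; exact: cs.
Qed.

End processes_in_space.

Section modulus.
Context {R : realType} {V : normedModType R}.
Variable x : R -> V.
Hypothesis unif : forall T e : R, 0 < e -> exists2 del : R, 0 < del &
  forall s t, 0 <= s -> s <= T -> 0 <= t -> t <= T -> `|s - t| < del -> `|x s - x t| < e.

Lemma modulus_cadlag : cadlag x.
Proof.
move=> t t0; split.
  apply/right_limP => e e0; have [del del0 delP] := unif (t + 1) e0.
  exists (Num.min 1 del) => [|u tu]; first by rewrite lt_min ltr01.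
  rewrite -ltrBlDl lt_min => /andP[u1 u2]; apply: delP; try lra.
  by rewrite gtr0_norm ?subr_gt0.
move=> t_gt0; exists (x t); apply/left_limP => e e0; have [del del0 delP] := unif t e0.
exists (Num.min t del) => [|u ut]; first by rewrite lt_min t_gt0.
move=> tu; have m1 : Num.min t del <= t by rewrite ge_min lexx.
have m2 : Num.min t del <= del by rewrite ge_min lexx orbT.
apply: delP => //; [lra|exact: ltW|].
by rewrite ltr0_norm ?subr_lt0//; lra.
Qed.

Lemma modulus_within_continuous : {within `[0, +oo[%classic, continuous x}.
Proof.
apply/subspace_continuousP => t; rewrite /= in_itv/= andbT => t0.
apply/cvgrPdist_lt => e e0; have [del del0 delP] := unif (t + 1) e0.
have m0 : 0 < Num.min 1 del by rewrite lt_min ltr01.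
rewrite near_withinE; apply: filterS (near_dist t m0) => u h.
rewrite /= in_itv/= andbT => u0; move: h; rewrite lt_min => /andP[h1 h2].
apply: delP => //; first by rewrite lerDl.
by move: h1; rewrite ltr_norml => /andP[? ?]; lra.
Qed.

End modulus.

(** * The leaves and their invariance *)

Section quasi_exponential.
Context {R : realType} {d : measure_display} {Omega : measurableType d}.
Variables (P : probability Omega R) (F : R -> set (set Omega)).
Hypothesis usualF : usual_conditions P F.
Variables (m : nat) (X : R -> Omega -> 'rV[R]_m).
Hypotheses (levyX : levy_process P F X)
  (martX : forall k, square_integrable_martingale P F (component X k)).
Context {H : completeNormedModType R}.
Variable ip : H -> H -> R.
Hypotheses (ipH : inner_product ip) (sepH : separable H).
Variable S : R -> H -> H.
Hypotheses (semiS : C0_semigroup S) (pcS : pseudo_contractive S).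
Variables (D : set H) (A : H -> H).
Hypothesis genA : generator S D A.
Variables (alpha : H -> H) (a : H).
Hypothesis alphaE : forall h, alpha h = a.
Variable sigma : 'I_m -> H -> H.
Hypothesis lip_sigma : forall k, lipschitz (sigma k).
Local Notation mu := (@lebesgue_measure R).
Local Notation adj := (adjoint_at ip D A).
Local Notation weak := (weak_solution P F X ip D A alpha sigma).
Local Notation JS := (J ip S).

Lemma J_cocycle t u h : 0 <= t -> 0 <= u -> JS (t + u) h = JS t h + S t (JS u h).
Proof.
move=> t0 u0; apply: (ip_injr ipH) => eta.
rewrite (ipDr ipH) !(JE ipH semiS pcS) ?addr_ge0// -(adjSE ipH semiS pcS)// (JE ipH semiS pcS)//.
have -> : \int[mu]_(s in `[0, u]) ip (adjS ip S t eta) (S s h) = \int[mu]_(s in `[0, u]) ip eta (S (t + s) h).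
  apply: eq_Rintegral => s; rewrite inE/= in_itv/= => /andP[s0 _].
  by rewrite (S_add semiS)// (adjSE ipH semiS pcS).
by rewrite (orbit_shift ipH semiS pcS)// [RHS]addrC subrK.
Qed.

(* The parameter of the leaves: the solution of the equation without noise. *)
Definition drift_orbit (h0 : H) (t : R) : H := S t h0 + JS t a.

Lemma drift_orbit0 h0 : drift_orbit h0 0 = h0.
Proof.
rewrite /drift_orbit (S0 semiS) -[RHS]addr0; congr (_ + _); apply: (ip_injr ipH) => eta.
by rewrite (JE ipH semiS pcS)// Rintegral_itv0 (ip0r ipH).
Qed.

Lemma drift_orbit_cocycle h0 t0 t : 0 <= t0 -> 0 <= t ->
  drift_orbit (drift_orbit h0 t0) t = drift_orbit h0 (t0 + t).
Proof.
move=> t00 t0'; rewrite /drift_orbit (SD semiS _ _ t0') -(S_add semiS _ t0' t00).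
by rewrite [t0 + t]addrC (J_cocycle _ t0' t00) -addrA [X in _ + X = _]addrC.
Qed.

Lemma drift_orbit_unif h0 (T e : R) : 0 < e -> exists2 del : R, 0 < del &
  forall s t, 0 <= s -> s <= T -> 0 <= t -> t <= T -> `|s - t| < del ->
  `|drift_orbit h0 s - drift_orbit h0 t| < e.
Proof.
move=> e0; have e4 : 0 < e / 4 by rewrite divr_gt0.
have [d1 d10 d1P] := orbit_unif semiS pcS T h0 e4.
have [C C0 CP] := S_bound pcS T; have [C' C'0 C'P] := J_bound ipH semiS pcS T.
pose B := C * C' * (`|a| + 1).
have B0 : 0 < B by rewrite !mulr_gt0// ltr_wpDl.
exists (Num.min d1 (e / 4 / B)) => [|s t s0 sT t0 tT]; first by rewrite lt_min d10 divr_gt0.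
wlog st : s t s0 sT t0 tT / t <= s.
  by move=> W; have [st|/ltW st] := leP t s; [exact: W|rewrite distrC => dst; rewrite distrC; exact: W].
rewrite ger0_norm ?subr_ge0// lt_min => /andP[u1 u2].
have u0 : 0 <= s - t by rewrite subr_ge0.
have := d1P t (s - t) t0 tT u0 u1; rewrite [t + (s - t)]addrC subrK => h1.
have h2 : `|JS s a - JS t a| <= e / 4.
  rewrite -{1}(subrK t s) [s - t + t]addrC J_cocycle// addrAC subrr add0r.
  apply: le_trans (CP _ _ t0 tT) _.
  have uT : s - t <= T by rewrite lerBlDr (le_trans sT)// lerDl.
  apply: (@le_trans _ _ (C * (C' * (s - t) * `|a|))); first by rewrite ler_wpM2l ?(ltW C0)// C'P.
  rewrite ltr_pdivlMr// in u2; apply: le_trans (ltW u2).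
  rewrite /B; have : 0 <= C * C' * (s - t) by rewrite !mulr_ge0 ?(ltW C0) ?(ltW C'0).
  lra.
have -> : drift_orbit h0 s - drift_orbit h0 t = (S s h0 - S t h0) + (JS s a - JS t a).
  by rewrite /drift_orbit opprD addrACA.
have := ler_normD (S s h0 - S t h0) (JS s a - JS t a); lra.
Qed.

Lemma drift_orbit_weak h0 xi zeta t : adj xi zeta -> 0 <= t ->
  ip xi (drift_orbit h0 t) = ip xi h0 +
    \int[mu]_(s in `[0, t]) (ip zeta (drift_orbit h0 s) + ip xi a).
Proof.
move=> xz t0; have w1 := weak_orbit ipH semiS pcS genA h0 xz t0.
rewrite /drift_orbit (ipDr ipH) (JE ipH semiS pcS)//.
have -> : ip xi (S t h0) = ip xi h0 + ip zeta (JS t h0) by rewrite -w1 addrC subrK.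
rewrite (JE ipH semiS pcS)// -addrA; congr (_ + _).
have I h eta : mu.-integrable `[0, t] (EFin \o (fun s => ip eta (S s h))).
  exact: (bounded_measurable_integrable t (orbit_bm ipH semiS pcS h eta) (lexx 0)).
rewrite -RintegralD//; apply: eq_Rintegral => s; rewrite inE/= in_itv/= => /andP[s0 _].
(* The integrand [ip zeta (JS s a) + ip xi a] collapses to [ip xi (S s a)], since [A] maps [JS s a]
   to [S s a - a]. *)
have [Dj Aj] := J_dom ipH semiS pcS genA a s0.
by rewrite (ipDr ipH) -(xz _ Dj) Aj (ipBr ipH) -addrA subrK.
Qed.

Lemma A_sigma_linear : linear_set (A_sigma A sigma).
Proof.
split.
  exists (fun=> 0); split; last by rewrite big1.
  by move=> k; case: (linear_span_linear [set g | exists n h, g = iter n A (sigma k h)]).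
move=> c x y [u [uP ->]] [u' [u'P ->]]; exists (fun k => c *: u k + u' k); split.
  by move=> k; have [_ L] := linear_span_linear [set g | exists n h, g = iter n A (sigma k h)]; exact: L.
by rewrite scaler_sumr -big_split.
Qed.

Hypothesis qe : quasi_exponential D A sigma.

Lemma iter_dom n k h : D (iter n A (sigma k h)).
Proof.
have [/(_ k h) dom _] := qe.
have := dom n.+1 I; elim: n (sigma k h) {dom} => [|n IH] x; first by case.
by rewrite iterSr => -[_ Dx]; exact: IH.
Qed.

Lemma A_sigma_gen n k h : A_sigma A sigma (iter n A (sigma k h)).
Proof.
exists (fun k' => if k' == k then iter n A (sigma k h) else 0); split => [k'|].
  case: eqVneq => [->|_]; last by case: (linear_span_linear [set g | exists n h, g = iter n A (sigma k' h)]).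
  by apply: sub_linear_span; exists n, h.
by rewrite -big_mkcond/= big_pred1_eq.
Qed.

Lemma A_sigma_dom x : A_sigma A sigma x -> D x /\ A_sigma A sigma (A x).
Proof.
pose E := [set x | D x /\ A_sigma A sigma (A x)].
have linE : linear_set E.
  have [V0 VL] := A_sigma_linear.
  have [D0 A0] : D 0 /\ A 0 = 0.
    by apply: (adj_closed ipH semiS pcS genA) => xi zeta _; rewrite !(ip0r ipH).
  split; first by split; rewrite ?A0.
  move=> c u v [Du Vu] [Dv Vv].
  have [Dw Aw] : D (c *: u + v) /\ A (c *: u + v) = c *: A u + A v.
    apply: (adj_closed ipH semiS pcS genA) => xi zeta xz.
    by rewrite !(ipDr ipH) !(ipZr ipH) !xz.
  by split=> //; rewrite Aw; exact: VL.
move=> [u [uP ->]]; rewrite -[X in D X /\ _](_ : \sum_k 1 *: u k = _); last first.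
  by apply: eq_bigr => k _; rewrite scale1r.
rewrite -[X in A_sigma A sigma (A X)](_ : \sum_k 1 *: u k = _); last first.
  by apply: eq_bigr => k _; rewrite scale1r.
apply: (linear_set_sum (E := E) _ _ _ linE) => k.
apply: (linear_span_sub linE _ (uP k)) => _ [n [h ->]]; split; first exact: iter_dom.
exact: (A_sigma_gen n.+1).
Qed.

Lemma A_sigma_frame : exists (n : nat) (e : 'I_n -> H), (forall i, A_sigma A sigma (e i)) /\
  forall x, A_sigma A sigma x -> x = \sum_i ip (e i) x *: e i.
Proof.
have [_ [n0 [b0 Vb0]]] := qe.
have [|n1 [v [Vv vV]]] := @linear_subset_generators R H n0 b0 _ A_sigma_linear.
  move=> x /Vb0; apply: linear_span_sub; first exact: combinations_linear.
  by move=> _ [i _ <-]; exact: combinations_gen.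
have [e [ev eE]] := parseval_frame ipH v.
exists n1, e; split=> [i|x Vx]; last exact/eE/vV.
by have [c ->] := ev i; apply: linear_set_sum => //; exact: A_sigma_linear.
Qed.

Section frame.
Variables (n : nat) (e : 'I_n -> H).
Hypotheses (Ve : forall i, A_sigma A sigma (e i))
  (eV : forall x, A_sigma A sigma x -> x = \sum_i ip (e i) x *: e i).

(** The bipolar theorem in finite dimension: pairing with [x] vanishes on the common kernel of the
    pairings with the [e i], and so is a combination of them. *)
Lemma A_sigma_orthogonal x : (forall eta, (forall i, ip eta (e i) = 0) -> ip eta x = 0) ->
  A_sigma A sigma x.
Proof.
move=> xe; have Hlin : linear_set (setT : set H) by [].
have [y0 y1 y2 _ _|i|eta _ he|c cP] := functional_combination (l := fun eta => ip eta x)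
  (ls := fun i eta => ip eta (e i)) Hlin.
- by rewrite (ipDl ipH) (ipZl ipH).
- exact: ip_functionall.
- exact: xe.
suff -> : x = \sum_i c i *: e i by apply: linear_set_sum => //; exact: A_sigma_linear.
apply: (ip_injr ipH) => eta; rewrite (ip_sumr ipH) cP//.
Qed.

Lemma A_sigma_invariant xi t v : (forall i, ip xi (e i) = 0) -> 0 <= t ->
  A_sigma A sigma v -> ip xi (S t v) = 0.
Proof.
move=> xe t0 Vv; rewrite (eV Vv) -(adjSE ipH semiS pcS)// (ip_sumr ipH) big1// => i _.
rewrite (adjSE ipH semiS pcS)//.
rewrite (@orthogonal_orbit _ _ _ ipH _ semiS pcS _ _ genA n e (fun i j => ip (e j) (A (e i))) xi t i) ?mulr0// => j.
by have [De VAe] := A_sigma_dom (Ve j); split=> //; exact: eV.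
Qed.

Lemma invariance h0 r : weak h0 r ->
  {ae P, forall w, forall t, 0 <= t -> A_sigma A sigma (r t w - drift_orbit h0 t)}.
Proof.
move=> wr; pose Q := [set xi | forall i, ip xi (e i) = 0].
have Q0 : Q 0 by move=> i; rewrite (ip0l ipH).
have [p [pP pd]] := @adjoint_sequence R H ip ipH sepH D A Q Q0.
have E k : {ae P, forall w, forall t, 0 <= t -> ip (p k).1 (r t w - drift_orbit h0 t) =
    \int[mu]_(s in `[0, t]) ip (p k).2 (r s w - drift_orbit h0 s)}.
  have [pk Qk] := pP k; have [J' [intJ eqJ]] := solution_equation ipH alphaE wr pk.
  have orth l h : ip (p k).1 (sigma l h) = 0.
    have Vs : A_sigma A sigma (sigma l h) := A_sigma_gen 0 l h.
    by rewrite (eV Vs) (ip_sumr ipH) big1// => i _; rewrite Qk mulr0.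
  have J0 : {ae P, forall w l t, 0 <= t -> J' l t w = 0}.
    apply: ae_countable => l; apply: (integral_zero usualF (component_orthogonal usualF levyX martX l)).
    have := intJ l; congr (stochastic_integral _ _ _ _ _).
    by apply/funext => s; apply/funext => w; rewrite orth.
  apply: filterS2 J0 eqJ => w J0w [cw bm eqw] t t0.
  have bp : bounded_measurable (fun s => ip (p k).2 (drift_orbit h0 s) + ip (p k).1 a).
    apply: bounded_measurableD; last exact: bounded_measurable_cst.
    by apply: ip_bm => //; apply: modulus_cadlag => T e' e0; exact: drift_orbit_unif.
  rewrite (ipBr ipH) (drift_orbit_weak h0 pk t0) opprD addrA eqw// big1 ?addr0 => [|l _]; last exact: J0w.
  rewrite -RintegralB//; [|exact: bounded_measurable_integrable|exact: bounded_measurable_integrable].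
  apply: eq_Rintegral => s _; rewrite (ipBr ipH); ring.
have [_ cr] := wr.1; have r0 := solution_initial usualF levyX martX ipH sepH semiS pcS genA alphaE lip_sigma wr.
apply: filterS3 (ae_countable E) cr r0 => w Ew cw r0w.
pose y t := r t w - drift_orbit h0 t.
have cpsi : cadlag (drift_orbit h0) by apply: modulus_cadlag => T e' e0; exact: drift_orbit_unif.
have cy : cadlag y.
  move=> t t0; have [r1 l1] := cw t t0; have [r2 l2] := cpsi t t0; split; first exact: cvgB.
  by move=> s0; have [x1 xl1] := l1 s0; have [x2 xl2] := l2 s0; exists (x1 - x2); exact: cvgB.
have y0 : y 0 = 0 by rewrite /y r0w drift_orbit0 subrr.
(* Outside one null set the equation holds for the pairs [p k]. The same pair approximates [xi] and
   [zeta] simultaneously, and [y] is bounded on [[0, t]]. *)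
have Eall xi zeta : Q xi -> adj xi zeta -> forall t, 0 <= t ->
    ip xi (y t) = ip xi (y 0) + \int[mu]_(s in `[0, t]) ip zeta (y s).
  move=> Qxi xz t t0; rewrite y0 (ip0r ipH) add0r.
  have [B B0 BP] := cadlag_bounded t cy.
  apply/eqP; rewrite -subr_eq0 -normr_le0; apply/ler_addgt0Pr => e' e'0; rewrite add0r.
  have Bt : 0 < B + B * t + 1 by rewrite ltr_wpDl// addr_ge0// mulr_ge0.
  have e1 : 0 < e' / (B + B * t + 1) by exact: divr_gt0.
  have [k [k1 k2]] := pd xi zeta _ xz Qxi e1.
  set del := e' / _ in e1 k1 k2.
  have Ik eta : mu.-integrable `[0, t] (EFin \o (fun s => ip eta (y s))).
    by apply: bounded_measurable_integrable => //; exact: ip_bm.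
  have -> : ip xi (y t) - \int[mu]_(s in `[0, t]) ip zeta (y s) =
      ip (xi - (p k).1) (y t) - \int[mu]_(s in `[0, t]) ip (zeta - (p k).2) (y s).
    under [X in _ = _ - X]eq_Rintegral do rewrite (ipBl ipH).
    by rewrite RintegralB// (ipBl ipH) -(Ew k t t0) opprB addrA addrNK.
  apply: le_trans (ler_normB _ _) _.
  have h1 : `|ip (xi - (p k).1) (y t)| <= del * B.
    apply: le_trans (cauchy_schwarz ipH _ _) _; apply: ler_pM => //; [exact: ltW|exact: BP].
  have h2 : `|\int[mu]_(s in `[0, t]) ip (zeta - (p k).2) (y s)| <= del * B * (t - 0).
    apply: Rintegral_itv_bound => // [|s s0 st]; first exact: ip_bm.
    by apply: le_trans (cauchy_schwarz ipH _ _) _; apply: ler_pM => //; [exact: ltW|exact: BP].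
  apply: le_trans (lerD h1 h2) _; rewrite subr0.
  apply: (@le_trans _ _ (del * (B + B * t + 1))); last by rewrite /del divfK// gt_eqF.
  by rewrite -mulrA -mulrDr ler_wpM2l ?(ltW e1)// lerDl.
move=> t t0; apply: A_sigma_orthogonal => eta Qeta.
(* The annihilator [Q] is stable under the adjoint, the adjoint semigroup and its integrals, because
   [A_sigma] is stable under [A] and the semigroup preserves it. Hence uniqueness holds with test
   functionals from [Q] alone. *)
rewrite (@weak_uniqueness _ _ _ ipH _ semiS pcS _ _ genA Q y cy _ _ _ Eall eta t)//.
- by rewrite y0 (S_0 semiS)// (ip0r ipH).
- move=> xi zeta Qxi xz i; have [De VAe] := A_sigma_dom (Ve i).
  rewrite -(xz _ De) (eV VAe) (ip_sumr ipH) big1// => j _; by rewrite Qxi mulr0.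
- by move=> s xi s0 Qxi i; rewrite (adjSE ipH semiS pcS)//; exact: A_sigma_invariant.
- move=> s xi s0 Qxi i; rewrite (adjJE ipH semiS pcS)// (JE ipH semiS pcS)//.
  transitivity (\int[mu]_(u in `[0, s]) (0 : R)); last by rewrite Rintegral_itv_cst// mul0r.
  by apply: eq_Rintegral => u; rewrite inE/= in_itv/= => /andP[u0 _]; exact: A_sigma_invariant.
Qed.

End frame.
End quasi_exponential.

(** * Existence of solutions on a leaf *)

Section existence.
Context {R : realType} {d : measure_display} {Omega : measurableType d}.
Variables (P : probability Omega R) (F : R -> set (set Omega)).
Hypothesis usualF : usual_conditions P F.
Variables (m : nat) (X : R -> Omega -> 'rV[R]_m).
Hypotheses (levyX : levy_process P F X)
  (martX : forall k, square_integrable_martingale P F (component X k)).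
Context {H : completeNormedModType R}.
Variable ip : H -> H -> R.
Hypotheses (ipH : inner_product ip) (sepH : separable H).
Variable S : R -> H -> H.
Hypotheses (semiS : C0_semigroup S) (pcS : pseudo_contractive S).
Variables (D : set H) (A : H -> H).
Hypothesis genA : generator S D A.
Variables (alpha : H -> H) (a : H).
Hypothesis alphaE : forall h, alpha h = a.
Variable sigma : 'I_m -> H -> H.
Hypothesis lip_sigma : forall k, lipschitz (sigma k).
Hypothesis qe : quasi_exponential D A sigma.
Variables (n : nat) (e : 'I_n -> H).
Hypotheses (Ve : forall i, A_sigma A sigma (e i))
  (eV : forall x, A_sigma A sigma x -> x = \sum_i ip (e i) x *: e i).
Variable h0 : H.
Local Notation mu := (@lebesgue_measure R).
Local Notation psi := (drift_orbit ip S a h0).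
Local Notation simple := (@simple R d Omega).

Definition leaf_integrator (k : option 'I_m) : R -> Omega -> R :=
  if k is Some l then component X l else fun t _ => t.

(* The equation for the coordinates [x] of a solution psi + \sum_j x_j e_j; the
   index [None] is the time. *)
Definition leaf_coef (k : option 'I_m) (i : 'I_n) (s : R) (x : 'I_n -> R) : R :=
  if k is Some l then ip (e i) (sigma l (psi s + \sum_j x j *: e j))
  else \sum_j x j * ip (e i) (A (e j)).

Let psi_unif (T eps : R) : 0 < eps -> exists2 del : R, 0 < del &
  forall s t, 0 <= s -> s <= T -> 0 <= t -> t <= T -> `|s - t| < del -> `|psi s - psi t| < eps.
Proof. exact: (drift_orbit_unif ipH semiS pcS). Qed.

Let cpsi : cadlag psi. Proof. by apply: modulus_cadlag => T eps eps0; exact: psi_unif. Qed.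

Lemma leaf_integrator_good k : good_integrator P F (leaf_integrator k).
Proof.
case: k => [k|]; last exact: time_good.
apply: (orthogonal_good usualF (component_orthogonal usualF levyX martX k)).
have [[_ cX] _ _ _] := levyX; apply: filterS cX => w cX t t0.
rewrite component_combination; have cu := @combination_continuous R m (unit_coef k).
have [r l] := cX t t0; split; first exact: continuous_cvg (cu _) r.
by move=> /l[y yl]; exists (combination (unit_coef k) y); exact: continuous_cvg (cu _) yl.
Qed.

Lemma leaf_coef_Fm k i s t (x : 'I_n -> Omega -> R) : 0 <= t -> (forall j, Fm F t (x j)) ->
  Fm F t (fun w => leaf_coef k i s (fun j => x j w)).
Proof.
move=> t0 Fx; case: k => [l|] /=; last first.
  by apply: Fm_sum => j; apply: FmM => //; exact: Fm_cst.
apply/(FmP usualF _ t0) => B mB.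
pose phi h := ip (e i) (sigma l h).
apply: (span_measurable usualF ipH sepH e (psi s) (B := phi @^-1` B) t0 Fx).
apply: continuous_preimage mB; exact: (coefficient_continuous ipH lip_sigma).
Qed.

Lemma leaf_coef_lip : exists2 C : R, 0 <= C & forall k i s s' x x',
  `|leaf_coef k i s x - leaf_coef k i s' x'| <= C * (`|psi s - psi s'| + \sum_j `|x j - x' j|).
Proof.
have [L L1 LP] := common_lipschitz lip_sigma; have L0 := ltW L1.
(* The summand 1 ensures [1 <= E], so that [E] also covers the term with [psi], which carries no
   frame vector. *)
pose E := 1 + \sum_i `|e i|.
pose C0 := \sum_i \sum_j `|ip (e i) (A (e j))|.
have E1 : 1 <= E by rewrite lerDl sumr_ge0.
have C00 : 0 <= C0 by apply: sumr_ge0 => i _; exact: sumr_ge0.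
have eE i : `|e i| <= E by rewrite /E (bigD1 i)//= addrCA lerDl addr_ge0// sumr_ge0.
have E0 : 0 <= E by exact: le_trans E1.
have EL0 : 0 <= E * L * E by rewrite !mulr_ge0.
exists (C0 + E * L * E) => [|k i s s' x x']; first by rewrite addr_ge0.
set N := `|psi s - psi s'|; set Sx := \sum_j _.
have N0 : 0 <= N := normr_ge0 _.
have Sx0 : 0 <= Sx by exact: sumr_ge0.
case: k => [l|] /=.
  rewrite -(ipBr ipH); apply: le_trans (cauchy_schwarz ipH _ _) _.
  apply: (@le_trans _ _ (E * L * E * (N + Sx))); last by rewrite ler_wpM2r ?addr_ge0// lerDr.
  rewrite -!mulrA; apply: ler_pM => //.
  apply: le_trans (LP l _ _) _; rewrite ler_wpM2l//.
  rewrite opprD addrACA -sumrB mulrDr; apply: le_trans (ler_normD _ _) _.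
  rewrite lerD//; first by rewrite ler_peMl.
  apply: le_trans (ler_norm_sum _ _ _) _; rewrite mulr_sumr; apply: ler_sum => j _.
  by rewrite -scalerBl normrZ mulrC ler_wpM2r.
apply: (@le_trans _ _ (C0 * Sx)); last by apply: ler_pM => //; rewrite ?lerDl ?lerDr.
rewrite -sumrB; apply: le_trans (ler_norm_sum _ _ _) _; rewrite mulr_sumr; apply: ler_sum => j _.
rewrite -mulrBl normrM mulrC ler_wpM2r//.
rewrite /C0 (bigD1 i)//= (bigD1 j)//= -addrA lerDl addr_ge0// ?sumr_ge0// => i' _.
exact: sumr_ge0.
Qed.

Let sqr_combine (u B C : R) (v : 'I_n -> R) : 0 <= B -> 0 <= C -> `|u| <= B + C * \sum_j `|v j| ->
  u ^+ 2 <= 2 * B ^+ 2 + 2 * C ^+ 2 * n%:R * \sum_j v j ^+ 2.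
Proof.
move=> B0 C0 uB; have := sqr_sum_le (fun j => `|v j|); rewrite card_ord.
under [X in _ <= _ * X -> _]eq_bigr do rewrite real_normK ?num_real//.
set V := \sum_j `|v j| in uB *; set W := \sum_j _ => VW.
have V0 : 0 <= V by exact: sumr_ge0.
have h1 : u ^+ 2 <= (B + C * V) ^+ 2.
  by rewrite -real_normK ?num_real// lerXn2r// nnegrE addr_ge0// mulr_ge0.
have h2 : C ^+ 2 * V ^+ 2 <= C ^+ 2 * (n%:R * W) by rewrite ler_wpM2l// sqr_ge0.
by have := sqr_ge0 (B - C * V); nra.
Qed.

Lemma leaf_lip : exists2 B : R, 0 <= B & forall s s' x x', 0 <= s -> 0 <= s' ->
  \sum_k \sum_i (leaf_coef k i s x - leaf_coef k i s' x') ^+ 2 <=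
  B * (`|psi s - psi s'| ^+ 2 + \sum_j (x j - x' j) ^+ 2).
Proof.
have [C C0 CP] := leaf_coef_lip.
pose b := 2 * C ^+ 2 * (n%:R + 1).
have b0 : 0 <= b by rewrite !mulr_ge0 ?sqr_ge0 ?addr_ge0.
exists (\sum_(k : option 'I_m) \sum_(i < n) b) => [|s s' x x' _ _].
  by apply: sumr_ge0 => k _; exact: sumr_ge0.
rewrite mulr_suml; apply: ler_sum => k _; rewrite mulr_suml; apply: ler_sum => i _.
have := CP k i s s' x x'; rewrite mulrDr => /sqr_combine; set N := `|psi s - psi s'|.
have N0 : 0 <= N := normr_ge0 _.
move=> /(_ (mulr_ge0 C0 N0) C0) h; apply: le_trans h _; rewrite /b exprMn.
set W := \sum_j _; have W0 : 0 <= W by apply: sumr_ge0 => j _; exact: sqr_ge0.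
have CN : 0 <= C ^+ 2 * N ^+ 2 by rewrite mulr_ge0// sqr_ge0.
have CW : 0 <= C ^+ 2 * W by rewrite mulr_ge0// sqr_ge0.
have nn : 0 <= n%:R :> R by [].
by have := mulr_ge0 nn CN; nra.
Qed.

Lemma leaf_growth (T : R) : exists2 B : R, 0 <= B & forall s x, 0 <= s -> s <= T ->
  \sum_k \sum_i leaf_coef k i s x ^+ 2 <= B * (1 + \sum_j x j ^+ 2).
Proof.
have [C C0 CP] := leaf_coef_lip; have [G G0 GP] := cadlag_bounded T cpsi.
pose M := \sum_k \sum_i `|leaf_coef k i 0 (fun=> 0)| + C * (G + `|psi 0|).
have M0 : 0 <= M.
  by rewrite addr_ge0 ?mulr_ge0 ?addr_ge0//; apply: sumr_ge0 => k _; exact: sumr_ge0.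
pose b := 2 * M ^+ 2 + 2 * C ^+ 2 * n%:R.
have b0 : 0 <= b by rewrite addr_ge0// !mulr_ge0 ?sqr_ge0.
exists (\sum_(k : option 'I_m) \sum_(i < n) b) => [|s x s0 sT].
  by apply: sumr_ge0 => k _; exact: sumr_ge0.
rewrite mulr_suml; apply: ler_sum => k _; rewrite mulr_suml; apply: ler_sum => i _.
have h : `|leaf_coef k i s x| <= M + C * \sum_j `|x j|.
  have := CP k i s 0 x (fun=> 0); under eq_bigr do rewrite subr0.
  have k0 : `|leaf_coef k i 0 (fun=> 0)| <= \sum_k \sum_i `|leaf_coef k i 0 (fun=> 0)|.
    rewrite (bigD1 k)//= (bigD1 i)//= -addrA lerDl addr_ge0// ?sumr_ge0// => k' _.
    exact: sumr_ge0.
  have k1 : C * `|psi s - psi 0| <= C * (G + `|psi 0|).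
    by rewrite ler_wpM2l//; apply: le_trans (ler_normB _ _) _; rewrite lerD2r GP.
  have := ler_normD (leaf_coef k i s x - leaf_coef k i 0 (fun=> 0)) (leaf_coef k i 0 (fun=> 0)).
  by rewrite subrK /M mulrDr; lra.
apply: le_trans (sqr_combine M0 C0 h) _; rewrite /b.
set W := \sum_j _; have W0 : 0 <= W by apply: sumr_ge0 => j _; exact: sqr_ge0.
have MW : 0 <= M ^+ 2 * W by rewrite mulr_ge0// sqr_ge0.
have Cn : 0 <= C ^+ 2 * n%:R by rewrite mulr_ge0// sqr_ge0.
by nra.
Qed.

Lemma leaf_cadlag k i (x : 'I_n -> R -> R) : (forall j, cadlag (x j)) ->
  cadlag (fun s => leaf_coef k i s (fun j => x j s)).
Proof.
move=> cx; case: k => [l|] /=.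
  apply: (@cadlag_comp R H (fun s => psi s + \sum_j x j s *: e j) (fun h => ip (e i) (sigma l h)));
    last exact: (coefficient_continuous ipH lip_sigma).
  exact: span_cadlag.
apply: cadlag_sum => j t t0; have [r l] := cx j t t0; split.
  by apply: cvgM => //; exact: cvg_cst.
move=> /l[y yl]; exists (y * ip (e i) (A (e j))); apply: cvgM => //; exact: cvg_cst.
Qed.

Local Notation limit_coef := (limit_integrand leaf_coef).

Lemma existence : exists r, weak_solution P F X ip D A alpha sigma h0 r.
Proof.
have [nu [Jl [nul FJ aeJ]]] := euler_limit usualF leaf_integrator_good leaf_coef_Fm leaf_growth leaf_lip psi_unif.
pose x (i : 'I_n) t w := \sum_k Jl (k, i) t w.
pose r t w := psi t + \sum_i x i t w *: e i.
have Fx i t : 0 <= t -> Fm F t (x i t) by move=> t0; apply: Fm_sum => k; exact: FJ.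
have adr : adapted_cadlag P F r.
  split=> [t t0 B sB|].
    by apply: (span_measurable usualF ipH sepH e (psi t) t0 _ sB) => j; exact: Fx.
  apply: filterS aeJ => w Jw; apply: span_cadlag => // j; apply: cadlag_sum => k.
  by case: (Jw (k, j)).
exists r; split=> // xi zeta xz.
pose theta i := ip xi (e i).
pose I (l : 'I_m) t w := \sum_i theta i * Jl (Some l, i) t w.
have FI l t : 0 <= t -> Fm F t (I l t).
  by move=> t0; apply: Fm_sum => i; apply: FmM; [exact: Fm_cst|exact: FJ].
(* The range of [sigma] lies in [A_sigma] and is reproduced by the frame: weighted with [theta], the
   coordinates of the coefficient add up to the integrand tested with [xi]. *)
have coefE l s w : \sum_i theta i * limit_coef Jl (Some l) i s w = ip xi (sigma l (r s w)).
  have Vs : A_sigma A sigma (sigma l (r s w)) := A_sigma_gen A sigma 0 l (r s w).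
  by rewrite [in RHS](eV Vs) (ip_sumr ipH); apply: eq_bigr => i _; rewrite mulrC.
exists I; split=> [l|]; last first.
  apply: filterS aeJ => w Jw t t0.
  have cJ q : cadlag (Jl q ^~ w) by case: (Jw q).
  have uJ q := proj2 (Jw q).
  have timeE := time_integral leaf_lip leaf_cadlag nul cJ uJ theta (k := None) t0 (fun s => erefl s).
  have cx : cadlag (r ^~ w) by apply: span_cadlag => // j; exact: cadlag_sum.
  have E s : \sum_i theta i * limit_coef Jl None i s w = ip zeta (r s w) - ip zeta (psi s).
    rewrite /r (ipDr ipH) [X in _ = X - _]addrC addrK (ip_sumr ipH).
    transitivity (\sum_i theta i * \sum_j x j s w * ip (e i) (A (e j))) => //.
    under eq_bigr do rewrite mulr_sumr; rewrite exchange_big/=; apply: eq_bigr => j _.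
    have [De VAe] := A_sigma_dom ipH semiS pcS genA qe (Ve j).
    rewrite -(xz _ De) [in RHS](eV VAe) (ip_sumr ipH) mulr_sumr; apply: eq_bigr => i _.
    by rewrite /theta; ring.
  have rE : ip xi (r t w) = ip xi (psi t) + (\sum_i theta i * Jl (None, i) t w + \sum_l I l t w).
    rewrite /r (ipDr ipH) (ip_sumr ipH); congr (_ + _); rewrite exchange_big/= -big_split/=.
    apply: eq_bigr => i _; rewrite -mulr_sumr -mulrDr mulrC; congr (_ * _).
    rewrite /x (bigD1 None)//= (reindex_omap Some id) => [|[]//]; congr (_ + _).
    by apply: eq_bigl => k; rewrite eqxx.
  rewrite rE timeE (drift_orbit_weak ipH semiS pcS genA a h0 xz t0) !addrA; congr (_ + _).
  rewrite -addrA; congr (_ + _).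
  have b1 : bounded_measurable (fun s => ip zeta (psi s)) by exact: ip_bm.
  have b2 : bounded_measurable (fun s => ip zeta (r s w)) by exact: ip_bm.
  rewrite -RintegralD//.
  - by apply: eq_Rintegral => s _; rewrite E alphaE; ring.
  - apply: bounded_measurable_integrable => //.
    by apply: bounded_measurableD => //; exact: bounded_measurable_cst.
  - apply: bounded_measurable_integrable => //; under eq_fun do rewrite E.
    by apply: bounded_measurableD => //; exact: bounded_measurableN.
have comp := complete_P usualF.
have ll := coefficient_left_limit usualF ipH lip_sigma l xi adr.
split; first split.
- by apply/(adapted_FmP usualF) => t; exact: FI.
- apply: filterS aeJ => w Jw; apply: cadlag_sum => i t t0; have [cJ _] := Jw (Some l, i).
  have [rl ll'] := cJ t t0; split; first by apply: cvgM => //; exact: cvg_cst.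
  by move=> /ll'[y yl]; exists (theta i * y); apply: cvgM => //; exact: cvg_cst.
pose Zs p : simple := euler_simple leaf_integrator leaf_coef nu theta (Some l) p.
have predZ p : simple_predictable F (Zs p).
  exact: (euler_simple_predictable usualF leaf_integrator_good leaf_coef_Fm leaf_growth).
exists Zs; split=> // t t0; split.
  pose en p w := energy t (fun s => simple_value (Zs p) s w - ip xi (sigma l (left_limit r s w))).
  have men p : measurable_fun setT (en p).
    have mc i : measurable_fun setT (simple_coef (Zs p) i).
      by have [l0 _ _ _] := predZ p i; exact: (Fm_measurable usualF l0 (simple_coef_Fm usualF (predZ p))).
    exact: (energy_measurable usualF ll (simple_left (Zs p)) (simple_right (Zs p)) t0 mc).
  apply/(cvg0_in_probabilityP comp men).
    move=> p; apply: filterS (ll_ae ll) => w [_ _ bY]; rewrite energyE//.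
    by apply: bounded_measurableD; [exact: simple_value_bm|exact: bounded_measurableN].
  apply: cvgP0_ae => //; apply: filterS2 aeJ (ll_ae ll) => w Jw [_ lY _].
  have cJ q : cadlag (Jl q ^~ w) by case: (Jw q).
  have uJ q := proj2 (Jw q).
  apply: (euler_simple_energy leaf_lip leaf_cadlag nul cJ uJ (theta := theta) (k := Some l) t0).
  by under eq_fun do rewrite coefE.
have mI p : measurable_fun setT (fun w => simple_integral (Zs p) (component X l) t w - I l t w).
  apply: measurable_funB; last exact: (Fm_measurable usualF t0 (FI l t t0)).
  exact: (simple_integral_measurable usualF (component_orthogonal usualF levyX martX l) (predZ p) t0).
apply/(cvg0_in_probabilityP comp mI); first by move=> p; exact: aeW.
apply: cvgP0_ae => //; apply: filterS aeJ => w Jw.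
have cJ q : cadlag (Jl q ^~ w) by case: (Jw q).
have uJ q := proj2 (Jw q).
have := euler_simple_integral leaf_lip leaf_cadlag cJ uJ (theta := theta) (k := Some l) t0.
move=> cI; rewrite -(subrr (I l t w)); apply: cvgB; last exact: cvg_cst.
exact: cI.
Qed.

End existence.

Section sufficiency.
Context {R : realType} {d : measure_display} {Omega : measurableType d}.
Variables (P : probability Omega R) (F : R -> set (set Omega)).
Hypothesis usualF : usual_conditions P F.
Variables (m : nat) (X : R -> Omega -> 'rV[R]_m).
Hypotheses (levyX : levy_process P F X)
  (martX : forall k, square_integrable_martingale P F (component X k)).
Context {H : completeNormedModType R}.
Variable ip : H -> H -> R.
Hypotheses (ipH : inner_product ip) (sepH : separable H).
Variable S : R -> H -> H.
Hypotheses (semiS : C0_semigroup S) (pcS : pseudo_contractive S).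
Variables (D : set H) (A : H -> H).
Hypothesis genA : generator S D A.
Variables (alpha : H -> H) (a : H).
Hypothesis alphaE : forall h, alpha h = a.
Variable sigma : 'I_m -> H -> H.
Hypothesis lip_sigma : forall k, lipschitz (sigma k).
Hypothesis qe : quasi_exponential D A sigma.
Local Notation V := (A_sigma A sigma).

Lemma A_sigma_subspace : finite_dimensional_subspace V.
Proof.
split; last by case: qe.
by apply/seteqP; split; [exact: sub_linear_span|apply: linear_span_sub => //; exact: A_sigma_linear].
Qed.

Lemma quasi_exponential_realization : affine_realization_by P F X ip D A alpha sigma V.
Proof.
move=> h0; pose M t := [set drift_orbit ip S a h0 t + v | v in V].
have [n [e [Ve eV]]] := A_sigma_frame ipH qe.
have [V0 VL] := A_sigma_linear A sigma.
exists M; split.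
- exists (drift_orbit ip S a h0); split=> //.
  by apply: modulus_within_continuous => T e' e0; exact: (drift_orbit_unif ipH semiS pcS).
- move=> t0 h1 t00 [v Vv <-]; split.
    by exact: (existence usualF levyX martX ipH sepH semiS pcS genA alphaE lip_sigma qe Ve eV).
  move=> r /(invariance usualF levyX martX ipH sepH semiS pcS genA alphaE lip_sigma qe Ve eV).
  apply: filterS => w rw t t0'; have Vr := rw t t0'.
  (* The solution starts at [psi(t0) + v], not at [psi(t0)]. Its own drift orbit differs from that
     of the leaf by [S t v], which lies in [V] again. *)
  have orbE : drift_orbit ip S a (drift_orbit ip S a h0 t0 + v) t = drift_orbit ip S a h0 (t0 + t) + S t v.
    rewrite -(drift_orbit_cocycle ipH semiS pcS a h0 t00 t0') /drift_orbit (SD semiS _ _ t0').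
    by rewrite -!addrA; congr (_ + _); rewrite addrC.
  have VS : V (S t v).
    apply: (A_sigma_orthogonal ipH Ve) => eta eta_e.
    exact: (A_sigma_invariant ipH semiS pcS genA qe Ve eV).
  exists (S t v + (r t w - drift_orbit ip S a (drift_orbit ip S a h0 t0 + v) t)).
    by rewrite -[S t v]scale1r; exact: VL.
  by rewrite orbE addrA addrC subrK.
- by exists 0 => //; rewrite (drift_orbit0 ipH semiS pcS) addr0.
Qed.

End sufficiency.

Theorem theorem5p6 (R : realType)
  (d : measure_display) (Omega : measurableType d) (P : probability Omega R)
  (F : R -> set (set Omega)) (usualF : usual_conditions P F)
  (m : nat) (m_gt0 : (0 < m)%N)
  (X : R -> Omega -> 'rV[R]_m) (levyX : levy_process P F X)
  (martX : forall k, square_integrable_martingale P F (component X k))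
  (ntX : nontrivial_components P X)
  (H : completeNormedModType R) (ip : H -> H -> R)
  (ipH : inner_product ip) (sepH : separable H)
  (S : R -> H -> H) (semiS : C0_semigroup S) (pcS : pseudo_contractive S)
  (D : set H) (A : H -> H) (genA : generator S D A)
  (alpha : H -> H) (lip_alpha : lipschitz alpha)
  (sigma : 'I_m -> H -> H) (lip_sigma : forall k, lipschitz (sigma k))
  (linear_spde : exists a : H, forall h, alpha h = a) :
  has_affine_realization P F X ip D A alpha sigma <->
  quasi_exponential D A sigma.
Proof.
have [a alphaE] := linear_spde; split=> [[V [Vfd realV]]|qe].
  exact: (realization_quasi_exponential usualF levyX martX ipH sepH semiS pcS genA alphaE lip_sigma ntX Vfd realV).
exists (A_sigma A sigma); split; first exact: A_sigma_subspace qe.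
exact: (quasi_exponential_realization usualF levyX martX ipH sepH semiS pcS genA alphaE lip_sigma qe).
Qed.
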